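(* Let $P_0$ be a probability distribution on $\mathbb{R}$ with $\mathbb{E}_{P_0}[X]=0$ and $\mathbb{E}_{P_0}[X^2]=1$, and let $\lambda_c=\sup\{\lambda>0\ |\ q^*(\lambda)=0\}$. For all $\lambda\in(0,\lambda_c)$, $$\lim_{n\to\infty}\frac1nI(\mathbf X,\mathbf Y)=\frac{\lambda}{4}\quad\text{and}\quad\lim_{n\to\infty}\mathrm{MMSE}_n(\lambda)=1.$$ For almost all $\lambda>\lambda_c$, $$\lim_{n\to\infty}\frac1nI(\mathbf X,\mathbf Y)=\frac{\lambda}{4}-\mathcal F(\lambda,q^*(\lambda))\quad\text{and}\quad\lim_{n\to\infty}\mathrm{MMSE}_n(\lambda)=1-q^*(\lambda)^2<1,$$ where $q^*(\lambda)$ is the unique maximizer of $q\ge0\mapsto\mathcal F(\lambda,q)$.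
   Context: For $\lambda>0$ and $n\ge 1$, consider $Y_{i,j}=\sqrt{\lambda/n}\,X_iX_j+Z_{i,j}$ for $1\le i<j\le n$, where $X_i\overset{i.i.d.}{\sim}P_0$ and $Z_{i,j}\overset{i.i.d.}{\sim}\mathcal N(0,1)$ are independent; $\mathbf X=(X_1,\dots,X_n)$, $\mathbf Y=(Y_{i,j})_{i<j}$. $I(\mathbf X,\mathbf Y)$ is the mutual information (natural logarithm) and $$\mathrm{MMSE}_n(\lambda)=\frac{2}{n(n-1)}\sum_{1\le i<j\le n}\mathbb{E}\big[(X_iX_j-\mathbb{E}[X_iX_j|\mathbf Y])^2\big].$$ For $\lambda,q\ge 0$, $$\mathcal F(\lambda,q)=-\frac{\lambda}{4}q^2+\mathbb{E}\log\left(\int dP_0(x)\exp\Big(\sqrt{\lambda q}\,Zx+\lambda q\,xX-\frac{\lambda}{2}q x^2\Big)\right),$$ with $Z\sim\mathcal N(0,1)$, $X\sim P_0$ independent. $D\subset(0,\infty)$ is the set of $\lambda$ at which $\lambda\mapsto\sup_{q\ge0}\mathcal F(\lambda,q)$ is differentiable (all of $(0,\infty)$ except a countable set); for $\lambda\in D$, $q\ge 0\mapsto\mathcal F(\lambda,q)$ has a unique maximizer, denoted $q^*(\lambda)$. In the definition of $\lambda_c$, $\lambda$ ranges over $D$, and $\sup\emptyset=0$. *)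

(* Defs.v *)
(* MathComp / MathComp-Analysis development over an abstract R : realType. *)
From HB Require Import structures.
From mathcomp Require Import all_boot all_order all_algebra.
From mathcomp Require Import all_classical all_reals all_analysis.
From mathcomp Require Import measurable_realfun.

Set Implicit Arguments.
Unset Strict Implicit.
Unset Printing Implicit Defensive.

Import Order.TTheory GRing.Theory Num.Theory.
Import numFieldNormedType.Exports.

Local Open Scope classical_set_scope.
Local Open Scope ring_scope.

Section probability_notions.
Context {R : realType}.

Definition mutually_independent d (T : measurableType d) (P : probability T R)
    (I : finType) (W : I -> T -> R) : Prop :=
  forall (J : {set I}) (B : I -> set R), (forall i, measurable (B i)) ->
    P (\bigcap_(i in [set i | i \in J]) W i @^-1` B i) =
    (\prod_(i in J) P (W i @^-1` B i))%E.

(* Kullback-Leibler divergence, with the natural logarithm. *)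
Definition kl_divergence d (T : measurableType d) (mu nu : probability T R)
    : \bar R :=
  if `[< mu `<< nu >] then
    (\int[mu]_x lne (Radon_Nikodym (charge_of_finite_measure mu) nu x))%E
  else +oo%E.

Section random_elements.
Context d d1 d2 (T : measurableType d) (A : measurableType d1)
  (B : measurableType d2) (P : probability T R).

Definition pair_rv (X : {RV P >-> A}) (Y : {RV P >-> B}) : T -> A * B :=
  fun w => (X w, Y w).

Lemma measurable_pair_rv (X : {RV P >-> A}) (Y : {RV P >-> B}) :
  measurable_fun setT (pair_rv X Y).
Proof. by apply: measurable_fun_pair; exact: measurable_funPT. Qed.

HB.instance Definition _ (X : {RV P >-> A}) (Y : {RV P >-> B}) :=
  isMeasurableFun.Build _ _ _ _ (pair_rv X Y) (measurable_pair_rv X Y).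

Definition mutual_information (X : {RV P >-> A}) (Y : {RV P >-> B}) : \bar R :=
  kl_divergence (distribution P (pair_rv X Y))
                (distribution P X \x distribution P Y)%E.

(* g is a version of E[f | Y]: measurable with respect to sigma(Y), integrable,
   and with the same integral as f on every event of sigma(Y). *)
Definition is_cond_expectation (f : T -> R) (Y : {RV P >-> B}) (g : T -> R)
    : Prop :=
  [/\ measurable_fun [set: g_sigma_algebra_preimageType Y] g,
      P.-integrable setT (EFin \o g) &
      forall E, g_sigma_algebra_preimage Y E ->
        (\int[P]_(w in E) (g w)%:E = \int[P]_(w in E) (f w)%:E)%E].

(* A chosen version; one exists as soon as f is integrable, and it is unique
   up to P-almost sure equality. *)
Definition cond_expectation (f : T -> R) (Y : {RV P >-> B}) : T -> R :=
  xget (cst 0) [set g | is_cond_expectation f Y g].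

End random_elements.
End probability_notions.

Definition edge (n : nat) : finType := {p : 'I_n * 'I_n | (p.1 < p.2)%N}.

Section model.
Context {R : realType}.
Variable P0 : probability R R.

Record spiked_wigner (n : nat) := SpikedWigner {
  sw_display : measure_display ;
  sw_space : measurableType sw_display ;
  sw_prob : probability sw_space R ;
  sw_X : 'I_n -> {RV sw_prob >-> R} ;
  sw_Z : edge n -> {RV sw_prob >-> R} ;
  sw_X_law : forall i (A : set R), measurable A ->
    distribution sw_prob (sw_X i) A = P0 A ;
  sw_Z_law : forall e (A : set R), measurable A ->
    distribution sw_prob (sw_Z e) A = normal_prob 0 1 A ;
  sw_indep : mutually_independent sw_prob
    (fun k : 'I_n + edge n =>
       match k with inl i => sw_X i : _ -> R | inr e => sw_Z e : _ -> R end) }.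

Variables (n : nat) (M : spiked_wigner n) (lambda : R).

Definition sw_XX (e : edge n) (w : sw_space M) : R :=
  sw_X M (val e).1 w * sw_X M (val e).2 w.

Definition sw_Yij (e : edge n) (w : sw_space M) : R :=
  Num.sqrt (lambda / n%:R) * sw_XX e w + sw_Z M e w.

Definition sw_Xvec (w : sw_space M) : n.-tuple R := [tuple sw_X M i w | i < n].

(* The pairs i < j are listed in the order of their canonical enumeration. *)
Definition sw_Yvec (w : sw_space M) : #|edge n|.-tuple R :=
  [tuple sw_Yij (enum_val k) w | k < #|edge n|].

Lemma measurable_sw_Xvec : measurable_fun setT sw_Xvec.
Proof.
apply/measurable_fun_tnthP => i.
rewrite (_ : _ \o _ = sw_X M i); first exact: measurable_funPT.
by apply/funext => w /=; rewrite tnth_mktuple.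
Qed.

Lemma measurable_sw_Yvec : measurable_fun setT sw_Yvec.
Proof.
apply/measurable_fun_tnthP => k.
rewrite (_ : _ \o _ = sw_Yij (enum_val k)); last first.
  by apply/funext => w /=; rewrite tnth_mktuple.
apply: measurable_funD; last exact: measurable_funPT.
apply: measurable_funM; first exact: measurable_cst.
by apply: measurable_funM; exact: measurable_funPT.
Qed.

HB.instance Definition _ :=
  isMeasurableFun.Build _ _ _ _ sw_Xvec measurable_sw_Xvec.
HB.instance Definition _ :=
  isMeasurableFun.Build _ _ _ _ sw_Yvec measurable_sw_Yvec.

Definition sw_information : \bar R :=
  mutual_information (P := sw_prob M) sw_Xvec sw_Yvec.

Definition sw_mmse : \bar R :=
  ((2 / (n%:R * (n%:R - 1)))%:E *
   \sum_(e : edge n) 'E_(sw_prob M)[fun w =>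
     ((sw_XX e w - cond_expectation (P := sw_prob M) (sw_XX e) sw_Yvec w) ^+ 2)%R])%E.

End model.

Section replica_formula.
Context {R : realType}.
Variable P0 : probability R R.

(* The pair (X, Z) has law P0 (x) N(0,1). For P0 centered with unit variance
   and lambda, q >= 0 all the integrals below converge. *)
Definition rs_potential (lambda q : R) : R :=
  - (lambda / 4) * q ^+ 2 +
  \int[(P0 \x normal_prob 0 1)%E]_xz
    ln (\int[P0]_x expR (Num.sqrt (lambda * q) * xz.2 * x
                         + lambda * q * x * xz.1
                         - lambda / 2 * q * x ^+ 2)).

(* Over q >= 0, rs_potential lambda is bounded above, so this is a genuine
   supremum. *)
Definition rs_sup (lambda : R) : R :=
  sup [set rs_potential lambda q | q in [set q : R | 0 <= q]].

Definition regular_snr : set R :=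
  [set lambda | 0 < lambda /\ derivable rs_sup lambda 1].

Definition is_maximizer (lambda q : R) : Prop :=
  0 <= q /\
  forall q', 0 <= q' -> rs_potential lambda q' <= rs_potential lambda q.

(* q = q*(lambda) *)
Definition is_qstar (lambda q : R) : Prop := unique (is_maximizer lambda) q.

(* The maximum with 0 only implements the convention sup(empty) = 0. *)
Definition lambda_c : \bar R :=
  Order.max 0%E
    (ereal_sup [set l%:E | l in regular_snr `&` [set l | is_qstar l 0]]).

End replica_formula.

(* Main.v *)
Require Import Defs.
From HB Require Import structures.
From mathcomp Require Import all_boot all_order all_algebra.
From mathcomp Require Import all_classical all_reals all_analysis.
From mathcomp Require Import measurable_realfun.
From mathcomp Require Import ring lra zify.
Set Implicit Arguments.
Unset Strict Implicit.
Unset Printing Implicit Defensive.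
Import Order.TTheory GRing.Theory Num.Theory.
Import numFieldNormedType.Exports.
Import HBNNSimple.
Local Open Scope classical_set_scope.
Local Open Scope ring_scope.

(** Let L be the density of the law of Y with respect to pure Gaussian noise, and Phi_n(lambda) the
    noise expectation of L ln L, a relative entropy ([PhiP]). The joint law of X and Y has density
    [expo] / L with respect to the product of its marginals, so that I(X,Y) = lambda (n-1)/4 - Phi_n
    ([sw_information_formula]). Moreover Phi_n is convex in lambda, with slope DP/(2n), where DP
    sums the squared posterior means of the products X_i X_j ([DP_tangent]), and the MMSE is 1 - 2
    DP/(n(n-1)) ([sw_mmseE]). Everything therefore follows from the limit of Phi_n/n, which is
    phi(lambda) = sup over g >= 0 of psi(g) - g^2/(4 lambda) ([PhiP_limit]). Here psi(g) is the
    relative entropy of one scalar Gaussian channel of signal-to-noise ratio g, and g = lambda q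
    turns the bracket into the replica potential ([rs_potentialE], [rs_potential_gain]).

    The lower bound on Phi_n is an interpolation ([guerra]): the pair channels are switched on while
    scalar side channels of total snr lambda q are switched off. The exchange costs n lambda q^2/4
    up to O(1), because the squared overlap of two replicas lies above each of its tangents
    ([pair_moments_ge]).

    The upper bound adds one spin at a time ([cavity_limit]). Given the other spins, the new one
    sees a channel close to a scalar channel, up to errors controlled by posterior covariances
    ([cavity_ent]). A vanishing side channel of snr k/n tames them: raising k by one increases the
    squared posterior means by an amount proportional to the squared covariances ([gain_cov],
    [sqV_gain]), and the total increase is bounded. Summed over K values of k, the covariance errors
    stay bounded independently of K, so they are negligible on average once K is large.

    Both bounds are proved for spins with finitely many values, where all functions of the noise
    grow at most exponentially. A prior with finite second moment is reached by quantization: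
    relative entropies are continuous in mean square, uniformly in n after division by n
    ([PhiP_compare], [psiP_compare]), and all quantities are limits of their quantized versions by a
    generalized dominated convergence ([cvg_gent], [cvg_gsqm]).

    For the conclusion, the maximizing g is nondecreasing in lambda, hence has at most countably
    many jumps ([unstable_countable]). Away from the jumps the maximizer is unique and phi has
    derivative g^2/(4 lambda^2) = q^2/4 ([stable_linearizes]); slopes of convex functions converge
    where the limit is differentiable ([tangent_limit]), and the MMSE tends to 1 - q^2. If g = 0 is
    optimal at some lambda it is optimal at every smaller one, so phi vanishes on (0, lambda_c) and
    the first regime follows ([subcritical_max_gain]). *)

Lemma mfun_section1 d d1 d2 (T : measurableType d) (T1 : measurableType d1)
  (T2 : measurableType d2) (f : T1 * T2 -> T) (x : T1) :
  measurable_fun setT f -> measurable_fun setT (fun y => f (x, y)).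
Proof. by move=> mf; apply: (measurableT_comp mf); exact: pair1_measurable. Qed.

Lemma mfun_section2 d d1 d2 (T : measurableType d) (T1 : measurableType d1)
  (T2 : measurableType d2) (f : T1 * T2 -> T) (y : T2) :
  measurable_fun setT f -> measurable_fun setT (fun x => f (x, y)).
Proof. by move=> mf; apply: (measurableT_comp mf); exact: pair2_measurable. Qed.

Lemma measurable_integral_section d d' (T : measurableType d) (T' : measurableType d')
  (R : realType) (P : probability T' R)
  (f : T * T' -> \bar R) : measurable_fun setT f -> (forall z, 0 <= f z)%E -> 
  measurable_fun setT (fun x => \int[P]_y f (x, y))%E.
Proof. by move=> mf f0; exact: measurable_fun_fubini_tonelli_F. Qed.


(** * Integration against a measure given by a density *)

Section density.
Context d (T : measurableType d) (R : realType).
Variables (mu nu : {measure set T -> \bar R}) (g : T -> R).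
Hypotheses (mg : measurable_fun setT g) (g0 : forall x, 0 <= g x).
Hypothesis nuE : forall A, measurable A -> (nu A = \int[mu]_(x in A) (g x)%:E)%E.

(** Both sides pass to the limit along an increasing sequence of simple functions; on a level set of
    a simple function the identity is [nuE]. *)
Lemma ge0_integral_density (h : T -> \bar R) :
  measurable_fun setT h -> (forall x, 0 <= h x)%E ->
  (\int[nu]_x h x = \int[mu]_x (h x * (g x)%:E))%E.
Proof.
move=> mh h0; pose h_ := nnsfun_approx measurableT mh.
have -> : (\int[nu]_x h x)%E = lim ((\int[nu]_x (h_ n x)%:E)%E @[n --> \oo]).
  rewrite -monotone_convergence//=.
  - by apply: eq_integral => x _; apply/esym/cvg_lim => //; exact: cvg_nnsfun_approx.
  - by move=> n; exact/measurable_EFinP/measurable_funTS.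
  - by move=> n x _; rewrite lee_fin.
  - by move=> x _ a b ab; rewrite lee_fin; exact/lefP/nd_nnsfun_approx.
have -> : (\int[mu]_x (h x * (g x)%:E))%E =
    lim ((\int[mu]_x ((h_ n x)%:E * (g x)%:E))%E @[n --> \oo]).
  rewrite -monotone_convergence//=.
  - apply: eq_integral => x _; apply/esym/cvg_lim => //.
    by apply: cvgeZr => //; exact: cvg_nnsfun_approx.
  - move=> n; apply: emeasurable_funM; exact/measurable_EFinP/measurable_funTS.
  - by move=> n x _; rewrite mule_ge0// lee_fin.
  - move=> x _ a b ab; rewrite lee_wpmul2r ?lee_fin//.
    exact/lefP/nd_nnsfun_approx.
suff suf n : (\int[mu]_x ((h_ n x)%:E * (g x)%:E) = \int[nu]_x (h_ n x)%:E)%E.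
  by apply: congr_lim; apply/funext => n; rewrite -suf.
transitivity (\int[nu]_x
   (\sum_(y \in range (h_ n)) (y * \1_(h_ n @^-1` [set y]) x)%:E))%E; last first.
  by apply: eq_integral => t tE; rewrite /= fimfunE -fsumEFin.
have indich m r : measurable_fun setT (fun x => (r * \1_(h_ m @^-1` [set r]) x)%:E).
  by apply: (measurable_comp measurableT) => //; exact: measurable_funM.
rewrite ge0_integral_fsum//; last by move=> m y Ey; exact: nnfun_muleindic_ge0.
transitivity (\int[mu]_x (\sum_(y \in range (h_ n))
    (y * \1_(h_ n @^-1` [set y]) x)%:E * (g x)%:E))%E.
  under [RHS]eq_integral => x xE.
    rewrite -ge0_mule_fsuml => [|y]; last exact: nnfun_muleindic_ge0.
    rewrite fsumEFin // -(fimfunE _ x); over.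
  by [].
rewrite ge0_integral_fsum//; last 2 first.
  - by move=> y; apply: emeasurable_funM => //; exact/measurable_EFinP.
  - move=> m y Ey; rewrite mule_ge0//; last by rewrite lee_fin.
    exact: nnfun_muleindic_ge0.
apply: eq_fsbigr => r rhn.
under [RHS]eq_integral do rewrite EFinM.
rewrite integralZl_indic_nnsfun => //.
under eq_integral do rewrite EFinM -muleA.
rewrite ge0_integralZl//.
- under eq_integral do rewrite muleC.
  rewrite (eq_integral ((EFin \o g) \_ (h_ n @^-1` [set r]))); last first.
    by move=> x xE; rewrite epatch_indic.
  by rewrite -integral_mkcond -nuE// integral_indic// setIT.
- by apply: emeasurable_funM; exact/measurable_EFinP.
- by move=> t Et; rewrite mule_ge0 ?lee_fin ?g0.
- by move: rhn; rewrite inE => -[t _ <-]; rewrite lee_fin.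
Qed.

End density.

(** * Changes of variables for the normal law *)

Section normal_prob.
Context {R : realType}.
Notation leb := (@lebesgue_measure R).
Notation ngauss := (normal_prob 0 (1 : R)).

(** The scaled image measure agrees with Lebesgue measure on half-open intervals, which characterize
    the latter. *)
Lemma ge0_integral_affine (c b : R) (h : R -> \bar R) : 0 < c ->
  measurable_fun setT h -> (forall x, 0 <= h x)%E ->
  (\int[leb]_x h x = \int[leb]_x (h (c * x + b)%R * c%:E))%E.
Proof.
move=> c0 mh h0.
pose phi := (fun x : measurableTypeR R => c * x + b : measurableTypeR R).
have mphi : measurable_fun setT phi.
  by apply: measurable_funD => //; apply: measurable_funM.
pose c' : {nonneg R} := NngNum (ltW c0).
rewrite ge0_integralZr//; last 2 first.
- exact: (measurableT_comp mh mphi).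
- by rewrite lee_fin ltW.
pose phim : {mfun (measurableTypeR R) >-> (measurableTypeR R)} :=
  HB.pack phi (isMeasurableFun.Build _ _ _ _ _ mphi).
rewrite -[X in (X * _)%E](@ge0_integral_pushforward _ _ _ _ _ phim _ leb setT h)//.
rewrite muleC -(@ge0_integral_mscale _ _ _ (pushforward leb phim) setT measurableT c' h)//.
apply: eq_measure_integral => /= A mA _.
apply: (@lebesgue_measure_unique R (mscale c' (pushforward leb phim))) => //.
move=> _ [[l r]] _ <-.
transitivity (c%:E * leb (phi @^-1` `]l, r]))%E; last by [].
have -> : phi @^-1` `]l, r] = `](l - b) / c, (r - b) / c]%classic.
  apply/seteqP; split=> x /=; rewrite !in_itv/= /phi ltr_pdivrMr// ler_pdivlMr//;
    by rewrite ltrBlDr lerBrDr (mulrC x).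
rewrite !lebesgue_measure_itv/= !lte_fin ltr_pM2r ?invr_gt0// ltrD2r.
case: ifPn => lr; last by rewrite mule0.
rewrite -EFinB -EFinM; congr EFin; field.
by rewrite gt_eqF.
Qed.

Lemma ge0_integral_normal_prob (h : R -> \bar R) :
  measurable_fun setT h -> (forall x, 0 <= h x)%E ->
  (\int[ngauss]_x h x = \int[leb]_x (h x * (normal_pdf 0 1 x)%:E))%E.
Proof.
move=> mh h0; rewrite (@ge0_integral_density _ _ _ leb ngauss (normal_pdf 0 1))//.
- exact: measurable_normal_pdf.
- exact: normal_pdf_ge0.
Qed.

Lemma normal_pdf_shift (m y : R) :
  normal_pdf m 1 y = expR (m * y - m ^+ 2 / 2) * normal_pdf 0 1 y.
Proof.
rewrite !normal_pdfE ?oner_eq0// /normal_fun mulrCA -expRD.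
by congr (_ * expR _); rewrite expr1n; field.
Qed.

(** The Cameron-Martin formula in dimension one: the exponential is the density of the normal law of
    mean a relative to the centred one. *)
Lemma normal_prob_shift (a : R) (h : R -> \bar R) :
  measurable_fun setT h -> (forall x, 0 <= h x)%E ->
  (\int[ngauss]_y h (y + a)%R = \int[ngauss]_y ((expR (a * y - a ^+ 2 / 2))%:E * h y))%E.
Proof.
move=> mh h0; rewrite !ge0_integral_normal_prob//; last 3 first.
- apply: emeasurable_funM => //; apply/measurable_EFinP.
  by apply: measurableT_comp => //; apply: measurable_funB => //; apply: measurable_funM.
- by move=> x; rewrite mule_ge0// lee_fin expR_ge0.
- by apply: measurableT_comp => //; exact: measurable_funD.
rewrite [RHS](@ge0_integral_affine 1 a) ?ltr01//; last 2 first.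
- apply: emeasurable_funM => //; first apply: emeasurable_funM => //; apply/measurable_EFinP.
    by apply: measurableT_comp => //; apply: measurable_funB => //; apply: measurable_funM.
  exact: measurable_normal_pdf.
- by move=> x; rewrite !mule_ge0// lee_fin ?expR_ge0// normal_pdf_ge0.
apply: eq_integral => y _; rewrite mul1r mule1 [in RHS]muleC muleA -EFinM muleC.
congr (_%:E * _)%E.
rewrite [RHS]mulrC -normal_pdf_shift !normal_pdfE ?oner_eq0// /normal_fun.
by rewrite addrK subr0.
Qed.

(** A unit combination of two independent standard normals is standard normal. For b > 0 the inner
    variable is replaced by u = a x + b y, and after Tonelli the integral over x is that of a normal
    density. The degenerate case b = 0 is separate, since the substitution divides by b. *)
Lemma normal_prob_merge (a b : R) (h : R -> \bar R) : 0 <= a -> 0 <= b ->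
  a ^+ 2 + b ^+ 2 = 1 ->
  measurable_fun setT h -> (forall x, 0 <= h x)%E ->
  (\int[ngauss]_x \int[ngauss]_y h (a * x + b * y)%R = \int[ngauss]_y h y)%E.
Proof.
move=> a0; rewrite le_eqVlt => /predU1P[<-|b0] ab mh h0.
  have -> : a = 1.
    by apply/eqP; rewrite -(@pexpr_eq1 _ _ 2)//; move: ab; rewrite expr0n addr0 => ->.
  under eq_integral => x _.
    under eq_integral => y _ do rewrite mul1r mul0r addr0.
    rewrite integral_cst//= probability_setT mule1; over.
  by [].
pose p (u x : R) := normal_pdf 0 1 x * (normal_pdf 0 1 ((u - a * x) / b) / b).
have p0 u x : 0 <= p u x.
  by rewrite mulr_ge0 ?normal_pdf_ge0// divr_ge0 ?normal_pdf_ge0// ltW.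
have mp : measurable_fun setT (fun z : R * R => p z.2 z.1).
  apply: measurable_funM; first by apply: measurableT_comp => //; exact: measurable_normal_pdf.
  apply: measurable_funM => //; apply: measurableT_comp; first exact: measurable_normal_pdf.
  apply: measurable_funM => //; apply: measurable_funB => //; exact: measurable_funM.
have mF : measurable_fun setT (fun z : R * R => (h z.2 * (p z.2 z.1)%:E)%E).
  apply: emeasurable_funM; first exact: measurableT_comp.
  exact/measurable_EFinP.
have F0 (z : R * R) : (0 <= h z.2 * (p z.2 z.1)%:E)%E.
  by rewrite mule_ge0// lee_fin.
transitivity (\int[leb]_x \int[leb]_u (h u * (p u x)%:E))%E.
  rewrite ge0_integral_normal_prob; last 2 first.
  - apply: (@measurable_fun_fubini_tonelli_F _ _ _ _ R ngauss (fun z => h (a * z.1 + b * z.2)%R)) => //=.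
    by apply: measurableT_comp => //; apply: measurable_funD; exact: measurable_funM.
  - by move=> x; exact: integral_ge0.
  apply: eq_integral => x _.
  rewrite ge0_integral_normal_prob//; last first.
    by apply: measurableT_comp => //; apply: measurable_funD.
  rewrite (@ge0_integral_affine b (a * x) (fun u => h u * (p u x)%:E)%E)//; last 2 first.
  - exact: (mfun_section1 x mF).
  - by move=> u; exact: (F0 (x, u)).
  rewrite -ge0_integralZr//; last 3 first.
  - apply: emeasurable_funM; last by apply/measurable_EFinP; exact: measurable_normal_pdf.
    by apply: measurableT_comp => //; apply: measurable_funD.
  - by move=> y _; rewrite mule_ge0// lee_fin normal_pdf_ge0.
  - by rewrite lee_fin normal_pdf_ge0.
  apply: eq_integral => y _; rewrite -!muleA -!EFinM (addrC (b * y)).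
  congr (_ * _%:E)%E; rewrite /p addrAC subrr add0r [b * y]mulrC mulfK ?gt_eqF//.
  by rewrite -mulrA divfK ?gt_eqF// mulrC.
have := @fubini_tonelli _ _ _ _ R leb leb (fun z => h z.2 * (p z.2 z.1)%:E)%E mF F0.
rewrite /= => ->.
rewrite ge0_integral_normal_prob//; apply: eq_integral => u _.
rewrite ge0_integralZl//; last 2 first.
  by apply/measurable_EFinP; exact: (mfun_section2 u mp).
  by move=> x _; rewrite lee_fin.
congr (_ * _)%E.
(* Completing the square: given u, the variable x is normal with mean a u and standard deviation
   b. *)
have pE x : p u x = normal_pdf 0 1 u * normal_pdf (a * u) b x.
  rewrite /p !normal_pdfE ?oner_eq0 ?gt_eqF// /normal_fun /normal_peak.
  have -> : (Num.sqrt (b ^+ 2 * pi *+ 2))^-1 = (Num.sqrt (1 ^+ 2 * pi *+ 2))^-1 / b :> R.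
    rewrite -mulrnAr sqrtrM ?sqr_ge0// sqrtr_sqr gtr0_norm// invfM mulrC.
    by rewrite expr1n mul1r.
  set c := (Num.sqrt _)^-1.
  set e1 := expR _; set e2 := expR _; set e3 := expR _; set e4 := expR _.
  have E : e1 * e2 = e3 * e4.
    rewrite -!expRD; congr expR; rewrite !subr0 expr1n.
    have b2 : b ^+ 2 = 1 - a ^+ 2 by rewrite -ab addrAC subrr add0r.
    have b2n : 1 - a ^+ 2 != 0 by rewrite -b2 expf_neq0// gt_eqF.
    by rewrite expr_div_n b2; field; rewrite b2n.
  transitivity (c * c / b * (e1 * e2)); first by ring.
  by rewrite E; ring.
under eq_integral do rewrite pE EFinM.
rewrite ge0_integralZl//; last 3 first.
- by apply/measurable_EFinP; exact: measurable_normal_pdf.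
- by move=> x _; rewrite lee_fin normal_pdf_ge0.
- by rewrite lee_fin normal_pdf_ge0.
by rewrite integral_normal_pdf mule1.
Qed.

End normal_prob.

(** * The standard Gaussian on the default measurable structure of R *)

Section standard_gaussian.
Context {R : realType}.
(** The identity, seen as a measurable map from the copy of R that carries Lebesgue measure to R
    with its default structure, which tuples are built from. *)
Definition unborel (x : measurableTypeR R) : R := x.
Lemma measurable_unborel : measurable_fun setT unborel.
Proof. by move=> _ A mA; rewrite setTI. Qed.
HB.instance Definition _ := isMeasurableFun.Build _ _ _ _ unborel measurable_unborel.
(* [normal_prob] on the default Borel structure of R *)
Definition gauss : probability R R := distribution (normal_prob 0 (1 : R)) unborel.

Lemma gaussE (A : set R) : gauss A = normal_prob 0 1 A.
Proof. by []. Qed.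

Lemma integral_gaussE (h : R -> \bar R) :
  measurable_fun setT h -> (forall x, 0 <= h x)%E ->
  (\int[gauss]_x h x = \int[normal_prob 0 (1 : R)]_x h x)%E.
Proof.
by move=> mh h0; rewrite ge0_integral_pushforward.
Qed.

Lemma gauss_shift (a : R) (h : R -> \bar R) :
  measurable_fun setT h -> (forall x, 0 <= h x)%E ->
  (\int[gauss]_y h (y + a)%R = \int[gauss]_y ((expR (a * y - a ^+ 2 / 2))%:E * h y))%E.
Proof.
move=> mh h0; rewrite !integral_gaussE//; first exact: normal_prob_shift.
- apply: emeasurable_funM => //; apply/measurable_EFinP.
  by apply: measurableT_comp => //; apply: measurable_funB => //; apply: measurable_funM.
- by move=> x; rewrite mule_ge0// lee_fin expR_ge0.
- by apply: measurableT_comp => //; exact: measurable_funD.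
Qed.

Lemma gauss_merge (a b : R) (h : R -> \bar R) : 0 <= a -> 0 <= b ->
  a ^+ 2 + b ^+ 2 = 1 ->
  measurable_fun setT h -> (forall x, 0 <= h x)%E ->
  (\int[gauss]_x \int[gauss]_y h (a * x + b * y)%R = \int[gauss]_y h y)%E.
Proof.
move=> a0 b0 ab mh h0.
have mab : measurable_fun setT (fun z : R * R => h (a * z.1 + b * z.2)).
  by apply: measurableT_comp => //; apply: measurable_funD; exact: measurable_funM.
rewrite [RHS]integral_gaussE// -(normal_prob_merge a0 b0 ab)// integral_gaussE.
- by apply: eq_integral => x _; rewrite integral_gaussE//; exact: (mfun_section1 x mab).
- exact: (measurable_integral_section gauss (f := fun z => h (a * z.1 + b * z.2))).
- by move=> x; exact: integral_ge0.
Qed.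

End standard_gaussian.

Lemma emeasurable_bigprod d (X : measurableType d) (R : realType) (I : Type)
    (s : seq I) (F : I -> X -> \bar R) :
  (forall i, measurable_fun setT (F i)) ->
  measurable_fun setT (fun x => \prod_(i <- s) F i x)%E.
Proof.
move=> mF; elim: s => [|i s IHs].
  by rewrite (_ : (fun _ => _) = cst 1%E)//; apply/funext => x; rewrite big_nil.
rewrite (_ : (fun _ => _) = (F i \* (fun x => \prod_(j <- s) F j x))%E).
  exact: emeasurable_funM.
by apply/funext => x; rewrite big_cons.
Qed.

(** * Product laws on tuples *)

Section tuple_product.
Context d (T : measurableType d) {R : realType}.

Definition tcons n (z : T * n.-tuple T) : n.+1.-tuple T := [tuple of z.1 :: z.2].

Lemma measurable_tcons n : measurable_fun setT (@tcons n).
Proof. exact: (measurable_cons (@measurable_fst _ _ T _) measurable_snd). Qed.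

HB.instance Definition _ n :=
  isMeasurableFun.Build _ _ _ _ (@tcons n) (@measurable_tcons n).

(** The recursion through [tcons] lets every integral be unfolded one coordinate at a time by
    [tprodSE]. *)
Fixpoint tprod (P : probability T R) n : probability (n.-tuple T) R :=
  match n with
  | 0 => \d_ [tuple]
  | n.+1 => distribution (P \x tprod P n)%E (@tcons n)
  end.

Variable P : probability T R.

Lemma tprod0E (h : 0.-tuple T -> \bar R) : measurable_fun setT h ->
  (\int[tprod P 0]_t h t = h [tuple])%E.
Proof. by move=> mh; rewrite integral_dirac// diracT mul1e. Qed.

Lemma tprodSE n (h : n.+1.-tuple T -> \bar R) :
  measurable_fun setT h -> (forall x, 0 <= h x)%E ->
  (\int[tprod P n.+1]_t h t = \int[P]_x \int[tprod P n]_t h (tcons (x, t)))%E.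
Proof.
move=> mh h0; rewrite /= ge0_integral_pushforward//.
rewrite preimage_setT fubini_tonelli1//.
- by apply: measurableT_comp => //; exact: measurable_tcons.
- by move=> x; exact: h0.
Qed.

Lemma tprod_prod n (h : 'I_n -> T -> \bar R) :
  (forall i, measurable_fun setT (h i)) -> (forall i x, 0 <= h i x)%E ->
  (\int[tprod P n]_t (\prod_i h i (tnth t i)) = \prod_i \int[P]_x h i x)%E.
Proof.
have mprod m (k : 'I_m -> T -> \bar R) : (forall i, measurable_fun setT (k i)) ->
    measurable_fun setT (fun t : m.-tuple T => \prod_i k i (tnth t i))%E.
  by move=> mk; apply: emeasurable_bigprod => i; apply: measurableT_comp => //; exact: measurable_tnth.
elim: n h => [|n IHn] h mh h0.
  by rewrite tprod0E ?big_ord0//; exact: mprod.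
rewrite tprodSE; [|exact: mprod|by move=> x; exact: prode_ge0].
transitivity (\int[P]_x (h ord0 x * \prod_i \int[P]_y h (lift ord0 i) y))%E.
  apply: eq_integral => x _.
  transitivity (\int[tprod P n]_t (h ord0 x * \prod_i h (lift ord0 i) (tnth t i)))%E.
    by apply: eq_integral => t _; rewrite big_ord_recl tnth0; under eq_bigr do rewrite tnthS.
  rewrite ge0_integralZl//; last 2 first.
  - by apply: (mprod _ (fun i => h (lift ord0 i))) => i; exact: mh.
  - by move=> t _; exact: prode_ge0.
  by congr (_ * _)%E; exact: (IHn (fun i => h (lift ord0 i))).
rewrite ge0_integralZr//=; first by rewrite big_ord_recl.
by apply: prode_ge0 => i _; exact: integral_ge0.
Qed.

Definition box n (B : 'I_n -> set T) : set (n.-tuple T) :=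
  [set t | forall i, B i (tnth t i)].

Lemma measurable_box n (B : 'I_n -> set T) :
  (forall i, measurable (B i)) -> measurable (box B).
Proof.
move=> mB.
have -> : box B = \big[setI/setT]_(i < n) ((fun t : n.-tuple T => tnth t i) @^-1` B i).
  rewrite -bigcap_seq; apply/seteqP; split => t /=.
    by move=> Bt i _; exact: Bt.
  by move=> Bt i; apply: (Bt i); rewrite /= mem_index_enum.
apply: bigsetI_measurable => i _; rewrite -[X in measurable X]setTI.
exact: measurable_tnth.
Qed.

(** Boxes are stable under intersection and generate the measurable sets of tuples; finiteness of m1
    completes the uniqueness argument for measures. *)
Lemma tuple_measure_unique n (m1 m2 : {measure set (n.-tuple T) -> \bar R}) :
  (m1 setT < +oo)%E ->
  (forall B : 'I_n -> set T, (forall i, measurable (B i)) -> m1 (box B) = m2 (box B)) ->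
  forall A, measurable A -> m1 A = m2 A.
Proof.
move=> m1oo m12 A mA.
pose G : set (set (n.-tuple T)) :=
  [set A | exists2 B : 'I_n -> set T, (forall i, measurable (B i)) & A = box B].
have GT : G setT.
  by exists (fun=> setT) => //; apply/seteqP; split.
apply: (measure_unique G (fun=> setT)) => //.
- apply/seteqP; split.
    apply: smallest_sub; first exact: smallest_sigma_algebra.
    rewrite -bigcup_seq => C [i _ [D mD]]; rewrite setTI => <-.
    apply: sub_sigma_algebra; exists (fun j => if j == i then D else setT).
      by move=> j; case: ifP.
    apply/seteqP; split => t /=; last by move=> /(_ i); rewrite eqxx.
    by move=> Dt j; case: eqP => // ->.
  apply: smallest_sub; first exact: sigma_algebra_measurable.
  by move=> C [B mB ->]; exact: measurable_box.
- move=> C D [B mB ->] [B' mB' ->]; exists (fun i => B i `&` B' i).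
    by move=> i; exact: measurableI.
  apply/seteqP; split => t /=; first by move=> [Bt B't] i; split; [exact: Bt|exact: B't].
  by move=> Bt; split => i; have [] := Bt i.
- by apply/seteqP; split => // t _; exists 0%N.
- by move=> C [B mB ->]; exact: m12.
Qed.

Lemma tprod_box n (B : 'I_n -> set T) : (forall i, measurable (B i)) ->
  (tprod P n (box B) = \prod_i P (B i))%E.
Proof.
move=> mB; have mbB := measurable_box mB.
rewrite -[LHS]mul1e -[X in (X * _)%E]/(1%:E) -integral_cst//.
rewrite integral_mkcond.
under eq_integral => t _.
  rewrite patchE.
  have -> : (if t \in box B then cst 1%:E t else 0%E : \bar R) =
      (\prod_i (\1_(B i) (tnth t i))%:E)%E.
    case: ifPn.
      rewrite inE => Bt; rewrite big1// => i _; rewrite indicE mem_set//; exact: Bt.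
    rewrite notin_setE => /existsNP[i Bi]; rewrite (bigD1 i)//=.
    by rewrite indicE memNset// mul0e.
  over.
rewrite (tprod_prod (h := fun i x => (\1_(B i) x)%:E))//; last first.
  by move=> i; exact/measurable_EFinP/measurable_indic.
by apply: eq_bigr => i _; rewrite integral_indic// setIT.
Qed.

Lemma tprod_unique n (m : {measure set (n.-tuple T) -> \bar R}) :
  (forall B : 'I_n -> set T, (forall i, measurable (B i)) ->
     m (box B) = \prod_i P (B i))%E ->
  forall A, measurable A -> m A = tprod P n A.
Proof.
move=> mbox A mA; apply/esym; apply: tuple_measure_unique => //.
  by rewrite [X in (X < _)%E](@probability_setT _ _ _ (tprod P n)) ltry.
by move=> B mB; rewrite mbox//; exact: tprod_box.
Qed.

End tuple_product.

(** * Gaussian noise indexed by an arbitrary finite type *)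

Section noise.
Context {R : realType}.
Notation gauss := (@gauss R).

Definition noise (I : finType) : probability (#|I|.-tuple R) R := tprod gauss #|I|.

(** With [co] and [mk], coordinates are addressed by the elements of I themselves, so that edges,
    sums and options can be index sets and their enumerations stay out of sight. *)
Definition co (I : finType) (y : #|I|.-tuple R) (i : I) : R := tnth y (enum_rank i).
Definition mk (I : finType) (f : I -> R) : #|I|.-tuple R :=
  [tuple f (enum_val k) | k < #|I|].

Lemma co_mk (I : finType) (f : I -> R) i : co (mk f) i = f i.
Proof. by rewrite /co tnth_mktuple enum_rankK. Qed.

Lemma tnth_mk (I : finType) (f : I -> R) k : tnth (mk f) k = f (enum_val k).
Proof. by rewrite tnth_mktuple. Qed.

Lemma mk_co (I : finType) (y : #|I|.-tuple R) : mk (co y) = y.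
Proof. by apply: eq_from_tnth => k; rewrite tnth_mk /co enum_valK. Qed.

Lemma measurable_co (I : finType) (i : I) :
  measurable_fun setT (fun y : #|I|.-tuple R => co y i).
Proof. exact: measurable_tnth. Qed.

Lemma measurable_mk (I : finType) d (T : measurableType d) (f : T -> I -> R) :
  (forall i, measurable_fun setT (fun x => f x i)) ->
  measurable_fun setT (fun x => mk (f x)).
Proof.
move=> mf; apply/measurable_fun_tnthP => k.
by rewrite (_ : _ \o _ = fun x => f x (enum_val k))//; apply/funext => x /=; rewrite tnth_mk.
Qed.

Lemma noise_prod (I : finType) (h : I -> R -> \bar R) :
  (forall i, measurable_fun setT (h i)) -> (forall i x, 0 <= h i x)%E ->
  (\int[noise I]_y (\prod_i h i (co y i)) = \prod_i \int[gauss]_x h i x)%E.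
Proof.
move=> mh h0.
have enumP (F : I -> \bar R) : (\prod_i F i = \prod_(k < #|I|) F (enum_val k))%E.
  rewrite (reindex (fun k : 'I_#|I| => enum_val k))//=.
  by exists enum_rank => i _; rewrite ?enum_valK ?enum_rankK.
rewrite enumP -(tprod_prod _ (h := fun k => h (enum_val k)))//.
apply: eq_integral => y _; rewrite enumP.
by apply: eq_bigr => k _; rewrite /co enum_valK.
Qed.

Lemma noise_unique (I : finType) (m : {measure set (#|I|.-tuple R) -> \bar R}) :
  (forall B : I -> set R, (forall i, measurable (B i)) ->
     m [set y | forall i, B i (co y i)] = \prod_i gauss (B i))%E ->
  forall A, measurable A -> m A = noise I A.
Proof.
move=> mB A mA; apply: tprod_unique => // B mB'.
rewrite (reindex (fun i : I => enum_rank i))/=; last first.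
  by exists enum_val => i _; rewrite ?enum_valK ?enum_rankK.
rewrite -(mB (fun i => B (enum_rank i)))//; congr (m _).
apply/seteqP; split => y /= By i; first exact: By.
by have := By (enum_val i); rewrite /co enum_valK.
Qed.

Lemma noise_indic (I : finType) (B : I -> set R) (y : #|I|.-tuple R) :
  (\1_[set y | forall i, B i (co y i)] y)%:E = (\prod_i (\1_(B i) (co y i))%:E)%E
    :> \bar R.
Proof.
rewrite indicE; case: (boolP (_ \in _)).
  by rewrite inE /= => By; rewrite big1// => i _; rewrite indicE mem_set//; exact: By.
rewrite notin_setE/= => /existsNP[i Bi]; rewrite (bigD1 i)//=.
by rewrite indicE memNset// mul0e.
Qed.

Lemma measurable_cobox (I : finType) (B : I -> set R) :
  (forall i, measurable (B i)) ->
  measurable [set y : #|I|.-tuple R | forall i, B i (co y i)].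
Proof.
move=> mB; rewrite (_ : [set _ | _] = box (fun k => B (enum_val k))).
  by apply: measurable_box => k; exact: mB.
apply/seteqP; split => y /= By k.
  by have := By (enum_val k); rewrite /co enum_valK.
by have := By (enum_rank k); rewrite enum_rankK.
Qed.

Definition reco (I J : finType) (s : I -> J) (y : #|J|.-tuple R) : #|I|.-tuple R :=
  mk (fun i => co y (s i)).

Lemma measurable_reco (I J : finType) (s : I -> J) : measurable_fun setT (reco s).
Proof. by apply: measurable_mk => i; exact: measurable_co. Qed.

HB.instance Definition _ (I J : finType) (s : I -> J) :=
  isMeasurableFun.Build _ _ _ _ (reco s) (measurable_reco s).

(** Marginals of a product: forgetting the coordinates outside the image of s, and renaming the
    others, leaves standard noise. *)
Lemma noise_reco (I J : finType) (s : I -> J) : injective s ->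
  forall A, measurable A -> pushforward (noise J) (reco s) A = noise I A.
Proof.
move=> sI; apply: noise_unique => B mB.
rewrite /pushforward.
(* The box on J that pulls back the box B: by injectivity it is B i at s i, and it is the whole line
   where s does not reach. *)
pose B' j : set R := [set x | forall i, s i = j -> B i x].
have B's i : B' (s i) = B i.
  by apply/seteqP; split => x /=; [exact|move=> Bx i' /sI ->].
have B'N j : j \notin codom s -> B' j = setT.
  move=> js; apply/seteqP; split => // x _ i sij.
  by move: js; rewrite -sij codom_f.
have mB' j : measurable (B' j).
  have [/codomP[i ->]|/B'N ->//] := boolP (j \in codom s).
  by rewrite B's.
transitivity (noise J (reco s @^-1` [set y | forall i, B i (co y i)])); first by [].
have -> : reco s @^-1` [set y | forall i, B i (co y i)] =
    [set y | forall j, B' j (co y j)].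
  apply/seteqP; split => y /= By.
    by move=> j i <-; have := By i; rewrite co_mk.
  by move=> i; rewrite co_mk; exact: By.
rewrite -[LHS]mul1e -[LHS]/(1%:E * _)%E -integral_cst; last exact: measurable_cobox.
rewrite integral_mkcond.
transitivity (\int[noise J]_y (\prod_j (\1_(B' j) (co y j))%:E))%E.
  apply: eq_integral => y _; rewrite -noise_indic patchE indicE.
  by case: ifPn.
rewrite (noise_prod (h := fun j x => (\1_(B' j) x)%:E))//; last first.
  by move=> j; exact/measurable_EFinP/measurable_indic.
under eq_bigr => j _ do rewrite integral_indic// setIT.
rewrite (bigID (mem (codom s)))/= [X in (_ * X)%E]big1; last first.
  by move=> j /B'N ->; rewrite probability_setT.
rewrite mule1 (eq_bigl (mem [set s i | i in I]%SET)); last first.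
  move=> j; by apply/codomP/imsetP => [[i ->]|[i _ ->]]; exists i.
rewrite big_imset/=; last by move=> i i' _ _ /sI.
by apply: eq_big => i // _; rewrite B's.
Qed.

Definition mix (I : finType) (a b : I -> R) (z : #|I|.-tuple R * #|I|.-tuple R) :
    #|I|.-tuple R :=
  mk (fun i => a i * co z.1 i + b i * co z.2 i).

Lemma measurable_mix (I : finType) (a b : I -> R) : measurable_fun setT (mix a b).
Proof.
apply: measurable_mk => i; apply: measurable_funD; apply: measurable_funM => //.
  exact: (measurableT_comp (measurable_co i) measurable_fst).
exact: (measurableT_comp (measurable_co i) measurable_snd).
Qed.

HB.instance Definition _ (I : finType) (a b : I -> R) :=
  isMeasurableFun.Build _ _ _ _ (mix a b) (measurable_mix a b).

(** [gauss_merge] in each coordinate, with weights that may differ between coordinates. Read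
    backwards, it splits one noise into two independent ones, which is how an observation is cut
    into successive weaker observations. *)
Lemma noise_mix (I : finType) (a b : I -> R) :
  (forall i, 0 <= a i) -> (forall i, 0 <= b i) ->
  (forall i, a i ^+ 2 + b i ^+ 2 = 1) ->
  forall A, measurable A ->
    pushforward (noise I \x noise I)%E (mix a b) A = noise I A.
Proof.
move=> a0 b0 ab; apply: noise_unique => B mB.
rewrite /pushforward.
have mbB := measurable_cobox mB.
have mT : measurable (mix a b @^-1` [set y | forall i, B i (co y i)]).
  by rewrite -[X in measurable X]setTI; exact: measurable_mix.
transitivity ((noise I \x noise I)%E (mix a b @^-1` [set y | forall i, B i (co y i)])); first by [].
rewrite -[LHS]mul1e -[LHS]/(1%:E * _)%E -integral_cst// integral_mkcond.
have mab i : measurable_fun setT (fun z : R * R => \1_(B i) (a i * z.1 + b i * z.2) : R).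
  apply: (measurableT_comp (f := \1_(B i) : R -> R)) => //.
  by apply: measurable_funD; exact: measurable_funM.
transitivity (\int[(noise I \x noise I)%E]_z
    (\prod_i (\1_(B i) (a i * co z.1 i + b i * co z.2 i))%:E))%E.
  apply: eq_integral => z _; rewrite patchE.
  transitivity ((\1_[set y | forall i, B i (co y i)] (mix a b z))%:E : \bar R).
    rewrite indicE; case: ifPn => [/set_mem hz|/negP hz]; first by rewrite mem_set.
    by rewrite memNset// => hz'; apply: hz; exact: mem_set.
  by rewrite noise_indic; under eq_bigr do rewrite co_mk.
rewrite fubini_tonelli1//=; last 2 first.
- apply: emeasurable_bigprod => i; apply/measurable_EFinP.
  apply: (measurableT_comp (f := \1_(B i) : R -> R)) => //.
  apply: measurable_funD; apply: measurable_funM => //.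
    exact: (measurableT_comp (measurable_co i) measurable_fst).
  exact: (measurableT_comp (measurable_co i) measurable_snd).
- by move=> z; apply: prode_ge0 => i _; rewrite lee_fin.
rewrite /fubini_F/=.
transitivity (\int[noise I]_y (\prod_i \int[gauss]_x
    (\1_(B i) (a i * co y i + b i * x))%:E))%E.
  apply: eq_integral => y _.
  rewrite (noise_prod (h := fun i x => (\1_(B i) (a i * co y i + b i * x))%:E))//.
  by move=> i; apply/measurable_EFinP; exact: (mfun_section1 (co y i) (mab i)).
rewrite (noise_prod (h := fun i x => \int[gauss]_x' (\1_(B i) (a i * x + b i * x'))%:E)%E).
- apply: eq_bigr => i _.
  rewrite (gauss_merge (h := fun x => (\1_(B i) x)%:E))//.
    by rewrite integral_indic// setIT.
  by exact/measurable_EFinP/measurable_indic.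
- move=> i; apply: (measurable_integral_section gauss
    (f := fun z => (\1_(B i) (a i * z.1 + b i * z.2))%:E)) => //=.
  + exact/measurable_EFinP.
- by move=> i x; apply: integral_ge0 => x' _; rewrite lee_fin.
Qed.

Definition tshift n (v y : n.-tuple R) : n.-tuple R :=
  [tuple tnth y k + tnth v k | k < n].

Lemma measurable_tshift n (v : n.-tuple R) : measurable_fun setT (tshift v).
Proof.
apply/measurable_fun_tnthP => k.
rewrite (_ : _ \o _ = fun y => tnth y k + tnth v k).
  by apply: measurable_funD => //; exact: measurable_tnth.
by apply/funext => y /=; rewrite tnth_mktuple.
Qed.

(** Cameron-Martin in n dimensions: the shift of the tail is absorbed in [g] by induction, the shift
    of the head by [gauss_shift]. *)
Lemma tprod_shift n (v : n.-tuple R) (h : n.-tuple R -> \bar R) :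
  measurable_fun setT h -> (forall x, 0 <= h x)%E ->
  (\int[tprod gauss n]_y h (tshift v y) = \int[tprod gauss n]_y
     ((expR (\sum_k (tnth v k * tnth y k - tnth v k ^+ 2 / 2)))%:E * h y))%E.
Proof.
have mexp m (v' : m.-tuple R) : measurable_fun setT (fun y : m.-tuple R =>
   expR (\sum_k (tnth v' k * tnth y k - tnth v' k ^+ 2 / 2))).
  apply: measurableT_comp => //; apply: measurable_sum => k.
  by apply: measurable_funB => //; apply: measurable_funM => //; exact: measurable_tnth.
elim: n v h => [|n IHn] v h mh h0.
  rewrite !tprod0E.
  - by rewrite big_ord0 expR0 mul1e; congr h; exact: tuple0.
  - by apply: emeasurable_funM => //; apply/measurable_EFinP; exact: mexp.
  - by apply: measurableT_comp => //; exact: measurable_tshift.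
pose v0 := thead v; pose v' := [tuple of behead v].
have vE : v = tcons (v0, v') by rewrite /tcons/= [LHS]tuple_eta.
rewrite !tprodSE//; last 3 first.
- by apply: emeasurable_funM => //; apply/measurable_EFinP; exact: mexp.
- by move=> x; rewrite mule_ge0// lee_fin expR_ge0.
- by apply: measurableT_comp => //; exact: measurable_tshift.
pose g x := (\int[tprod gauss n]_t
  ((expR (\sum_k (tnth v' k * tnth t k - tnth v' k ^+ 2 / 2)))%:E * h (tcons (x, t))))%E.
transitivity (\int[gauss]_x g (x + v0)%R)%E.
  apply: eq_integral => x _; rewrite /g -IHn//; last first.
    by apply: (mfun_section1 _ (f := h \o tcons (n := n))); apply: measurableT_comp => //; exact: measurable_tcons.
  apply: eq_integral => t _; congr h; apply: eq_from_tnth => k.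
  rewrite tnth_mktuple vE.
  have [->|[j ->]] : k = ord0 \/ exists j, k = lift ord0 j.
    by case: (unliftP ord0 k) => [j ->|->]; [right; exists j|left].
    by rewrite !tnth0.
  by rewrite !tnthS tnth_mktuple.
transitivity (\int[gauss]_x ((expR (v0 * x - v0 ^+ 2 / 2))%:E * g x))%E.
  apply: gauss_shift.
- apply: (measurable_integral_section (tprod gauss n) (f := fun z =>
  ((expR (\sum_k (tnth v' k * tnth z.2 k - tnth v' k ^+ 2 / 2)))%:E * h (tcons z)))%E).
  + apply: emeasurable_funM; first by apply/measurable_EFinP; apply: (measurableT_comp (mexp _ v')).
    by apply: measurableT_comp => //; exact: measurable_tcons.
  + by move=> z; rewrite mule_ge0// lee_fin expR_ge0.
- by move=> x; apply: integral_ge0 => t _; rewrite mule_ge0// lee_fin expR_ge0.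
apply: eq_integral => x _; rewrite /g -ge0_integralZl//; last 2 first.
- apply: emeasurable_funM; first by apply/measurable_EFinP; exact: mexp.
  by apply: (mfun_section1 _ (f := h \o tcons (n := n))); apply: measurableT_comp => //; exact: measurable_tcons.
- by move=> t _; rewrite mule_ge0// lee_fin expR_ge0.
apply: eq_integral => t _; rewrite muleA -EFinM -expRD; congr (_%:E * _)%E.
congr expR; rewrite big_ord_recl vE !tnth0; congr (_ + _).
by apply: eq_bigr => k _; rewrite !tnthS.
Qed.

End noise.

(** No integrability is assumed: the extended integral is a difference of two nonnegative ones, each
    measurable by Tonelli. *)
Lemma measurable_Rintegral_section d d' (T : measurableType d) (T' : measurableType d')
  (R : realType) (P : probability T' R) (f : T * T' -> R) :
  measurable_fun setT f -> measurable_fun setT (fun x => \int[P]_y f (x, y)).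
Proof.
move=> mf; apply: measurableT_comp => //.
rewrite (_ : (fun x => _) = ((fun x => \int[P]_y (maxe (f (x, y))%:E 0%E)) \-
    (fun x => \int[P]_y (maxe (- (f (x, y))%:E) 0%E)))%E).
  apply: emeasurable_funB.
    apply: (measurable_integral_section P (f := fun z => maxe (f z)%:E 0%E)).
      by apply: measurable_maxe => //; exact/measurable_EFinP.
    by move=> z; rewrite le_max lexx orbT.
  apply: (measurable_integral_section P (f := fun z => maxe (- (f z)%:E)%E 0%E)).
    by apply: measurable_maxe => //; apply: measurableT_comp => //; exact/measurable_EFinP.
  by move=> z; rewrite le_max lexx orbT.
apply/funext => x; rewrite [LHS]integralE.
by congr (_ - _)%E; apply: eq_integral => y _; rewrite ?funeposE ?funenegE.
Qed.

Lemma sqr_le_expR (R : realType) (x : R) : x ^+ 2 <= 4 * (expR x + expR (- x)).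
Proof.
have E (u : R) : 0 <= u -> u ^+ 2 <= 4 * expR u.
  move=> u0; have -> : 4 * expR u = (2 * expR (u / 2)) ^+ 2.
    rewrite exprMn -expRM_natl; congr (_ * expR _); first by ring.
    by rewrite -mulr_natl; field.
  rewrite ler_sqr ?nnegrE ?mulr_ge0 ?expR_ge0//.
  have := expR_ge1Dx (u / 2); lra.
have [x0|x0] := leP 0 x.
  rewrite mulrDr; have := E _ x0; have := expR_ge0 (- x); lra.
have := E (- x); rewrite sqrrN oppr_ge0 => /(_ (ltW x0)).
have := expR_ge0 x; lra.
Qed.

(** * Functions of exponential growth and their Gaussian expectations *)

Section tame.
Context {R : realType}.

Section fixed_index.
Variable I : finType.
Implicit Types (h k : #|I|.-tuple R -> R) (y : #|I|.-tuple R).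

Definition nrm y : R := \sum_(i : I) `|co y i|.

(** A class closed under sums, products, translations and rotations of the noise, and integrable
    because Gaussians have all exponential moments. One constant serves as factor and as rate, which
    costs nothing by [tame_weak]. For finite priors every function met below is tame, so
    integrability becomes syntactic. *)
Definition tame h := measurable_fun setT h /\
  exists C, forall y, `|h y| <= C * expR (C * nrm y).

Definition EG h : R := \int[noise I]_y h y.

Lemma nrm_ge0 y : 0 <= nrm y.
Proof. by apply: sumr_ge0. Qed.

Lemma tame_bound h : tame h -> exists2 C, 0 <= C & forall y, `|h y| <= C * expR (C * nrm y).
Proof.
move=> [_ [C hC]]; exists C => //.
have y : #|I|.-tuple R := mk (fun=> 0).
have := le_trans (normr_ge0 _) (hC y).
by rewrite pmulr_lge0 // expR_gt0.
Qed.

Lemma tame_weak h C D : measurable_fun setT h ->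
  (forall y, `|h y| <= C * expR (D * nrm y)) -> tame h.
Proof.
move=> mh hC; split => //; exists (Num.max C D) => y.
apply: le_trans (hC y) _.
have C0 : 0 <= C.
  by have := le_trans (normr_ge0 _) (hC y); rewrite pmulr_lge0 // expR_gt0.
apply: ler_pM; rewrite ?expR_ge0// ?le_max ?lexx//.
by rewrite ler_expR ler_wpM2r ?nrm_ge0// le_max lexx orbT.
Qed.

Lemma tame_le h k : measurable_fun setT h -> (forall y, `|h y| <= `|k y|) ->
  tame k -> tame h.
Proof. by move=> mh hk [_ [C kC]]; split => //; exists C => y; exact: le_trans (hk y) _. Qed.

Lemma tame_cst c : tame (fun=> c).
Proof.
split=> //; exists `|c| => y; rewrite ler_peMr//.
have := expR_ge1Dx (`|c| * nrm y); apply: le_trans.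
by rewrite lerDl mulr_ge0 ?nrm_ge0.
Qed.

Lemma tameD h k : tame h -> tame k -> tame (fun y => h y + k y).
Proof.
move=> th tk; have [C C0 hC] := tame_bound th; have [D D0 kD] := tame_bound tk.
apply: (@tame_weak _ (C + D) (C + D)).
  by apply: measurable_funD; [case: th|case: tk].
move=> y; apply: le_trans (ler_normD _ _) _.
rewrite mulrDl lerD//.
  apply: le_trans (hC y) _; rewrite ler_wpM2l// ler_expR ler_wpM2r ?nrm_ge0//.
  by rewrite lerDl.
apply: le_trans (kD y) _; rewrite ler_wpM2l// ler_expR ler_wpM2r ?nrm_ge0//.
by rewrite lerDr.
Qed.

Lemma tameM h k : tame h -> tame k -> tame (fun y => h y * k y).
Proof.
move=> th tk; have [C C0 hC] := tame_bound th; have [D D0 kD] := tame_bound tk.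
apply: (@tame_weak _ (C * D) (C + D)).
  by apply: measurable_funM; [case: th|case: tk].
by move=> y; rewrite normrM mulrDl expRD mulrACA ler_pM.
Qed.

Lemma tameZ c h : tame h -> tame (fun y => c * h y).
Proof. by move=> th; apply: tameM => //; exact: tame_cst. Qed.

Lemma tameN h : tame h -> tame (fun y => - h y).
Proof.
move=> th; apply: (tame_le _ _ th); first by apply: measurableT_comp => //; case: th.
by move=> y; rewrite normrN.
Qed.

Lemma tameB h k : tame h -> tame k -> tame (fun y => h y - k y).
Proof. by move=> th tk; apply: tameD => //; exact: tameN. Qed.

Lemma tame_norm h : tame h -> tame (fun y => `|h y|).
Proof.
move=> th; apply: (tame_le _ _ th); first by apply: measurableT_comp => //; case: th.
by move=> y; rewrite normr_id.
Qed.

Lemma tameX h n : tame h -> tame (fun y => h y ^+ n).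
Proof.
move=> th; elim: n => [|n IHn]; first exact: tame_cst.
by rewrite (_ : (fun _ => _) = fun y => h y * h y ^+ n);
  [exact: tameM|apply/funext => y; rewrite exprS].
Qed.

Lemma tame_sum (K : Type) (s : seq K) (P : pred K) (h : K -> #|I|.-tuple R -> R) :
  (forall i, tame (h i)) -> tame (fun y => \sum_(i <- s | P i) h i y).
Proof.
move=> th; elim: s => [|i s IHs].
  by rewrite (_ : (fun _ => _) = cst 0);
    [exact: tame_cst|apply/funext => y; rewrite big_nil].
rewrite (_ : (fun _ => _) = (fun y => (if P i then h i y else 0) + \sum_(j <- s | P j) h j y)).
  by apply: tameD => //; case: (P i) => //; exact: tame_cst.
by apply/funext => y; rewrite big_cons; case: ifP => //; rewrite add0r.
Qed.

Lemma tame_co i : tame (fun y => co y i).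
Proof.
apply: (@tame_weak _ 1 1); first exact: measurable_co.
move=> y; rewrite !mul1r; apply: (@le_trans _ _ (nrm y)).
  by rewrite /nrm (bigD1 i)//= lerDl sumr_ge0.
by have := expR_ge1Dx (nrm y); lra.
Qed.

Lemma tame_lin (a : I -> R) : tame (fun y => \sum_i a i * co y i).
Proof. by apply: tame_sum => i; apply: tameZ; exact: tame_co. Qed.

Lemma tame_exp_lin (a : I -> R) c : tame (fun y => expR (\sum_i a i * co y i + c)).
Proof.
apply: (@tame_weak _ (expR c) (\sum_i `|a i|)).
  by apply: measurableT_comp => //; apply: measurable_funD => //; case: (tame_lin a).
move=> y; rewrite ger0_norm ?expR_ge0// expRD mulrC ler_wpM2l ?expR_ge0// ler_expR.
rewrite mulr_suml; apply: ler_sum => i _.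
apply: le_trans (ler_norm _) _; rewrite normrM ler_wpM2l//.
by rewrite /nrm (bigD1 i)//= lerDl sumr_ge0.
Qed.

(** From |ln t| <= t + 1/t. *)
Lemma tame_ln h : (forall y, 0 < h y) -> tame h -> tame (fun y => (h y)^-1) ->
  tame (fun y => ln (h y)).
Proof.
move=> h0 th tv; apply: (@tame_le _ (fun y => h y + (h y)^-1)); last exact: tameD.
  by apply: measurableT_comp; [exact: measurable_ln|case: th].
move=> y; rewrite [leRHS]ger0_norm; last by rewrite addr_ge0 ?invr_ge0// ltW.
have v0 : 0 < (h y)^-1 by rewrite invr_gt0.
rewrite ler_norml; apply/andP; split.
  rewrite lerNl -lnV ?posrE//; have := ln_sublinear v0; have := h0 y; lra.
by have := ln_sublinear (h0 y); lra.
Qed.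

(** The shift formula applied to the constant 1 says that the Cameron-Martin density has total mass
    1. *)
Lemma gauss_expR (a : R) : (\int[gauss]_x (expR (a * x))%:E = (expR (a ^+ 2 / 2))%:E)%E.
Proof.
have mexp c : measurable_fun setT (fun x : R => (expR (c * x - c ^+ 2 / 2))%:E).
  apply/measurable_EFinP; apply: measurableT_comp => //.
  by apply: measurable_funB => //; exact: measurable_funM.
have /esym := gauss_shift a (h := fun=> 1%E) (measurable_cst _) (fun=> lee01).
rewrite (_ : \int[gauss]__ 1 = 1)%E; last first.
  by rewrite integral_cst// mul1e; exact: (@probability_setT _ _ _ gauss).
under eq_integral do rewrite mule1.
move=> H; rewrite -[RHS]mule1 -{1}H -ge0_integralZl//.
by apply: eq_integral => x _; rewrite -EFinM -expRD; congr (expR _)%:E; ring.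
Qed.

Lemma nrm_exp_integral (C : R) : 0 <= C -> (\int[noise I]_y (expR (C * nrm y))%:E < +oo)%E.
Proof.
move=> C0.
have mexp c : measurable_fun setT (fun x : R => (expR (c * x))%:E).
  by apply/measurable_EFinP; apply: measurableT_comp => //; exact: measurable_funM.
have mabs : measurable_fun setT (fun x : R => (expR (C * `|x|))%:E).
  apply/measurable_EFinP; apply: measurableT_comp => //.
  by apply: measurable_funM => //; exact: measurableT_comp.
rewrite (_ : (fun y => _) = fun y => (\prod_i (expR (C * `|co y i|))%:E)%E); last first.
  by apply/funext => y; rewrite /nrm mulr_sumr expR_sum -prodEFin.
rewrite (noise_prod (h := fun i x => (expR (C * `|x|))%:E))//.
suff H : (\int[gauss]_x (expR (C * `|x|))%:E < +oo :> \bar R)%E.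
  rewrite (_ : (\int[gauss]_x (expR (C * `|x|))%:E)%E =
    (fine (\int[gauss]_x (expR (C * `|x|))%:E)%E)%:E) ?prodEFin ?ltry//.
  by rewrite fineK// ge0_fin_numE// integral_ge0// => x _; rewrite lee_fin expR_ge0.
apply: (@le_lt_trans _ _ (\int[gauss]_x ((expR (C * x))%:E + (expR (- C * x))%:E))%E).
  apply: ge0_le_integral => //.
  - exact: emeasurable_funD.
  - move=> x _; rewrite -EFinD lee_fin; have [x0|x0] := leP 0 x.
      by rewrite ger0_norm// lerDl expR_ge0.
    by rewrite ltr0_norm// mulrN -mulNr lerDr expR_ge0.
rewrite ge0_integralD//.
by rewrite !gauss_expR -EFinD ltry.
Qed.

Lemma tame_integrable h : tame h -> (noise I).-integrable setT (EFin \o h).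
Proof.
move=> th; have [C C0 hC] := tame_bound th; have [mh _] := th.
have mC : measurable_fun setT (fun y : #|I|.-tuple R => expR (C * nrm y)).
  apply: measurableT_comp => //; apply: measurable_funM => //.
  apply: measurable_sum => i; apply: measurableT_comp => //; exact: measurable_co.
apply: (@le_integrable _ _ _ _ _ measurableT _ (EFin \o (fun y => C * expR (C * nrm y)))).
- exact/measurable_EFinP.
- move=> y _ /=; rewrite lee_fin; apply: le_trans (hC y) _.
  exact: ler_norm.
rewrite (_ : EFin \o _ = (fun y => C%:E * (expR (C * nrm y))%:E)%E)//.
apply: integrableZl => //; apply/integrableP; split; first exact/measurable_EFinP.
rewrite (le_lt_trans _ (nrm_exp_integral C0))//; apply: ge0_le_integral => //.
- exact/measurable_EFinP/measurableT_comp.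
- exact/measurable_EFinP.
- by move=> y _; rewrite /= ger0_norm ?expR_ge0.
Qed.

Lemma EGD h k : tame h -> tame k -> EG (fun y => h y + k y) = EG h + EG k.
Proof. by move=> th tk; apply: RintegralD => //; exact: tame_integrable. Qed.

Lemma EGB h k : tame h -> tame k -> EG (fun y => h y - k y) = EG h - EG k.
Proof. by move=> th tk; apply: RintegralB => //; exact: tame_integrable. Qed.

Lemma EGZ c h : tame h -> EG (fun y => c * h y) = c * EG h.
Proof. by move=> th; apply: RintegralZl => //; exact: tame_integrable. Qed.

Lemma EG_cst c : EG (fun=> c) = c.
Proof.
transitivity (c * fine (noise I setT)); first exact: Rintegral_cst.
by rewrite (_ : noise I setT = 1%E) ?mulr1//; exact: probability_setT.
Qed.

Lemma le_EG h k : tame h -> tame k -> (forall y, h y <= k y) -> EG h <= EG k.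
Proof. by move=> th tk hk; apply: le_Rintegral => //; exact: tame_integrable. Qed.

Lemma EG_ge0 h : (forall y, 0 <= h y) -> 0 <= EG h.
Proof. by move=> h0; exact: Rintegral_ge0. Qed.

Lemma EG_sum (K : Type) (s : seq K) (h : K -> #|I|.-tuple R -> R) :
  (forall i, tame (h i)) ->
  EG (fun y => \sum_(i <- s) h i y) = \sum_(i <- s) EG (h i).
Proof.
move=> th; elim: s => [|i s IHs].
  by rewrite big_nil -[RHS](EG_cst 0); congr EG; apply/funext => y; rewrite big_nil.
rewrite big_cons -IHs -EGD//; last exact: tame_sum.
by congr EG; apply/funext => y; rewrite big_cons.
Qed.

Lemma EG_EFin h : tame h -> (EG h)%:E = (\int[noise I]_y (h y)%:E)%E.
Proof.
move=> th; rewrite /EG fineK//; apply: integrable_fin_num => //.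
exact: tame_integrable.
Qed.


Lemma EG_pos_neg h : tame h -> EG h = EG (fun y => h y + `|h y|) - EG (fun y => `|h y|).
Proof. by move=> th; rewrite EGD ?addrK//; exact: tame_norm. Qed.

Definition yshift (v : I -> R) y : #|I|.-tuple R := mk (fun i => co y i + v i).

Lemma shiftE v y : yshift v y = tshift (mk v) y.
Proof. by apply: eq_from_tnth => k; rewrite tnth_mk tnth_mktuple tnth_mk /co enum_valK. Qed.

(** The likelihood ratio of signal v plus noise against noise alone. *)
Definition expo (v : I -> R) y : R := expR (\sum_i (v i * co y i - v i ^+ 2 / 2)).

Lemma expoE v y : expo v y = expR (\sum_i v i * co y i + - \sum_i v i ^+ 2 / 2).
Proof. by rewrite /expo sumrB. Qed.

Lemma expo_gt0 v y : 0 < expo v y.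
Proof. exact: expR_gt0. Qed.

Lemma tame_expo v : tame (expo v).
Proof.
by rewrite (_ : expo v = fun y => expR (\sum_i v i * co y i + - \sum_i v i ^+ 2 / 2));
  [exact: tame_exp_lin|apply/funext => y; rewrite expoE].
Qed.

Lemma expo_inv v y : (expo v y)^-1 = expR (\sum_i (- v i) * co y i + \sum_i v i ^+ 2 / 2).
Proof.
rewrite expoE -expRN opprD opprK -sumrN; congr expR; congr (_ + _).
by apply: eq_bigr => i _; rewrite mulNr.
Qed.

Lemma tame_expo_inv v : tame (fun y => (expo v y)^-1).
Proof.
by rewrite (_ : (fun _ => _) = fun y => expR (\sum_i (- v i) * co y i + \sum_i v i ^+ 2 / 2));
  [exact: tame_exp_lin|apply/funext => y; rewrite expo_inv].
Qed.

Lemma nrm_shift v y : nrm (yshift v y) <= nrm y + \sum_i `|v i|.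
Proof. by rewrite /nrm -big_split/=; apply: ler_sum => i _; rewrite co_mk ler_normD. Qed.

Lemma tame_shift v h : tame h -> tame (fun y => h (yshift v y)).
Proof.
move=> th; have [C C0 hC] := tame_bound th.
apply: (@tame_weak _ (C * expR (C * \sum_i `|v i|)) C).
  apply: measurableT_comp; first by case: th.
  by apply: measurable_mk => i; apply: measurable_funD => //; exact: measurable_co.
move=> y; apply: le_trans (hC _) _; rewrite -mulrA -expRD ler_wpM2l// ler_expR.
by rewrite -mulrDr ler_wpM2l// addrC nrm_shift.
Qed.

(** [tprod_shift] covers nonnegative functions; a tame h is the difference of h + |h| and |h|. *)
Lemma EG_shift v h : tame h -> EG (fun y => h (yshift v y)) = EG (fun y => expo v y * h y).
Proof.
have pos k : tame k -> (forall y, 0 <= k y) ->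
    EG (fun y => k (yshift v y)) = EG (fun y => expo v y * k y).
  move=> tk k0; rewrite /EG /Rintegral; congr fine.
  have := @tprod_shift R _ (mk v) (EFin \o k) _ _.
  move=> H.
  transitivity (\int[tprod gauss #|I|]_y (k (tshift (mk v) y))%:E)%E.
    by apply: eq_integral => y _; rewrite shiftE.
  rewrite H.
  - apply: eq_integral => y _; rewrite -EFinM /expo; congr (expR _ * _)%:E.
    rewrite [RHS](reindex (fun k : 'I_#|I| => enum_val k))/=; last first.
      by exists enum_rank => i _; rewrite ?enum_valK ?enum_rankK.
    by apply: eq_bigr => i _; rewrite tnth_mk /co enum_valK.
  - by apply/measurable_EFinP; case: tk.
  - by move=> x; rewrite lee_fin.
move=> th; have ta := tame_norm th; have td := tameD th ta.
rewrite (EG_pos_neg (tame_shift v th)) (pos _ ta)// (pos _ td); last first.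
  by move=> y; rewrite -lerBlDr sub0r lerNnormlW.
rewrite -EGB; last 2 first.
- by apply: tameM => //; exact: tame_expo.
- by apply: tameM => //; exact: tame_expo.
by congr EG; apply/funext => y; rewrite -mulrBr addrK.
Qed.

Lemma EG_expo v : EG (expo v) = 1.
Proof.
rewrite -[RHS](EG_cst 1) (EG_shift v (tame_cst 1)).
by congr EG; apply/funext => y; rewrite mulr1.
Qed.

End fixed_index.

Section changes_of_index.
Variables (I J : finType).

Lemma tame_reco (s : I -> J) (h : #|I|.-tuple R -> R) : tame h ->
  tame (fun y : #|J|.-tuple R => h (reco s y)).
Proof.
move=> th; have [C C0 hC] := tame_bound th.
apply: (@tame_weak _ _ C (C * #|I|%:R)).
  by apply: measurableT_comp; [case: th|exact: measurable_reco].
move=> y; apply: le_trans (hC _) _; rewrite ler_wpM2l// ler_expR -mulrA ler_wpM2l//.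
rewrite mulrC mulr_natr -sumr_const; apply: ler_sum => i _; rewrite co_mk.
by rewrite /nrm (bigD1 (s i))//= lerDl sumr_ge0.
Qed.

Lemma EG_reco (s : I -> J) (h : #|I|.-tuple R -> R) : injective s -> tame h ->
  EG (fun y : #|J|.-tuple R => h (reco s y)) = EG h.
Proof.
move=> sI th; rewrite /EG /Rintegral; congr fine.
transitivity (\int[pushforward (noise J) (reco s)]_y (h y)%:E)%E.
  rewrite integral_pushforward//.
  - by apply/measurable_EFinP; case: th.
  - by rewrite preimage_setT; exact: (tame_integrable (tame_reco s th)).
by apply: eq_measure_integral => A mA _; exact: noise_reco.
Qed.

End changes_of_index.

Section mixing.
Variables (I : finType) (a b : I -> R).
Hypotheses (a0 : forall i, 0 <= a i) (b0 : forall i, 0 <= b i).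
Hypothesis ab : forall i, a i ^+ 2 + b i ^+ 2 = 1.

Let a1 i : `|a i| <= 1.
Proof.
rewrite ger0_norm// -ler_sqr ?nnegrE// expr1n -(ab i).
by rewrite lerDl sqr_ge0.
Qed.

Let b1 i : `|b i| <= 1.
Proof.
rewrite ger0_norm// -ler_sqr ?nnegrE// expr1n -(ab i).
by rewrite lerDr sqr_ge0.
Qed.

Lemma nrm_mix y y' : nrm (mix a b (y, y')) <= nrm y + nrm y'.
Proof.
rewrite /nrm -big_split/=; apply: ler_sum => i _; rewrite co_mk.
apply: le_trans (ler_normD _ _) _; rewrite !normrM; apply: lerD.
  by rewrite ler_piMl.
by rewrite ler_piMl.
Qed.

Lemma tame_mix1 h y : tame h -> tame (fun y' => h (mix a b (y, y'))).
Proof.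
move=> th; have [C C0 hC] := tame_bound th.
apply: (@tame_weak _ _ (C * expR (C * nrm y)) C).
  apply: (measurableT_comp (proj1 th)); exact: (mfun_section1 y (measurable_mix a b)).
move=> y'; apply: le_trans (hC _) _; rewrite -mulrA -expRD ler_wpM2l// ler_expR.
by rewrite -mulrDr ler_wpM2l// nrm_mix.
Qed.

Lemma tame_mix h : tame h -> tame (fun y => EG (fun y' => h (mix a b (y, y')))).
Proof.
move=> th; have [C C0 hC] := tame_bound th.
have tC : tame (fun y : #|I|.-tuple R => expR (C * nrm y)).
  apply: (@tame_weak _ _ 1 C).
    apply: measurableT_comp => //; apply: measurable_funM => //.
    apply: measurable_sum => i; apply: measurableT_comp => //; exact: measurable_co.
  by move=> y; rewrite mul1r ger0_norm// expR_ge0.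
apply: (@tame_weak _ _ (C * EG (fun y : #|I|.-tuple R => expR (C * nrm y))) C).
  apply: (measurable_Rintegral_section (noise I) (f := fun z => h (mix a b z))).
  by apply: (measurableT_comp (proj1 th)); exact: measurable_mix.
move=> y; apply: (@le_trans _ _ (EG (fun y' => `|h (mix a b (y, y'))|))).
  apply: le_normr_Rintegral => //; apply: tame_integrable; exact: tame_mix1.
rewrite mulrAC -EGZ//.
apply: le_EG.
- by apply: tame_norm; exact: tame_mix1.
- exact: tameZ.
- move=> y'; apply: le_trans (hC _) _; rewrite -mulrA ler_wpM2l// -expRD ler_expR.
  by rewrite -mulrDr ler_wpM2l// nrm_mix.
Qed.

Lemma EG_mix h : tame h -> EG h = EG (fun y => EG (fun y' => h (mix a b (y, y')))).
Proof.
move=> th.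
have eqI (k : #|I|.-tuple R -> \bar R) : (\int[noise I]_y k y =
    \int[pushforward (noise I \x noise I) (mix a b)]_y k y)%E.
  by apply: eq_measure_integral => A mA _; exact/esym/noise_mix.
have inth : (noise I \x noise I)%E.-integrable setT (fun z => (h (mix a b z))%:E).
  have [mh hoo] := integrableP _ _ _ (tame_integrable th).
  apply/integrableP; split.
    by apply: (measurableT_comp mh); exact: measurable_mix.
  rewrite (le_lt_trans _ hoo)//.
  rewrite eqI.
  rewrite ge0_integral_pushforward//.
  by apply: measurableT_comp.
rewrite /EG {1}/Rintegral.
transitivity (fine (\int[(noise I \x noise I)%E]_z (h (mix a b z))%:E)%E).
  congr fine.
  rewrite eqI.
  rewrite integral_pushforward//.
  by apply/measurable_EFinP; case: th.
rewrite -integral12_prod_meas1//; congr fine; apply: eq_integral => y _.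
by rewrite /fubini_F -EG_EFin//; exact: tame_mix1.
Qed.

End mixing.

Section moments.
Variable I : finType.

(** A rotation with both weights c, c^2 = 1/2, shows that the mean equals 2c times itself, and 2c is
    not 1. *)
Lemma EG_co (i : I) : EG (fun y => co y i) = 0.
Proof.
pose c := Num.sqrt (1 / 2 : R).
have c2 : c ^+ 2 = 1 / 2 by rewrite sqr_sqrtr// divr_ge0.
have c0 : 0 <= c by exact: sqrtr_ge0.
have cc (i' : I) : c ^+ 2 + c ^+ 2 = 1 by rewrite c2; field.
have t := tame_co i.
have := EG_mix (fun=> c0) (fun=> c0) cc t.
rewrite (_ : (fun y => EG _) = fun y => c * co y i + c * EG (fun y => co y i)); last first.
  apply/funext => y; rewrite -EGZ// -[c * co y i](@EG_cst I) -EGD; last 2 first.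
  - exact: tame_cst.
  - exact: tameZ.
  by congr EG; apply/funext => y'; rewrite co_mk.
rewrite EGD; last 2 first.
- exact: tameZ.
- exact: tame_cst.
rewrite EG_cst EGZ// => H.
have : (1 - (c + c)) * EG (fun y => co y i) = 0 by rewrite mulrBl mul1r mulrDl -H subrr.
move=> /eqP; rewrite mulf_eq0 => /orP[/eqP h|/eqP//].
have {cc} h2 : c = 1 / 2 by clear cc; lra.
by move: c2; rewrite h2 => h3; exfalso; move: h3; lra.
Qed.

Lemma EG_expo_co (v : I -> R) i : EG (fun y => expo v y * co y i) = v i.
Proof.
rewrite -(EG_shift v (tame_co i)).
rewrite (_ : (fun y => _) = fun y => co y i + v i); last first.
  by apply/funext => y; rewrite co_mk.
rewrite EGD ?EG_co ?EG_cst ?add0r//; [exact: tame_co|exact: tame_cst].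
Qed.

Lemma EG_lin (c : I -> R) : EG (fun y => \sum_i c i * co y i) = 0.
Proof.
rewrite EG_sum; last by move=> i; apply: tameZ; exact: tame_co.
by rewrite big1// => i _; rewrite EGZ ?EG_co ?mulr0//; exact: tame_co.
Qed.

(** After normalization the square is dominated by exponentials through [sqr_le_expR], whose
    expectations are known. The constant is far from the true variance, but only some absolute
    constant matters later. *)
Lemma EG_lin2 (c : I -> R) :
  EG (fun y => (\sum_i c i * co y i) ^+ 2) <= 8 * expR (1 / 2) * \sum_i c i ^+ 2.
Proof.
have S0 : 0 <= \sum_i c i ^+ 2 by apply: sumr_ge0 => i _; exact: sqr_ge0.
have tl := tame_lin c.
have [S00|Sn0] := eqVneq (\sum_i c i ^+ 2) 0.
  have ci i : c i = 0.
    apply/eqP; rewrite -sqrf_eq0; apply/eqP; apply: le_anti; rewrite sqr_ge0 andbT.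
    by rewrite -S00 (bigD1 i)//= lerDl sumr_ge0// => j _; exact: sqr_ge0.
  rewrite S00 mulr0 le_eqVlt -[X in _ == X](@EG_cst I 0).
  apply/orP; left; apply/eqP; congr EG; apply/funext => y.
  by rewrite big1 ?expr0n// => i _; rewrite ci mul0r.
set s := Num.sqrt (\sum_i c i ^+ 2).
have s2 : s ^+ 2 = \sum_i c i ^+ 2 by rewrite sqr_sqrtr.
have s0 : 0 < s by rewrite sqrtr_gt0 lt_neqAle eq_sym Sn0.
pose v e i := e * (c i / s).
have v2 e : e ^+ 2 = 1 -> \sum_i v e i ^+ 2 / 2 = 1 / 2.
  move=> e1; rewrite -mulr_suml; congr (_ / _).
  under eq_bigr => i _ do rewrite /v exprMn e1 mul1r expr_div_n.
  by rewrite -mulr_suml s2 divff.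
have vE e y : e ^+ 2 = 1 ->
    expR (e * ((\sum_i c i * co y i) / s)) = expR (1 / 2) * expo (v e) y.
  move=> e1; rewrite expoE v2// -expRD; congr expR.
  rewrite addrCA subrr addr0 mulr_suml mulr_sumr.
  by apply: eq_bigr => i _; rewrite /v; ring.
have -> : (fun y => (\sum_i c i * co y i) ^+ 2) =
    (fun y => s ^+ 2 * ((\sum_i c i * co y i) / s) ^+ 2).
  by apply/funext => y; rewrite expr_div_n mulrC divfK// expf_neq0// gt_eqF.
have tls : tame (fun y => ((\sum_i c i * co y i) / s) ^+ 2).
  by apply: tameX; rewrite (_ : (fun _ => _) = fun y => s^-1 * \sum_i c i * co y i);
    [exact: tameZ|apply/funext => y; rewrite mulrC].
rewrite EGZ// s2 mulrC ler_wpM2r//.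
have te e : tame (expo (v e)) by exact: tame_expo.
apply: (@le_trans _ _ (EG (fun y => 4 * expR (1 / 2) * (expo (v 1) y + expo (v (-1)) y)))).
  apply: le_EG => //; first by apply: tameZ; exact: tameD.
  move=> y; apply: le_trans (sqr_le_expR _) _.
  rewrite -[X in expR X + _]mul1r -[X in _ + expR X]mulN1r !vE ?expr1n ?sqrrN ?expr1n//.
  by rewrite -mulrDr mulrA.
rewrite EGZ; last exact: tameD.
rewrite EGD// !EG_expo; lra.
Qed.

End moments.
End tame.

(** * Pointwise inequalities behind the entropy bounds *)

Section elementary.
Context {R : realType}.
Implicit Types x z t l g K : R.

Lemma ln_le_subr1 t : 0 < t -> ln t <= t - 1.
Proof.
move=> t0; rewrite -{1}(subrK 1 t) addrC; apply: le_ln1Dx.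
by rewrite ltrBrDl subrr.
Qed.

(** The logarithm lies below its tangent at 1. Integrated for two probability densities l and g,
    this is Gibbs' inequality: replacing ln l by ln g can only decrease the entropy integral. *)
Lemma gibbs_lower l g : 0 < l -> 0 < g -> l * ln g + l - g <= l * ln l.
Proof.
move=> l0 g0; have := ln_le_subr1 (divr_gt0 g0 l0); rewrite ln_div ?posrE//.
rewrite -(ler_pM2l l0) !mulrBr mulr1 mulrCA divff ?gt_eqF//; lra.
Qed.

(** The matching upper bound, with a chi-square type remainder l^2/g - l. *)
Lemma gibbs_upper l g : 0 < l -> 0 < g -> l * ln l <= l * ln g + l ^+ 2 / g - l.
Proof.
move=> l0 g0; have := ln_le_subr1 (divr_gt0 l0 g0); rewrite ln_div ?posrE//.
rewrite -(ler_pM2l l0) !mulrBr mulr1 mulrA -expr2; lra.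
Qed.

(** Keeping the linear term exact is essential: it averages to zero in [avg_expR_cov], leaving only
    second-order errors. *)
Lemma expR_le_quad z K : `|z| <= K -> expR z - 1 <= z + z ^+ 2 * expR K.
Proof.
move=> zK; have h1 : expR z * (1 - z) <= 1.
  rewrite -ler_pdivlMl ?expR_gt0// mulr1 -expRN.
  exact: expR_ge1Dx.
have [z0|z0] := leP 0 z.
  have h2 : expR z <= expR K by rewrite ler_expR (le_trans (ler_norm z)).
  have h3 : z ^+ 2 * expR z <= z ^+ 2 * expR K by rewrite ler_wpM2l ?sqr_ge0.
  have h4 : z * (expR z - 1) <= z * (z * expR z).
    by rewrite ler_wpM2l//; lra.
  rewrite expr2 in h3; lra.
have h2 : 1 <= expR K by rewrite -expR0 ler_expR (le_trans _ zK).
have h3 : z ^+ 2 * 1 <= z ^+ 2 * expR K by rewrite ler_wpM2l ?sqr_ge0.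
have h4 := expR_ge1Dx z.
have h5 : - z * (1 - expR z) <= - z * - z by rewrite ler_wpM2l; lra.
rewrite expr2 in h3; lra.
Qed.

(** Each c gives an affine minorant of the convex function (t, l) -> t^2/l. A trial value of c thus
    gives a lower bound on a squared posterior mean. *)
Lemma perspective t l c : 0 < l -> 2 * t * c - c ^+ 2 * l <= t ^+ 2 / l.
Proof.
move=> l0; rewrite ler_pdivlMr//.
have := sqr_ge0 (t - c * l); rewrite sqrrB; lra.
Qed.

End elementary.

(** * Observation of a finitely supported signal in Gaussian noise *)

Section finite_prior.
Context {R : realType}.

Definition weights (W : finType) (w : W -> R) :=
  (forall x, 0 <= w x) /\ \sum_x w x = 1.

Definition xlnx (t : R) := t * ln t.

Definition lik (W I : finType) (w : W -> R) (f : W -> I -> R) (y : #|I|.-tuple R) : R :=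
  \sum_x w x * expo (f x) y.

(** The relative entropy, with respect to pure noise, of the law of f x plus noise when x is drawn
    with weights w; [lik] is the density of that law. *)
Definition ent (W I : finType) (w : W -> R) (f : W -> I -> R) : R :=
  EG (fun y => xlnx (lik w f y)).

Definition avg (W : finType) (w : W -> R) (h : W -> R) : R := \sum_x w x * h x.

Lemma weights_avg_cst (W : finType) (w : W -> R) c : weights w -> avg w (fun=> c) = c.
Proof. by case=> _ w1; rewrite /avg -mulr_suml w1 mul1r. Qed.

Lemma avgD (W : finType) (w : W -> R) h k :
  avg w (fun x => h x + k x) = avg w h + avg w k.
Proof. by rewrite /avg -big_split; apply: eq_bigr => x _; rewrite mulrDr. Qed.

Lemma avgZ (W : finType) (w : W -> R) c h : avg w (fun x => c * h x) = c * avg w h.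
Proof. by rewrite /avg mulr_sumr; apply: eq_bigr => x _; rewrite mulrCA. Qed.

Lemma avgB (W : finType) (w : W -> R) h k :
  avg w (fun x => h x - k x) = avg w h - avg w k.
Proof. by rewrite /avg -sumrB; apply: eq_bigr => x _; rewrite mulrBr. Qed.

Lemma avg_sum (W K : finType) (w : W -> R) (h : K -> W -> R) :
  avg w (fun x => \sum_k h k x) = \sum_k avg w (h k).
Proof. by rewrite /avg exchange_big/=; apply: eq_bigr => x _; rewrite mulr_sumr. Qed.

Lemma le_avg (W : finType) (w : W -> R) h k : (forall x, 0 <= w x) ->
  (forall x, h x <= k x) -> avg w h <= avg w k.
Proof. by move=> w0 hk; apply: ler_sum => x _; rewrite ler_wpM2l. Qed.

Lemma avg_sqr_le (W : finType) (w : W -> R) h : weights w ->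
  avg w h ^+ 2 <= avg w (fun x => h x ^+ 2).
Proof.
move=> ww; have [w0 _] := ww; set m := avg w h.
have : 0 <= avg w (fun x => (h x - m) ^+ 2).
  by apply: sumr_ge0 => x _; rewrite mulr_ge0 ?sqr_ge0.
rewrite (_ : (fun x => _) = fun x => h x ^+ 2 + (- 2 * m * h x + m ^+ 2)); last first.
  by apply/funext => x; ring.
rewrite !avgD avgZ weights_avg_cst// -/m; lra.
Qed.

Section fixed.
Variables (W I : finType) (w : W -> R) (f : W -> I -> R).
Hypothesis ww : weights w.

Let w0 : forall x, 0 <= w x. Proof. by case: ww. Qed.
Let w1 : \sum_x w x = 1. Proof. by case: ww. Qed.

Lemma weights_pos : exists x, 0 < w x.
Proof.
apply: contrapT => /forallNP h; have := w1; rewrite big1 => [/eqP|x _].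
  by rewrite eq_sym oner_eq0.
by apply/eqP; rewrite eq_le w0 andbT leNgt; apply/negP; exact: h.
Qed.

Lemma lik_gt0 y : 0 < lik w f y.
Proof.
have [x wx] := weights_pos; rewrite /lik (bigD1 x)//=.
rewrite ltr_pwDl ?mulr_gt0 ?expo_gt0// sumr_ge0// => x' _.
by rewrite mulr_ge0// ltW ?expo_gt0.
Qed.

Lemma tame_lik : tame (lik w f).
Proof. by apply: tame_sum => x; apply: tameZ; exact: tame_expo. Qed.

(** The likelihood is at least the contribution of a single point of positive weight, whose inverse
    is again an exponential of a linear form. *)
Lemma tame_lik_inv : tame (fun y => (lik w f y)^-1).
Proof.
have [x wx] := weights_pos.
apply: (@tame_le _ _ _ (fun y => (w x)^-1 * (expo (f x) y)^-1)); last first.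
  by apply: tameZ; exact: tame_expo_inv.
- move=> y; have l0 := lik_gt0 y; have e0 := expo_gt0 (f x) y.
  have d0 : 0 <= (w x)^-1 / expo (f x) y by rewrite divr_ge0 ?invr_ge0 ?(ltW wx) ?(ltW e0).
  rewrite ger0_norm ?invr_ge0 ?(ltW l0)// ger0_norm//.
  rewrite -invfM lef_pV2 ?posrE ?lik_gt0 ?mulr_gt0 ?expo_gt0//.
  rewrite /lik (bigD1 x)//= lerDl sumr_ge0// => x' _.
  by rewrite mulr_ge0// ltW ?expo_gt0.
- rewrite (_ : (fun y => _) = fun y => expR (- ln (lik w f y))); last first.
    by apply/funext => y; rewrite expRN lnK// posrE lik_gt0.
  apply: measurableT_comp => //; apply: measurableT_comp => //.
  by apply: measurableT_comp; [exact: measurable_ln|case: tame_lik].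
Qed.

Lemma tame_ln_lik : tame (fun y => ln (lik w f y)).
Proof. exact: tame_ln lik_gt0 tame_lik tame_lik_inv. Qed.

Lemma tame_xlnx_lik : tame (fun y => xlnx (lik w f y)).
Proof. by apply: tameM; [exact: tame_lik|exact: tame_ln_lik]. Qed.

Lemma EG_likM h : tame h ->
  EG (fun y => lik w f y * h y) = avg w (fun x => EG (fun y => expo (f x) y * h y)).
Proof.
move=> th; rewrite (_ : (fun y => _) = fun y => \sum_x w x * (expo (f x) y * h y)).
  rewrite EG_sum; last by move=> x; apply: tameZ; apply: tameM => //; exact: tame_expo.
  by apply: eq_bigr => x _; rewrite EGZ//; apply: tameM => //; exact: tame_expo.
by apply/funext => y; rewrite mulr_suml; apply: eq_bigr => x _; rewrite mulrA.
Qed.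

Lemma EG_lik : EG (lik w f) = 1.
Proof.
rewrite (_ : lik w f = fun y => lik w f y * 1); last by apply/funext => y; rewrite mulr1.
rewrite EG_likM; last exact: tame_cst.
rewrite -[RHS](weights_avg_cst 1 ww); congr avg; apply/funext => x.
by rewrite (_ : (fun y => _) = expo (f x)) ?EG_expo//; apply/funext => y; rewrite mulr1.
Qed.

Let m i := avg w (fun x => f x i).

Lemma EG_lik_ln_expo :
  EG (fun y => lik w f y * ln (expo m y)) = \sum_i m i ^+ 2 / 2.
Proof.
rewrite (_ : (fun y => _) = fun y => lik w f y *
    (\sum_i m i * co y i + - \sum_i m i ^+ 2 / 2)); last first.
  by apply/funext => y; rewrite expoE expRK.
rewrite EG_likM; last by apply: tameD; [exact: tame_lin|exact: tame_cst].
transitivity (avg w (fun x => \sum_i m i * f x i - \sum_i m i ^+ 2 / 2)).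
  congr avg; apply/funext => x.
  rewrite (_ : (fun y => _) = fun y => \sum_i (m i * (expo (f x) y * co y i))
      + - (\sum_i m i ^+ 2 / 2) * expo (f x) y); last first.
    by apply/funext => y; rewrite mulrDr mulr_sumr [X in _ + X]mulrC; congr (_ + _);
      apply: eq_bigr => i _; rewrite mulrCA.
  have te i : tame (fun y => expo (f x) y * co y i).
    by apply: tameM; [exact: tame_expo|exact: tame_co].
  rewrite EGD; last 2 first.
  - by apply: tame_sum => i; exact: tameZ.
  - by apply: tameZ; exact: tame_expo.
  rewrite EGZ; last exact: tame_expo.
  rewrite EG_expo mulr1 EG_sum; last by move=> i; exact: tameZ.
  by congr (_ + _); apply: eq_bigr => i _; rewrite EGZ// EG_expo_co.
rewrite avgB weights_avg_cst// avg_sum.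
under eq_bigr do rewrite avgZ -/(m _).
by rewrite -sumrB; apply: eq_bigr => i _; field.
Qed.

Lemma tame_lik_ln_expo (v : I -> R) : tame (fun y => lik w f y * ln (expo v y)).
Proof.
apply: tameM; first exact: tame_lik.
by apply: tame_ln (expo_gt0 v) (tame_expo v) (tame_expo_inv v).
Qed.

(** Gibbs' inequality against the noise centred at the mean signal m; the cross term is computed in
    [EG_lik_ln_expo]. *)
Lemma ent_lower : \sum_i m i ^+ 2 / 2 <= ent w f.
Proof.
have te := tame_expo m; have tl := tame_lik; have tle := tame_lik_ln_expo m.
rewrite -EG_lik_ln_expo; have -> : EG (fun y => lik w f y * ln (expo m y)) =
    EG (fun y => lik w f y * ln (expo m y) + lik w f y - expo m y).
  by rewrite EGB ?EGD ?EG_lik ?EG_expo ?addrK//; exact: tameD.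
apply: le_EG.
- by apply: tameB => //; exact: tameD.
- exact: tame_xlnx_lik.
- by move=> y; apply: gibbs_lower; [exact: lik_gt0|exact: expo_gt0].
Qed.

Lemma expo_expo_div (a b c : I -> R) y : expo a y * expo b y / expo c y =
  expR (\sum_i (a i - c i) * (b i - c i)) * expo (fun i => a i + b i - c i) y.
Proof.
rewrite /expo -expRN -!expRD; congr expR; rewrite -sumrN -!big_split/=.
by apply: eq_bigr => i _; field.
Qed.

(** Expanding the square introduces two independent replicas x and x', and the remaining noise
    expectation is Gaussian by [expo_expo_div]. *)
Lemma EG_lik_sqr_div (c : I -> R) : EG (fun y => lik w f y ^+ 2 / expo c y) =
  avg w (fun x => avg w (fun x' => expR (\sum_i (f x i - c i) * (f x' i - c i)))).
Proof.
rewrite (_ : (fun y => _) = fun y => lik w f y * (lik w f y / expo c y)); last first.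
  by apply/funext => y; rewrite expr2 mulrA.
rewrite EG_likM; last by apply: tameM; [exact: tame_lik|exact: tame_expo_inv].
congr avg; apply/funext => x.
rewrite (_ : (fun y => _) = fun y => lik w f y * (expo (f x) y / expo c y)); last first.
  by apply/funext => y; rewrite mulrCA.
rewrite EG_likM; last by apply: tameM; [exact: tame_expo|exact: tame_expo_inv].
congr avg; apply/funext => x'.
rewrite (_ : (fun y => _) = fun y => expR (\sum_i (f x i - c i) * (f x' i - c i)) *
    expo (fun i => f x i + f x' i - c i) y); last first.
  by apply/funext => y; rewrite -expo_expo_div mulrA; congr (_ / _); rewrite mulrC.
by rewrite EGZ ?EG_expo ?mulr1//; exact: tame_expo.
Qed.

(** The same reference as in [ent_lower], now with [gibbs_upper]: lower and upper bounds differ by a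
    chi-square term, small for weak signals. *)
Lemma ent_upper_chi2 : ent w f <= \sum_i m i ^+ 2 / 2 +
  (avg w (fun x => avg w (fun x' => expR (\sum_i (f x i - m i) * (f x' i - m i)))) - 1).
Proof.
have tl := tame_lik; have tle := tame_lik_ln_expo m.
have td : tame (fun y => lik w f y ^+ 2 / expo m y).
  by apply: tameM; [exact: tameX|exact: tame_expo_inv].
rewrite -EG_lik_ln_expo -EG_lik_sqr_div -EG_lik -EGB// -EGD//; last exact: tameB.
apply: le_EG.
- exact: tame_xlnx_lik.
- by apply: tameD => //; exact: tameB.
- by move=> y; rewrite addrA; apply: gibbs_upper; [exact: lik_gt0|exact: expo_gt0].
Qed.

(** The scalar product of two independent centred replicas has mean zero, so [expR_le_quad] leaves
    only its second moment. *)
Lemma avg_expR_cov (c : I -> R) (K : R) :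
  (forall i, avg w (fun x => f x i) = c i) ->
  (forall x x', `|\sum_i (f x i - c i) * (f x' i - c i)| <= K) ->
  avg w (fun x => avg w (fun x' => expR (\sum_i (f x i - c i) * (f x' i - c i)))) - 1
  <= expR K * avg w (fun x => avg w (fun x' =>
       (\sum_i (f x i - c i) * (f x' i - c i)) ^+ 2)).
Proof.
move=> /funext <-; rewrite -/m.
set z := fun x x' => \sum_i (f x i - m i) * (f x' i - m i) => zK.
have zE : avg w (fun x => avg w (z x)) = 0.
  rewrite -[RHS](weights_avg_cst 0 ww); congr avg; apply/funext => x.
  rewrite avg_sum big1// => i _; rewrite avgZ avgB weights_avg_cst//.
  by rewrite -/(m i) subrr mulr0.
apply: (@le_trans _ _ (avg w (fun x => avg w (z x)) + expR K *
    avg w (fun x => avg w (fun x' => z x x' ^+ 2)))); last by rewrite zE add0r.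
rewrite -[X in _ - X](weights_avg_cst 1 ww) -avgB -avgZ -avgD; apply: le_avg => // x.
rewrite -[X in _ - X](weights_avg_cst 1 ww) -avgB -avgZ -avgD; apply: le_avg => // x'.
by rewrite [expR K * _]mulrC; apply: expR_le_quad; exact: zK.
Qed.

Lemma ent_upper (K : R) :
  (forall x x', `|\sum_i (f x i - m i) * (f x' i - m i)| <= K) ->
  ent w f <= \sum_i m i ^+ 2 / 2 + K ^+ 2 * expR K.
Proof.
move=> zK; apply: le_trans ent_upper_chi2 _; rewrite lerD2l.
apply: (le_trans (avg_expR_cov (fun=> erefl) zK)).
rewrite mulrC ler_wpM2r ?expR_ge0// -(weights_avg_cst (K ^+ 2) ww).
apply: le_avg => // x; rewrite -(weights_avg_cst (K ^+ 2) ww).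
apply: le_avg => // x'; rewrite -real_normK ?num_real//.
have K0 : 0 <= K := le_trans (normr_ge0 _) (zK x x').
by rewrite ler_sqr ?nnegrE.
Qed.

(** Observing can only increase the second moment of the posterior mean; [perspective] is used with
    the constant trial value given by the prior mean of h. *)
Lemma gain_sqr (h : W -> R) :
  avg w h ^+ 2 <= EG (fun y => (\sum_x w x * h x * expo (f x) y) ^+ 2 / lik w f y).
Proof.
set c := avg w h; pose t y := \sum_x w x * h x * expo (f x) y.
have tt : tame t by apply: tame_sum => x; apply: tameZ; exact: tame_expo.
have tl := tame_lik.
have -> : c ^+ 2 = EG (fun y => 2 * c * t y - c ^+ 2 * lik w f y).
  rewrite EGB; last 2 first.
  - exact: tameZ.
  - exact: tameZ.
  rewrite !EGZ// EG_lik EG_sum; last by move=> x; apply: tameZ; exact: tame_expo.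
  rewrite (_ : \sum_(i <- _) _ = c); first by ring.
  by apply: eq_bigr => x _; rewrite EGZ ?EG_expo ?mulr1//; exact: tame_expo.
apply: le_EG.
- by apply: tameB; exact: tameZ.
- by apply: tameM; [exact: tameX|exact: tame_lik_inv].
- move=> y; rewrite mulrAC; exact: perspective (lik_gt0 y).
Qed.

End fixed.
End finite_prior.

(** * Laws of linear forms of the noise *)

Section projections.
Context {R : realType}.
Notation gauss := (@gauss R).

Lemma integral_probability_cst d (T : measurableType d) (P : probability T R) (c : \bar R) :
  (\int[P]__ c = c)%E.
Proof.
by transitivity (c * P setT)%E; [exact: integral_cst|rewrite probability_setT mule1].
Qed.

Lemma gauss_opp (h : R -> \bar R) :
  measurable_fun setT h -> (forall x, 0 <= h x)%E ->
  (\int[gauss]_x h (- x)%R = \int[gauss]_x h x)%E.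
Proof.
move=> mh h0.
have mhN : measurable_fun setT (fun x : R => h (- x)%R) by exact: measurableT_comp.
rewrite !integral_gaussE// !ge0_integral_normal_prob//.
pose k x := (h x * (normal_pdf 0 1 x)%:E)%E.
have mk : measurable_fun setT k.
  by apply: emeasurable_funM => //; apply/measurable_EFinP; exact: measurable_normal_pdf.
transitivity (\int[@lebesgue_measure R]_x k (- x)%R)%E.
  apply: eq_integral => x _; rewrite /k !normal_pdfE ?oner_eq0// /normal_fun !subr0.
  by rewrite sqrrN.
pose opp := (fun x : measurableTypeR R => - x : measurableTypeR R).
have mopp : measurable_fun setT opp by exact: measurableT_comp.
transitivity (\int[pushforward (@lebesgue_measure R) opp]_x k x)%E.
  rewrite (@ge0_integral_pushforward _ _ _ _ _ opp mopp _ setT k)//.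
  by move=> x _; rewrite mule_ge0// lee_fin normal_pdf_ge0.
by apply: eq_measure_integral => A mA _; exact: lebesgue_measureN.
Qed.

Lemma gauss_abs (c : R) (h : R -> \bar R) :
  measurable_fun setT h -> (forall x, 0 <= h x)%E ->
  (\int[gauss]_x h (c * x)%R = \int[gauss]_x h (`|c| * x)%R)%E.
Proof.
move=> mh h0; have [c0|c0] := leP 0 c; first by rewrite ger0_norm.
rewrite ltr0_norm// -gauss_opp//; last first.
  by apply: measurableT_comp => //; exact: measurable_funM.
by apply: eq_integral => x _; rewrite mulrN mulNr.
Qed.

Lemma gauss_merge_scaled (a b : R) (h : R -> \bar R) :
  measurable_fun setT h -> (forall x, 0 <= h x)%E ->
  (\int[gauss]_x \int[gauss]_y h (a * x + b * y)%R =
   \int[gauss]_y h (Num.sqrt (a ^+ 2 + b ^+ 2) * y)%R)%E.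
Proof.
move=> mh h0.
have mab x : measurable_fun setT (fun y : R => h (x + y)%R).
  by apply: measurableT_comp => //; exact: measurable_funD.
have mab' a' b' : measurable_fun setT (fun z : R * R => h (a' * z.1 + b' * z.2)).
  by apply: measurableT_comp => //; apply: measurable_funD; exact: measurable_funM.
transitivity (\int[gauss]_x \int[gauss]_y h (`|a| * x + `|b| * y)%R)%E.
  transitivity (\int[gauss]_x \int[gauss]_y h (a * x + `|b| * y)%R)%E.
    by apply: eq_integral => x _; exact: (gauss_abs b (mab (a * x))).
  pose k (u : R) := (\int[gauss]_y h (u + `|b| * y)%R)%E.
  apply: (@gauss_abs a k); last by move=> x; exact: integral_ge0.
  apply: (measurable_integral_section gauss (f := fun z : R * R => h (z.1 + `|b| * z.2)%R)) => //.
  apply: measurableT_comp => //; apply: measurable_funD => //; exact: measurable_funM.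
set s := Num.sqrt _.
have s2 : s ^+ 2 = a ^+ 2 + b ^+ 2 by rewrite sqr_sqrtr// addr_ge0 ?sqr_ge0.
have [s0|sn0] := eqVneq s 0.
  have a0 : a = 0.
    apply/eqP; rewrite -sqrf_eq0 eq_le sqr_ge0 andbT.
    have : a ^+ 2 + b ^+ 2 = 0 by rewrite -s2 s0 expr0n.
    have := sqr_ge0 b; lra.
  have b0 : b = 0.
    apply/eqP; rewrite -sqrf_eq0 eq_le sqr_ge0 andbT.
    have : a ^+ 2 + b ^+ 2 = 0 by rewrite -s2 s0 expr0n.
    have := sqr_ge0 a; lra.
  rewrite s0 a0 b0; apply: eq_integral => x _.
  under eq_integral do rewrite normr0 !mul0r addr0.
  by rewrite integral_probability_cst mul0r.
have sgt0 : 0 < s by rewrite lt_neqAle eq_sym sn0 sqrtr_ge0.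
transitivity (\int[gauss]_x \int[gauss]_y h (s * (`|a| / s * x + `|b| / s * y))%R)%E; last first.
  apply: (@gauss_merge _ (`|a| / s) (`|b| / s) (fun u => h (s * u))).
  - by rewrite divr_ge0// ltW.
  - by rewrite divr_ge0// ltW.
  - by rewrite !expr_div_n !real_normK ?num_real// -mulrDl -s2 divff// expf_neq0.
  - by apply: measurableT_comp => //; exact: measurable_funM.
  - by move=> x; exact: h0.
apply: eq_integral => x _; apply: eq_integral => y _; congr h.
by field.
Qed.

Lemma tprod_lin n (c : 'I_n -> R) (h : R -> \bar R) :
  measurable_fun setT h -> (forall x, 0 <= h x)%E ->
  (\int[tprod gauss n]_t h (\sum_k c k * tnth t k)%R =
   \int[gauss]_x h (Num.sqrt (\sum_k c k ^+ 2) * x)%R)%E.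
Proof.
have mlin m (c' : 'I_m -> R) : measurable_fun setT (fun t : m.-tuple R => \sum_k c' k * tnth t k).
  by apply: measurable_sum => k; apply: measurable_funM => //; exact: measurable_tnth.
elim: n c h => [|n IHn] c h mh h0.
  rewrite tprod0E; last exact: (measurableT_comp mh (mlin _ c)).
  under eq_integral do rewrite big_ord0 sqrtr0 mul0r.
  by rewrite big_ord0 integral_probability_cst.
rewrite tprodSE//; last exact: (measurableT_comp mh (mlin _ c)).
transitivity (\int[gauss]_x \int[gauss]_y
   h (c ord0 * x + Num.sqrt (\sum_k c (lift ord0 k) ^+ 2) * y)%R)%E.
  apply: eq_integral => x _.
  rewrite -(IHn (fun k => c (lift ord0 k)) (fun u => h (c ord0 * x + u)))//; last first.
    by apply: measurableT_comp => //; exact: measurable_funD.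
  apply: eq_integral => t _; rewrite big_ord_recl tnth0; congr (h (_ + _)).
  by apply: eq_bigr => k _; rewrite tnthS.
rewrite gauss_merge_scaled// big_ord_recl sqr_sqrtr//.
by apply: sumr_ge0 => k _; exact: sqr_ge0.
Qed.

(** A linear form of standard noise is a centred normal whose variance is the sum of squared
    coefficients, whatever the index set. *)
Lemma EG_project (I J : finType) (c : I -> R) (d : J -> R) (h : R -> R) :
  \sum_i c i ^+ 2 = \sum_j d j ^+ 2 ->
  measurable_fun setT h -> (forall x, 0 <= h x) ->
  EG (fun y => h (\sum_i c i * co y i)) = EG (fun y => h (\sum_j d j * co y j)).
Proof.
move=> cd mh h0.
have toord (K : finType) (F : K -> R) : \sum_i F i = \sum_(k < #|K|) F (enum_val k).
  rewrite (reindex (fun k : 'I_#|K| => enum_val k))//=.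
  by exists enum_rank => i _; rewrite ?enum_valK ?enum_rankK.
have E (K : finType) (e : K -> R) : EG (fun y => h (\sum_i e i * co y i)) =
    fine (\int[gauss]_x (h (Num.sqrt (\sum_i e i ^+ 2) * x)%R)%:E)%E.
  rewrite /EG /Rintegral; congr fine; rewrite toord.
  rewrite -(tprod_lin (fun k => e (enum_val k)) (h := EFin \o h))//; last first.
    exact/measurable_EFinP.
  apply: eq_integral => y _; rewrite /= toord; congr (h _)%:E.
  by apply: eq_bigr => k _; rewrite /co enum_valK.
by rewrite !E cd.
Qed.

End projections.

(** * Reduction to a scalar channel, and covariances *)

Section cavity_bounds.
Context {R : realType}.

(** Joint convexity of l^2/g: the chi-square term of a mixture is at most the average of the
    individual ones. *)
Lemma perspective_avg (A : finType) (p l g : A -> R) : weights p ->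
  (forall a, 0 < g a) -> 0 < avg p g ->
  avg p l ^+ 2 / avg p g <= avg p (fun a => l a ^+ 2 / g a).
Proof.
move=> pp g0 G0; set c := avg p l / avg p g.
have -> : avg p l ^+ 2 / avg p g = avg p (fun a => 2 * c * l a - c ^+ 2 * g a).
  by rewrite avgB !avgZ /c; field; rewrite gt_eqF.
apply: le_avg; first by case: pp.
by move=> a; rewrite mulrAC; exact: perspective.
Qed.

(** When one scalar is observed through several channels, the likelihood depends on the data only
    through a single linear form, so [EG_project] applies. Adding 1 makes t ln t nonnegative. *)
Lemma ent_project (A I J : finType) (p : A -> R) (v : A -> R) (c : I -> R) (d : J -> R) :
  weights p -> \sum_i c i ^+ 2 = \sum_j d j ^+ 2 ->
  ent p (fun a i => c i * v a) = ent p (fun a j => d j * v a).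
Proof.
move=> pp cd.
pose G (u : R) := \sum_a p a * expR (v a * u - v a ^+ 2 * \sum_i c i ^+ 2 / 2).
have mG : measurable_fun setT G.
  apply: measurable_sum => a; apply: measurable_funM => //; apply: measurableT_comp => //.
  by apply: measurable_funB => //; exact: measurable_funM.
have G0 u : 0 < G u.
  have [a pa] := weights_pos pp; rewrite /G (bigD1 a)//=.
  rewrite ltr_pwDl ?mulr_gt0 ?expR_gt0// sumr_ge0// => a' _.
  by rewrite mulr_ge0 ?expR_ge0//; case: pp.
have likE (K : finType) (e : K -> R) y : \sum_i e i ^+ 2 = \sum_i c i ^+ 2 ->
    lik p (fun a i => e i * v a) y = G (\sum_i e i * co y i).
  move=> ec; apply: eq_bigr => a _; congr (_ * _); rewrite expoE; congr expR.
  congr (_ + - _); first by rewrite mulr_sumr; apply: eq_bigr => i _; ring.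
  rewrite -!mulr_suml -ec mulrA mulr_sumr; congr (_ / _).
  by apply: eq_bigr => i _; rewrite exprMn mulrC.
have entE (K : finType) (e : K -> R) : \sum_i e i ^+ 2 = \sum_i c i ^+ 2 ->
    ent p (fun a i => e i * v a) = EG (fun y => xlnx (G (\sum_i e i * co y i)) + 1) - 1.
  move=> ec; rewrite EGD ?EG_cst ?addrK.
  - by congr EG; apply/funext => y; rewrite likE.
  - have := tame_xlnx_lik (fun a i => e i * v a) pp.
    by rewrite (_ : (fun y => _) = fun y => xlnx (G (\sum_i e i * co y i)))//;
      apply/funext => y; rewrite likE.
  - exact: tame_cst.
rewrite !entE//; congr (_ - _).
apply: (EG_project (h := fun u => xlnx (G u) + 1)) => //.
  apply: measurable_funD => //; apply: measurable_funM => //.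
  by apply: measurableT_comp => //; exact: measurable_ln.
move=> u; have := gibbs_lower (G0 u) ltr01; rewrite ln1 mulr0 add0r /xlnx.
by have := G0 u; lra.
Qed.

(** The scalar channel of snr h. Together with the quadratic term in q it makes up the replica
    potential. *)
Definition psi (A : finType) (p v : A -> R) (h : R) : R :=
  ent p (fun a (_ : unit) => Num.sqrt h * v a).

Lemma ent_psi (A I : finType) (p v : A -> R) (c : I -> R) : weights p ->
  ent p (fun a i => c i * v a) = psi p v (\sum_i c i ^+ 2).
Proof.
move=> pp; apply: ent_project => //; rewrite big_const card_unit/= addr0 sqr_sqrtr//.
by apply: sumr_ge0 => i _; exact: sqr_ge0.
Qed.

Definition cov (W I : finType) (w : W -> R) (X : W -> I -> R) (i j : I) : R :=
  avg w (fun x => X x i * X x j) - avg w (fun x => X x i) * avg w (fun x => X x j).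

Definition cov2 (W I : finType) (w : W -> R) (X : W -> I -> R) : R :=
  \sum_i \sum_j cov w X i j ^+ 2.

Section one_posterior.
Variables (W I : finType) (w : W -> R) (X : W -> I -> R) (B : R).
Hypotheses (ww : weights w) (B0 : 0 <= B) (XB : forall x i, `|X x i| <= B).

Let m i := avg w (fun x => X x i).
Let u x i := X x i - m i.

Lemma avg_le_bound (h : W -> R) : (forall x, `|h x| <= B) -> `|avg w h| <= B.
Proof.
move=> hB; rewrite ler_norml -{1}(weights_avg_cst (- B) ww) -{2}(weights_avg_cst B ww).
by apply/andP; split; apply: le_avg => [|x]; case: ww => // _ _;
  have := hB x; rewrite ler_norml => /andP[].
Qed.

Lemma centered_bound x i : `|u x i| <= 2 * B.
Proof.
apply: le_trans (ler_normB _ _) _; rewrite mulr2n mulrDl mul1r lerD//.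
by apply: avg_le_bound => x'; exact: XB.
Qed.

Lemma covE i j : cov w X i j = avg w (fun x => u x i * u x j).
Proof.
rewrite /cov -!/(m _) (_ : (fun x => u x i * u x j) = fun x =>
  X x i * X x j + (- m i * X x j + (- m j * X x i + m i * m j))); last first.
  by apply/funext => x; rewrite /u; ring.
by rewrite !avgD !avgZ weights_avg_cst// -!/(m _); ring.
Qed.

(** The squared overlap of two centred replicas is a double sum in which the replicas factorize;
    this is how posterior covariances enter the bounds. *)
Lemma cov2E : avg w (fun x => avg w (fun x' => (\sum_i u x i * u x' i) ^+ 2)) = cov2 w X.
Proof.
transitivity (avg w (fun x => avg w (fun x' => \sum_i \sum_j
    (u x i * u x j) * (u x' i * u x' j)))).
  congr avg; apply/funext => x; congr avg; apply/funext => x'.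
  rewrite expr2 mulr_suml; apply: eq_bigr => i _; rewrite mulr_sumr.
  by apply: eq_bigr => j _; ring.
transitivity (avg w (fun x => \sum_i \sum_j (u x i * u x j) * cov w X i j)).
  congr avg; apply/funext => x; rewrite avg_sum; apply: eq_bigr => i _.
  by rewrite avg_sum; apply: eq_bigr => j _; rewrite avgZ covE.
rewrite avg_sum; apply: eq_bigr => i _; rewrite avg_sum; apply: eq_bigr => j _.
under eq_fun do rewrite mulrC.
by rewrite avgZ -covE expr2.
Qed.

End one_posterior.

End cavity_bounds.

(** By Lagrange's identity, the gap is half a double sum of squares. *)
Lemma cauchy_schwarz (R : realFieldType) (I : finType) (a b : I -> R) :
  (\sum_i a i * b i) ^+ 2 <= (\sum_i a i ^+ 2) * (\sum_i b i ^+ 2).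
Proof.
have : 0 <= \sum_i \sum_j (a i * b j - a j * b i) ^+ 2.
  by apply: sumr_ge0 => i _; apply: sumr_ge0 => j _; exact: sqr_ge0.
have -> : \sum_i \sum_j (a i * b j - a j * b i) ^+ 2 =
    2 * ((\sum_i a i ^+ 2) * (\sum_i b i ^+ 2)) - 2 * (\sum_i a i * b i) ^+ 2.
  rewrite [in X in _ - X]expr2 !mulr_suml.
  transitivity (\sum_i \sum_j (a i ^+ 2 * b j ^+ 2 + a j ^+ 2 * b i ^+ 2
      - 2 * (a i * b i * (a j * b j)))).
    by apply: eq_bigr => i _; apply: eq_bigr => j _; ring.
  transitivity (\sum_i \sum_j a i ^+ 2 * b j ^+ 2 + \sum_i \sum_j a j ^+ 2 * b i ^+ 2
      - \sum_i \sum_j 2 * (a i * b i * (a j * b j))).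
    rewrite -big_split -sumrB; apply: eq_bigr => i _.
    by rewrite -big_split -sumrB.
  rewrite [X in _ + X - _]exchange_big/= mulr2n mulrDl mul1r mulr_sumr.
  congr (_ + _ - _).
  - by apply: eq_bigr => i _; rewrite mulr_sumr.
  - by apply: eq_bigr => i _; rewrite mulr_sumr.
  - by apply: eq_bigr => i _; rewrite mulr_sumr mulr_sumr.
by lra.
Qed.

(** * Gain from a side channel, and the cavity estimate, for one posterior *)

Section one_posterior_gains.
Context {R : realType}.
Variables (W I : finType) (w : W -> R) (X : W -> I -> R) (B : R).
Hypotheses (ww : weights w) (B0 : 0 <= B) (XB : forall x i, `|X x i| <= B).

Let w0 : forall x, 0 <= w x. Proof. by case: ww. Qed.
Let m i := avg w (fun x => X x i).
Let u x i := X x i - m i.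
Let C := cov w X.

Lemma cov2_ge0 : 0 <= cov2 w X.
Proof. by apply: sumr_ge0 => i _; apply: sumr_ge0 => j _; exact: sqr_ge0. Qed.

(** Bounds from below the squared posterior means after an extra observation of snr eta by the
    performance of an explicit linear estimator, through [perspective]. For th of order sqrt eta the
    increase is of order eta times the squared covariances; this is what makes covariances summable
    in the cavity argument. *)
Lemma gain_cov (eta th : R) : 0 <= eta ->
  \sum_i m i ^+ 2 + 2 * th * Num.sqrt eta * cov2 w X
  - th ^+ 2 * (eta * (#|I|%:R * (4 * B ^+ 2)) + 8 * expR (1 / 2)) * cov2 w X <=
  \sum_i EG (fun y => (\sum_x w x * X x i * expo (fun j => Num.sqrt eta * X x j) y) ^+ 2 /
     lik w (fun x j => Num.sqrt eta * X x j) y).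
Proof.
move=> eta0; set r := Num.sqrt eta; set f := fun x j => r * X x j.
set c0 := 8 * expR (1 / 2); set nB := #|I|%:R * (4 * B ^+ 2).
have r2 : r ^+ 2 = eta by rewrite sqr_sqrtr.
pose L i y := \sum_j C i j * co y j.
(* The trial estimator m_i + th * sum_j C_ij (y_j - r m_j), which corrects the prior mean along the
   row of the covariance matrix. *)
pose t i y := L i y * th + (m i - th * (r * \sum_j C i j * m j)).
have tt i : tame (t i).
  apply: tameD; last exact: tame_cst.
  by apply: tameM; [exact: tame_lin|exact: tame_cst].
pose a i y := \sum_x w x * X x i * expo (f x) y.
have ta i : tame (a i) by apply: tame_sum => x; apply: tameZ; exact: tame_expo.
have tl := tame_lik w f; have tli := tame_lik_inv f ww.
pose g x i := \sum_j C i j * u x j.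
pose S i := \sum_j C i j ^+ 2.
have S0 i : 0 <= S i by apply: sumr_ge0 => j _; exact: sqr_ge0.
have step i : m i ^+ 2 + 2 * th * r * S i - th ^+ 2 * (eta * nB + c0) * S i <=
    EG (fun y => a i y ^+ 2 / lik w f y).
  apply: (@le_trans _ _ (EG (fun y => 2 * a i y * t i y - t i y ^+ 2 * lik w f y))); last first.
    apply: le_EG.
    - apply: tameB; apply: tameM => //; first exact: tameZ.
      exact: tameX.
    - by apply: tameM => //; exact: tameX.
    - by move=> y; apply: perspective; exact: lik_gt0.
  rewrite (_ : (fun y => _) = fun y => \sum_x w x *
      (expo (f x) y * (2 * X x i * t i y - t i y ^+ 2))); last first.
    apply/funext => y; rewrite /a /lik !mulr_sumr mulr_suml -sumrB.
    by apply: eq_bigr => x _; ring.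
  have tx x : tame (fun y => 2 * X x i * t i y - t i y ^+ 2).
    by apply: tameB; [exact: tameZ|exact: tameX].
  rewrite EG_sum; last first.
    by move=> x; apply: tameZ; apply: tameM; [exact: tame_expo|exact: tx].
  have -> : m i ^+ 2 = avg w (fun x => 2 * m i * X x i - m i ^+ 2).
    by rewrite avgB avgZ weights_avg_cst// -/(m i); ring.
  have SE : S i = avg w (fun x => g x i * u x i).
    rewrite /g; under eq_fun do rewrite mulr_suml.
    rewrite avg_sum; apply: eq_bigr => j _.
    under eq_fun => x do rewrite -mulrA [u x j * _]mulrC.
    by rewrite avgZ -covE// expr2.
  have gS x : g x i ^+ 2 <= S i * nB.
    apply: le_trans (cauchy_schwarz _ _) _; rewrite ler_wpM2l ?(S0 i)//.
    have -> : nB = \sum_(j : I) 4 * B ^+ 2 by rewrite sumr_const /nB mulr_natl.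
    apply: ler_sum => j _.
    rewrite -real_normK ?num_real// (_ : 4 * B ^+ 2 = (2 * B) ^+ 2); last by ring.
    by rewrite ler_sqr ?nnegrE ?mulr_ge0// centered_bound.
  rewrite {1}SE -avgZ -avgD.
  rewrite -(weights_avg_cst (th ^+ 2 * (eta * nB + c0) * S i) ww) -avgB.
  apply: ler_sum => x _; rewrite EGZ; last by apply: tameM; [exact: tame_expo|exact: tx].
  rewrite ler_wpM2l// -(EG_shift _ (tx x)).
  (* After the shift the data are signal plus noise, and the estimator splits into centred noise L i
     and a term depending on x only. *)
  have tS y : t i (yshift (f x) y) = th * L i y + (m i + th * r * g x i).
    rewrite /t /L /g.
    have -> : \sum_j C i j * co (yshift (f x) y) j =
        \sum_j C i j * co y j + r * \sum_j C i j * X x j.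
      rewrite mulr_sumr -big_split; apply: eq_bigr => j _.
      by rewrite co_mk /f /=; ring.
    have -> : \sum_j C i j * u x j = \sum_j C i j * X x j - \sum_j C i j * m j.
      by rewrite -sumrB; apply: eq_bigr => j _; rewrite -mulrBr.
    by ring.
  set b := m i + th * r * g x i.
  rewrite (_ : (fun y => _) = fun y => 2 * th * (X x i - b) * L i y +
      (2 * X x i * b - b ^+ 2) - th ^+ 2 * L i y ^+ 2); last first.
    by apply/funext => y; rewrite tS -/b; ring.
  have tL : tame (L i) by exact: tame_lin.
  rewrite EGB; last 2 first.
  - by apply: tameD; [exact: tameZ|exact: tame_cst].
  - by apply: tameZ; exact: tameX.
  rewrite EGD; [|exact: tameZ|exact: tame_cst].
  rewrite !EGZ//; last exact: tameX.
  rewrite EG_cst EG_lin mulr0 add0r.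
  have L2 := EG_lin2 (C i); rewrite -/(S i) -/c0 in L2.
  have gSx := gS x.
  have h1 : th ^+ 2 * EG (fun y => L i y ^+ 2) <= th ^+ 2 * (c0 * S i).
    by rewrite ler_wpM2l ?sqr_ge0.
  have h2 : (th ^+ 2 * eta) * g x i ^+ 2 <= (th ^+ 2 * eta) * (S i * nB).
    by rewrite ler_wpM2l// mulr_ge0 ?sqr_ge0.
  have -> : 2 * X x i * b - b ^+ 2 = 2 * m i * X x i - m i ^+ 2 +
      2 * th * r * (g x i * u x i) - (th ^+ 2 * eta) * g x i ^+ 2.
    by rewrite /b /u -r2; ring.
  by lra.
apply: le_trans (ler_sum _ (fun i _ => step i)).
by rewrite !big_split/= sumrN -!mulr_sumr.
Qed.

(** A new spin v a is seen through its products with the spins X. If X were equal to its mean m,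
    this would be a scalar channel of snr s times sum m^2, whence the term [psi]. That situation
    supplies the reference density: [gibbs_upper] leaves a chi-square error, governed by [cov2], and
    a cross term, governed by the fluctuation of the overlap with m. *)
Lemma cavity_ent (A : finType) (p v : A -> R) (s K : R) : weights p ->
  (forall a, `|v a| <= B) -> 0 <= s -> s * (#|I|%:R * (4 * B ^+ 4)) <= K ->
  ent (fun z : A * W => p z.1 * w z.2) (fun z i => Num.sqrt s * v z.1 * X z.2 i) <=
  psi p v (s * \sum_i m i ^+ 2) + expR K * (s ^+ 2 * B ^+ 4) * cov2 w X
  + s * B ^+ 2 * avg w (fun x => `|\sum_i u x i * m i|).
Proof.
move=> pp vB s0 sK; set r := Num.sqrt s.
have r2 : r ^+ 2 = s by rewrite sqr_sqrtr.
have r0 : 0 <= r by exact: sqrtr_ge0.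
have p0 a : 0 <= p a by case: pp.
pose fa a x i := r * v a * X x i; pose ga a i := r * v a * m i.
pose la a y := lik w (fa a) y.
(* The reference: the law of the data with X frozen at its mean. It is still a mixture over the new
   spin. *)
pose g y := lik p ga y.
set pw := fun z : A * W => p z.1 * w z.2; set F := fun z i => _.
have pww : weights pw.
  split=> [z|]; first by rewrite mulr_ge0.
  rewrite -(pair_bigA _ (fun a x => p a * w x))/=.
  under eq_bigr do rewrite -mulr_sumr (proj2 ww) mulr1.
  by case: pp.
have likE y : lik pw F y = avg p (fun a => la a y).
  rewrite /lik -(pair_bigA _ (fun a x => p a * w x * expo (F (a, x)) y))/=.
  apply: eq_bigr => a _; rewrite mulr_sumr; apply: eq_bigr => x _.
  by rewrite mulrA.
have g0 y : 0 < g y by exact: lik_gt0.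
have tg : tame g by exact: tame_lik.
have tgi : tame (fun y => (g y)^-1) by exact: tame_lik_inv.
have tlng : tame (fun y => ln (g y)) by exact: tame_ln.
have tl : tame (lik pw F) by exact: tame_lik.
have tla a : tame (la a) by exact: tame_lik.
have gE : ent p ga = psi p v (s * \sum_i m i ^+ 2).
  rewrite (_ : ga = fun a i => (r * m i) * v a); last first.
    by apply/funext => a; apply/funext => i; rewrite /ga; ring.
  transitivity (psi p v (\sum_i (r * m i) ^+ 2)); first exact: (ent_psi v (fun i => r * m i) pp).
  by rewrite mulr_sumr; congr (psi p v _); apply: eq_bigr => i _; rewrite exprMn r2.
apply: (@le_trans _ _ (EG (fun y => lik pw F y * ln (g y)) +
    (EG (fun y => avg p (fun a => la a y ^+ 2 / expo (ga a) y)) - 1))).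
  rewrite -(EG_lik F pww).
  have tq : tame (fun y => avg p (fun a => la a y ^+ 2 / expo (ga a) y)).
    apply: tame_sum => a; apply: tameZ; apply: tameM; first exact: tameX.
    exact: tame_expo_inv.
  rewrite -EGB// -EGD; [|exact: tameM|exact: tameB].
  apply: le_EG.
  - exact: tame_xlnx_lik.
  - by apply: tameD; [exact: tameM|exact: tameB].
  - move=> y; apply: le_trans (gibbs_upper (lik_gt0 F pww y) (g0 y)) _.
    rewrite addrA lerD2r lerD2l likE; apply: perspective_avg => //.
      by move=> a; exact: expo_gt0.
    exact: g0.
have uE a x i : fa a x i - ga a i = r * v a * u x i by rewrite /fa /ga -mulrBr.
have faE a i : avg w (fun x => fa a x i) = ga a i by rewrite avgZ.
have B4 a : v a ^+ 4 <= B ^+ 4.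
  by rewrite -[v a ^+ 4]ger0_norm ?exprn_even_ge0// normrX lerXn2r ?nnegrE.
have H1 : EG (fun y => lik pw F y * ln (g y)) <=
    psi p v (s * \sum_i m i ^+ 2) + s * B ^+ 2 * avg w (fun x => `|\sum_i u x i * m i|).
  have -> : EG (fun y => lik pw F y * ln (g y)) =
      avg p (fun a => avg w (fun x => EG (fun y => ln (g (yshift (fa a x) y))))).
    rewrite EG_likM// /avg -(pair_bigA _ (fun a x => p a * w x *
      EG (fun y => expo (F (a, x)) y * ln (g y))))/=.
    apply: eq_bigr => a _; rewrite mulr_sumr; apply: eq_bigr => x _.
    by rewrite mulrA; congr (_ * _); exact/esym/(EG_shift (fa a x) tlng).
  have -> : psi p v (s * \sum_i m i ^+ 2) =
      avg p (fun a => EG (fun y => ln (g (yshift (ga a) y)))).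
    rewrite -gE /ent /xlnx -/g EG_likM//; congr avg; apply/funext => a.
    exact/esym/(EG_shift (ga a) tlng).
  rewrite -avgZ -(weights_avg_cst (avg w (fun x => s * B ^+ 2 * `|\sum_i u x i * m i|)) pp).
  rewrite -avgD; apply: le_avg => // a.
  rewrite -(weights_avg_cst (EG (fun y => ln (g (yshift (ga a) y)))) ww) -avgD.
  apply: le_avg => // x; set c := s * B ^+ 2 * _.
  rewrite -(@EG_cst _ I c) -EGD; [|exact: (tame_shift (ga a) tlng)|exact: tame_cst].
  apply: le_EG.
  - exact: (tame_shift (fa a x) tlng).
  - by apply: tameD; [exact: (tame_shift (ga a) tlng)|exact: tame_cst].
  - move=> y; rewrite -ler_expR expRD !lnK ?posrE// mulr_suml.
    apply: ler_sum => b _; rewrite -mulrA ler_wpM2l//.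
    (* Replacing the shift by its mean multiplies each component of g by a factor whose exponent is
       s v_a v_b times the centred overlap, so ln g moves by at most s B^2 times the absolute
       overlap. *)
    have -> : expo (ga b) (yshift (fa a x) y) =
        expo (ga b) (yshift (ga a) y) * expR (\sum_i ga b i * (fa a x i - ga a i)).
      rewrite /expo -expRD; congr expR; rewrite -big_split; apply: eq_bigr => i _.
      by rewrite !co_mk/=; ring.
    rewrite ler_wpM2l ?(ltW (expo_gt0 _ _))// ler_expR.
    have -> : \sum_i ga b i * (fa a x i - ga a i) = s * (v a * v b) * \sum_i u x i * m i.
      by rewrite mulr_sumr; apply: eq_bigr => i _; rewrite uE /ga -r2; ring.
    apply: le_trans (ler_norm _) _; rewrite normrM ler_wpM2r// normrM ger0_norm//.
    by rewrite ler_wpM2l// normrM expr2 ler_pM.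
have H2 : EG (fun y => avg p (fun a => la a y ^+ 2 / expo (ga a) y)) - 1 <=
    expR K * (s ^+ 2 * B ^+ 4) * cov2 w X.
  have tq a : tame (fun y => la a y ^+ 2 / expo (ga a) y).
    by apply: tameM; [exact: tameX|exact: tame_expo_inv].
  have -> : EG (fun y => avg p (fun a => la a y ^+ 2 / expo (ga a) y)) =
      avg p (fun a => EG (fun y => la a y ^+ 2 / expo (ga a) y)).
    rewrite EG_sum; last by move=> a; exact: tameZ.
    by apply: eq_bigr => a _; rewrite EGZ.
  rewrite -(weights_avg_cst 1 pp) -(weights_avg_cst (_ * cov2 w X) pp) -avgB.
  apply: le_avg => // a; rewrite EG_lik_sqr_div//.
  pose z x x' := \sum_i (fa a x i - ga a i) * (fa a x' i - ga a i).
  have zE x x' : z x x' = s * v a ^+ 2 * \sum_i u x i * u x' i.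
    by rewrite mulr_sumr; apply: eq_bigr => i _; rewrite !uE -r2; ring.
  have zK x x' : `|z x x'| <= K.
    apply: le_trans sK; rewrite zE normrM ger0_norm; last by apply: mulr_ge0 => //; exact: sqr_ge0.
    have -> : s * (#|I|%:R * (4 * B ^+ 4)) = s * B ^+ 2 * (#|I|%:R * (4 * B ^+ 2)) by ring.
    have sv0 : 0 <= s * v a ^+ 2 by apply: mulr_ge0 => //; exact: sqr_ge0.
    apply: ler_pM => //.
      by rewrite ler_wpM2l// -real_normK ?num_real// lerXn2r ?nnegrE.
    apply: le_trans (ler_norm_sum _ _ _) _.
    have -> : #|I|%:R * (4 * B ^+ 2) = \sum_(j : I) 4 * B ^+ 2.
      by rewrite sumr_const mulr_natl.
    apply: ler_sum => j _; rewrite normrM (_ : 4 * B ^+ 2 = 2 * B * (2 * B)); last by ring.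
    by rewrite ler_pM// centered_bound.
  apply: le_trans (avg_expR_cov ww (faE a) zK) _.
  rewrite -mulrA ler_wpM2l ?expR_ge0// -cov2E// -/u -avgZ; apply: le_avg => // x.
  rewrite -avgZ; apply: le_avg => // x'; rewrite -/(z x x') zE.
  rewrite exprMn ler_wpM2r ?sqr_ge0// exprMn -exprM ler_wpM2l ?sqr_ge0//.
by lra.
Qed.

End one_posterior_gains.

(** * Dependence on the signal-to-noise ratios *)

Section snr_calculus.
Context {R : realType}.

Lemma sum_unit (f : unit -> R) : \sum_i f i = f tt.
Proof. by rewrite (bigD1 tt)//= big1 ?addr0// => -[]. Qed.

Lemma expo_drop (I J : finType) (s : J -> I) (v : I -> R) (y : #|I|.-tuple R) :
  injective s -> (forall i, i \notin codom s -> v i = 0) ->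
  expo v y = expo (fun j => v (s j)) (reco s y).
Proof.
move=> sI v0; rewrite /expo; congr expR.
rewrite (bigID (mem (codom s)))/= [X in _ + X]big1 ?addr0; last first.
  by move=> i /v0 ->; rewrite mul0r expr0n/= mul0r subrr.
rewrite (eq_bigl (mem [set s j | j in J]%SET)); last first.
  by move=> i; apply/codomP/imsetP => [[j ->]|[j _ ->]]; exists j.
rewrite big_imset/=; last by move=> j j' _ _ /sI.
by apply: eq_bigr => j _; rewrite co_mk.
Qed.

Lemma EG_expo_ln (I : finType) (v : I -> R) :
  EG (fun y => expo v y * ln (expo v y)) = \sum_i v i ^+ 2 / 2.
Proof.
have te i : tame (fun y => expo v y * co y i).
  by apply: tameM; [exact: tame_expo|exact: tame_co].
rewrite (_ : (fun y => _) = fun y => \sum_i (v i * (expo v y * co y i))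
    + - (\sum_i v i ^+ 2 / 2) * expo v y); last first.
  apply/funext => y; rewrite [in ln _]expoE expRK mulrDr mulr_sumr [X in _ + X]mulrC.
  by congr (_ + _); apply: eq_bigr => i _; rewrite mulrCA.
rewrite EGD; last 2 first.
- by apply: tame_sum => i; exact: tameZ.
- by apply: tameZ; exact: tame_expo.
rewrite EGZ; last exact: tame_expo.
rewrite EG_expo mulr1 EG_sum; last by move=> i; exact: tameZ.
rewrite -sumrN -big_split; apply: eq_bigr => i _.
by rewrite EGZ// EG_expo_co/=; field.
Qed.

Section fixed_prior.
Variables (W I : finType) (w : W -> R) (F : W -> I -> R).
Hypothesis ww : weights w.
Implicit Types (tau delta : I -> R) (h : W -> R).

Let w0 x : 0 <= w x. Proof. by case: ww. Qed.

Definition obs tau (x : W) (i : I) : R := Num.sqrt (tau i) * F x i.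

Definition Phi tau : R := ent w (obs tau).

(** The second moment of the posterior mean of h under the law of the data; see [sqmE]. *)
Definition sqm tau h : R :=
  EG (fun y => (\sum_x w x * h x * expo (obs tau x) y) ^+ 2 / lik w (obs tau) y).

Definition post tau (y : #|I|.-tuple R) (x : W) : R :=
  w x * expo (obs tau x) y / lik w (obs tau) y.

Lemma post_weights tau y : weights (post tau y).
Proof.
have l0 := lik_gt0 (obs tau) ww y; split=> [x|].
  by rewrite /post divr_ge0 ?mulr_ge0 ?(ltW l0)// ltW// expo_gt0.
by rewrite /post -mulr_suml divff// gt_eqF.
Qed.

Lemma avg_post tau y h :
  avg (post tau y) h = (\sum_x w x * h x * expo (obs tau x) y) / lik w (obs tau) y.
Proof. by rewrite mulr_suml; apply: eq_bigr => x _; rewrite /post; ring. Qed.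

Lemma lik_avg_post_sqr tau y h : lik w (obs tau) y * avg (post tau y) h ^+ 2 =
  (\sum_x w x * h x * expo (obs tau x) y) ^+ 2 / lik w (obs tau) y.
Proof.
rewrite avg_post; have l0 := lik_gt0 (obs tau) ww y.
by field; rewrite gt_eqF.
Qed.

Lemma tame_avg_post tau h : tame (fun y => avg (post tau y) h).
Proof.
rewrite (_ : (fun y => _) = fun y =>
    (\sum_x w x * h x * expo (obs tau x) y) * (lik w (obs tau) y)^-1); last first.
  by apply/funext => y; rewrite avg_post.
apply: tameM; last exact: tame_lik_inv.
by apply: tame_sum => x; apply: tameZ; exact: tame_expo.
Qed.

Lemma sqmE tau h :
  sqm tau h = EG (fun y => lik w (obs tau) y * avg (post tau y) h ^+ 2).
Proof. by rewrite /sqm; congr EG; apply/funext => y; rewrite lik_avg_post_sqr. Qed.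

Lemma tame_lik_avg_sqr tau h :
  tame (fun y => lik w (obs tau) y * avg (post tau y) h ^+ 2).
Proof. by apply: tameM; [exact: tame_lik|apply: tameX; exact: tame_avg_post]. Qed.

Lemma EG_lik_avg tau h : EG (fun y => lik w (obs tau) y * avg (post tau y) h) = avg w h.
Proof.
rewrite (_ : (fun y => _) = fun y => \sum_x w x * h x * expo (obs tau x) y); last first.
  apply/funext => y; rewrite avg_post mulrCA divff ?mulr1// gt_eqF//.
  exact: lik_gt0.
rewrite EG_sum; last by move=> x; apply: tameZ; exact: tame_expo.
by apply: eq_bigr => x _; rewrite EGZ ?EG_expo ?mulr1//; exact: tame_expo.
Qed.

Section add.
Variables tau delta : I -> R.
Hypotheses (tau0 : forall i, 0 <= tau i) (delta0 : forall i, 0 <= delta i).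

Let sum i := tau i + delta i.
(** Weights that split one noise into two, so that data of snr tau + delta are equivalent to
    independent data of snr tau and delta. The value at a zero sum only keeps the weights on the
    unit circle. *)
Let al i := if sum i == 0 then 1 else Num.sqrt (tau i / sum i).
Let be i := if sum i == 0 then 0 else Num.sqrt (delta i / sum i).

Let sum0 i : 0 <= sum i. Proof. exact: addr_ge0. Qed.

Let al0 i : 0 <= al i.
Proof. by rewrite /al; case: ifP => // _; exact: sqrtr_ge0. Qed.

Let be0 i : 0 <= be i.
Proof. by rewrite /be; case: ifP => // _; exact: sqrtr_ge0. Qed.

Let albe i : al i ^+ 2 + be i ^+ 2 = 1.
Proof.
rewrite /al /be; case: ifPn => [_|s0]; first by rewrite expr1n expr0n addr0.
by rewrite !sqr_sqrtr ?divr_ge0// -mulrDl divff.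
Qed.

Let alE i : Num.sqrt (sum i) * al i = Num.sqrt (tau i).
Proof.
rewrite /al; case: ifPn => [/eqP s0|s0].
  have -> : tau i = 0 by have := tau0 i; have := delta0 i; move: s0; rewrite /sum; lra.
  by rewrite s0 sqrtr0 mul0r.
by rewrite -sqrtrM// mulrC divfK.
Qed.

Let beE i : Num.sqrt (sum i) * be i = Num.sqrt (delta i).
Proof.
rewrite /be; case: ifPn => [/eqP s0|s0].
  have -> : delta i = 0 by have := tau0 i; have := delta0 i; move: s0; rewrite /sum; lra.
  by rewrite s0 sqrtr0 mul0r.
by rewrite -sqrtrM// mulrC divfK.
Qed.

Let expo_mix x y y' : expo (obs sum x) (mix al be (y, y')) =
  expo (obs tau x) y * expo (obs delta x) y'.
Proof.
rewrite /expo -expRD -big_split; congr expR; apply: eq_bigr => i _.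
rewrite co_mk /obs -alE -beE /= !exprMn.
have a2 : al i ^+ 2 = 1 - be i ^+ 2 by rewrite -(albe i) addrK.
by rewrite a2; field.
Qed.

Let lik_mix y y' : lik w (obs sum) (mix al be (y, y')) =
  lik w (obs tau) y * lik (post tau y) (obs delta) y'.
Proof.
rewrite /lik mulr_sumr; apply: eq_bigr => x _; rewrite expo_mix /post.
have l0 := lik_gt0 (obs tau) ww y; rewrite /lik in l0 *.
by field; rewrite gt_eqF.
Qed.

Let num_mix h y y' : \sum_x w x * h x * expo (obs sum x) (mix al be (y, y')) =
  lik w (obs tau) y * \sum_x post tau y x * h x * expo (obs delta x) y'.
Proof.
rewrite mulr_sumr; apply: eq_bigr => x _; rewrite expo_mix /post.
have l0 := lik_gt0 (obs tau) ww y.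
by field; rewrite gt_eqF.
Qed.

Lemma xlnx_mix y : EG (fun y' => xlnx (lik w (obs sum) (mix al be (y, y')))) =
  xlnx (lik w (obs tau) y) + lik w (obs tau) y * ent (post tau y) (obs delta).
Proof.
have pw := post_weights tau y; set L := lik w (obs tau) y.
have L0 : 0 < L by exact: lik_gt0.
rewrite (_ : (fun y' => _) = fun y' => xlnx L * lik (post tau y) (obs delta) y' +
    L * xlnx (lik (post tau y) (obs delta) y')); last first.
  apply/funext => y'; rewrite lik_mix /xlnx lnM ?posrE//; last exact: lik_gt0.
  rewrite -/L; move: (lik _ _ _) (ln L) (ln _) => a b c.
  by ring.
rewrite EGD; last 2 first.
- by apply: tameZ; exact: tame_lik.
- by apply: tameZ; exact: tame_xlnx_lik.
rewrite !EGZ; last 2 first.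
- exact: tame_xlnx_lik.
- exact: tame_lik.
by rewrite EG_lik// mulr1.
Qed.

Lemma tame_lik_ent :
  tame (fun y => lik w (obs tau) y * ent (post tau y) (obs delta)).
Proof.
rewrite (_ : (fun y => _) = fun y =>
  EG (fun y' => xlnx (lik w (obs sum) (mix al be (y, y')))) - xlnx (lik w (obs tau) y)).
  apply: tameB; last exact: tame_xlnx_lik.
  by apply: (tame_mix al0 be0 albe (h := fun z => xlnx (lik w (obs sum) z))); exact: tame_xlnx_lik.
by apply/funext => y; rewrite [X in _ = X - _]xlnx_mix addrC addKr.
Qed.

(** The chain rule for relative entropy: observe at snr tau, then at snr delta with the posterior as
    new prior. *)
Lemma Phi_add : Phi (fun i => tau i + delta i) =
  Phi tau + EG (fun y => lik w (obs tau) y * ent (post tau y) (obs delta)).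
Proof.
transitivity (EG (fun y => EG (fun y' => xlnx (lik w (obs sum) (mix al be (y, y')))))).
  exact: (EG_mix al0 be0 albe (tame_xlnx_lik (obs sum) ww)).
rewrite -EGD; [|exact: tame_xlnx_lik|exact: tame_lik_ent].
by congr EG; apply/funext => y; exact: xlnx_mix.
Qed.

Lemma sqm_mix h y :
  EG (fun y' => (\sum_x w x * h x * expo (obs sum x) (mix al be (y, y'))) ^+ 2 /
      lik w (obs sum) (mix al be (y, y'))) =
  lik w (obs tau) y * EG (fun y' =>
    (\sum_x post tau y x * h x * expo (obs delta x) y') ^+ 2 /
    lik (post tau y) (obs delta) y').
Proof.
have pw := post_weights tau y; set L := lik w (obs tau) y.
have L0 : 0 < L by exact: lik_gt0.
rewrite -EGZ; last first.
  apply: tameM; last exact: tame_lik_inv.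
  by apply: tameX; apply: tame_sum => x; apply: tameZ; exact: tame_expo.
congr EG; apply/funext => y'; rewrite num_mix lik_mix -/L.
have l0 := lik_gt0 (obs delta) pw y'.
by field; rewrite !gt_eqF.
Qed.

Let tame_sqm_fun h : tame (fun z => (\sum_x w x * h x * expo (obs sum x) z) ^+ 2 /
  lik w (obs sum) z).
Proof.
apply: tameM; last exact: tame_lik_inv.
by apply: tameX; apply: tame_sum => x; apply: tameZ; exact: tame_expo.
Qed.

Lemma tame_lik_sqm h : tame (fun y => lik w (obs tau) y * EG (fun y' =>
    (\sum_x post tau y x * h x * expo (obs delta x) y') ^+ 2 /
    lik (post tau y) (obs delta) y')).
Proof.
rewrite (_ : (fun y => _) = fun y =>
  EG (fun y' => (\sum_x w x * h x * expo (obs sum x) (mix al be (y, y'))) ^+ 2 /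
      lik w (obs sum) (mix al be (y, y')))).
  exact: (tame_mix al0 be0 albe (h := fun z => (\sum_x w x * h x * expo (obs sum x) z) ^+ 2 /
    lik w (obs sum) z)).
by apply/funext => y; exact/esym/sqm_mix.
Qed.

Lemma sqm_add h : sqm (fun i => tau i + delta i) h =
  EG (fun y => lik w (obs tau) y * EG (fun y' =>
    (\sum_x post tau y x * h x * expo (obs delta x) y') ^+ 2 /
    lik (post tau y) (obs delta) y')).
Proof.
transitivity (EG (fun y => EG (fun y' =>
    (\sum_x w x * h x * expo (obs sum x) (mix al be (y, y'))) ^+ 2 /
    lik w (obs sum) (mix al be (y, y'))))).
  exact: (EG_mix al0 be0 albe (tame_sqm_fun h)).
by congr EG; apply/funext => y; exact: sqm_mix.
Qed.

Lemma sqm_le h : sqm tau h <= sqm (fun i => tau i + delta i) h.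
Proof.
rewrite sqm_add sqmE; apply: le_EG.
- exact: tame_lik_avg_sqr.
- exact: tame_lik_sqm.
- move=> y; rewrite ler_wpM2l ?(ltW (lik_gt0 _ ww _))//.
  exact: (gain_sqr _ (post_weights tau y)).
Qed.

Let meansE y : \sum_i avg (post tau y) (fun x => obs delta x i) ^+ 2 / 2 =
  \sum_i delta i / 2 * avg (post tau y) (fun x => F x i) ^+ 2.
Proof.
apply: eq_bigr => i _; rewrite /obs avgZ exprMn sqr_sqrtr//.
by field.
Qed.

Let sum_sqmE : EG (fun y => lik w (obs tau) y *
    \sum_i delta i / 2 * avg (post tau y) (fun x => F x i) ^+ 2) =
  \sum_i delta i / 2 * sqm tau (fun x => F x i).
Proof.
rewrite (_ : (fun y => _) = fun y => \sum_i delta i / 2 *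
    (lik w (obs tau) y * avg (post tau y) (fun x => F x i) ^+ 2)); last first.
  by apply/funext => y; rewrite mulr_sumr; apply: eq_bigr => i _; rewrite mulrCA.
rewrite EG_sum; last by move=> i; apply: tameZ; exact: tame_lik_avg_sqr.
by apply: eq_bigr => i _; rewrite EGZ ?sqmE//; exact: tame_lik_avg_sqr.
Qed.

Let tame_means : tame (fun y => lik w (obs tau) y *
    \sum_i delta i / 2 * avg (post tau y) (fun x => F x i) ^+ 2).
Proof.
apply: tameM; first exact: tame_lik.
by apply: tame_sum => i; apply: tameZ; apply: tameX; exact: tame_avg_post.
Qed.

(** [ent_lower] applied to each posterior: the free energy lies above its tangent at tau. *)
Lemma Phi_add_lower : Phi tau + \sum_i delta i / 2 * sqm tau (fun x => F x i) <=
  Phi (fun i => tau i + delta i).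
Proof.
rewrite Phi_add lerD2l -sum_sqmE; apply: le_EG => //; first exact: tame_lik_ent.
move=> y; rewrite ler_wpM2l ?(ltW (lik_gt0 _ ww _))// -meansE.
exact: (ent_lower _ (post_weights tau y)).
Qed.

Variables (B : R).
Hypotheses (B0 : 0 <= B) (FB : forall x i, `|F x i| <= B).

(** [ent_upper] applied to each posterior. The error is of second order in delta, so it disappears
    when an increment is cut into many pieces. *)
Lemma Phi_add_upper : Phi (fun i => tau i + delta i) <=
  Phi tau + \sum_i delta i / 2 * sqm tau (fun x => F x i) +
  (4 * B ^+ 2 * \sum_i delta i) ^+ 2 * expR (4 * B ^+ 2 * \sum_i delta i).
Proof.
set K := 4 * B ^+ 2 * \sum_i delta i.
rewrite Phi_add -addrA lerD2l -sum_sqmE.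
have -> : K ^+ 2 * expR K = EG (fun y => lik w (obs tau) y * (K ^+ 2 * expR K)).
  rewrite (_ : (fun y => _) = fun y => (K ^+ 2 * expR K) * lik w (obs tau) y); last first.
    by apply/funext => y; rewrite mulrC.
  by rewrite EGZ ?EG_lik ?mulr1//; exact: tame_lik.
have tc : tame (fun y => lik w (obs tau) y * (K ^+ 2 * expR K)).
  by apply: tameM; [exact: tame_lik|exact: tame_cst].
rewrite -EGD//; apply: le_EG.
- exact: tame_lik_ent.
- exact: tameD.
- move=> y; rewrite -mulrDr ler_wpM2l ?(ltW (lik_gt0 _ ww _))// -meansE.
  have pw := post_weights tau y.
  apply: (ent_upper pw) => x x'; apply: le_trans (ler_norm_sum _ _ _) _.
  rewrite /K mulr_sumr; apply: ler_sum => i _.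
  have E z : obs delta z i - avg (post tau y) (fun x => obs delta x i) =
      Num.sqrt (delta i) * (F z i - avg (post tau y) (fun x => F x i)).
    by rewrite /obs avgZ mulrBr.
  rewrite !E mulrACA -expr2 sqr_sqrtr// normrM ger0_norm// mulrC ler_wpM2r//.
  rewrite normrM (_ : 4 * B ^+ 2 = 2 * B * (2 * B)); last by ring.
  by rewrite ler_pM// (centered_bound pw FB).
Qed.

(** Convexity of t ln t bounds a relative entropy by the mean energy of the signal. This crude bound
    suffices for the new spin's own side channel, whose snr vanishes. *)
Lemma Phi_add_energy : Phi (fun i => tau i + delta i) <=
  Phi tau + \sum_i delta i / 2 * B ^+ 2.
Proof.
rewrite Phi_add lerD2l.
set E := \sum_i _.
have -> : E = EG (fun y => E * lik w (obs tau) y).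
  by rewrite EGZ ?EG_lik ?mulr1//; exact: tame_lik.
apply: le_EG.
- exact: tame_lik_ent.
- by apply: tameZ; exact: tame_lik.
- move=> y; rewrite mulrC ler_wpM2r ?(ltW (lik_gt0 _ ww _))//.
  have pw := post_weights tau y; set q := post tau y in pw *.
  set f := obs delta.
  have tln x : tame (fun z => expo (f x) z * ln (expo (f x) z)).
    apply: tameM; first exact: tame_expo.
    by apply: tame_ln (expo_gt0 _) (tame_expo _) (tame_expo_inv _).
  apply: (@le_trans _ _ (EG (fun z => \sum_x q x * (expo (f x) z * ln (expo (f x) z))))).
    apply: le_EG; first exact: tame_xlnx_lik.
      by apply: tame_sum => x; exact: tameZ.
    move=> z; set l := lik q f z.
    have l0 : 0 < l by exact: lik_gt0.
    have -> : xlnx l = avg q (fun x => expo (f x) z * ln l + expo (f x) z - l).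
      rewrite avgB avgD weights_avg_cst// [X in X + _ - _](_ : _ = l * ln l).
        by rewrite [X in _ + X - _](_ : _ = l)// addrK.
      by rewrite mulr_suml; apply: eq_bigr => x _; rewrite mulrA.
    apply: le_avg; first by case: pw.
    by move=> x; apply: gibbs_lower => //; exact: expo_gt0.
  rewrite EG_sum; last by move=> x; exact: tameZ.
  rewrite -(weights_avg_cst E pw); apply: ler_sum => x _.
  rewrite EGZ// ler_wpM2l//; first by case: pw.
  rewrite EG_expo_ln /E; apply: ler_sum => i _.
  rewrite /f /obs exprMn sqr_sqrtr//.
  rewrite mulrAC ler_wpM2l ?divr_ge0//.
  by rewrite -real_normK ?num_real// lerXn2r ?nnegrE.
Qed.

End add.
End fixed_prior.
End snr_calculus.

(** * Renaming signals and dropping silent channels *)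

Section transport.
Context {R : realType}.

Lemma avgZr (W : finType) (w : W -> R) c h : avg w (fun x => h x * c) = avg w h * c.
Proof. by rewrite /avg mulr_suml; apply: eq_bigr => x _; rewrite mulrA. Qed.

(** States that w' is the image of w under h, in the form of integrals against test functions. *)
Definition pushw (W W' : finType) (h : W -> W') (w : W -> R) (w' : W' -> R) :=
  forall G : W' -> R, avg w (fun x => G (h x)) = avg w' G.

Lemma sum_transport (W W' I J : finType) (h : W -> W') (s : J -> I)
    (w : W -> R) (w' : W' -> R) (f : W -> I -> R) (f' : W' -> J -> R) (k : W' -> R) y :
  pushw h w w' -> injective s ->
  (forall x j, f x (s j) = f' (h x) j) ->
  (forall x i, i \notin codom s -> f x i = 0) ->
  \sum_x w x * k (h x) * expo (f x) y = \sum_x w' x * k x * expo (f' x) (reco s y).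
Proof.
move=> hw sI ff' f0.
have -> : \sum_x w' x * k x * expo (f' x) (reco s y) =
    avg w' (fun x => k x * expo (f' x) (reco s y)).
  by apply: eq_bigr => x _; rewrite mulrA.
rewrite -(hw (fun x => k x * expo (f' x) (reco s y))); apply: eq_bigr => x _.
have fE : (fun j => f x (s j)) = f' (h x) by apply/funext => j; rewrite ff'.
by rewrite -mulrA (expo_drop y sI (f0 x)) fE.
Qed.

Lemma lik_transport (W W' I J : finType) (h : W -> W') (s : J -> I)
    (w : W -> R) (w' : W' -> R) (f : W -> I -> R) (f' : W' -> J -> R) y :
  pushw h w w' -> injective s ->
  (forall x j, f x (s j) = f' (h x) j) ->
  (forall x i, i \notin codom s -> f x i = 0) ->
  lik w f y = lik w' f' (reco s y).
Proof.
move=> hw sI ff' f0; have := sum_transport (fun=> 1) y hw sI ff' f0.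
by under eq_bigr do rewrite mulr1; under [in X in _ = X -> _]eq_bigr do rewrite mulr1.
Qed.

(** The likelihood only sees the part of the signal that is observed, and coordinates carrying no
    signal contribute a factor 1 ([expo_drop]). This lemma performs all changes of model below. *)
Lemma ent_transport (W W' I J : finType) (h : W -> W') (s : J -> I)
    (w : W -> R) (w' : W' -> R) (f : W -> I -> R) (f' : W' -> J -> R) :
  weights w' -> pushw h w w' -> injective s ->
  (forall x j, f x (s j) = f' (h x) j) ->
  (forall x i, i \notin codom s -> f x i = 0) ->
  ent w f = ent w' f'.
Proof.
move=> ww' hw sI ff' f0; rewrite /ent -(EG_reco sI (tame_xlnx_lik f' ww')).
by congr EG; apply/funext => y; rewrite (lik_transport y hw sI ff' f0).
Qed.

Lemma EG_sqr_transport (W W' I J : finType) (h : W -> W') (s : J -> I)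
    (w : W -> R) (w' : W' -> R) (f : W -> I -> R) (f' : W' -> J -> R) (k : W' -> R) :
  weights w' -> pushw h w w' -> injective s ->
  (forall x j, f x (s j) = f' (h x) j) ->
  (forall x i, i \notin codom s -> f x i = 0) ->
  EG (fun y => (\sum_x w x * k (h x) * expo (f x) y) ^+ 2 / lik w f y) =
  EG (fun y => (\sum_x w' x * k x * expo (f' x) y) ^+ 2 / lik w' f' y).
Proof.
move=> ww' hw sI ff' f0.
rewrite -[RHS](EG_reco sI); last first.
  apply: tameM; last exact: tame_lik_inv.
  by apply: tameX; apply: tame_sum => x; apply: tameZ; exact: tame_expo.
congr EG; apply/funext => y.
by rewrite (lik_transport y hw sI ff' f0) (sum_transport k y hw sI ff' f0).
Qed.

Lemma pushw_id (W : finType) (w : W -> R) : pushw id w w.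
Proof. by []. Qed.

Lemma prodw_weights (W1 W2 : finType) (w1 : W1 -> R) (w2 : W2 -> R) :
  weights w1 -> weights w2 -> weights (fun z : W1 * W2 => w1 z.1 * w2 z.2).
Proof.
move=> [w10 w11] [w20 w21]; split=> [z|]; first by rewrite mulr_ge0.
rewrite -(pair_bigA _ (fun a x => w1 a * w2 x))/=.
by under eq_bigr do rewrite -mulr_sumr w21 mulr1.
Qed.

Lemma pushw_snd (W1 W2 : finType) (w1 : W1 -> R) (w2 : W2 -> R) :
  weights w1 -> pushw snd (fun z : W1 * W2 => w1 z.1 * w2 z.2) w2.
Proof.
move=> [_ w11] G; rewrite /avg -(pair_bigA _ (fun a x => w1 a * w2 x * G x))/=.
rewrite exchange_big/=; apply: eq_bigr => x _.
under eq_bigr do rewrite -mulrA.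
by rewrite -mulr_suml w11 mul1r.
Qed.

Lemma pushw_fst (W1 W2 : finType) (w1 : W1 -> R) (w2 : W2 -> R) :
  weights w2 -> pushw fst (fun z : W1 * W2 => w1 z.1 * w2 z.2) w1.
Proof.
move=> [_ w21] G; rewrite /avg -(pair_bigA _ (fun a x => w1 a * w2 x * G a))/=.
apply: eq_bigr => x _; under eq_bigr do rewrite mulrAC.
by rewrite -mulr_sumr w21 mulr1.
Qed.

(** Observe the first block, then the second, by [Phi_add] with snr 0 or 1 in each block. The first
    observation leaves the law of the second component unchanged. *)
Lemma ent_indep (W1 W2 I1 I2 : finType) (w1 : W1 -> R) (w2 : W2 -> R)
    (f1 : W1 -> I1 -> R) (f2 : W2 -> I2 -> R) : weights w1 -> weights w2 ->
  ent (fun z : W1 * W2 => w1 z.1 * w2 z.2)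
    (fun z (i : I1 + I2) => match i with inl i => f1 z.1 i | inr i => f2 z.2 i end) =
  ent w1 f1 + ent w2 f2.
Proof.
move=> ww1 ww2; set w := fun z : W1 * W2 => _; set F := fun (z : W1 * W2) => _.
have ww : weights w by exact: prodw_weights.
pose t1 (i : I1 + I2) : R := if i is inl _ then 1 else 0.
pose t2 (i : I1 + I2) : R := if i is inl _ then 0 else 1.
have t10 i : 0 <= t1 i by case: i => /=.
have t20 i : 0 <= t2 i by case: i => /=.
have codl (i : I1 + I2) : i \notin codom inl -> exists j, i = inr j.
  by case: i => [i|j _]; [rewrite codom_f|exists j].
have codr (i : I1 + I2) : i \notin codom inr -> exists j, i = inl j.
  by case: i => [j _|i]; [exists j|rewrite codom_f].
have inlI : injective (@inl I1 I2) by move=> ? ? [].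
have inrI : injective (@inr I1 I2) by move=> ? ? [].
have -> : ent w F = Phi w F (fun i => t1 i + t2 i).
  congr ent; apply/funext => z; apply/funext => i.
  by rewrite /obs; case: i => i /=; rewrite ?addr0 ?add0r sqrtr1 mul1r.
rewrite (Phi_add F ww t10 t20); congr (_ + _).
  apply: (ent_transport (h := fst) (s := inl)) => //.
  - exact: pushw_fst.
  - by move=> z j; rewrite /obs /= sqrtr1 mul1r.
  - by move=> z i /codl[j ->]; rewrite /obs /= sqrtr0 mul0r.
rewrite (_ : (fun y => _) = fun y => ent w2 f2 * lik w (obs F t1) y).
  by rewrite EGZ ?EG_lik ?mulr1//; exact: tame_lik.
apply/funext => y; rewrite mulrC; congr (_ * _).
apply: (ent_transport (h := snd) (s := inr)) => //.
(* The unnormalized posterior of the first component; the full posterior is its product with w2. *)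
- pose pa (a : W1) := w1 a * expo (obs f1 (fun=> 1) a) (reco inl y).
  have pE z : expo (obs F t1 z) y = expo (obs f1 (fun=> 1) z.1) (reco inl y).
    rewrite (expo_drop y inlI)//.
    by move=> i /codl[j ->]; rewrite /obs /= sqrtr0 mul0r.
  have lE : lik w (obs F t1) y = \sum_a pa a.
    rewrite /lik -(pair_bigA _ (fun a x => w1 a * w2 x * expo (obs F t1 (a, x)) y))/=.
    apply: eq_bigr => a _; under eq_bigr do rewrite pE/= mulrAC.
    by rewrite -mulr_sumr (proj2 ww2) mulr1.
  move=> G; rewrite /avg /post lE.
  rewrite -(pair_bigA _ (fun a x => w1 a * w2 x * expo (obs F t1 (a, x)) y / (\sum_b pa b) * G x))/=.
  rewrite exchange_big/=; apply: eq_bigr => x _.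
  have l0 : 0 < \sum_b pa b by rewrite -lE; exact: lik_gt0.
  transitivity (\sum_a pa a * (w2 x * G x / \sum_b pa b)).
    by apply: eq_bigr => a _; rewrite pE /pa/=; ring.
  by rewrite -mulr_suml mulrCA divff ?mulr1// gt_eqF.
- by move=> z j; rewrite /obs /= sqrtr1 mul1r.
- by move=> z i /codr[j ->]; rewrite /obs /= sqrtr0 mul0r.
Qed.

End transport.

(** * Independent spins and sums over pairs *)

Section tuple_prior.
Context {R : realType}.

Lemma sum_tupleS (A : finType) n (G : n.+1.-tuple A -> R) :
  \sum_t G t = \sum_a \sum_(t : n.-tuple A) G [tuple of a :: t].
Proof.
rewrite pair_bigA/= (reindex (fun z : A * n.-tuple A => [tuple of z.1 :: z.2]))//=.
exists (fun t => (thead t, [tuple of behead t])) => [[a t] _|t _].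
  by congr pair; apply: val_inj.
by rewrite [RHS]tuple_eta.
Qed.

Definition ptup (A : finType) (p : A -> R) n (t : n.-tuple A) : R :=
  \prod_(i < n) p (tnth t i).

Lemma ptupS (A : finType) (p : A -> R) n a (t : n.-tuple A) :
  ptup p [tuple of a :: t] = p a * ptup p t.
Proof.
by rewrite /ptup big_ord_recl tnth0; congr (_ * _); apply: eq_bigr => i _; rewrite tnthS.
Qed.

Lemma ptup_weights (A : finType) (p : A -> R) n : weights p -> weights (@ptup A p n).
Proof.
move=> [p0 p1]; split=> [t|]; first exact: prodr_ge0.
elim: n => [|n IHn].
  rewrite (eq_bigr (fun=> 1)); last by move=> t _; rewrite /ptup big_ord0.
  by rewrite sumr_const card_tuple expn0.
rewrite sum_tupleS; under eq_bigr do under eq_bigr do rewrite ptupS.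
by under eq_bigr do rewrite -mulr_sumr IHn mulr1.
Qed.

Definition unconst (A : finType) n (t : n.+1.-tuple A) : A * n.-tuple A :=
  (thead t, [tuple of behead t]).

Lemma tnth_unconst0 (A : finType) n (t : n.+1.-tuple A) : tnth t ord0 = (unconst t).1.
Proof. by []. Qed.

Lemma tnth_unconstS (A : finType) n (t : n.+1.-tuple A) j :
  tnth t (lift ord0 j) = tnth (unconst t).2 j.
Proof. by rewrite [in LHS](tuple_eta t) tnthS. Qed.

Lemma pushw_unconst (A : finType) (p : A -> R) n :
  pushw (@unconst A n) (@ptup A p n.+1) (fun z => p z.1 * ptup p z.2).
Proof.
move=> G; rewrite /avg sum_tupleS [RHS](eq_bigr (fun z => p z.1 * ptup p z.2 * G (z.1, z.2))).
  2: by case.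
rewrite -(pair_bigA _ (fun a t => p a * ptup p t * G (a, t)))/=.
apply: eq_bigr => a _; apply: eq_bigr => t _; rewrite ptupS; congr (_ * G _).
by rewrite /unconst; congr pair; apply: val_inj.
Qed.

Lemma ent_scalar_channels (A : finType) (p v : A -> R) n (h : R) : weights p ->
  ent (@ptup A p n) (fun t i => Num.sqrt h * v (tnth t i)) = n%:R * psi p v h.
Proof.
move=> pp; elim: n => [|n IHn].
  rewrite mul0r /ent -[RHS](@EG_cst _ 'I_0 0); congr EG; apply/funext => y.
  rewrite /xlnx (_ : lik _ _ _ = 1) ?ln1 ?mulr0//.
  rewrite /lik -[RHS](proj2 (ptup_weights 0 pp)); apply: eq_bigr => t _.
  by rewrite /expo big_ord0 expR0 mulr1.
rewrite -natr1 mulrDl mul1r -IHn addrC -(ent_indep _ _ pp (ptup_weights n pp)).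
pose s (i : unit + 'I_n) : 'I_n.+1 := if i is inr i then lift ord0 i else ord0.
apply: (ent_transport (h := @unconst A n) (s := s)).
- exact: prodw_weights pp (ptup_weights n pp).
- exact: pushw_unconst.
- move=> [[]|i] [[]|j] //=.
  by move=> /lift_inj ->.
- by move=> t [[]|j]; rewrite /s ?tnth_unconst0 ?tnth_unconstS.
- move=> t i /negP h0; exfalso; apply: h0; apply/codomP.
  by case: (unliftP ord0 i) => [j ->|->]; [exists (inr j)|exists (inl tt)].
Qed.

Lemma sum_edge n (G : 'I_n -> 'I_n -> R) : (forall i j, G i j = G j i) ->
  \sum_(e : edge n) G (val e).1 (val e).2 =
  2^-1 * (\sum_i \sum_j G i j - \sum_i G i i).
Proof.
move=> Gs.
have -> : \sum_(e : edge n) G (val e).1 (val e).2 =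
    \sum_(i < n) \sum_(j < n | (i < j)%N) G i j.
  rewrite pair_big_dep/= -(big_sub [pred p : 'I_n * 'I_n | (p.1 < p.2)%N] (fun p => G p.1 p.2)).
  by apply: eq_bigl.
have E : \sum_i \sum_j G i j = \sum_(i < n) \sum_(j < n | (i < j)%N) G i j +
    \sum_(i < n) \sum_(j < n | (j < i)%N) G i j + \sum_i G i i.
  rewrite -!big_split; apply: eq_bigr => i _ /=.
  rewrite (bigD1 i)//= addrC; congr (_ + _).
  rewrite (bigID (fun j : 'I_n => (i < j)%N))/=; congr (_ + _); apply: eq_bigl => j.
    by case: ltngtP => //; rewrite ?andbF// => ij; rewrite andbT; apply/eqP => ji;
       move: ij; rewrite ji ltnn.
  rewrite -leqNgt leq_eqVlt andb_orr.
  have -> : (j != i) && (j == i :> nat) = false.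
    by apply/negbTE; rewrite negb_and negbK; case: eqVneq => //= /eqP/val_eqP ->.
  by rewrite /= andbC; case: ltngtP => //= ij; apply/eqP => ji; move: ij; rewrite ji ltnn.
have -> : \sum_(i < n) \sum_(j < n | (i < j)%N) G i j = \sum_(i < n) \sum_(j < n | (j < i)%N) G i j.
  rewrite (exchange_big_dep predT)//=; apply: eq_bigr => j _.
  by apply: eq_bigr => i _; rewrite Gs.
move: E; have -> : \sum_(i < n) \sum_(j < n | (i < j)%N) G i j = \sum_(i < n) \sum_(j < n | (j < i)%N) G i j.
  rewrite (exchange_big_dep predT)//=; apply: eq_bigr => j _.
  by apply: eq_bigr => i _; rewrite Gs.
lra.
Qed.

(** With two independent replicas, the double sum of squared pair moments is the mean of the squared
    overlap, which is at least 2c times the mean overlap minus c^2. Halving, and discarding the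
    diagonal, costs the term n B^4/2. The free parameter c is the guess for the overlap. *)
Lemma pair_moments_ge (W : finType) (w : W -> R) n (X : W -> 'I_n -> R) (B c : R) :
  weights w -> 0 <= B -> (forall x i, `|X x i| <= B) ->
  c * \sum_i avg w (fun x => X x i) ^+ 2 - c ^+ 2 / 2 - n%:R * B ^+ 4 / 2 <=
  \sum_(e : edge n) avg w (fun x => X x (val e).1 * X x (val e).2) ^+ 2.
Proof.
move=> ww B0 XB.
rewrite (sum_edge (G := fun i j => avg w (fun x => X x i * X x j) ^+ 2)); last first.
  by move=> i j; congr (avg w _ ^+ 2); apply/funext => x; rewrite mulrC.
have H1 : 2 * c * \sum_i avg w (fun x => X x i) ^+ 2 - c ^+ 2 <=
    \sum_i \sum_j avg w (fun x => X x i * X x j) ^+ 2.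
  have -> : \sum_i \sum_j avg w (fun x => X x i * X x j) ^+ 2 =
      avg w (fun x => avg w (fun x' => (\sum_i X x i * X x' i) ^+ 2)).
    transitivity (avg w (fun x => \sum_i \sum_j (X x i * X x j) *
        avg w (fun x' => X x' i * X x' j))).
      rewrite avg_sum; apply: eq_bigr => i _; rewrite avg_sum; apply: eq_bigr => j _.
      by rewrite avgZr expr2.
    congr avg; apply/funext => x.
    rewrite (_ : (fun x' => _) = fun x' =>
        \sum_i \sum_j X x i * X x j * (X x' i * X x' j)); last first.
      apply/funext => x'; rewrite expr2 mulr_suml; apply: eq_bigr => i _.
      by rewrite mulr_sumr; apply: eq_bigr => j _; ring.
    rewrite avg_sum; apply: eq_bigr => i _; rewrite avg_sum; apply: eq_bigr => j _.
    by rewrite avgZ.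
  have -> : \sum_i avg w (fun x => X x i) ^+ 2 =
      avg w (fun x => avg w (fun x' => \sum_i X x i * X x' i)).
    rewrite (_ : (fun x => avg w _) = fun x => \sum_i X x i * avg w (fun x' => X x' i)); last first.
      by apply/funext => x; rewrite avg_sum; apply: eq_bigr => i _; rewrite avgZ.
    rewrite avg_sum; apply: eq_bigr => i _.
    by rewrite avgZr expr2.
  rewrite -avgZ -(weights_avg_cst (c ^+ 2) ww) -avgB; apply: le_avg; first by case: ww.
  move=> x; rewrite -avgZ -(weights_avg_cst (c ^+ 2) ww) -avgB; apply: le_avg; first by case: ww.
  by move=> x'; have := sqr_ge0 (\sum_i X x i * X x' i - c); rewrite sqrrB; lra.
have H2 : \sum_i avg w (fun x => X x i * X x i) ^+ 2 <= n%:R * B ^+ 4.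
  have -> : n%:R * B ^+ 4 = \sum_(i < n) B ^+ 4 by rewrite sumr_const card_ord mulr_natl.
  apply: ler_sum => i _; rewrite -real_normK ?num_real// (_ : B ^+ 4 = (B * B) ^+ 2); last by ring.
  rewrite lerXn2r ?nnegrE ?mulr_ge0//; apply: (avg_le_bound ww) => x.
  by rewrite normrM ler_pM.
by lra.
Qed.

End tuple_prior.

(** * Discrete integration along paths of snr *)

Section steps.
Context {R : realType}.

Lemma ler_of_inv_nat (x y d : R) :
  (forall K : nat, (0 < K)%N -> x <= y + d / K%:R) -> x <= y.
Proof.
move=> H; apply/ler_addgt0Pr => e e0.
have d0 : 0 <= Num.max d 0 by rewrite le_max lexx orbT.
have := H (Num.truncn (Num.max d 0 / e)).+1 isT; set K := _.+1 => HK.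
have K0 : 0 < K%:R :> R by rewrite ltr0n.
apply: le_trans HK _; rewrite lerD2l ler_pdivrMr// -ler_pdivrMl// mulrC.
apply: (@le_trans _ _ (Num.max d 0 / e)).
  by rewrite ler_wpM2r ?invr_ge0 ?(ltW e0)// le_max lexx.
exact/ltW/truncnS_gt.
Qed.

Lemma ler_telescope (u : nat -> R) (K : nat) (e : R) :
  (forall k, (k < K)%N -> u k <= u k.+1 + e) -> u 0%N <= u K + K%:R * e.
Proof.
elim: K => [|K IHK] H; first by rewrite mul0r addr0.
have h1 := IHK (fun k kK => H k (ltnW kK)).
have h2 := H K (ltnSn K).
by rewrite -natr1 mulrDl mul1r; clear H IHK; lra.
Qed.

Lemma step_error (c : R) (K : nat) : 0 <= c -> (0 < K)%N ->
  K%:R * ((c / K%:R) ^+ 2 * expR (c / K%:R)) <= c ^+ 2 * expR c / K%:R.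
Proof.
move=> c0 K0; have KR : 0 < K%:R :> R by rewrite ltr0n.
have -> : K%:R * ((c / K%:R) ^+ 2 * expR (c / K%:R)) =
    c ^+ 2 * expR (c / K%:R) / K%:R by field; rewrite gt_eqF.
rewrite ler_wpM2r ?invr_ge0 ?(ltW KR)// ler_wpM2l ?sqr_ge0// ler_expR.
by rewrite ler_pdivrMr// ler_peMr// ler1n.
Qed.

(** The increment is cut into K steps, each bounded by [Phi_add_upper]. Since [sqm] increases with
    the snr, all slopes are at most the final one, and the accumulated error is O(1/K). *)
Lemma Phi_convex_upper (W I : finType) (w : W -> R) (F : W -> I -> R) (B : R)
    (tau delta : I -> R) : weights w -> (forall x i, `|F x i| <= B) ->
  (forall i, 0 <= tau i) -> (forall i, 0 <= delta i) ->
  Phi w F (fun i => tau i + delta i) <= Phi w F tau +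
    \sum_i delta i / 2 * sqm w F (fun i => tau i + delta i) (fun x => F x i).
Proof.
move=> ww FB tau0 delta0.
set D := \sum_i _; set c := 4 * B ^+ 2 * \sum_i delta i.
have c0 : 0 <= c by rewrite mulr_ge0 ?sumr_ge0// mulr_ge0 ?sqr_ge0.
apply: (@ler_of_inv_nat _ _ (c ^+ 2 * expR c)) => K K0.
have KR : 0 < K%:R :> R by rewrite ltr0n.
pose t k i := tau i + (K - k)%N%:R / K%:R * delta i.
have := @ler_telescope (fun k => Phi w F (t k)) K (D / K%:R + (c / K%:R) ^+ 2 * expR (c / K%:R)).
have -> : t 0%N = fun i => tau i + delta i.
  by apply/funext => i; rewrite /t subn0 divff ?mul1r// gt_eqF.
have -> : t K = tau by apply/funext => i; rewrite /t subnn mul0r mul0r addr0.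
rewrite mulrDr mulrCA divff ?gt_eqF// mulr1 => H; rewrite -addrA.
apply: le_trans (H _) _; last by rewrite lerD2l lerD2l step_error.
move=> k kK {H}.
have t0 l i : 0 <= t l i by rewrite addr_ge0// mulr_ge0// divr_ge0.
pose d i := delta i / K%:R.
have d0 i : 0 <= d i by rewrite divr_ge0// ltW.
have tE : t k = fun i => t k.+1 i + d i.
  apply/funext => i; rewrite /t /d -addrA; congr (_ + _).
  by rewrite -(subnSK kK) -natr1; field; rewrite gt_eqF.
rewrite tE; apply: le_trans (Phi_add_upper ww (t0 k.+1) d0 FB) _.
have -> : 4 * B ^+ 2 * \sum_i d i = c / K%:R by rewrite /d -mulr_suml mulrA.
rewrite -addrA !lerD2l lerD2r /D mulr_suml; apply: ler_sum => i _.
have -> : d i / 2 * sqm w F (t k.+1) (F^~ i) =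
    delta i / K%:R / 2 * sqm w F (t k.+1) (F^~ i) by [].
rewrite [leRHS](_ : _ = delta i / K%:R / 2 * sqm w F (fun j => tau j + delta j) (F^~ i)).
  2: by move: (sqm _ _ _ _) => z; field; rewrite gt_eqF.
have dK : 0 <= delta i / K%:R / 2 by rewrite !divr_ge0.
apply: (ler_wpM2l dK); move: dK => _.
(* The snr still missing between this step and the end point, to which [sqm_le] is applied. *)
pose r i := (1 - (K - k.+1)%N%:R / K%:R) * delta i.
have r0 j : 0 <= r j.
  by rewrite mulr_ge0// subr_ge0 ler_pdivrMr// mul1r ler_nat leq_subr.
rewrite (_ : (fun i => tau i + delta i) = fun i => t k.+1 i + r i).
  exact: (@sqm_le R W I w F ww (t k.+1) r (t0 k.+1) r0 (F^~ i)).
by apply/funext => j; rewrite /t /r; ring.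
Qed.

End steps.

(** * The finite spin model with side channels, and the interpolation bound *)

Section spin_model.
Context {R : realType}.
Variables (A : finType) (p v : A -> R) (B : R).
Hypotheses (pp : weights p) (B1 : 1 <= B) (vB : forall a, `|v a| <= B).

Let B0 : 0 <= B. Proof. exact: le_trans B1. Qed.

(** Pair channels and, for each spin, an auxiliary direct channel. The direct channels are one end
    of the interpolation in [guerra], and the perturbation controlling covariances in the cavity
    argument. *)
Definition sidx n : finType := (edge n + 'I_n)%type.

Definition sobs n (t : n.-tuple A) (i : sidx n) : R :=
  match i with
  | inl e => v (tnth t (val e).1) * v (tnth t (val e).2)
  | inr i => v (tnth t i)
  end.

Definition snr n (a r : R) (i : sidx n) : R := if i is inl _ then a else r.

Definition PhiN n a r : R := Phi (@ptup R A p n) (@sobs n) (snr a r).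

(** The normalization 1 <= B lets B^2 cover the direct observations as well. *)
Lemma sobs_bound n (t : n.-tuple A) i : `|sobs t i| <= B ^+ 2.
Proof.
case: i => [e|i] /=; first by rewrite normrM expr2 ler_pM.
by apply: le_trans (vB _) _; rewrite expr2 ler_peMr.
Qed.

Lemma snr_ge0 n a r (i : sidx n) : 0 <= a -> 0 <= r -> 0 <= snr a r i.
Proof. by case: i. Qed.

Lemma snrD n a r a' r' : (fun i : sidx n => snr a r i + snr a' r' i) = snr (a + a') (r + r').
Proof. by apply/funext => -[]. Qed.

Lemma sum_sidx n (G : sidx n -> R) : \sum_i G i = \sum_e G (inl e) + \sum_i G (inr i).
Proof. by rewrite big_sumType. Qed.

Definition sqE n a r : R := \sum_(e : edge n)
  sqm (@ptup R A p n) (@sobs n) (snr a r) (fun t => v (tnth t (val e).1) * v (tnth t (val e).2)).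

Definition sqV n a r : R := \sum_(i < n)
  sqm (@ptup R A p n) (@sobs n) (snr a r) (fun t => v (tnth t i)).

Let wn n : weights (@ptup R A p n). Proof. exact: ptup_weights. Qed.

Let sqBge0 : 0 <= B ^+ 2. Proof. exact: sqr_ge0. Qed.

Lemma PhiN_edges_lower n a r d : 0 <= a -> 0 <= r -> 0 <= d ->
  PhiN n a r + d / 2 * sqE n a r <= PhiN n (a + d) r.
Proof.
move=> a0 r0 d0.
have := Phi_add_lower (@sobs n) (wn n) (fun i => @snr_ge0 n a r i a0 r0)
  (fun i => @snr_ge0 n d 0 i d0 (lexx 0)).
rewrite snrD addr0 sum_sidx/= [X in _ + (_ + X)]big1 ?addr0 -?mulr_sumr//.
by move=> i _; rewrite mul0r mul0r.
Qed.

Lemma PhiN_edges_upper n a r d : 0 <= a -> 0 <= r -> 0 <= d ->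
  PhiN n (a + d) r <= PhiN n a r + d / 2 * sqE n (a + d) r.
Proof.
move=> a0 r0 d0.
have := Phi_convex_upper (wn n) (@sobs_bound n) (fun i => @snr_ge0 n a r i a0 r0)
  (fun i => @snr_ge0 n d 0 i d0 (lexx 0)).
rewrite snrD addr0 sum_sidx/= [X in _ + (_ + X)]big1 ?addr0 -?mulr_sumr//.
by move=> i _; rewrite mul0r mul0r.
Qed.

Lemma PhiN_mono_side n a r d : 0 <= a -> 0 <= r -> 0 <= d -> PhiN n a r <= PhiN n a (r + d).
Proof.
move=> a0 r0 d0.
have := Phi_add_lower (@sobs n) (wn n) (fun i => @snr_ge0 n a r i a0 r0)
  (fun i => @snr_ge0 n 0 d i (lexx 0) d0).
rewrite snrD addr0; apply: le_trans; rewrite lerDl; apply: sumr_ge0 => i _.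
rewrite mulr_ge0 ?divr_ge0 ?snr_ge0// /sqm; apply: EG_ge0 => y.
by rewrite divr_ge0 ?sqr_ge0// ltW// lik_gt0.
Qed.

Lemma PhiN_side_upper n a r d : 0 <= a -> 0 <= r -> 0 <= d ->
  PhiN n a (r + d) <= PhiN n a r + d / 2 * sqV n a r +
    (4 * B ^+ 4 * (n%:R * d)) ^+ 2 * expR (4 * B ^+ 4 * (n%:R * d)).
Proof.
move=> a0 r0 d0.
have := Phi_add_upper (wn n) (fun i => @snr_ge0 n a r i a0 r0)
  (fun i => @snr_ge0 n 0 d i (lexx 0) d0) (@sobs_bound n).
rewrite snrD addr0 !sum_sidx/= [X in _ + (X + _)]big1; last first.
  by move=> e _; rewrite mul0r mul0r.
have -> : \sum_(e : edge n) (0 : R) + \sum_(i < n) d = n%:R * d.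
  by rewrite big1_eq add0r sumr_const card_ord mulr_natl.
by rewrite [0 + _]add0r -mulr_sumr -exprM.
Qed.

Lemma PhiN_scalar n h : PhiN n 0 h = n%:R * psi p v h.
Proof.
rewrite -ent_scalar_channels// /PhiN /Phi.
apply: (ent_transport (h := id) (s := inr)) => //.
- by move=> ? ? [].
- move=> t [e|i]; first by rewrite /obs /= sqrtr0 mul0r.
  by rewrite codom_f.
Qed.

Lemma sqE_lower n a r c : c * sqV n a r - c ^+ 2 / 2 - n%:R * B ^+ 4 / 2 <= sqE n a r.
Proof.
have -> : c * sqV n a r - c ^+ 2 / 2 - n%:R * B ^+ 4 / 2 =
    EG (fun y => c * (\sum_i lik (@ptup R A p n) (obs (@sobs n) (snr a r)) y *
      avg (post (@ptup R A p n) (@sobs n) (snr a r) y) (fun t => v (tnth t i)) ^+ 2) +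
    - (c ^+ 2 / 2 + n%:R * B ^+ 4 / 2) * lik (@ptup R A p n) (obs (@sobs n) (snr a r)) y).
  have ts i := tame_lik_avg_sqr (@sobs n) (wn n) (snr a r) (fun t => v (tnth t i)).
  rewrite EGD; last 2 first.
  - by apply: tameZ; apply: tame_sum => i; exact: ts.
  - by apply: tameZ; exact: tame_lik.
  rewrite EGZ; last by apply: tame_sum => i; exact: ts.
  rewrite EGZ; last exact: tame_lik.
  rewrite EG_lik// mulr1 EG_sum//.
  rewrite /sqV; under eq_bigr do rewrite sqmE//.
  by ring.
have te e := tame_lik_avg_sqr (@sobs n) (wn n) (snr a r)
  (fun t => v (tnth t (val e).1) * v (tnth t (val e).2)).
rewrite /sqE; under eq_bigr do rewrite sqmE//.
rewrite -EG_sum; last exact: te.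
apply: le_EG.
- apply: tameD; last by apply: tameZ; exact: tame_lik.
  by apply: tameZ; apply: tame_sum => i; exact: tame_lik_avg_sqr.
- by apply: tame_sum => e; exact: te.
- move=> y; set L := lik _ _ _; set q := post _ _ _ _.
  have q1 : weights q by exact: post_weights.
  have L0 : 0 <= L by apply/ltW; exact: lik_gt0.
  have := @pair_moments_ge R _ q n (fun t i => v (tnth t i)) B c q1 B0 (fun t i => vB _).
  move=> /(ler_wpM2l L0); rewrite [leRHS]mulr_sumr; apply: le_trans.
  rewrite -mulr_sumr; set S := \sum_i _ ^+ 2; rewrite le_eqVlt.
  by apply/orP; left; apply/eqP; move: S L {L0} => S L'; ring.
Qed.

(** Along the path, raising the pair snr gains in proportion to [sqE] and lowering the side snr
    loses in proportion to [sqV]. [sqE_lower] with overlap guess n q makes the [sqV] terms cancel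
    exactly, leaving the deterministic cost. *)
Lemma guerra (lambda q : R) n : 0 <= lambda -> 0 <= q -> (0 < n)%N ->
  n%:R * (psi p v (lambda * q) - lambda / 4 * q ^+ 2) - lambda / 4 * B ^+ 4 <=
  PhiN n (lambda / n%:R) 0.
Proof.
move=> l0 q0 n0; have nR : 0 < n%:R :> R by rewrite ltr0n.
set c := 4 * B ^+ 4 * (n%:R * (lambda * q)).
have c0 : 0 <= c by rewrite !mulr_ge0 ?exprn_ge0.
pose e := n%:R * (lambda / 4 * q ^+ 2) + lambda / 4 * B ^+ 4.
rewrite mulrBr lerBlDr lerBlDr; apply: (@ler_of_inv_nat _ _ _ (c ^+ 2 * expR c)) => K K0.
have KR : 0 < K%:R :> R by rewrite ltr0n.
(* Pair snr grows from 0 to lambda/n while side snr falls from lambda q to 0; at k = 0 the spins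
   decouple into scalar channels. *)
pose u k := PhiN n (k%:R * (lambda / n%:R / K%:R)) ((K - k)%N%:R * (lambda * q / K%:R)).
have := @ler_telescope _ u K (e / K%:R + (c / K%:R) ^+ 2 * expR (c / K%:R)).
have -> : u 0%N = n%:R * psi p v (lambda * q).
  rewrite /u mul0r subn0 PhiN_scalar; congr (_ * psi p v _).
  by field; rewrite gt_eqF.
have -> : u K = PhiN n (lambda / n%:R) 0.
  rewrite /u subnn mul0r; congr (PhiN n _ 0).
  by field; rewrite !gt_eqF.
rewrite mulrDr mulrCA divff ?gt_eqF// mulr1 => H.
apply: le_trans (H _) _; last first.
  by have := step_error c0 K0; rewrite /e; clear; lra.
move=> k kK {H}; rewrite /u.
set d := lambda * q / K%:R; set h := lambda / n%:R / K%:R.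
have d0 : 0 <= d by rewrite divr_ge0 ?mulr_ge0.
have h0 : 0 <= h by rewrite !divr_ge0.
have -> : (K - k)%N%:R * d = (K - k.+1)%N%:R * d + d by rewrite -(subnSK kK) -natr1; ring.
have -> : k.+1%:R * h = k%:R * h + h by rewrite -natr1; ring.
have kh0 : 0 <= k%:R * h by rewrite mulr_ge0.
have kd0 : 0 <= (K - k.+1)%N%:R * d by rewrite mulr_ge0.
have H1 := PhiN_edges_lower n kh0 kd0 h0.
have H2 := PhiN_side_upper n kh0 kd0 d0.
have H3 := sqE_lower n (k%:R * h) ((K - k.+1)%N%:R * d) (n%:R * q).
have cE : 4 * B ^+ 4 * (n%:R * d) = c / K%:R by rewrite /c /d; ring.
rewrite cE in H2.
have H4 : h / 2 * (n%:R * q * sqV n (k%:R * h) ((K - k.+1)%N%:R * d) - (n%:R * q) ^+ 2 / 2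
    - n%:R * B ^+ 4 / 2) <= h / 2 * sqE n (k%:R * h) ((K - k.+1)%N%:R * d).
  by rewrite ler_wpM2l// divr_ge0.
have E : h / 2 * (n%:R * q * sqV n (k%:R * h) ((K - k.+1)%N%:R * d) - (n%:R * q) ^+ 2 / 2
    - n%:R * B ^+ 4 / 2) = d / 2 * sqV n (k%:R * h) ((K - k.+1)%N%:R * d) - e / K%:R.
  by rewrite /h /d /e; field; rewrite !gt_eqF.
rewrite {}E in H4.
clear -H1 H2 H4; move: (expR _) (PhiN n (k%:R * h + h) _) (PhiN n (k%:R * h) _) H1 H2 H4 => E0 P1.
move: (PhiN n _ _) (sqV _ _ _) (sqE _ _ _) => P2 S1 S2 P0; lra.
Qed.

End spin_model.

(** * Fluctuations of the overlap in terms of covariances *)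

Section cavity_estimates.
Context {R : realType}.

Lemma archimedean_mul (c e : R) : 0 < e ->
  exists N, forall n, (N <= n)%N -> c <= n%:R * e.
Proof.
move=> e0; have [c0|c0] := lerP c 0.
  by exists 0%N => n _; rewrite (le_trans c0)// mulr_ge0// ltW.
exists (Num.truncn (c / e)).+1 => n Nn.
rewrite -ler_pdivrMr//; apply: (le_trans (ltW (truncnS_gt _))).
by rewrite ler_nat.
Qed.

Lemma abs_le_amgm (x e : R) : 0 < e -> `|x| <= e + x ^+ 2 / e.
Proof.
move=> e0; rewrite -(@ler_pM2r _ e)// mulrDl -[x ^+ 2 / e * e]mulrA mulVf ?gt_eqF// mulr1.
rewrite -(real_normK (num_real x)); have := normr_ge0 x; move: `|x| => t t0.
by have := sqr_ge0 (t - e / 2); nra.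
Qed.

Lemma mul_le_amgm (m n c e B : R) : 0 < e -> 0 <= B -> `|m| <= B -> `|n| <= B ->
  m * n * c <= B ^+ 2 * (e ^+ 2 + c ^+ 2 / e ^+ 2).
Proof.
move=> e0 B0 mB nB; have := abs_le_amgm c (exprn_gt0 2 e0) => H.
apply: le_trans (ler_norm _) _; rewrite normrM normrM.
by rewrite ler_pM ?mulr_ge0// expr2 ler_pM.
Qed.

(** The variance of the centred overlap is the double sum of m_i m_j C_ij. Two uses of the
    arithmetic-geometric inequality, at scales e n and e^2, bound its mean absolute value by a small
    multiple of n plus a multiple of [cov2]. *)
Lemma avg_abs_overlap (W : finType) (q : W -> R) n (X : W -> 'I_n -> R) (B e : R) :
  weights q -> 0 <= B -> (forall x i, `|X x i| <= B) -> (0 < n)%N -> 0 < e ->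
  avg q (fun x => `|\sum_i (X x i - avg q (X^~ i)) * avg q (X^~ i)|) <=
  e * n%:R * (1 + B ^+ 2) + B ^+ 2 / (e ^+ 3 * n%:R) * cov2 q X.
Proof.
move=> qq B0 XB n0 e0; have nR : 0 < n%:R :> R by rewrite ltr0n.
have [q0 _] := qq.
have en0 : 0 < e * n%:R by rewrite mulr_gt0.
pose Z x := \sum_i (X x i - avg q (X^~ i)) * avg q (X^~ i).
apply: (@le_trans _ _ (avg q (fun x => e * n%:R + (e * n%:R)^-1 * Z x ^+ 2))).
  by apply: le_avg => // x; rewrite [_^-1 * _]mulrC abs_le_amgm.
rewrite avgD weights_avg_cst// avgZ.
have -> : avg q (fun x => Z x ^+ 2) =
    \sum_i \sum_j avg q (X^~ i) * avg q (X^~ j) * cov q X i j.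
  under eq_bigr do under eq_bigr do rewrite covE// -avgZ.
  under eq_bigr do rewrite -avg_sum.
  rewrite -avg_sum; apply: eq_bigr => x _; congr (_ * _).
  rewrite expr2 /Z mulr_suml; apply: eq_bigr => i _.
  rewrite mulr_sumr; apply: eq_bigr => j _.
  by move: (avg q (X^~ i)) (avg q (X^~ j)) => a b; ring.
apply: (@le_trans _ _ (e * n%:R + (e * n%:R)^-1 *
    (B ^+ 2 * (n%:R ^+ 2 * e ^+ 2 + cov2 q X / e ^+ 2)))).
  rewrite lerD2l ler_wpM2l ?invr_ge0 ?(ltW en0)//.
  apply: (@le_trans _ _ (\sum_(i < n) \sum_(j < n)
      (B ^+ 2 * (e ^+ 2 + cov q X i j ^+ 2 / e ^+ 2)))).
    apply: ler_sum => i _; apply: ler_sum => j _.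
    by apply: mul_le_amgm => //; apply: avg_le_bound.
  under eq_bigr do rewrite -mulr_sumr big_split/= sumr_const card_ord -mulr_suml.
  rewrite -mulr_sumr big_split/= sumr_const card_ord -mulr_suml -/(cov2 q X).
  by have -> : e ^+ 2 *+ n *+ n = n%:R ^+ 2 * e ^+ 2 by rewrite -mulrnA -(mulr_natr (e ^+ 2)) natrM; ring.
rewrite le_eqVlt; apply/orP; left; apply/eqP; move: (cov2 q X) => c.
by field; rewrite !gt_eqF.
Qed.

End cavity_estimates.

(** * The cavity argument: adding one spin at a time *)

Section cavity.
Context {R : realType}.
Variables (A : finType) (p v : A -> R) (B : R).
Hypotheses (pp : weights p) (B1 : 1 <= B) (vB : forall a, `|v a| <= B).

Let B0 : 0 <= B. Proof. exact: le_trans B1. Qed.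

(** The factor of [cov2] / n^2 once both errors of [cavity_ent] are collected; it depends on e but
    not on n. *)
Definition cavity_cost (lambda e : R) : R :=
  expR (4 * lambda * B ^+ 4) * lambda ^+ 2 * B ^+ 4 + lambda * B ^+ 4 / e ^+ 3.

Lemma cavity_cost_ge0 (lambda e : R) : 0 <= lambda -> 0 <= e -> 0 <= cavity_cost lambda e.
Proof. by move=> l0 e0; rewrite addr_ge0 ?divr_ge0 ?mulr_ge0 ?exprn_ge0 ?expR_ge0. Qed.

Definition cov_cost : R := 4 * B ^+ 2 + 8 * expR (1 / 2).

Lemma cov_cost_gt0 : 0 < cov_cost.
Proof. by rewrite /cov_cost ltr_wpDl ?mulr_gt0 ?expR_gt0// mulr_ge0 ?sqr_ge0. Qed.

(** Here S is any upper bound of psi(g) - g^2/(4 lambda). Applied at g = s times sum m^2 it turns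
    [psi] into S plus a quadratic term, which the change of normalization will pay for in
    [cavity_step_full]. *)
Lemma cavity_pointwise (lambda S e : R) (W : finType) (q : W -> R) n (X : W -> 'I_n -> R) :
  0 < lambda -> (forall g, 0 <= g -> psi p v g <= S + g ^+ 2 / (4 * lambda)) ->
  weights q -> (forall x i, `|X x i| <= B) -> (0 < n)%N -> 0 < e ->
  ent (fun z : A * W => p z.1 * q z.2)
    (fun z i => Num.sqrt (lambda / n.+1%:R) * v z.1 * X z.2 i) <=
  S + lambda * B ^+ 2 * (1 + B ^+ 2) * e +
  (lambda / n.+1%:R) / (4 * n%:R) * (\sum_i avg q (X^~ i) ^+ 2) ^+ 2 +
  cavity_cost lambda e / n%:R ^+ 2 * cov2 q X.
Proof.
move=> l0 HS qq XB n0 e0.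
have nR : 0 < n%:R :> R by rewrite ltr0n.
have nR1 : 0 < n.+1%:R :> R by rewrite ltr0n.
set s := lambda / n.+1%:R; set M := \sum_i _ ^+ 2.
have s0 : 0 < s by rewrite divr_gt0.
have M0 : 0 <= M by apply: sumr_ge0 => i _; exact: sqr_ge0.
have c0 : 0 <= cov2 q X by exact: cov2_ge0.
have sn : s <= lambda / n%:R.
  by rewrite ler_wpM2l ?(ltW l0)// lef_pV2 ?posrE// ler_nat.
have hK : s * (#|'I_n|%:R * (4 * B ^+ 4)) <= 4 * lambda * B ^+ 4.
  rewrite card_ord [leRHS](_ : _ = lambda / n%:R * (n%:R * (4 * B ^+ 4))).
    by rewrite ler_wpM2r// !mulr_ge0 ?exprn_ge0.
  by field; rewrite gt_eqF.
have := cavity_ent qq B0 XB pp vB (ltW s0) hK; rewrite -/M.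
have H1 : psi p v (s * M) <= S + s / (4 * n%:R) * M ^+ 2.
  apply: le_trans (HS _ _) _; first by rewrite mulr_ge0// ltW.
  rewrite lerD2l [leLHS](_ : _ = s / (4 * n.+1%:R) * M ^+ 2).
    rewrite ler_wpM2r ?sqr_ge0// ler_wpM2l ?(ltW s0)// lef_pV2 ?posrE ?mulr_gt0//.
    by rewrite ler_wpM2l// ler_nat.
  by rewrite /s; field; rewrite !gt_eqF.
have H2 := avg_abs_overlap qq B0 XB n0 e0.
set Z := avg q _ in H2 *; move=> H3.
have s2 : s ^+ 2 <= lambda ^+ 2 / n%:R ^+ 2.
  by rewrite -expr_div_n lerXn2r ?nnegrE ?(ltW s0)// divr_ge0// ltW.
have H4 : expR (4 * lambda * B ^+ 4) * (s ^+ 2 * B ^+ 4) * cov2 q X <=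
    expR (4 * lambda * B ^+ 4) * (lambda ^+ 2 / n%:R ^+ 2 * B ^+ 4) * cov2 q X.
  by rewrite ler_wpM2r// ler_wpM2l ?expR_ge0// ler_wpM2r// exprn_ge0.
have H5 : s * B ^+ 2 * Z <= lambda / n%:R * B ^+ 2 *
   (e * n%:R * (1 + B ^+ 2) + B ^+ 2 / (e ^+ 3 * n%:R) * cov2 q X).
  apply: (@le_trans _ _ (s * B ^+ 2 *
    (e * n%:R * (1 + B ^+ 2) + B ^+ 2 / (e ^+ 3 * n%:R) * cov2 q X))).
    by rewrite ler_wpM2l// mulr_ge0 ?sqr_ge0// ltW.
  have b1 : 0 <= 1 + B ^+ 2 by rewrite addr_ge0 ?sqr_ge0.
  have b2 : 0 <= e ^+ 3 * n%:R by rewrite mulr_ge0 ?exprn_ge0 ?(ltW e0).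
  have b3 : 0 <= e * n%:R by rewrite mulr_ge0 ?(ltW e0).
  apply: ler_wpM2r; last by apply: ler_wpM2r; rewrite ?sqr_ge0.
  by apply: addr_ge0; apply: mulr_ge0 => //; rewrite divr_ge0 ?sqr_ge0.
have E : lambda * B ^+ 2 * (1 + B ^+ 2) * e + cavity_cost lambda e / n%:R ^+ 2 * cov2 q X =
    expR (4 * lambda * B ^+ 4) * (lambda ^+ 2 / n%:R ^+ 2 * B ^+ 4) * cov2 q X +
    lambda / n%:R * B ^+ 2 *
      (e * n%:R * (1 + B ^+ 2) + B ^+ 2 / (e ^+ 3 * n%:R) * cov2 q X).
  rewrite /cavity_cost; move: (cov2 q X) (expR _) => c x.
  by field; rewrite !gt_eqF.
apply: le_trans H3 _.
rewrite [leRHS](_ : _ = (S + s / (4 * n%:R) * M ^+ 2) +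
  (lambda * B ^+ 2 * (1 + B ^+ 2) * e + cavity_cost lambda e / n%:R ^+ 2 * cov2 q X)).
  by rewrite E -addrA lerD// lerD.
by move: (cavity_cost _ _ / _ * _) => a; ring.
Qed.


Section one_size.
Variable n : nat.

Definition edge_lift (e : edge n) : edge n.+1 :=
  exist _ (lift ord0 (val e).1, lift ord0 (val e).2) (valP e).
Definition edge_new (i : 'I_n) : edge n.+1 := exist _ (ord0, lift ord0 i) isT.

(** The observations of n + 1 spins sorted relative to the new spin, which is number 0: those of the
    old spins, the pairs with the old spin i ([Some i]), and the new direct channel ([None]). *)
Definition cidx : finType := (sidx n + option 'I_n)%type.

Definition cpos (j : cidx) : sidx n.+1 :=
  match j with
  | inl (inl e) => inl (edge_lift e)
  | inl (inr i) => inr (lift ord0 i)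
  | inr (Some i) => inl (edge_new i)
  | inr None => inr ord0
  end.

Lemma cpos_inj : injective cpos.
Proof.
move=> [[e|i]|[i|]] [[e'|i']|[i'|]] //= [].
- by move=> h1 h2; congr (inl (inl _)); apply: val_inj; move: e e' h1 h2 =>
    [[a b] ?] [[a' b'] ?] /= ? ?; congr (_, _); apply: ord_inj; lia.
- by move=> h; congr (inl (inr _)); apply: ord_inj; lia.
- by move=> h; congr (inr (Some _)); apply: ord_inj; lia.
Qed.

Lemma cpos_codom i : i \in codom cpos.
Proof.
have ex (P : exists j, cpos j = i) : i \in codom cpos.
  by case: P => j <-; exact: codom_f.
apply: ex; case: i => [[[a b] ab]|i].
- have [b' bE|bE] := unliftP ord0 b; last by exfalso; move: ab; rewrite bE.
  have [a' aE|aE] := unliftP ord0 a.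
    have ab' : ((a', b').1 < (a', b').2)%N by move: ab; rewrite aE bE.
    exists (inl (inl (exist _ (a', b') ab'))) => /=.
    by congr inl; apply: val_inj => /=; rewrite aE bE.
  exists (inr (Some b')) => /=; congr inl; apply: val_inj => /=.
  by rewrite aE bE.
- have [j ->|->] := unliftP ord0 i; first by exists (inl (inr j)).
  by exists (inr None).
Qed.

Definition cobs (z : A * n.-tuple A) (j : cidx) : R :=
  match j with
  | inl i => sobs v z.2 i
  | inr (Some i) => v z.1 * v (tnth z.2 i)
  | inr None => v z.1
  end.

Definition csnr (a r b c : R) (j : cidx) : R :=
  match j with inl i => snr a r i | inr (Some _) => b | inr None => c end.

Let wn : weights (@ptup R A p n). Proof. exact: ptup_weights. Qed.
Let wc (z : A * n.-tuple A) : R := p z.1 * ptup p z.2.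
Let wwc : weights wc. Proof. exact: prodw_weights. Qed.

Lemma csnr_ge0 a r b c j : 0 <= a -> 0 <= r -> 0 <= b -> 0 <= c -> 0 <= csnr a r b c j.
Proof. by case: j => [[|]|[|]]. Qed.

Lemma csnrD a r b c a' r' b' c' :
  (fun j => csnr a r b c j + csnr a' r' b' c' j) = csnr (a + a') (r + r') (b + b') (c + c').
Proof. by apply/funext => -[[|]|[|]]. Qed.

Lemma cobs_bound z j : `|cobs z j| <= B ^+ 2.
Proof.
case: j => [i|[i|]] /=; first exact: sobs_bound.
  by rewrite normrM expr2 ler_pM.
by apply: le_trans (vB _) _; rewrite expr2 ler_peMr.
Qed.

Lemma PhiN_cidx a r : PhiN p v n.+1 a r = Phi wc cobs (csnr a r a r).
Proof.
apply: (@ent_transport R _ _ _ _ (@unconst A n) cpos) => //.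
- exact: pushw_unconst.
- exact: cpos_inj.
- move=> t [[e|i]|[i|]] //=; rewrite /obs /=; congr (_ * _).
  + by congr (v _ * v _); exact: tnth_unconstS.
  + by congr (v _); exact: tnth_unconstS.
  + by congr (v _ * v _); exact: tnth_unconstS.
- by move=> t i; rewrite cpos_codom.
Qed.

Lemma PhiN_base a r : Phi wc cobs (csnr a r 0 0) = PhiN p v n a r.
Proof.
apply: (@ent_transport R _ _ _ _ snd inl) => //.
- exact: pushw_snd.
- by move=> ? ? [].
- move=> t [i|[i|]]; last 2 first.
  + by rewrite /obs /= sqrtr0 mul0r.
  + by rewrite /obs /= sqrtr0 mul0r.
  by rewrite codom_f.
Qed.

Let Fn := @sobs R A v n.
Let L a r := lik (@ptup R A p n) (obs Fn (snr a r)).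
Let Q a r := post (@ptup R A p n) Fn (snr a r).
Let V (t : n.-tuple A) (i : 'I_n) := v (tnth t i).

Definition sqV2 a r : R := EG (fun y => L a r y * (\sum_i avg (Q a r y) (V^~ i) ^+ 2) ^+ 2).
Definition covN a r : R := EG (fun y => L a r y * cov2 (Q a r y) V).

Let tame_sumsq a r : tame (fun y => \sum_i avg (Q a r y) (V^~ i) ^+ 2).
Proof. by apply: tame_sum => i; apply: tameX; exact: tame_avg_post. Qed.

Let tame_V2 a r : tame (fun y => L a r y * (\sum_i avg (Q a r y) (V^~ i) ^+ 2) ^+ 2).
Proof. by apply: tameM; [exact: tame_lik|apply: tameX; exact: tame_sumsq]. Qed.

Let tame_cov2 a r : tame (fun y => L a r y * cov2 (Q a r y) V).
Proof.
apply: tameM; first exact: tame_lik.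
apply: tame_sum => i; apply: tame_sum => j; apply: tameX.
by apply: tameB; [|apply: tameM]; exact: tame_avg_post.
Qed.

Let lik_base a r y : lik wc (obs cobs (csnr a r 0 0)) y = L a r (reco inl y).
Proof.
apply: (@lik_transport R _ _ _ _ snd inl) => //.
- exact: pushw_snd.
- by move=> ? ? [].
- move=> t [i|[i|]]; last 2 first.
  + by rewrite /obs /= sqrtr0 mul0r.
  + by rewrite /obs /= sqrtr0 mul0r.
  by rewrite codom_f.
Qed.

(** Before the new channels are opened, the new spin keeps its prior p and is independent of the old
    ones. *)
Let post_base a r y : post wc cobs (csnr a r 0 0) y =
  fun z => p z.1 * Q a r (reco inl y) z.2.
Proof.
apply/funext => z; rewrite /post lik_base /wc -mulrA -mulrA /Q /post -mulrA.
congr (_ * (_ * (_ / _))); apply: (@expo_drop R _ _ inl) => //.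
- by move=> ? ? [].
- move=> [i|[i|]]; last 2 first.
  + by rewrite /obs /= sqrtr0 mul0r.
  + by rewrite /obs /= sqrtr0 mul0r.
  by rewrite codom_f.
Qed.

(** The new channels are opened in two stages: the pairs, by the chain rule and [cavity_pointwise]
    for each posterior of the old spins, then the direct channel, by the energy bound. *)
Lemma cavity_step (lambda S e r : R) : 0 < lambda -> 0 <= r ->
  (forall g, 0 <= g -> psi p v g <= S + g ^+ 2 / (4 * lambda)) -> (0 < n)%N -> 0 < e ->
  PhiN p v n.+1 (lambda / n.+1%:R) r <= PhiN p v n (lambda / n.+1%:R) r +
  (S + lambda * B ^+ 2 * (1 + B ^+ 2) * e +
   (lambda / n.+1%:R) / (4 * n%:R) * sqV2 (lambda / n.+1%:R) r +
   cavity_cost lambda e / n%:R ^+ 2 * covN (lambda / n.+1%:R) r) + r / 2 * B ^+ 4.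
Proof.
move=> l0 r0 HS n0 e0; set s := lambda / n.+1%:R.
have s0 : 0 <= s by rewrite divr_ge0// ltW.
rewrite PhiN_cidx.
have -> : csnr s r s r = fun j => csnr s r s 0 j + csnr 0 0 0 r j.
  by rewrite csnrD !addr0 add0r.
apply: (le_trans (@Phi_add_energy R _ _ wc cobs wwc _ _
  (fun j => csnr_ge0 j s0 r0 s0 (lexx 0)) (fun j => csnr_ge0 j (lexx 0) (lexx 0) (lexx 0) r0)
  (B ^+ 2) (sqr_ge0 B) cobs_bound)).
have -> : \sum_i csnr 0 0 0 r i / 2 * (B ^+ 2) ^+ 2 = r / 2 * B ^+ 4.
  rewrite (bigD1 (inr None))//= big1 ?addr0 -?exprM//.
  by move=> [[?|?]|[?|]] //= _; rewrite mul0r mul0r.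
rewrite lerD2r.
have -> : csnr s r s 0 = fun j => csnr s r 0 0 j + csnr 0 0 s 0 j.
  by rewrite csnrD !addr0 add0r.
rewrite (@Phi_add R _ _ wc cobs wwc _ _ (fun j => csnr_ge0 j s0 r0 (lexx 0) (lexx 0))
  (fun j => csnr_ge0 j (lexx 0) (lexx 0) s0 (lexx 0))) PhiN_base lerD2l.
pose D := S + lambda * B ^+ 2 * (1 + B ^+ 2) * e.
pose G y := D * L s r y +
  ((s / (4 * n%:R)) * (L s r y * (\sum_i avg (Q s r y) (V^~ i) ^+ 2) ^+ 2) +
   (cavity_cost lambda e / n%:R ^+ 2) * (L s r y * cov2 (Q s r y) V)).
have tG : tame G.
  by apply: tameD; [apply: tameZ; exact: tame_lik|apply: tameD; apply: tameZ].
have -> : S + lambda * B ^+ 2 * (1 + B ^+ 2) * e + s / (4 * n%:R) * sqV2 s r +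
    cavity_cost lambda e / n%:R ^+ 2 * covN s r = EG G.
  rewrite EGD; last 2 first.
  - by apply: tameZ; exact: tame_lik.
  - by apply: tameD; apply: tameZ.
  rewrite EGZ; last exact: tame_lik.
  rewrite EG_lik// mulr1 EGD; last 2 first.
  - exact: tameZ.
  - exact: tameZ.
  by rewrite !EGZ// addrA.
rewrite -(@EG_reco R (sidx n) cidx inl G)//; last by move=> ? ? [].
apply: le_EG.
- by apply: tame_lik_ent => // j; exact: csnr_ge0.
- exact: tame_reco.
move=> y; rewrite lik_base post_base.
have -> : ent (fun z => p z.1 * Q s r (reco inl y) z.2) (obs cobs (csnr 0 0 s 0)) =
    ent (fun z => p z.1 * Q s r (reco inl y) z.2)
      (fun z i => Num.sqrt s * v z.1 * V z.2 i).
  apply: (@ent_transport R _ _ _ _ id (fun i => inr (Some i))) => //.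
  - by apply: prodw_weights => //; exact: post_weights.
  - by move=> ? ? [].
  - by move=> z j; rewrite /obs /= mulrA.
  - move=> z [[i|i]|[i|]]; rewrite /obs /= ?sqrtr0 ?mul0r//.
    by rewrite codom_f.
have L0 : 0 <= L s r (reco inl y) by apply/ltW; exact: lik_gt0.
have H := @cavity_pointwise lambda S e _ (Q s r (reco inl y)) n V l0 HS
  (post_weights _ wn _ _) (fun t i => vB _) n0 e0.
apply: le_trans (ler_wpM2l L0 H) _; rewrite /G /D -/s.
move: (L s r _) (cavity_cost _ _ / _) (cov2 _ _) (\sum_i _ ^+ 2) => a b c d.
by rewrite le_eqVlt; apply/orP; left; apply/eqP; ring.
Qed.

(** [pair_moments_ge] with the guess c equal to the posterior value of the mean overlap, so that the
    bound becomes quadratic. *)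
Lemma sqE_lower_sqr a r : sqV2 a r / 2 - n%:R * B ^+ 4 / 2 <= sqE p v n a r.
Proof.
have te e := tame_lik_avg_sqr Fn wn (snr a r)
  (fun t => v (tnth t (val e).1) * v (tnth t (val e).2)).
rewrite /sqE; under eq_bigr do rewrite sqmE//.
rewrite -EG_sum; last exact: te.
have -> : sqV2 a r / 2 - n%:R * B ^+ 4 / 2 = EG (fun y =>
    2^-1 * (L a r y * (\sum_i avg (Q a r y) (V^~ i) ^+ 2) ^+ 2) + (- (n%:R * B ^+ 4 / 2)) * L a r y).
  rewrite EGD; last 2 first.
  - exact: tameZ.
  - by apply: tameZ; exact: tame_lik.
  by rewrite !EGZ// ?EG_lik// ?mulr1 1?mulrC//; exact: tame_lik.
apply: le_EG.
- by apply: tameD; [exact: tameZ|apply: tameZ; exact: tame_lik].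
- by apply: tame_sum => e; exact: te.
move=> y; have L0 : 0 <= L a r y by apply/ltW; exact: lik_gt0.
set M := \sum_i _ ^+ 2.
have q1 : weights (Q a r y) by exact: post_weights.
have := pair_moments_ge M q1 B0 (fun t i => vB (tnth t i) : `|V t i| <= B).
rewrite -/M => /(ler_wpM2l L0); rewrite [leRHS]mulr_sumr; apply: le_trans.
rewrite le_eqVlt; apply/orP; left; apply/eqP; move: (L a r y) M {q1 L0} => a' b.
by field.
Qed.

Lemma sqV_le a r : sqV p v n a r <= n%:R * B ^+ 2.
Proof.
rewrite /sqV; under eq_bigr do rewrite sqmE//.
apply: (@le_trans _ _ (\sum_(i < n) B ^+ 2)); last first.
  by rewrite sumr_const card_ord mulr_natl.
apply: ler_sum => i _.
rewrite -[leRHS]mulr1 -(EG_lik (obs Fn (snr a r)) wn) -EGZ; last exact: tame_lik.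
apply: le_EG; first exact: tame_lik_avg_sqr.
  by apply: tameZ; exact: tame_lik.
move=> y; rewrite mulrC ler_wpM2r//; first by apply/ltW; exact: lik_gt0.
rewrite -[leLHS]real_normK ?num_real// lerXn2r ?nnegrE//.
by apply: avg_le_bound => //; exact: post_weights.
Qed.

(** [gain_cov] with th = sqrt eta / [cov_cost], which balances its linear and quadratic terms; n eta
    <= 1 keeps the quadratic coefficient below [cov_cost]. *)
Lemma sqV_gain a r eta : 0 <= a -> 0 <= r -> 0 <= eta -> n%:R * eta <= 1 ->
  sqV p v n a r + eta / cov_cost * covN a r <= sqV p v n a (r + eta).
Proof.
move=> a0 r0 eta0 neta.
have c0 := cov_cost_gt0.
pose dl := @snr R n 0 eta.
have dl0 i : 0 <= dl i by exact: snr_ge0.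
have tau0 i : 0 <= @snr R n a r i by exact: snr_ge0.
pose g i y := L a r y * EG (fun y' =>
    (\sum_t Q a r y t * V t i * expo (obs Fn dl t) y') ^+ 2 / lik (Q a r y) (obs Fn dl) y').
have tg i : tame (g i) by exact: (@tame_lik_sqm R _ _ _ Fn wn (snr a r) dl tau0 dl0 (V^~ i)).
have -> : sqV p v n a (r + eta) = EG (fun y => \sum_(i < n) g i y).
  rewrite EG_sum//; apply: eq_bigr => i _.
  have -> : snr a (r + eta) = fun j => snr a r j + dl j by rewrite snrD addr0.
  exact: (@sqm_add R _ _ _ Fn wn (snr a r) dl tau0 dl0 (V^~ i)).
pose h i y := L a r y * avg (Q a r y) (V^~ i) ^+ 2.
have th i : tame (h i) by exact: tame_lik_avg_sqr.
have -> : sqV p v n a r + eta / cov_cost * covN a r =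
    EG (fun y => \sum_(i < n) h i y + eta / cov_cost * (L a r y * cov2 (Q a r y) V)).
  rewrite EGD; last 2 first.
  - exact: tame_sum.
  - exact: tameZ.
  by rewrite EGZ// EG_sum//; congr (_ + _); apply: eq_bigr => i _; rewrite sqmE.
apply: le_EG.
- by apply: tameD; [exact: tame_sum|exact: tameZ].
- exact: tame_sum.
move=> y; have L0 : 0 <= L a r y by apply/ltW; exact: lik_gt0.
have q1 : weights (Q a r y) by exact: post_weights.
rewrite /h /g -!mulr_sumr mulrCA -mulrDr; apply: (ler_wpM2l L0).
rewrite [leRHS](_ : _ = \sum_(i < n) EG (fun y' =>
    (\sum_t Q a r y t * V t i * expo (fun j => Num.sqrt eta * V t j) y') ^+ 2 /
    lik (Q a r y) (fun t j => Num.sqrt eta * V t j) y')); last first.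
  apply: eq_bigr => i _.
  apply: (@EG_sqr_transport R _ _ _ _ id inr (Q a r y) (Q a r y) _ _ (V^~ i)) => //.
  - by move=> ? ? [].
  - move=> t [e|j]; first by rewrite /obs /= sqrtr0 mul0r.
    by rewrite codom_f.
have := @gain_cov R _ _ (Q a r y) V B q1 B0 (fun t i => vB _) eta (Num.sqrt eta / cov_cost) eta0.
apply: le_trans; rewrite -addrA lerD2l -mulrBl ler_wpM2r//.
  exact: (cov2_ge0 (Q a r y) V).
rewrite card_ord -[8 * expR _](addrK (4 * B ^+ 2)) [8 * _ + _]addrC -/cov_cost.
move: (cov_cost) c0 => c c0.
rewrite expr_div_n sqr_sqrtr//.
rewrite [2 * _ * _](_ : _ = 2 * eta / c); last first.
  by rewrite -[in RHS](sqr_sqrtr eta0); ring.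
rewrite [leRHS](_ : _ = eta / c + eta * (4 * B ^+ 2) * (1 - n%:R * eta) / c ^+ 2).
  by rewrite lerDl divr_ge0 ?exprn_ge0 ?(ltW c0)// !mulr_ge0// subr_ge0.
by field; rewrite gt_eqF.
Qed.

End one_size.


Section one_snr.
Variables (lambda S : R).
Hypotheses (l0 : 0 < lambda)
  (HS : forall g, 0 <= g -> psi p v g <= S + g ^+ 2 / (4 * lambda)).

(** Passing from n + 1 to n spins also raises the pair snr from lambda/(n+1) to lambda/n. By
    convexity and [sqE_lower_sqr] this gain cancels the quadratic term of [cavity_step] up to
    O(1/n). The side snr rises as well, which only helps. *)
Lemma cavity_step_full n (k : nat) (e : R) : (0 < n)%N -> 0 < e ->
  PhiN p v n.+1 (lambda / n.+1%:R) (k%:R / n.+1%:R) <=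
  PhiN p v n (lambda / n%:R) (k%:R / n%:R) +
  (S + lambda * B ^+ 2 * (1 + B ^+ 2) * e) + (k%:R / 2 + lambda / 4) * B ^+ 4 / n.+1%:R +
  cavity_cost lambda e / n%:R ^+ 2 * covN n (lambda / n.+1%:R) (k%:R / n.+1%:R).
Proof.
move=> n0 e0; have nR : 0 < n%:R :> R by rewrite ltr0n.
have nR1 : 0 < n%:R + 1 :> R by rewrite addr_gt0.
have nE : n.+1%:R = n%:R + 1 :> R by rewrite natr1.
rewrite nE.
have r0 : 0 <= k%:R / (n%:R + 1) :> R by rewrite divr_ge0// ltW.
have s0 : 0 <= lambda / (n%:R + 1) by rewrite divr_ge0// ltW.
have := cavity_step l0 r0 HS n0 e0; rewrite nE.
have h0 : 0 <= lambda / (n%:R + 1) / n%:R by rewrite divr_ge0.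
have h1 : 0 <= k%:R / (n%:R + 1) / n%:R :> R by rewrite divr_ge0.
have H1 := sqE_lower_sqr n (lambda / (n%:R + 1)) (k%:R / (n%:R + 1)).
have H2 := PhiN_edges_lower v pp n s0 r0 h0.
have H3 := PhiN_mono_side v pp n (addr_ge0 s0 h0) r0 h1.
have E1 : lambda / (n%:R + 1) + lambda / (n%:R + 1) / n%:R = lambda / n%:R.
  by field; rewrite !gt_eqF.
have E2 : k%:R / (n%:R + 1) + k%:R / (n%:R + 1) / n%:R = k%:R / n%:R :> R.
  by field; rewrite !gt_eqF.
rewrite E1 in H2 H3; rewrite E2 in H3.
have H4 : lambda / (n%:R + 1) / (4 * n%:R) * sqV2 n (lambda / (n%:R + 1)) (k%:R / (n%:R + 1)) -
    lambda / 4 * B ^+ 4 / (n%:R + 1) <= lambda / (n%:R + 1) / n%:R / 2 *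
    sqE p v n (lambda / (n%:R + 1)) (k%:R / (n%:R + 1)).
  have h2 : 0 <= lambda / (n%:R + 1) / n%:R / 2 by rewrite divr_ge0.
  apply: le_trans (ler_wpM2l h2 H1); rewrite le_eqVlt.
  apply/orP; left; apply/eqP; move: (sqV2 _ _ _) => x.
  by field; rewrite !gt_eqF.
rewrite [(k%:R / 2 + _) * _ / _](_ : _ = k%:R / (n%:R + 1) / 2 * B ^+ 4 +
  lambda / 4 * B ^+ 4 / (n%:R + 1)); last by field; rewrite gt_eqF.
move: H2 H3 H4 {H1 E1 E2 h0 h1 r0 s0}.
move: (cavity_cost _ _ / _ * _) (_ * sqV2 _ _ _) (_ * sqE _ _ _ _ _) => x1 x2 x3.
move: (PhiN _ _ _ _ _) (PhiN _ _ _ _ _) (PhiN _ _ _ _ _) (PhiN _ _ _ _ _) => y1 y2 y3 y4.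
move: (lambda / 4 * B ^+ 4 / _) (k%:R / (n%:R + 1) / 2 * _) (lambda * B ^+ 2 * _ * e) => z1 z2 z3.
by clear; lra.
Qed.

(** A telescoping sum: each covariance is at most a multiple of the increment of [sqV] when the side
    snr grows by 1/(n+1), and [sqV] stays between 0 and n B^2. The bound does not depend on K. *)
Lemma cov_sum n K : \sum_(k < K) covN n (lambda / n.+1%:R) (k%:R / n.+1%:R) <=
  cov_cost * n.+1%:R * (n%:R * B ^+ 2).
Proof.
have nR1 : 0 < n.+1%:R :> R by rewrite ltr0n.
have c0 := cov_cost_gt0.
have s0 : 0 <= lambda / n.+1%:R by rewrite divr_ge0// ltW.
have eta0 : 0 <= n.+1%:R^-1 :> R by rewrite invr_ge0.
set s := lambda / _ in s0 *; pose u k := sqV p v n s (k%:R / n.+1%:R).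
have H k : n.+1%:R^-1 / cov_cost * covN n s (k%:R / n.+1%:R) <= u k.+1 - u k.
  rewrite lerBrDl /u -[k.+1%:R]natr1 mulrDl mul1r; apply: sqV_gain => //.
  by rewrite ler_pdivrMr// mul1r ler_nat.
have : n.+1%:R^-1 / cov_cost * \sum_(k < K) covN n s (k%:R / n.+1%:R) <= n%:R * B ^+ 2.
  rewrite mulr_sumr; apply: (@le_trans _ _ (\sum_(k < K) (u k.+1 - u k))).
    by apply: ler_sum => k _; exact: H.
  rewrite -(big_mkord xpredT (fun k => u k.+1 - u k)) telescope_sumr//.
  rewrite lerBlDr; apply: le_trans (sqV_le _ _ _) _; rewrite lerDl.
  apply: sumr_ge0 => i _; apply: EG_ge0 => y.
  by rewrite divr_ge0 ?sqr_ge0// ltW// lik_gt0//; exact: ptup_weights.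
rewrite -invfM mulrC ler_pdivrMr ?mulr_gt0//.
by rewrite [n.+1%:R * _]mulrC [leRHS]mulrC.
Qed.

(** The sum T of the free energies at K side levels grows by at most K (S + e') when a spin is
    added, since the K covariance errors have a bounded sum and K is large. The unperturbed free
    energy is the smallest of the K terms, hence at most T/K. *)
Lemma cavity_limit (e : R) : 0 < e ->
  exists N, forall n, (N <= n)%N -> PhiN p v n (lambda / n%:R) 0 <= n%:R * (S + e).
Proof.
move=> e0.
have S0 : 0 <= S.
  have := HS (lexx 0); rewrite expr0n/= mul0r addr0; apply: le_trans.
  apply: le_trans (ent_lower _ pp).
  by apply: sumr_ge0 => i _; rewrite divr_ge0 ?sqr_ge0.
pose c1 := lambda * B ^+ 2 * (1 + B ^+ 2).
have c1_0 : 0 <= c1 by rewrite !mulr_ge0 ?sqr_ge0 ?(ltW l0)// addr_ge0 ?sqr_ge0.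
have c3 : 0 < c1 + 3 by rewrite ltr_wpDl.
(* The overlap fluctuation costs c1 ep; one further ep each pays for the O(1/n) term, for the
   covariances averaged over the K levels, and for the initial value of T. *)
pose ep := e / (c1 + 3); have ep0 : 0 < ep by rewrite divr_gt0.
pose c2 := cavity_cost lambda ep * cov_cost * (2 * B ^+ 2).
have [K0 HK] := archimedean_mul c2 ep0.
pose K := K0.+1; have KR : 0 < K%:R :> R by rewrite ltr0n.
have {}HK : c2 <= K%:R * ep by exact: HK.
have [n0 Hn0] := archimedean_mul ((K%:R / 2 + lambda / 4) * B ^+ 4) ep0.
pose T n := \sum_(k < K) PhiN p v n (lambda / n%:R) (k%:R / n%:R).
pose e' := (c1 + 2) * ep.
have step n : (n0.+1 <= n)%N -> T n.+1 <= T n + K%:R * (S + e').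
  move=> nn0; have nR : 0 < n%:R :> R by rewrite ltr0n; case: (n) nn0.
  have nR1 : 0 < n.+1%:R :> R by rewrite ltr0n.
  have n1 : (0 < n)%N by case: (n) nn0.
  pose D := S + c1 * ep + (K%:R / 2 + lambda / 4) * B ^+ 4 / n.+1%:R.
  apply: (@le_trans _ _ (\sum_(k < K) (PhiN p v n (lambda / n%:R) (k%:R / n%:R) + D +
    cavity_cost lambda ep / n%:R ^+ 2 * covN n (lambda / n.+1%:R) (k%:R / n.+1%:R)))).
    apply: ler_sum => k _; apply: (le_trans (cavity_step_full k n1 ep0)).
    rewrite lerD2r /D -/c1 [leRHS]addrA.
    rewrite lerD2l ler_wpM2r ?invr_ge0// ler_wpM2r ?exprn_ge0// lerD2r ler_wpM2r//.
    by rewrite ler_nat ltnW.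
  rewrite big_split big_split/= -/(T n) -mulr_sumr sumr_const card_ord -addrA lerD2l.
  have H1 := cov_sum n K.
  have cc0 : 0 <= cavity_cost lambda ep / n%:R ^+ 2.
    by rewrite divr_ge0 ?exprn_ge0 ?cavity_cost_ge0// ltW.
  have H2 := ler_wpM2l cc0 H1.
  have H3 : cavity_cost lambda ep / n%:R ^+ 2 * (cov_cost * n.+1%:R * (n%:R * B ^+ 2)) <= c2.
    rewrite [leLHS](_ : _ = cavity_cost lambda ep * cov_cost * (n.+1%:R / n%:R * B ^+ 2)).
      rewrite ler_wpM2l//.
        rewrite mulr_ge0 ?cavity_cost_ge0 ?(ltW l0) ?(ltW ep0)//.
        exact/ltW/cov_cost_gt0.
      rewrite ler_wpM2r ?sqr_ge0// ler_pdivrMr// -natr1 mulrDl mul1r lerD2l.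
      by rewrite ler1n.
    by field; rewrite gt_eqF.
  have H4 : (K%:R / 2 + lambda / 4) * B ^+ 4 / n.+1%:R <= ep.
    by rewrite ler_pdivrMr// [leRHS]mulrC; apply: Hn0; rewrite leqW// ltnW.
  have H5 : K%:R * D <= K%:R * (S + c1 * ep + ep) by rewrite ler_wpM2l// lerD2l.
  apply: (@le_trans _ _ (K%:R * D + c2)).
    by rewrite mulr_natl lerD2l; exact: le_trans H3.
  apply: (@le_trans _ _ (K%:R * (S + c1 * ep + ep) + K%:R * ep)); first exact: lerD.
  by rewrite -mulrDr le_eqVlt; apply/orP; left; apply/eqP; rewrite /e'; ring.
(* Side information can only increase the free energy. *)
have T_ge n : K%:R * PhiN p v n (lambda / n%:R) 0 <= T n.
  rewrite mulr_natl -[X in _ *+ X]card_ord -sumr_const; apply: ler_sum => k _.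
  rewrite -[X in _ <= PhiN _ _ _ _ X]add0r; apply: (PhiN_mono_side v pp) => //.
  by rewrite divr_ge0// ltW.
have {step}T_le m : T (n0.+1 + m)%N <= T n0.+1 + m%:R * (K%:R * (S + e')).
  elim: m => [|m IHm]; first by rewrite addn0 mul0r addr0.
  rewrite addnS; apply: le_trans (step _ (leq_addr _ _)) _.
  by rewrite -natr1 mulrDl mul1r addrA lerD2r.
have [N1 HN1] := archimedean_mul (T n0.+1 / K%:R) ep0.
exists (n0.+1 + N1)%N => n nN.
have n0n : (n0.+1 <= n)%N by rewrite (leq_trans _ nN)// leq_addr.
have N1n : (N1 <= n)%N by rewrite (leq_trans _ nN)// leq_addl.
rewrite -(@ler_pM2l _ K%:R)//; apply: (le_trans (T_ge n)).
rewrite -(subnKC n0n); apply: (le_trans (T_le _)); rewrite (subnKC n0n).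
have H1 : T n0.+1 <= K%:R * (n%:R * ep).
  by rewrite mulrC -ler_pdivrMr// HN1.
have H2 : (n - n0.+1)%:R * (K%:R * (S + e')) <= n%:R * (K%:R * (S + e')).
  by rewrite ler_wpM2r ?ler_nat ?leq_subr// mulr_ge0// addr_ge0// mulr_ge0 ?addr_ge0 ?(ltW ep0).
apply: (le_trans (lerD H1 H2)).
rewrite [leRHS](_ : _ = K%:R * (n%:R * ep) + n%:R * (K%:R * (S + e')))//.
by rewrite /e' /ep; field; rewrite gt_eqF.
Qed.

End one_snr.

End cavity.

(** * Stability of relative entropy under perturbation of the signal *)

Section comparison.
Context {R : realType}.

Lemma ent_le_energy (W I : finType) (w : W -> R) (f : W -> I -> R) : weights w ->
  ent w f <= avg w (fun x => \sum_i f x i ^+ 2 / 2).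
Proof.
move=> ww; have [w0 _] := ww.
have -> : avg w (fun x => \sum_i f x i ^+ 2 / 2) =
    EG (fun y => \sum_x w x * (expo (f x) y * ln (expo (f x) y))).
  rewrite EG_sum; last first.
    move=> x; apply: tameZ; apply: tameM; first exact: tame_expo.
    by apply: tame_ln; [exact: expo_gt0|exact: tame_expo|exact: tame_expo_inv].
  apply: eq_bigr => x _; rewrite EGZ ?EG_expo_ln//.
  apply: tameM; first exact: tame_expo.
  by apply: tame_ln; [exact: expo_gt0|exact: tame_expo|exact: tame_expo_inv].
apply: le_EG.
- exact: tame_xlnx_lik.
- apply: tame_sum => x; apply: tameZ; apply: tameM; first exact: tame_expo.
  by apply: tame_ln; [exact: expo_gt0|exact: tame_expo|exact: tame_expo_inv].
move=> y; have L0 := lik_gt0 f ww y.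
have H x : w x * (expo (f x) y * ln (lik w f y) + expo (f x) y - lik w f y) <=
    w x * (expo (f x) y * ln (expo (f x) y)).
  by rewrite ler_wpM2l// gibbs_lower// expo_gt0.
apply: le_trans (ler_sum _ (fun x _ => H x)).
rewrite -/(avg w (fun x => expo (f x) y * ln (lik w f y) + expo (f x) y - lik w f y)).
rewrite avgB avgD avgZr weights_avg_cst// -/(lik w f y) addrK.
by rewrite /xlnx.
Qed.

Lemma avg_expR_ge (W : finType) (w : W -> R) (u : W -> R) : weights w ->
  expR (avg w u) <= avg w (fun x => expR (u x)).
Proof.
move=> ww; have [w0 _] := ww; set c := avg w u.
apply: (@le_trans _ _ (avg w (fun x => expR c * (1 - c + u x)))).
  by rewrite avgZ avgD weights_avg_cst// -/c subrK mulr1.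
apply: le_avg => // x; rewrite -[u x in leRHS](subrK c) expRD mulrC ler_wpM2r ?expR_ge0//.
by have := expR_ge1Dx (u x - c); rewrite addrA addrAC.
Qed.

Section lower_bound.
Variables (W I : finType) (w : W -> R) (F : W -> I -> R) (tau : I -> R).
Hypothesis ww : weights w.

Let f' := obs F tau.
Let m y i := avg (post w F tau y) (fun x => f' x i).

(** The log-likelihood is convex and its gradient is the posterior mean of the signal; the
    inequality is Jensen's for the posterior. *)
Lemma ln_lik_shift (a b : I -> R) y :
  \sum_i (a i - b i) * m (yshift b y) i <=
  ln (lik w f' (yshift a y)) - ln (lik w f' (yshift b y)).
Proof.
set z := yshift b y; have pz := post_weights F ww tau z.
have -> : lik w f' (yshift a y) = lik w f' z *
    avg (post w F tau z) (fun x => expR (\sum_i (a i - b i) * f' x i)).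
  rewrite avg_post mulrCA divff ?mulr1 ?gt_eqF ?lik_gt0//.
  apply: eq_bigr => x _; rewrite -mulrA; congr (_ * _).
  rewrite /expo -expRD -big_split/=; congr expR; apply: eq_bigr => i _.
  by rewrite /z /yshift !co_mk -/f'; ring.
have L0 : 0 < lik w f' z by exact: lik_gt0.
rewrite lnM ?posrE//; last first.
  apply: lt_le_trans (avg_expR_ge _ pz); exact: expR_gt0.
rewrite addrAC subrr add0r.
rewrite [leLHS](_ : _ = avg (post w F tau z) (fun x => \sum_i (a i - b i) * f' x i)).
  rewrite -[leLHS]expRK ler_ln ?posrE ?expR_gt0//.
    exact: avg_expR_ge.
  by apply: lt_le_trans (avg_expR_ge _ pz); exact: expR_gt0.
by rewrite avg_sum; apply: eq_bigr => i _; rewrite avgZ.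
Qed.

(** Gibbs' inequality bounds the entropy for f below by the mean of the log-likelihood built with
    f'. The remaining difference of shifts is estimated by [ln_lik_shift] and Young's inequality
    with parameter t, the posterior means being bounded in mean square by the energy. *)
Lemma ent_diff (f : W -> I -> R) (t : R) : 0 < t ->
  ent w f' - ent w f <= t / 2 * avg w (fun x => \sum_i f' x i ^+ 2) +
    (2 * t)^-1 * avg w (fun x => \sum_i (f' x i - f x i) ^+ 2).
Proof.
move=> t0; have [w0 _] := ww.
have tl : tame (fun y => ln (lik w f' y)) by exact: tame_ln_lik.
have gibbs : avg w (fun x => EG (fun y => ln (lik w f' (yshift (f x) y)))) <= ent w f.
  have -> : avg w (fun x => EG (fun y => ln (lik w f' (yshift (f x) y)))) =
     EG (fun y => lik w f y * ln (lik w f' y)).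
    rewrite EG_likM//; apply: eq_bigr => x _; congr (_ * _).
    exact: (@EG_shift R I (f x) (fun y => ln (lik w f' y))).
  have -> : EG (fun y => lik w f y * ln (lik w f' y)) =
     EG (fun y => lik w f y * ln (lik w f' y) + lik w f y - lik w f' y).
    have tll : tame (fun y => lik w f y * ln (lik w f' y)).
      by apply: tameM => //; exact: tame_lik.
    rewrite EGB; last 2 first.
    - by apply: tameD => //; exact: tame_lik.
    - exact: tame_lik.
    rewrite EGD//; last exact: tame_lik.
    by rewrite !EG_lik// addrK.
  apply: le_EG.
  - apply: tameB; last exact: tame_lik.
    by apply: tameD; [apply: tameM => //|]; exact: tame_lik.
  - exact: tame_xlnx_lik.
  - by move=> y; apply: gibbs_lower; exact: lik_gt0.
have entE : ent w f' = avg w (fun x => EG (fun y => ln (lik w f' (yshift (f' x) y)))).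
  rewrite /ent (_ : (fun y => xlnx _) = fun y => lik w f' y * ln (lik w f' y))//.
  rewrite EG_likM//; apply: eq_bigr => x _; congr (_ * _).
  by rewrite (@EG_shift R I (f' x) (fun y => ln (lik w f' y))).
pose M y := \sum_i m y i ^+ 2.
have tM : tame M.
  by apply: tame_sum => i; apply: tameX; exact: tame_avg_post.
have MB : avg w (fun x => EG (fun y => M (yshift (f' x) y))) <=
    avg w (fun x => \sum_i f' x i ^+ 2).
  have -> : avg w (fun x => EG (fun y => M (yshift (f' x) y))) = EG (fun y => lik w f' y * M y).
    rewrite EG_likM//; apply: eq_bigr => x _; congr (_ * _).
    exact: (@EG_shift R I (f' x) M).
  rewrite -(EG_lik_avg F ww tau).
  apply: le_EG.
  - by apply: tameM => //; exact: tame_lik.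
  - by apply: tameM; [exact: tame_lik|exact: tame_avg_post].
  move=> y; apply: ler_wpM2l; first by apply/ltW; exact: lik_gt0.
  rewrite avg_sum; apply: ler_sum => i _; apply: avg_sqr_le; exact: post_weights.
apply: le_trans (lerB (lexx _) gibbs) _; rewrite entE -avgB.
apply: (@le_trans _ _ (avg w (fun x => t / 2 * EG (fun y => M (yshift (f' x) y)) +
   (2 * t)^-1 * \sum_i (f' x i - f x i) ^+ 2))); last first.
  by rewrite avgD !avgZ lerD2r ler_wpM2l// divr_ge0// ltW.
apply: le_avg => // x.
have ts b : tame (fun y => ln (lik w f' (yshift b y))) by exact: (@tame_shift R I b _ tl).
have tMs b : tame (fun y => M (yshift b y)) by exact: (@tame_shift R I b _ tM).
set D := _^-1 * _.
have -> : t / 2 * EG (fun y => M (yshift (f' x) y)) + D =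
    EG (fun y => t / 2 * M (yshift (f' x) y) + D).
  by rewrite EGD ?EG_cst ?EGZ//; [exact: tameZ|exact: tame_cst].
rewrite -EGB//; apply: le_EG.
- exact: tameB.
- by apply: tameD; [exact: tameZ|exact: tame_cst].
move=> y; have H := ln_lik_shift (f x) (f' x) y.
have : - \sum_i (f x i - f' x i) * m (yshift (f' x) y) i <=
    t / 2 * M (yshift (f' x) y) + (2 * t)^-1 * \sum_i (f' x i - f x i) ^+ 2.
  rewrite -sumrN !mulr_sumr -big_split/=; apply: ler_sum => i _.
  move: (f x i) (f' x i) (m _ _) => a b c.
  rewrite -subr_ge0 (_ : _ - _ = (t * c - (b - a)) ^+ 2 / (2 * t)).
    by rewrite divr_ge0 ?sqr_ge0// mulr_ge0// ltW.
  by field; rewrite gt_eqF.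
by apply: le_trans; rewrite lerNr opprB.
Qed.

End lower_bound.

Lemma ent_compare (W I : finType) (w : W -> R) (f f' : W -> I -> R) (t C : R) :
  weights w -> 0 < t ->
  avg w (fun x => \sum_i f x i ^+ 2) <= C -> avg w (fun x => \sum_i f' x i ^+ 2) <= C ->
  `|ent w f' - ent w f| <= t / 2 * C +
    (2 * t)^-1 * avg w (fun x => \sum_i (f' x i - f x i) ^+ 2).
Proof.
move=> ww t0 fC fC'.
(* Unit snr makes an arbitrary signal an instance of [obs], so that the lemmas on posteriors
   apply. *)
have obs1 (g : W -> I -> R) : obs g (fun=> 1) = g.
  by apply/funext => x; apply/funext => i; rewrite /obs sqrtr1 mul1r.
apply/ler_normlP; split; rewrite ?opprB.
  have := ent_diff f (fun=> 1) ww f' t0; rewrite obs1 => /le_trans; apply.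
  rewrite lerD ?ler_wpM2l ?divr_ge0 ?invr_ge0 ?mulr_ge0 ?(ltW t0)//.
  apply: le_avg; first by case: ww.
  by move=> x; apply: ler_sum => i _; rewrite -sqrrN opprB.
have := ent_diff f' (fun=> 1) ww f t0; rewrite obs1 => /le_trans; apply.
by rewrite lerD2r ler_wpM2l// divr_ge0// ltW.
Qed.

End comparison.

(** * Mean-square comparison of spin models and of scalar channels *)

Section product_prior.
Context {R : realType}.

Lemma sum_ptup_prod (A : finType) n (h : 'I_n -> A -> R) :
  \sum_(t : n.-tuple A) \prod_i h i (tnth t i) = \prod_i \sum_a h i a.
Proof.
elim: n h => [|n IHn] h.
  rewrite big_ord0 (eq_bigr (fun=> 1)); last by move=> t _; rewrite big_ord0.
  by rewrite sumr_const card_tuple expn0.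
rewrite sum_tupleS big_ord_recl mulr_suml; apply: eq_bigr => a _.
rewrite -(IHn (fun i => h (lift ord0 i))) mulr_sumr; apply: eq_bigr => t _.
rewrite big_ord_recl/= tnth0; congr (_ * _); apply: eq_bigr => i _.
by rewrite tnthS.
Qed.

Section pairs.
Variables (A : finType) (p : A -> R) (n : nat).
Hypothesis pp : weights p.

Lemma avg_ptup_pair (a b : A -> R) (i j : 'I_n) : i != j ->
  avg (@ptup R A p n) (fun t => a (tnth t i) * b (tnth t j)) = avg p a * avg p b.
Proof.
move=> ij; have ji : j != i by rewrite eq_sym.
pose h k x := p x * (if k == i then a x else if k == j then b x else 1).
transitivity (\sum_(t : n.-tuple A) \prod_k h k (tnth t k)).
  apply: eq_bigr => t _; rewrite big_split/= -/(ptup p t); congr (_ * _).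
  rewrite (bigD1 i)//= (bigD1 j)//= !eqxx (negbTE ji).
  by rewrite big1 ?mulr1// => k /andP[/negbTE -> /negbTE ->].
rewrite sum_ptup_prod (bigD1 i)//= (bigD1 j)//= [X in _ * (_ * X)]big1 ?mulr1; last first.
  move=> k /andP [] /negbTE ki /negbTE kj; rewrite /h ki kj.
  by under eq_bigr do rewrite mulr1; case: pp.
by congr (_ * _); apply: eq_bigr => x _; rewrite /h ?eqxx// (negbTE ji).
Qed.

Definition spin (v : A -> R) (lambda : R) (t : n.-tuple A) (e : edge n) : R :=
  Num.sqrt (lambda / n%:R) * (v (tnth t (val e).1) * v (tnth t (val e).2)).

Lemma PhiN_spin (v : A -> R) lambda :
  PhiN p v n (lambda / n%:R) 0 = ent (@ptup R A p n) (spin v lambda).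
Proof.
apply: (@ent_transport R _ _ _ _ id inl) => //.
- exact: ptup_weights.
- by move=> ? ? [].
- move=> t [i|i]; first by rewrite codom_f.
  by rewrite /obs /= sqrtr0 mul0r.
Qed.

Lemma edge_neq (e : edge n) : (val e).1 != (val e).2.
Proof. by rewrite neq_ltn (valP e). Qed.

Lemma sum_edge_cst_le (c : R) : 0 <= c -> \sum_(e : edge n) c <= n%:R ^+ 2 / 2 * c.
Proof.
move=> c0; rewrite (@sum_edge R n (fun _ _ => c))// !sumr_const !card_ord.
rewrite -mulrnA -[c *+ (_ * _)]mulr_natl natrM mulrBr.
rewrite [leRHS](_ : _ = 2^-1 * (n%:R * n%:R * c)); last by rewrite expr2; ring.
by rewrite lerBlDr lerDl mulr_ge0// mulrn_wge0.
Qed.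

Variables (v v' : A -> R) (lambda d : R).
Hypotheses (l0 : 0 <= lambda) (n0 : (0 < n)%N).

Lemma spin_energy (u : A -> R) : avg p (fun a => u a ^+ 2) <= 1 ->
  avg (@ptup R A p n) (fun t => \sum_e spin u lambda t e ^+ 2) <= n%:R * (lambda / 2).
Proof.
move=> u1; have nR : 0 < n%:R :> R by rewrite ltr0n.
have [p0 _] := pp.
have u0 : 0 <= avg p (fun a => u a ^+ 2).
  by apply: sumr_ge0 => a _; rewrite mulr_ge0 ?sqr_ge0.
rewrite avg_sum; apply: (@le_trans _ _ (\sum_(e : edge n) (lambda / n%:R))).
  apply: ler_sum => e _; rewrite /spin.
  under [X in avg _ X]eq_fun do rewrite exprMn sqr_sqrtr ?divr_ge0// exprMn.
  rewrite avgZ (avg_ptup_pair (fun a => u a ^+ 2) (fun a => u a ^+ 2) (edge_neq e)).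
  by rewrite ler_piMr ?divr_ge0// mulr_ile1.
apply: (le_trans (sum_edge_cst_le _)); first by rewrite divr_ge0.
by rewrite le_eqVlt; apply/orP; left; apply/eqP; field; rewrite gt_eqF.
Qed.

(** Energy and squared distance are both of order n: there are about n^2/2 pairs of snr lambda/n,
    and a difference of products is controlled by independence and unit second moments. The error
    per spin is thus uniform in n. *)
Lemma spin_compare (t : R) : 0 < t ->
  avg p (fun a => v a ^+ 2) <= 1 -> avg p (fun a => v' a ^+ 2) <= 1 ->
  `|ent (@ptup R A p n) (spin v' lambda) - ent (@ptup R A p n) (spin v lambda)| <=
  n%:R * (lambda * (t / 4 + avg p (fun a => (v' a - v a) ^+ 2) / t)).
Proof.
move=> t0 v1 v1'; have nR : 0 < n%:R :> R by rewrite ltr0n.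
have [p0 _] := pp; have [pt0 _] := ptup_weights n pp.
apply: (le_trans (ent_compare (ptup_weights n pp) t0 (spin_energy v1) (spin_energy v1'))).
set D := avg p (fun a => (v' a - v a) ^+ 2).
have D0 : 0 <= D by apply: sumr_ge0 => a _; rewrite mulr_ge0 ?sqr_ge0.
have H : avg (@ptup R A p n) (fun x => \sum_e (spin v' lambda x e - spin v lambda x e) ^+ 2) <=
    n%:R ^+ 2 / 2 * (lambda / n%:R * (4 * D)).
  rewrite avg_sum; apply: le_trans (sum_edge_cst_le _); last first.
    by rewrite mulr_ge0 ?divr_ge0// mulr_ge0.
  apply: ler_sum => e _; set i := (val e).1; set j := (val e).2.
  have ij : i != j by exact: edge_neq.
  apply: (@le_trans _ _ (avg (@ptup R A p n) (fun x => lambda / n%:R * (2 *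
     ((v' (tnth x i) - v (tnth x i)) ^+ 2 * v' (tnth x j) ^+ 2 +
      v (tnth x i) ^+ 2 * (v' (tnth x j) - v (tnth x j)) ^+ 2))))).
    apply: le_avg => // x; rewrite /spin -mulrBr exprMn sqr_sqrtr ?divr_ge0//.
    apply: ler_wpM2l; first by rewrite divr_ge0.
    rewrite -/i -/j; move: (v (tnth x i)) (v (tnth x j)) (v' (tnth x i)) (v' (tnth x j)) => a b c d'.
    rewrite -subr_ge0 (_ : _ - _ = ((c - a) * d' - a * (d' - b)) ^+ 2) ?sqr_ge0//.
    by ring.
  rewrite !avgZ avgD (avg_ptup_pair (fun a => (v' a - v a) ^+ 2) (fun a => v' a ^+ 2) ij).
  rewrite (avg_ptup_pair (fun a => v a ^+ 2) (fun a => (v' a - v a) ^+ 2) ij) -/D.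
  apply: ler_wpM2l; first by rewrite divr_ge0.
  rewrite (_ : 4 * D = 2 * (D * 1 + 1 * D)); last by ring.
  by apply: ler_wpM2l => //; apply: lerD; [apply: ler_wpM2l|apply: ler_wpM2r].
apply: (@le_trans _ _ (t / 2 * (n%:R * (lambda / 2)) +
    (2 * t)^-1 * (n%:R ^+ 2 / 2 * (lambda / n%:R * (4 * D))))).
  by rewrite lerD2l ler_wpM2l// invr_ge0 mulr_ge0// ltW.
by rewrite le_eqVlt; apply/orP; left; apply/eqP; field; rewrite !gt_eqF.
Qed.

End pairs.

(** The scalar analogue, allowing the snr to move too, with the square-root estimate (sqrt h' - sqrt
    h)^2 <= |h' - h|. *)
Lemma psi_compare (A : finType) (p v v' : A -> R) (h h' t : R) : weights p -> 0 <= h -> 0 <= h' ->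
  0 < t -> avg p (fun a => v a ^+ 2) <= 1 -> avg p (fun a => v' a ^+ 2) <= 1 ->
  `|psi p v' h' - psi p v h| <= t / 2 * Num.max h h' +
    t^-1 * (h * avg p (fun a => (v' a - v a) ^+ 2) + `|h' - h|).
Proof.
move=> pp h0 h0' t0 v1 v1'; have [p0 _] := pp.
have energy (u : A -> R) k : 0 <= k -> k <= Num.max h h' -> avg p (fun a => u a ^+ 2) <= 1 ->
    avg p (fun a => \sum_(i : unit) (Num.sqrt k * u a) ^+ 2) <= Num.max h h'.
  move=> k0 km u1; under [X in avg _ X]eq_fun do rewrite sum_unit exprMn sqr_sqrtr//.
  by rewrite avgZ; apply: le_trans km; rewrite ler_piMr.
apply: (le_trans (ent_compare pp t0 (energy v h h0 _ v1) (energy v' h' h0' _ v1'))).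
- by rewrite le_max lexx.
- by rewrite le_max lexx orbT.
rewrite lerD2l invfM [2^-1 * _]mulrC -mulrA ler_pM2l ?invr_gt0//.
rewrite [leLHS]mulrC ler_pdivrMr//; apply: (@le_trans _ _ (avg p (fun a => 2 * (h * (v' a - v a) ^+ 2) +
    2 * `|h' - h| * v' a ^+ 2))).
  apply: le_avg => // a; rewrite sum_unit.
  have H : (Num.sqrt h' - Num.sqrt h) ^+ 2 <= `|h' - h|.
    wlog hh : h h' h0 h0' {energy} / h <= h'.
      by move=> W; case: (leP h h') => [|/ltW] H; [|rewrite -sqrrN opprB distrC]; exact: W.
    rewrite ger0_norm ?subr_ge0//.
    have := ler_wsqrtr hh; have := sqrtr_ge0 h.
    rewrite -[X in _ -> _ -> _ <= X - _](sqr_sqrtr h0') -[X in _ -> _ -> _ <= _ - X](sqr_sqrtr h0).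
    move: (Num.sqrt h) (Num.sqrt h') => x y x0 xy; nra.
  have -> : Num.sqrt h' * v' a - Num.sqrt h * v a = Num.sqrt h * (v' a - v a) +
    (Num.sqrt h' - Num.sqrt h) * v' a by ring.
  apply: (@le_trans _ _ (2 * (Num.sqrt h * (v' a - v a)) ^+ 2 +
     2 * ((Num.sqrt h' - Num.sqrt h) * v' a) ^+ 2)).
    move: (_ * _) (_ * _) => x y; rewrite -subr_ge0 (_ : _ - _ = (x - y) ^+ 2) ?sqr_ge0//.
    by ring.
  rewrite !exprMn sqr_sqrtr// lerD2l -mulrA ler_wpM2l// ler_wpM2r ?sqr_ge0//.
by rewrite avgD !avgZ [leRHS]mulrC mulrDr lerD2l ler_piMr// mulr_ge0.
Qed.

Lemma psi_le (A : finType) (p v : A -> R) h : weights p -> 0 <= h ->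
  avg p (fun a => v a ^+ 2) <= 1 -> psi p v h <= h / 2.
Proof.
move=> pp h0 v1; apply: (le_trans (ent_le_energy _ pp)).
under [X in avg _ X]eq_fun do rewrite sum_unit exprMn sqr_sqrtr// mulrAC.
by rewrite avgZ ler_piMr// divr_ge0.
Qed.

End product_prior.

Lemma cvgr_min {R : realType} (u w : nat -> R) (a b : R) :
  u n @[n --> \oo] --> a -> w n @[n --> \oo] --> b ->
  Num.min (u n) (w n) @[n --> \oo] --> Num.min a b.
Proof.
move=> ua wb; under eq_fun do rewrite minr_absE; rewrite minr_absE.
by apply: cvgMl; apply: cvgB; [exact: cvgD|apply: cvg_norm; exact: cvgB].
Qed.

(** * Convergence theorems for real-valued integrals *)

Section real_integrals.
Context {R : realType} d (T : measurableType d) (mu : probability T R).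
Implicit Types (f g h u : T -> R).

Lemma integrable_bound f g : measurable_fun setT f -> (forall x, `|f x| <= g x) ->
  mu.-integrable setT (EFin \o g) -> mu.-integrable setT (EFin \o f).
Proof.
move=> mf fg; apply: le_integrable => //; first exact/measurable_EFinP.
move=> x _ /=; rewrite lee_fin; apply: le_trans (fg x) _; exact: ler_norm.
Qed.

Lemma integrable_bounded f (c : R) : measurable_fun setT f -> (forall x, `|f x| <= c) ->
  mu.-integrable setT (EFin \o f).
Proof.
move=> mf fc; apply: (integrable_bound (g := cst c)) => //.
by apply: finite_measure_integrable_cst.
Qed.

Lemma integrable_measurable f : mu.-integrable setT (EFin \o f) -> measurable_fun setT f.
Proof. by move=> /measurable_int/measurable_EFinP. Qed.

Lemma integrable_sub f g : mu.-integrable setT (EFin \o f) ->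
  mu.-integrable setT (EFin \o g) -> mu.-integrable setT (EFin \o (fun x => f x - g x)).
Proof.
move=> fi gi; rewrite (_ : EFin \o _ = ((EFin \o f) \- (EFin \o g))%E)//.
exact: integrableB.
Qed.

Lemma integrable_add f g : mu.-integrable setT (EFin \o f) ->
  mu.-integrable setT (EFin \o g) -> mu.-integrable setT (EFin \o (fun x => f x + g x)).
Proof.
move=> fi gi; rewrite (_ : EFin \o _ = ((EFin \o f) \+ (EFin \o g))%E)//.
exact: integrableD.
Qed.

Lemma integrable_scale c f : mu.-integrable setT (EFin \o f) ->
  mu.-integrable setT (EFin \o (fun x => c * f x)).
Proof.
move=> fi; rewrite (_ : EFin \o _ = (fun x => c%:E * (EFin \o f) x)%E)//.
exact: integrableZl.
Qed.

Lemma Rintegral_EFin f : mu.-integrable setT (EFin \o f) ->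
  (\int[mu]_x f x)%:E = (\int[mu]_x (f x)%:E)%E.
Proof. by move=> fi; rewrite /Rintegral fineK//; apply: integrable_fin_num. Qed.

Lemma RintegralP_cst (c : R) : \int[mu]_x c = c.
Proof. by rewrite /Rintegral integral_probability_cst. Qed.

Lemma cvg_Rintegral (f_ : nat -> T -> R) f g : (forall n, measurable_fun setT (f_ n)) ->
  (forall x, f_ ^~ x @ \oo --> f x) -> mu.-integrable setT (EFin \o g) ->
  (forall n x, `|f_ n x| <= g x) ->
  \int[mu]_x f_ n x @[n --> \oo] --> \int[mu]_x f x.
Proof.
move=> mf ff gi fg.
have mf0 : measurable_fun setT f by exact: (measurable_fun_cvg mf (fun x _ => ff x)).
have fi : mu.-integrable setT (EFin \o f).
  apply: (integrable_bound _ _ gi) => // x.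
  by apply: cvgr_to_le (cvg_norm (ff x)) _; near=> n; exact: fg.
rewrite (_ : (fun n => _) = fine \o (fun n => \int[mu]_x (f_ n x)%:E)%E)//.
apply: fine_cvg; rewrite Rintegral_EFin//.
apply: (@dominated_cvg _ _ _ mu setT measurableT (fun n x => (f_ n x)%:E) (EFin \o f)
  (EFin \o g)) => //.
- by move=> n; exact/measurable_EFinP.
- by move=> x _; apply: cvg_EFin; [near=> n|exact: ff].
- by move=> n x _ /=; rewrite lee_fin.
Unshelve. all: by end_near. Qed.

(** Pratt's lemma: the dominating functions may vary provided their integrals converge. F n is cut
    at U0, where ordinary domination applies; the excess is at most U n minus its own cut, whose
    integral tends to 0. *)
Lemma cvg_Rintegral_pratt (F U : nat -> T -> R) F0 U0 :
  (forall n, measurable_fun setT (F n)) -> 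
  (forall n, mu.-integrable setT (EFin \o U n)) -> mu.-integrable setT (EFin \o U0) ->
  (forall n x, 0 <= F n x <= U n x) ->
  (forall x, F ^~ x @ \oo --> F0 x) -> (forall x, U ^~ x @ \oo --> U0 x) ->
  \int[mu]_x U n x @[n --> \oo] --> \int[mu]_x U0 x ->
  \int[mu]_x F n x @[n --> \oo] --> \int[mu]_x F0 x.
Proof.
move=> mF Ui U0i FU FF UU IU.
have mU n := integrable_measurable (Ui n).
have mU0 := integrable_measurable U0i.
have F00 x : 0 <= F0 x.
  by apply: cvgr_to_ge (FF x) _; near=> n; case/andP: (FU n x).
have FU0 x : F0 x <= U0 x.
  by apply: ler_cvg_to (FF x) (UU x) _; near=> n; case/andP: (FU n x).
have U00 x : 0 <= U0 x by apply: le_trans (FU0 x).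
pose mn (G : nat -> T -> R) n x := Num.min (G n x) (U0 x).
have mmn G n : (forall n, measurable_fun setT (G n)) -> measurable_fun setT (mn G n).
  by move=> mG; apply: measurable_minr.
have mnb G n x : 0 <= G n x -> `|mn G n x| <= U0 x.
  move=> G0; rewrite ger0_norm; first by rewrite /mn ge_min lexx orbT.
  by rewrite /mn le_min G0 U00.
have F0n n x : 0 <= F n x by case/andP: (FU n x).
have U0n n x : 0 <= U n x by case/andP: (FU n x) => ? ?; apply: le_trans (F0n n x) _.
have Fi n : mu.-integrable setT (EFin \o F n).
  apply: (integrable_bound (mF n) _ (Ui n)) => x.
  by rewrite ger0_norm//; case/andP: (FU n x).
have mFi n : mu.-integrable setT (EFin \o mn F n).
  by apply: (integrable_bound (mmn F n mF) _ U0i) => x; apply: mnb.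
have mUi n : mu.-integrable setT (EFin \o mn U n).
  by apply: (integrable_bound (mmn U n mU) _ U0i) => x; apply: mnb.
have cF : \int[mu]_x mn F n x @[n --> \oo] --> \int[mu]_x F0 x.
  apply: (cvg_Rintegral (fun n => mmn F n mF) _ U0i) => [x|n x]; last exact: mnb.
  by rewrite -(min_l (FU0 x)); apply: cvgr_min; [exact: FF|exact: cvg_cst].
have cU : \int[mu]_x mn U n x @[n --> \oo] --> \int[mu]_x U0 x.
  apply: (cvg_Rintegral (fun n => mmn U n mU) _ U0i) => [x|n x]; last exact: mnb.
  suff : mn U n x @[n --> \oo] --> Num.min (U0 x) (U0 x) by rewrite minxx.
  by apply: cvgr_min; [exact: UU|exact: cvg_cst].
have cD : \int[mu]_x U n x - \int[mu]_x mn U n x @[n --> \oo] --> 0.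
  by rewrite -(subrr (\int[mu]_x U0 x)); apply: cvgB.
rewrite -[X in _ --> X]addr0 (_ : (fun n => _) = (fun n => \int[mu]_x mn F n x) \+
    (fun n => \int[mu]_x F n x - \int[mu]_x mn F n x)); last first.
  by apply/funext => n /=; rewrite addrC subrK.
apply: cvgD cF _; apply: (squeeze_cvgr _ _ cD); last exact: cvg_cst.
near=> n; apply/andP; split.
  rewrite subr_ge0; apply: le_Rintegral => // x _.
  by rewrite /mn ge_min lexx.
rewrite -RintegralB// -RintegralB//; apply: le_Rintegral => //.
- exact: integrable_sub.
- exact: integrable_sub.
move=> x _; rewrite /mn; case/andP: (FU n x) => _ H.
by rewrite /Num.min; case: ltP => h1; case: ltP => h2; move: H h1 h2; lra.
Unshelve. all: by end_near. Qed.

End real_integrals.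

Lemma Rtonelli {R : realType} d d' (T : measurableType d) (T' : measurableType d')
  (mu : probability T R) (nu : probability T' R) (f : T * T' -> R) (g : T -> R) :
  measurable_fun setT f -> (forall z, 0 <= f z) ->
  (forall x, nu.-integrable setT (fun y => (f (x, y))%:E)) ->
  (forall y, mu.-integrable setT (fun x => (f (x, y))%:E)) ->
  (forall x, \int[nu]_y f (x, y) = g x) -> mu.-integrable setT (EFin \o g) ->
  nu.-integrable setT (EFin \o (fun y => \int[mu]_x f (x, y))) /\
  \int[nu]_y \int[mu]_x f (x, y) = \int[mu]_x g x.
Proof.
move=> mf f0 fi1 fi2 fg gi.
have mfE : measurable_fun setT (EFin \o f) by exact/measurable_EFinP.
have E : (\int[nu]_y (\int[mu]_x f (x, y))%:E = \int[mu]_x (g x)%:E)%E.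
  have fE0 z : (0 <= (EFin \o f) z)%E by rewrite lee_fin.
  have := @fubini_tonelli _ _ T T' R mu nu (EFin \o f) mfE fE0.
  have -> : (\int[mu]_x \int[nu]_y (EFin \o f) (x, y) = \int[mu]_x (g x)%:E)%E.
    apply: eq_integral => x _; rewrite -fg.
    exact: esym (Rintegral_EFin (f := fun y => f (x, y)) (fi1 x)).
  move=> ->; apply: eq_integral => y _.
  exact: (Rintegral_EFin (f := fun x => f (x, y)) (fi2 y)).
have m1 : measurable_fun setT (fun y => \int[mu]_x f (x, y)).
  apply: (@measurable_Rintegral_section _ _ T' T R mu (fun z => f (z.2, z.1))).
  by apply: measurableT_comp => //; exact: measurable_swap.
have I : nu.-integrable setT (EFin \o (fun y => \int[mu]_x f (x, y))).
  apply/integrableP; split; first exact/measurable_EFinP.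
  rewrite (eq_integral (fun y => (\int[mu]_x f (x, y))%:E)); last first.
    by move=> y _ /=; rewrite ger0_norm// Rintegral_ge0.
  by rewrite E -Rintegral_EFin// ltry.
split => //; apply/EFin_inj.
by rewrite !Rintegral_EFin.
Qed.

(** * Relative entropies and posterior means for an arbitrary prior *)

Section general_prior.
Context {R : realType} d (T : measurableType d) (mu : probability T R) (I : finType).
Implicit Types (f : T -> I -> R) (h : T -> R) (y : #|I|.-tuple R) (t : R).

(** Has the same noise integral as t ln t when t is a probability density, but is nonnegative, which
    Tonelli and Pratt's lemma require. *)
Definition relent t : R := t * ln t - t + 1.

Lemma relent_ge t g : 0 < t -> 0 < g -> t * ln g - g + 1 <= relent t.
Proof. by move=> t0 g0; have := gibbs_lower t0 g0; rewrite /relent; lra. Qed.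

Lemma relent_ge0 t : 0 < t -> 0 <= relent t.
Proof. by move=> t0; have := relent_ge t0 ltr01; rewrite ln1 mulr0 add0r addNr. Qed.

Lemma relent_le t : 0 < t -> relent t <= (t - 1) ^+ 2.
Proof.
move=> t0; have := ler_wpM2l (ltW t0) (ln_le_subr1 t0); rewrite /relent.
by move: (ln t) => l; nra.
Qed.

(** The maximum of [expo] v y over v, attained at v = y. It dominates in the signal variable for
    fixed y; in y one needs Pratt's lemma, as this bound is not integrable against the noise in
    general. *)
Definition gbound y : R := expR (\sum_i co y i ^+ 2 / 2).

Lemma expo_le_gbound (v : I -> R) y : expo v y <= gbound y.
Proof.
rewrite ler_expR; apply: ler_sum => i _; rewrite -subr_ge0.
by rewrite (_ : _ - _ = (co y i - v i) ^+ 2 / 2) ?divr_ge0 ?sqr_ge0//; field.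
Qed.

Definition glik f y : R := \int[mu]_x expo (f x) y.
Definition gnum f h y : R := \int[mu]_x (h x * expo (f x) y).
Definition gent f : R := EG (fun y => relent (glik f y)).
Definition gsqm f h : R := EG (fun y => gnum f h y ^+ 2 / glik f y).

Definition measurable_obs f := forall i, measurable_fun setT (f ^~ i).

Lemma measurable_expo2 f : measurable_obs f ->
  measurable_fun setT (fun z : #|I|.-tuple R * T => expo (f z.2) z.1).
Proof.
move=> mf; apply: measurableT_comp => //; apply: measurable_sum => i.
have m2 : measurable_fun setT (fun z : #|I|.-tuple R * T => f z.2 i).
  by apply: measurableT_comp (mf i) _; exact: measurable_snd.
apply: measurable_funB.
  apply: measurable_funM => //.
  by apply: measurableT_comp (measurable_co i) _; exact: measurable_fst.
by apply: measurable_funM => //; exact: measurable_funX.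
Qed.

Lemma measurable_expo2_swap f : measurable_obs f ->
  measurable_fun setT (fun z : T * #|I|.-tuple R => expo (f z.1) z.2).
Proof.
move=> mf; apply: measurableT_comp => //; apply: measurable_sum => i.
have m1 : measurable_fun setT (fun z : T * #|I|.-tuple R => f z.1 i).
  by apply: measurableT_comp (mf i) _; exact: measurable_fst.
apply: measurable_funB.
  apply: measurable_funM => //.
  by apply: measurableT_comp (measurable_co i) _; exact: measurable_snd.
by apply: measurable_funM => //; exact: measurable_funX.
Qed.

Lemma measurable_expo_x f y : measurable_obs f -> measurable_fun setT (fun x => expo (f x) y).
Proof.
move=> mf; apply: measurableT_comp => //; apply: measurable_sum => i.
apply: measurable_funB; first by apply: measurable_funM.
by apply: measurable_funM => //; exact: measurable_funX.
Qed.

Lemma integrable_expo f y : measurable_obs f ->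
  mu.-integrable setT (EFin \o (fun x => expo (f x) y)).
Proof.
move=> mf; apply: (@integrable_bounded _ _ _ _ _ (gbound y)).
  exact: measurable_expo_x.
by move=> x; rewrite gtr0_norm ?expo_gt0// expo_le_gbound.
Qed.

Lemma integrable_hexpo f h y : measurable_obs f -> mu.-integrable setT (EFin \o h) ->
  mu.-integrable setT (EFin \o (fun x => h x * expo (f x) y)).
Proof.
move=> mf hi; have mh := integrable_measurable hi.
apply: (@integrable_bound _ _ _ _ _ (fun x => gbound y * `|h x|)).
- by apply: measurable_funM => //; exact: measurable_expo_x.
- move=> x; rewrite normrM mulrC gtr0_norm ?expo_gt0// ler_wpM2r//.
  exact: expo_le_gbound.
- apply: integrable_scale; rewrite (_ : EFin \o _ = abse \o (EFin \o h))//.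
  exact: integrable_abse.
Qed.

Lemma measurable_glik f : measurable_obs f -> measurable_fun setT (glik f).
Proof.
move=> mf.
exact: (measurable_Rintegral_section mu (measurable_expo2 mf)).
Qed.

Lemma measurable_gnum f h : measurable_obs f -> measurable_fun setT h ->
  measurable_fun setT (gnum f h).
Proof.
move=> mf mh.
have m2 : measurable_fun setT (fun z : #|I|.-tuple R * T => h z.2 * expo (f z.2) z.1).
  apply: measurable_funM; last exact: measurable_expo2.
  by apply: measurableT_comp mh _; exact: measurable_snd.
exact: (measurable_Rintegral_section mu m2).
Qed.

Lemma Rintegral_gt0 (u : T -> R) : mu.-integrable setT (EFin \o u) ->
  (forall x, 0 < u x) -> 0 < \int[mu]_x u x.
Proof.
move=> ui u0; rewrite lt_neqAle Rintegral_ge0 ?andbT; last by move=> x _; exact/ltW.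
apply/negP => /eqP E.
have [+ _] := @ae_eq_integral_abs _ _ _ mu setT measurableT (EFin \o u)
  (measurable_int _ ui).
rewrite (eq_integral (EFin \o u)); last first.
  by move=> x _ /=; rewrite ger0_norm// ltW.
rewrite /comp -Rintegral_EFin// -E => /(_ erefl).
move=> [N [mN N0 Nu]]; have : (mu setT <= mu N)%E.
  apply: le_measure; rewrite ?inE// => x _; apply: Nu => /= /(_ Logic.I) [ux].
  by have := u0 x; rewrite ux ltxx.
by rewrite N0 probability_setT lee_fin ler10.
Qed.

Lemma measurable_inv_pos (u : #|I|.-tuple R -> R) : (forall y, 0 < u y) ->
  measurable_fun setT u -> measurable_fun setT (fun y => (u y)^-1).
Proof.
move=> u0 mu_; rewrite (_ : (fun y => _) = fun y => expR (- ln (u y))).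
  apply: measurableT_comp => //; apply: measurableT_comp => //.
  exact: measurableT_comp (@measurable_ln R) mu_.
by apply/funext => z; rewrite expRN lnK// posrE.
Qed.

Lemma glik_gt0 f y : measurable_obs f -> 0 < glik f y.
Proof.
by move=> mf; apply: Rintegral_gt0 => [|x]; [exact: integrable_expo|exact: expo_gt0].
Qed.

Lemma gsqm_bound f h y : measurable_obs f -> mu.-integrable setT (EFin \o h) ->
  mu.-integrable setT (EFin \o (fun x => h x ^+ 2)) ->
  gnum f h y ^+ 2 / glik f y <= gnum f (fun x => h x ^+ 2) y.
Proof.
move=> mf hi h2i; have L0 := glik_gt0 y mf.
set N := gnum f h y; set L := glik f y.
have i1 := integrable_hexpo y mf hi.
have i2 := integrable_hexpo y mf h2i.
have i3 := integrable_expo y mf.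
have : 0 <= \int[mu]_x (h x ^+ 2 * expo (f x) y - (2 * (N / L)) * (h x * expo (f x) y) +
    (N / L) ^+ 2 * expo (f x) y).
  apply: Rintegral_ge0 => x _.
  rewrite (_ : _ + _ = (h x - N / L) ^+ 2 * expo (f x) y); last by ring.
  by rewrite mulr_ge0 ?sqr_ge0// ltW ?expo_gt0.
rewrite RintegralD//; last 2 first.
- by apply: integrable_sub => //; exact: integrable_scale.
- exact: integrable_scale.
rewrite RintegralB//; last exact: integrable_scale.
rewrite !RintegralZl// -/(gnum f h y) -/(glik f y) -/N -/L.
rewrite -/(gnum f (fun x => h x ^+ 2) y) => H.
rewrite -subr_ge0; apply: le_trans H _; rewrite le_eqVlt; apply/orP; left; apply/eqP.
by field; rewrite gt_eqF.
Qed.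

Lemma measurable_relent d' (T' : measurableType d') (u : T' -> R) :
  measurable_fun setT u -> measurable_fun setT (fun x => relent (u x)).
Proof.
move=> mu_; apply: measurable_funD => //; apply: measurable_funB => //.
apply: measurable_funM => //.
exact: measurableT_comp (@measurable_ln R) mu_.
Qed.

Lemma relent_expo_le (v : I -> R) y : `|relent (expo v y)| <= 1 + gbound y ^+ 2.
Proof.
have e0 := expo_gt0 v y; have eb := expo_le_gbound v y.
rewrite ger0_norm ?relent_ge0//; apply: (le_trans (relent_le e0)).
move: (expo v y) (gbound y) e0 eb => e b e0 eb; nra.
Qed.

Lemma integrable_relent_expo f y : measurable_obs f ->
  mu.-integrable setT (EFin \o (fun x => relent (expo (f x) y))).
Proof.
move=> mf; apply: (integrable_bounded _ _ (fun x => relent_expo_le (f x) y)).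
exact: measurable_relent (measurable_expo_x y mf).
Qed.

Lemma relent_jensen f y : measurable_obs f ->
  relent (glik f y) <= \int[mu]_x relent (expo (f x) y).
Proof.
move=> mf; have L0 := glik_gt0 y mf; have i1 := integrable_expo y mf.
set L := glik f y in L0 *.
rewrite (_ : relent L = \int[mu]_x (ln L * expo (f x) y + (1 - L))); last first.
  rewrite RintegralD//; last 2 first.
  - exact: integrable_scale.
  - by apply: finite_measure_integrable_cst.
  by rewrite RintegralZl// RintegralP_cst -/(glik f y) -/L /relent; ring.
apply: le_Rintegral => //.
- apply: integrable_add; first exact: integrable_scale.
  by apply: finite_measure_integrable_cst.
- exact: integrable_relent_expo.
move=> x _; have := relent_ge (expo_gt0 (f x) y) L0.
by rewrite mulrC -addrA [- L + 1]addrC.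
Qed.

Lemma EG_relent_expo (v : I -> R) : EG (fun y => relent (expo v y)) = \sum_i v i ^+ 2 / 2.
Proof.
have te := tame_expo v.
have tl : tame (fun y => expo v y * ln (expo v y)).
  by apply: tameM => //; apply: tame_ln (expo_gt0 v) te (tame_expo_inv v).
rewrite EGD; last 2 first.
- exact: tameB.
- exact: tame_cst.
by rewrite EGB// EG_expo_ln EG_expo EG_cst subrK.
Qed.

Lemma tame_relent_expo (v : I -> R) : tame (fun y => relent (expo v y)).
Proof.
have te := tame_expo v.
apply: tameD; last exact: tame_cst; apply: tameB => //; apply: tameM => //.
exact: tame_ln (expo_gt0 v) te (tame_expo_inv v).
Qed.

(** Tonelli, with the inner noise integral computed by [EG_relent_expo]: the convex majorant of the
    entropy density given by [relent_jensen] integrates to the energy. *)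
Lemma relent_energy f : measurable_obs f ->
  mu.-integrable setT (EFin \o (fun x => \sum_i f x i ^+ 2 / 2)) ->
  (noise I).-integrable setT (EFin \o (fun y => \int[mu]_x relent (expo (f x) y))) /\
  EG (fun y => \int[mu]_x relent (expo (f x) y)) = \int[mu]_x \sum_i f x i ^+ 2 / 2.
Proof.
move=> mf fi.
apply: (@Rtonelli R _ _ T (#|I|.-tuple R) mu (noise I)
  (fun z => relent (expo (f z.1) z.2)) (fun x => \sum_i f x i ^+ 2 / 2)) => //.
- apply: measurable_relent.
  exact: measurable_expo2_swap.
- by move=> z; rewrite relent_ge0// expo_gt0.
- by move=> x; exact: (tame_integrable (tame_relent_expo (f x))).
- by move=> y; exact: integrable_relent_expo.
- by move=> x; exact: (EG_relent_expo (f x)).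
Qed.

Lemma hexpo_energy f h : measurable_obs f -> mu.-integrable setT (EFin \o h) ->
  (forall x, 0 <= h x) ->
  (noise I).-integrable setT (EFin \o (gnum f h)) /\
  EG (gnum f h) = \int[mu]_x h x.
Proof.
move=> mf hi h0.
apply: (@Rtonelli R _ _ T (#|I|.-tuple R) mu (noise I)
  (fun z => h z.1 * expo (f z.1) z.2) h) => //.
- apply: measurable_funM.
    by apply: measurableT_comp measurable_fst; exact: integrable_measurable hi.
  exact: measurable_expo2_swap.
- by move=> z; rewrite mulr_ge0// ltW// expo_gt0.
- move=> x; apply: (@tame_integrable R I (fun y => h x * expo (f x) y)).
  by apply: tameZ; exact: tame_expo.
- by move=> y; exact: integrable_hexpo.
- move=> x; rewrite -[LHS]/(EG (fun y => h x * expo (f x) y)).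
  by rewrite EGZ ?EG_expo ?mulr1//; exact: tame_expo.
Qed.

Section limits.
Variables (f_ : nat -> T -> I -> R) (f : T -> I -> R) (h_ : nat -> T -> R) (h : T -> R).
Hypotheses (mf_ : forall n, measurable_obs (f_ n)) (mf : measurable_obs f).
Hypotheses (f_f : forall x i, f_ ^~ x ^~ i @ \oo --> f x i)
  (f_le : forall n x i, `|f_ n x i| <= `|f x i|).
Hypothesis fi : mu.-integrable setT (EFin \o (fun x => \sum_i f x i ^+ 2 / 2)).
Hypotheses (mh_ : forall n, measurable_fun setT (h_ n)).
Hypotheses (h_h : forall x, h_ ^~ x @ \oo --> h x) (h_le : forall n x, `|h_ n x| <= `|h x|).
Hypothesis hi : mu.-integrable setT (EFin \o h).
Hypothesis h2i : mu.-integrable setT (EFin \o (fun x => h x ^+ 2)).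

Lemma cvg_sum (J : finType) (u : J -> nat -> R) (l : J -> R) :
  (forall j, u j n @[n --> \oo] --> l j) ->
  \sum_j u j n @[n --> \oo] --> \sum_j l j.
Proof. by move=> ul; apply: cvg_big => //; exact: add_continuous. Qed.

Lemma cvg_expo x y : expo (f_ n x) y @[n --> \oo] --> expo (f x) y.
Proof.
apply: continuous_cvg; first exact: continuous_expR.
apply: cvg_sum => i; apply: cvgB; first by apply: cvgMl; exact: f_f.
by apply: cvgMl; rewrite expr2; under eq_fun do rewrite expr2; apply: cvgM; exact: f_f.
Qed.

Lemma cvg_glik y : glik (f_ n) y @[n --> \oo] --> glik f y.
Proof.
apply: (@cvg_Rintegral _ _ _ _ _ _ (cst (gbound y))) => //.
- by move=> n; exact: measurable_expo_x.
- by move=> x; exact: cvg_expo.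
- by apply: finite_measure_integrable_cst.
- by move=> n x; rewrite gtr0_norm ?expo_gt0// expo_le_gbound.
Qed.

Let hi_ n : mu.-integrable setT (EFin \o h_ n).
Proof.
apply: (@integrable_bound _ _ _ _ _ (fun x => `|h x|)) => //.
rewrite (_ : EFin \o _ = abse \o (EFin \o h))//; exact: integrable_abse.
Qed.

Let h2i_ n : mu.-integrable setT (EFin \o (fun x => h_ n x ^+ 2)).
Proof.
apply: (integrable_bound _ _ h2i) => //; first exact: measurable_funX.
by move=> x; rewrite normrX -(real_normK (num_real (h x))) lerXn2r ?nnegrE.
Qed.

Let fi_ n : mu.-integrable setT (EFin \o (fun x => \sum_i f_ n x i ^+ 2 / 2)).
Proof.
apply: (integrable_bound _ _ fi) => //.
  apply: measurable_sum => i; apply: measurable_funM => //.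
  by apply: measurable_funX; exact: mf_.
move=> x; rewrite ger0_norm; last first.
  by apply: sumr_ge0 => i _; rewrite divr_ge0 ?sqr_ge0.
apply: ler_sum => i _; rewrite ler_wpM2r//.
by rewrite -(real_normK (num_real (f x i))) -(real_normK (num_real (f_ n x i))) lerXn2r ?nnegrE.
Qed.

Lemma cvg_gnum y : gnum (f_ n) (h_ n) y @[n --> \oo] --> gnum f h y.
Proof.
apply: (@cvg_Rintegral _ _ _ _ _ _ (fun x => gbound y * `|h x|)) => //.
- by move=> n; apply: measurable_funM => //; exact: measurable_expo_x.
- by move=> x; apply: cvgM; [exact: h_h|exact: cvg_expo].
- apply: integrable_scale; rewrite (_ : EFin \o _ = abse \o (EFin \o h))//.
  exact: integrable_abse.
- move=> n x; rewrite normrM mulrC gtr0_norm ?expo_gt0//.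
  by apply: ler_pM => //; [exact/ltW/expo_gt0|exact: expo_le_gbound].
Qed.

Lemma cvg_relent (u : nat -> R) (l : R) : (forall n, 0 < u n) -> 0 < l ->
  u n @[n --> \oo] --> l -> relent (u n) @[n --> \oo] --> relent l.
Proof.
move=> u0 l0 ul; apply: cvgD; last exact: cvg_cst.
apply: cvgB => //; apply: cvgM => //.
by apply: continuous_cvg ul; exact: continuous_ln.
Qed.

(** Pratt's lemma with the Jensen majorants of [relent_jensen], whose integrals are the energies and
    converge by ordinary domination. *)
Lemma cvg_gent : gent (f_ n) @[n --> \oo] --> gent f.
Proof.
apply: (@cvg_Rintegral_pratt _ _ _ (noise I) (fun n y => relent (glik (f_ n) y))
  (fun n y => \int[mu]_x relent (expo (f_ n x) y)) (fun y => relent (glik f y))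
  (fun y => \int[mu]_x relent (expo (f x) y))).
- by move=> n; apply: measurable_relent; exact: measurable_glik.
- by move=> n; have [] := relent_energy (mf_ n) (fi_ n).
- by have [] := relent_energy mf fi.
- by move=> n y; rewrite relent_ge0 ?glik_gt0//= relent_jensen.
- move=> y; apply: cvg_relent; last exact: cvg_glik.
    by move=> n; exact: glik_gt0.
  exact: glik_gt0.
- move=> y; apply: (@cvg_Rintegral _ _ _ _ _ _ (cst (1 + gbound y ^+ 2))) => //.
  + by move=> n; apply: measurable_relent; exact: measurable_expo_x.
  + move=> x; apply: cvg_relent; last exact: cvg_expo.
      by move=> n; exact: expo_gt0.
    exact: expo_gt0.
  + by apply: finite_measure_integrable_cst.
  + by move=> n x; exact: relent_expo_le.
- have E : \int[noise I]_y \int[mu]_x relent (expo (f x) y) = _ := (relent_energy mf fi).2.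
  have E_ n : \int[noise I]_y \int[mu]_x relent (expo (f_ n x) y) = _ :=
    (relent_energy (mf_ n) (fi_ n)).2.
  rewrite E (funext E_).
  apply: (cvg_Rintegral _ _ fi).
  + by move=> n; exact: integrable_measurable (fi_ n).
  + move=> x; apply: cvg_sum => i; apply: cvgMl.
    by rewrite expr2; under eq_fun do rewrite expr2; apply: cvgM; exact: f_f.
  + move=> n x; rewrite ger0_norm; last first.
      by apply: sumr_ge0 => i _; rewrite divr_ge0 ?sqr_ge0.
    apply: ler_sum => i _; rewrite ler_wpM2r//.
    by rewrite -(real_normK (num_real (f x i))) -(real_normK (num_real (f_ n x i)))
       lerXn2r ?nnegrE.
Qed.

(** As for [cvg_gent], the majorants being the unnormalized posterior means of h^2, whose integrals
    are the prior second moments. *)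
Lemma cvg_gsqm : gsqm (f_ n) (h_ n) @[n --> \oo] --> gsqm f h.
Proof.
have h20 (k : T -> R) x : 0 <= k x ^+ 2 by exact: sqr_ge0.
have cs (u : nat -> R) (l : R) : u n @[n --> \oo] --> l -> u n ^+ 2 @[n --> \oo] --> l ^+ 2.
  by move=> ul; rewrite expr2; under eq_fun do rewrite expr2; exact: cvgM.
have h2le n x : `|h_ n x ^+ 2| <= h x ^+ 2.
  by rewrite normrX -(real_normK (num_real (h x))) lerXn2r ?nnegrE.
apply: (@cvg_Rintegral_pratt _ _ _ (noise I)
  (fun n y => gnum (f_ n) (h_ n) y ^+ 2 / glik (f_ n) y)
  (fun n => gnum (f_ n) (fun x => h_ n x ^+ 2)) (fun y => gnum f h y ^+ 2 / glik f y)
  (gnum f (fun x => h x ^+ 2))).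
- move=> n; apply: measurable_funM; first by apply: measurable_funX; exact: measurable_gnum.
  by apply: measurable_inv_pos => [y|]; [exact: glik_gt0|exact: measurable_glik].
- by move=> n; have [] := hexpo_energy (mf_ n) (h2i_ n) (h20 (h_ n)).
- by have [] := hexpo_energy mf h2i (h20 h).
- move=> n y; rewrite gsqm_bound// andbT divr_ge0 ?sqr_ge0// ltW//.
  exact: glik_gt0.
- move=> y; apply: cvgM; first by apply: cs; exact: cvg_gnum.
  by apply: cvgV; [rewrite gt_eqF// glik_gt0|exact: cvg_glik].
- move=> y; apply: (@cvg_Rintegral _ _ _ _ _ _ (fun x => gbound y * h x ^+ 2)) => //.
  + move=> n; apply: measurable_funM; first exact: measurable_funX.
    exact: measurable_expo_x.
  + by move=> x; apply: cvgM; [apply: cs; exact: h_h|exact: cvg_expo].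
  + exact: integrable_scale.
  + move=> n x; rewrite normrM mulrC gtr0_norm ?expo_gt0//.
    by apply: ler_pM => //; [exact/ltW/expo_gt0|exact: expo_le_gbound].
- have E : \int[noise I]_y gnum f (fun x => h x ^+ 2) y = _ := (hexpo_energy mf h2i (h20 h)).2.
  have E_ n : \int[noise I]_y gnum (f_ n) (fun x => h_ n x ^+ 2) y = _ :=
    (hexpo_energy (mf_ n) (h2i_ n) (h20 (h_ n))).2.
  rewrite E (funext E_).
  apply: (cvg_Rintegral _ _ h2i) => //.
  + by move=> n; exact: integrable_measurable (h2i_ n).
  + by move=> x; apply: cs; exact: h_h.
Qed.

End limits.

End general_prior.

From mathcomp Require Import finmap.

(** * Finite-valued approximation of the prior *)

Section quantization.
Context {R : realType}.

(** Positive and negative parts of x are approximated from below by simple functions; this yields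
    the bound by |x| that all domination arguments use. *)
Lemma quantizers : exists (A : nat -> finType) (q : forall n, R -> A n) (v : forall n, A n -> R),
  [/\ forall n a, measurable (q n @^-1` [set a]), forall n x, `|v n (q n x)| <= `|x|
    & forall x, v n (q n x) @[n --> \oo] --> x].
Proof.
pose part (s : R) (x : R) : \bar R := (Num.max (s * x) 0)%:E.
have mpart s : measurable_fun setT (part s).
  by apply/measurable_EFinP; apply: measurable_maxr => //; exact: measurable_funM.
pose P s n := nnsfun_approx measurableT (mpart s) n.
have Pc s x : P s ^~ x @ \oo --> Num.max (s * x) 0.
  suff /fine_cvg : (P s n x)%:E @[n --> \oo] --> (Num.max (s * x) 0)%:E by [].
  have := @cvg_nnsfun_approx _ _ _ _ measurableT _ (mpart s) _ x Logic.I.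
  by apply => y _; rewrite lee_fin le_max lexx orbT.
have P0 s n x : 0 <= P s n x by [].
have Ple s n x : P s n x <= Num.max (s * x) 0.
  rewrite -(cvg_lim (@Rhausdorff R) (Pc s x)); apply: nondecreasing_cvgn_le.
    by move=> i j ij; have /lefP := nd_nnsfun_approx measurableT (mpart s) ij; exact.
  by apply/cvg_ex; exists (Num.max (s * x) 0); exact: Pc.
have Pin s n x : P s n x \in fset_set (range (P s n)).
  rewrite in_fset_set; first by apply: mem_set; exists x.
  exact: fimfunP.
(* A letter is a pair of values, one for each part of x; its numerical value is their difference. *)
exists (fun n => (fset_set (range (P 1 n)) * fset_set (range (P (-1) n)))%type).
exists (fun n x => ([` Pin 1 n x]%fset, [` Pin (-1) n x]%fset)).
exists (fun n a => val a.1 - val a.2); split.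
- move=> n [a b].
  rewrite (_ : _ @^-1` _ = (P 1 n @^-1` [set val a]) `&` (P (-1) n @^-1` [set val b])).
    by apply: measurableI; exact: measurable_funPTI.
  apply/seteqP; split => [x /= [<- <-]//|x /= [Pa Mb]].
  by congr pair; apply: val_inj.
- move=> n x /=; have := Ple 1 n x; have := Ple (-1) n x.
  have := P0 1 n x; have := P0 (-1) n x; rewrite mul1r mulN1r.
  rewrite ler_norml; move: (P 1 n x) (P (-1) n x) => a b b0 a0.
  have [x0|x0] := lerP 0 x.
    rewrite (max_r (_ : - x <= 0)) ?oppr_le0// (ger0_norm x0).
    by move=> *; apply/andP; split; lra.
  rewrite (max_l (_ : 0 <= - x)) ?oppr_ge0 ?(ltW x0)// (ltr0_norm x0).
  by move=> *; apply/andP; split; lra.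
- move=> x /=; have := cvgB (Pc 1 x) (Pc (-1) x); rewrite mul1r mulN1r.
  have -> : Num.max x 0 - Num.max (- x) 0 = x; last exact.
  have [x0|x0] := lerP 0 x.
    by rewrite (max_r (_ : - x <= 0)) ?oppr_le0// subr0.
  by rewrite (max_l (_ : 0 <= - x)) ?oppr_ge0 ?(ltW x0)// sub0r opprK.
Qed.

Section finite_valued.
Context d (T : measurableType d) (mu : probability T R) (A : finType) (q : T -> A).
Hypothesis mq : forall a, measurable (q @^-1` [set a]).

Definition qlaw (a : A) : R := fine (mu (q @^-1` [set a])).

Lemma measurable_quantized (H : A -> R) : measurable_fun setT (fun x => H (q x)).
Proof.
rewrite (_ : (fun x => _) = fun x => \sum_a H a * \1_(q @^-1` [set a]) x).
  by apply: measurable_sum => a; apply: measurable_funM => //; exact: measurable_indic.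
apply/funext => x; rewrite (bigD1 (q x))//= indicE mem_set// mulr1 big1 ?addr0//.
by move=> a aq; rewrite indicE memNset ?mulr0// => /= E; rewrite E eqxx in aq.
Qed.

Lemma Rintegral_quantized (H : A -> R) : \int[mu]_x H (q x) = avg qlaw H.
Proof.
have E : (\int[mu]_x (H (q x))%:E = (avg qlaw H)%:E)%E.
  transitivity (\int[mu]_x (\sum_a (H a)%:E * (\1_(q @^-1` [set a]) x)%:E))%E.
    apply: eq_integral => x _.
    rewrite (bigD1 (q x))//= indicE mem_set// mule1 big1 ?adde0//.
    by move=> a aq; rewrite indicE memNset ?mule0// => /= E; rewrite E eqxx in aq.
  rewrite integral_sum//; last first.
    by move=> a; apply: integrableZl => //; exact: integrable_indic.
  rewrite /avg -sumEFin; apply: eq_bigr => a _.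
  rewrite integralZl//; last exact: integrable_indic.
  by rewrite integral_indic// setIT /qlaw EFinM muleC fineK// fin_num_measure.
by rewrite /Rintegral E.
Qed.

Lemma qlaw_weights : weights qlaw.
Proof.
split=> [a|]; first exact: fine_ge0.
have := Rintegral_quantized (fun=> 1); rewrite RintegralP_cst => ->.
by apply: eq_bigr => a _; rewrite mulr1.
Qed.

Variables (I : finType) (F : A -> I -> R).

Lemma glik_quantized y : glik mu (fun x => F (q x)) y = lik qlaw F y.
Proof. by rewrite /glik (Rintegral_quantized (fun a => expo (F a) y)). Qed.

Lemma gnum_quantized h y : gnum mu (fun x => F (q x)) (fun x => h (q x)) y =
  \sum_a qlaw a * h a * expo (F a) y.
Proof.
rewrite /gnum (Rintegral_quantized (fun a => h a * expo (F a) y)).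
by apply: eq_bigr => a _; rewrite mulrA.
Qed.

Lemma gent_quantized : gent mu (fun x => F (q x)) = ent qlaw F.
Proof.
have ww := qlaw_weights.
rewrite /gent; under eq_fun do rewrite glik_quantized.
rewrite EGD; last 2 first.
- by apply: tameB; [exact: tame_xlnx_lik|exact: tame_lik].
- exact: tame_cst.
rewrite EGB; last 2 first.
- exact: tame_xlnx_lik.
- exact: tame_lik.
by rewrite EG_lik// EG_cst subrK.
Qed.

Lemma gsqm_quantized h : gsqm mu (fun x => F (q x)) (fun x => h (q x)) =
  EG (fun y => (\sum_a qlaw a * h a * expo (F a) y) ^+ 2 / lik qlaw F y).
Proof. by rewrite /gsqm; under eq_fun do rewrite glik_quantized gnum_quantized. Qed.

End finite_valued.

Section tuple_quantization.
Variables (P0 : probability R R) (A : finType) (q : R -> A).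
Hypothesis mq : forall a, measurable (q @^-1` [set a]).

Definition qtuple n (x : n.-tuple R) : n.-tuple A := [tuple q (tnth x i) | i < n].

Lemma qtuple_preimage n (t : n.-tuple A) :
  @qtuple n @^-1` [set t] = box (fun i => q @^-1` [set tnth t i]).
Proof.
apply/seteqP; split => [x /= <- i /=|x /= H].
  by rewrite tnth_mktuple.
by apply: eq_from_tnth => i; rewrite tnth_mktuple; exact: H.
Qed.

Lemma measurable_qtuple n (t : n.-tuple A) : measurable (@qtuple n @^-1` [set t]).
Proof. by rewrite qtuple_preimage; exact: measurable_box. Qed.

Lemma qlaw_tuple n : qlaw (tprod P0 n) (@qtuple n) = @ptup R A (qlaw P0 q) n.
Proof.
apply/funext => t; rewrite /qlaw qtuple_preimage tprod_box// /ptup.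
rewrite (eq_bigr (fun i => (fine (P0 (q @^-1` [set tnth t i])))%:E)).
  by rewrite prodEFin.
by move=> i _; rewrite fineK// fin_num_measure.
Qed.

End tuple_quantization.

End quantization.

Lemma ler_cvgn {R : realType} (u w : nat -> R) (a b : R) : (forall n, u n <= w n) ->
  u n @[n --> \oo] --> a -> w n @[n --> \oo] --> b -> a <= b.
Proof. by move=> uw ua wb; apply: (ler_cvg_to ua wb); exact: nearW. Qed.

(** * From quantized spins to the prior itself *)

Section approximation.
Context {R : realType}.
Variable P0 : probability R R.

Definition pobs (g : R -> R) n (lambda : R) (x : n.-tuple R) (e : edge n) : R :=
  Num.sqrt (lambda / n%:R) * (g (tnth x (val e).1) * g (tnth x (val e).2)).

Definition PhiP g n lambda : R := gent (tprod P0 n) (@pobs g n lambda).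

Definition DP g n lambda : R := \sum_(e : edge n)
  gsqm (tprod P0 n) (@pobs g n lambda)
    (fun x => g (tnth x (val e).1) * g (tnth x (val e).2)).

Definition psiP (g : R -> R) h : R := gent P0 (fun x (_ : unit) => Num.sqrt h * g x).

Section quantized.
Variables (A : finType) (q : R -> A) (v : A -> R).
Hypothesis mq : forall a, measurable (q @^-1` [set a]).
Let p := qlaw P0 q.
Let g x := v (q x).

Let pp : weights p. Proof. exact: qlaw_weights. Qed.

Lemma pobs_quantized n lambda :
  @pobs g n lambda = fun x => spin v lambda (qtuple q x).
Proof.
by apply/funext => x; apply/funext => e; rewrite /spin !tnth_mktuple.
Qed.

Lemma PhiP_quantized n lambda : PhiP g n lambda = ent (@ptup R A p n) (spin v lambda).
Proof.
rewrite /PhiP pobs_quantized (gent_quantized _ (@measurable_qtuple _ _ _ mq n)).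
by rewrite qlaw_tuple.
Qed.

Lemma DP_quantized n lambda : DP g n lambda = sqE p v n (lambda / n%:R) 0.
Proof.
apply: eq_bigr => e _; rewrite pobs_quantized.
rewrite (_ : (fun x => _) = fun x => (fun t : n.-tuple A =>
    v (tnth t (val e).1) * v (tnth t (val e).2)) (qtuple q x)); last first.
  by apply/funext => x; rewrite /= !tnth_mktuple.
rewrite (gsqm_quantized _ (@measurable_qtuple _ _ _ mq n) (spin v lambda) (fun t =>
    v (tnth t (val e).1) * v (tnth t (val e).2))) qlaw_tuple//; apply: esym.
apply: (@EG_sqr_transport R _ _ _ _ id inl) => //.
- exact: ptup_weights.
- by move=> ? ? [].
- move=> t [i|i]; first by rewrite codom_f.
  by rewrite /obs /= sqrtr0 mul0r.
Qed.

Lemma psiP_quantized h : psiP g h = psi p v h.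
Proof. exact: (gent_quantized P0 mq (fun a (_ : unit) => Num.sqrt h * v a)). Qed.

Lemma finite_bound : exists2 B : R, 1 <= B & forall a, `|v a| <= B.
Proof.
exists (1 + \sum_a `|v a|); first by rewrite lerDl sumr_ge0.
by move=> a; rewrite (bigD1 a)//= addrCA lerDl addr_ge0// sumr_ge0.
Qed.

(** The tangent inequality of a convex function: the lower bound of [PhiN_edges_lower] to the right
    of lambda, and [PhiN_edges_upper], started from lambda', to its left. *)
Lemma DP_tangent_quantized n lambda lambda' : 0 <= lambda -> 0 <= lambda' ->
  (lambda' - lambda) / (2 * n%:R) * DP g n lambda <= PhiP g n lambda' - PhiP g n lambda.
Proof.
move=> l0 l0'; have [B B1 vB] := finite_bound.
rewrite DP_quantized !PhiP_quantized -!PhiN_spin// invfM [2^-1 * _]mulrC mulrA.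
have nn : 0 <= n%:R^-1 :> R by rewrite invr_ge0.
have [ll|ll] := leP lambda lambda'.
  have := PhiN_edges_lower v pp n (mulr_ge0 l0 nn) (lexx 0)
    (mulr_ge0 (_ : 0 <= lambda' - lambda) nn).
  rewrite -mulrDl [lambda + _]addrC subrK subr_ge0 lerBrDl => /(_ ll).
  by [].
have := PhiN_edges_upper pp B1 vB n (mulr_ge0 l0' nn) (lexx 0)
  (mulr_ge0 (_ : 0 <= lambda - lambda') nn).
rewrite -mulrDl (_ : lambda' + (lambda - lambda') = lambda) ?subr_ge0; last by ring.
move=> /(_ (ltW ll)).
rewrite -[lambda' - _]opprB !mulNr.
by move: (_ / _ / 2) (sqE _ _ _ _ _) (PhiN _ _ _ _ _) (PhiN _ _ _ _ _) => d x y z; lra.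
Qed.

End quantized.


Lemma tprod_pair n (i j : 'I_n) (a b : R -> R) : i != j ->
  measurable_fun setT a -> measurable_fun setT b -> (forall x, 0 <= a x) -> (forall x, 0 <= b x) ->
  (\int[tprod P0 n]_t (a (tnth t i) * b (tnth t j))%:E =
   \int[P0]_x (a x)%:E * \int[P0]_x (b x)%:E)%E.
Proof.
move=> ij ma mb a0 b0; have ji : j != i by rewrite eq_sym.
pose h k x : \bar R := if k == i then (a x)%:E else if k == j then (b x)%:E else 1%E.
transitivity (\int[tprod P0 n]_t \prod_k h k (tnth t k))%E.
  apply: eq_integral => t _; rewrite (bigD1 i)//= (bigD1 j)//= [X in (_ * (_ * X))%E]big1.
    by rewrite /h !eqxx (negbTE ji) mule1 EFinM.
  by move=> k /andP [] /negbTE ki /negbTE kj; rewrite /h ki kj.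
rewrite tprod_prod; last 2 first.
- move=> k; rewrite /h; case: (k == i); first exact/measurable_EFinP.
  by case: (k == j) => //; exact/measurable_EFinP.
- by move=> k x; rewrite /h; case: (k == i); [|case: (k == j)]; rewrite lee_fin.
rewrite (bigD1 i)//= (bigD1 j)//= [X in (_ * (_ * X))%E]big1.
  rewrite mule1; congr (_ * _)%E; apply: eq_integral => x _; rewrite /h ?eqxx//.
  by rewrite (negbTE ji).
move=> k /andP [] /negbTE ki /negbTE kj; rewrite /h ki kj.
by rewrite integral_probability_cst.
Qed.

Hypothesis i2 : P0.-integrable setT (EFin \o (fun x : R => x ^+ 2)).
Hypothesis var1 : \int[P0]_x x ^+ 2 = 1.

Lemma integral_pair n (i j : 'I_n) : i != j ->
  (\int[tprod P0 n]_t ((tnth t i * tnth t j) ^+ 2)%:E = 1)%E.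
Proof.
move=> ij; under eq_integral do rewrite exprMn.
rewrite (@tprod_pair n i j (fun x => x ^+ 2) (fun x => x ^+ 2))// => [|x|x]; rewrite ?sqr_ge0//.
by rewrite -Rintegral_EFin// var1 mule1.
Qed.

Lemma measurable_pair n (i j : 'I_n) (g : R -> R) : measurable_fun setT g ->
  measurable_fun setT (fun t : n.-tuple R => g (tnth t i) * g (tnth t j)).
Proof.
by move=> mg; apply: measurable_funM; apply: measurableT_comp mg _; exact: measurable_tnth.
Qed.

Lemma integrable_pair2 n (i j : 'I_n) : i != j ->
  (tprod P0 n).-integrable setT (EFin \o (fun t => (tnth t i * tnth t j) ^+ 2)).
Proof.
move=> ij; apply/integrableP; split.
  by apply/measurable_EFinP; apply: measurable_funX; exact: (measurable_pair _ _ (g := id)).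
rewrite (eq_integral (fun t : n.-tuple R => ((tnth t i * tnth t j) ^+ 2)%:E)) ?integral_pair ?ltry//.
by move=> t _ /=; rewrite ger0_norm ?sqr_ge0.
Qed.

Lemma Rintegral_pair2 n (i j : 'I_n) : i != j ->
  \int[tprod P0 n]_t (tnth t i * tnth t j) ^+ 2 = 1.
Proof. by move=> ij; rewrite /Rintegral integral_pair. Qed.

Lemma integrable_of_sqr d (T : measurableType d) (mu : probability T R) (h : T -> R) :
  measurable_fun setT h -> mu.-integrable setT (EFin \o (fun x => h x ^+ 2)) ->
  mu.-integrable setT (EFin \o h).
Proof.
move=> mh h2; apply: (@integrable_bound _ _ _ _ _ (fun x => 1 + h x ^+ 2)) => //.
  move=> x; rewrite -[_ ^+ 2]real_normK ?num_real//; have := normr_ge0 (h x).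
  by move: `|_| => t t0; have := sqr_ge0 (t - 1); nra.
by apply: integrable_add => //; apply: finite_measure_integrable_cst.
Qed.

Lemma integrable_pair n (i j : 'I_n) : i != j ->
  (tprod P0 n).-integrable setT (EFin \o (fun t => tnth t i * tnth t j)).
Proof.
move=> ij; apply: integrable_of_sqr; last exact: integrable_pair2.
exact: (measurable_pair _ _ (g := id)).
Qed.

Lemma measurable_pobs g n lambda : measurable_fun setT g -> measurable_obs (@pobs g n lambda).
Proof. by move=> mg e; apply: measurable_funM => //; exact: measurable_pair. Qed.

Lemma integrable_sumr d (T : measurableType d) (mu : probability T R) (J : finType)
    (u : J -> T -> R) : (forall j, mu.-integrable setT (EFin \o u j)) ->
  mu.-integrable setT (EFin \o (fun x => \sum_j u j x)).
Proof.
move=> ui; rewrite (_ : EFin \o _ = fun x => \sum_j (EFin \o u j) x)%E.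
  exact: integrable_sum.
by apply/funext => x; rewrite /= sumEFin.
Qed.

Lemma Rintegral_sumr d (T : measurableType d) (mu : probability T R) (J : finType)
    (u : J -> T -> R) : (forall j, mu.-integrable setT (EFin \o u j)) ->
  \int[mu]_x \sum_j u j x = \sum_j \int[mu]_x u j x.
Proof.
move=> ui; apply/EFin_inj; rewrite Rintegral_EFin; last exact: integrable_sumr.
under eq_integral do rewrite -sumEFin.
rewrite (@integral_sum _ _ _ mu setT measurableT _ (fun j => EFin \o u j) ui) -sumEFin.
by apply: eq_bigr => j _; rewrite Rintegral_EFin.
Qed.

Lemma integrable_pobs n lambda : 0 <= lambda ->
  (tprod P0 n).-integrable setT (EFin \o (fun x => \sum_e (@pobs id n lambda x e) ^+ 2 / 2)).
Proof.
move=> l0; apply: integrable_sumr => e.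
rewrite (_ : EFin \o _ = EFin \o (fun x : n.-tuple R =>
   lambda / n%:R / 2 * (tnth x (val e).1 * tnth x (val e).2) ^+ 2)).
  by apply: integrable_scale; apply: integrable_pair2; exact: edge_neq.
apply/funext => x /=; rewrite /pobs [in LHS]exprMn sqr_sqrtr ?divr_ge0//.
by rewrite mulrAC.
Qed.

Section sequence.
Variables (A : nat -> finType) (q : forall m, R -> A m) (v : forall m, A m -> R).
Hypotheses (mq : forall m a, measurable (q m @^-1` [set a]))
  (vx : forall m x, `|v (q m x)| <= `|x|) (vc : forall x, v (q m x) @[m --> \oo] --> x).
Let g m x := v (q m x).

Let mg m : measurable_fun setT (g m). Proof. exact: (measurable_quantized (@mq m) (@v m)). Qed.

Lemma cvg_PhiP n lambda : 0 <= lambda ->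
  PhiP (g m) n lambda @[m --> \oo] --> PhiP id n lambda.
Proof.
move=> l0; apply: cvg_gent.
- by move=> m; exact: measurable_pobs.
- exact: measurable_pobs.
- by move=> x e; apply: cvgM; [exact: cvg_cst|apply: cvgM; exact: vc].
- by move=> m x e; rewrite /pobs !normrM; apply: ler_wpM2l => //; apply: ler_pM => //; exact: vx.
- exact: integrable_pobs.
Qed.

Lemma cvg_DP n lambda : 0 <= lambda -> DP (g m) n lambda @[m --> \oo] --> DP id n lambda.
Proof.
move=> l0; apply: cvg_sum => e; apply: cvg_gsqm.
- by move=> m; exact: measurable_pobs.
- exact: measurable_pobs.
- by move=> x e'; apply: cvgM; [exact: cvg_cst|apply: cvgM; exact: vc].
- by move=> m; exact: measurable_pair.
- by move=> x; apply: cvgM; exact: vc.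
- by move=> m x; rewrite !normrM; apply: ler_pM => //; exact: vx.
- exact/integrable_pair/edge_neq.
- exact/integrable_pair2/edge_neq.
Qed.

Lemma cvg_psiP h : 0 <= h -> psiP (g m) h @[m --> \oo] --> psiP id h.
Proof.
move=> h0; apply: cvg_gent.
- by move=> m i; exact: measurable_funM.
- by move=> i; exact: measurable_funM.
- by move=> x i; apply: cvgM; [exact: cvg_cst|exact: vc].
- by move=> m x i; rewrite !normrM; apply: ler_wpM2l => //; exact: vx.
- apply: integrable_sumr => i.
  rewrite (_ : EFin \o _ = EFin \o (fun x : R => h / 2 * x ^+ 2)).
    exact: integrable_scale.
  by apply/funext => x /=; rewrite exprMn sqr_sqrtr// mulrAC.
Qed.

Lemma cvg_sqr_dist (w : R -> R) : measurable_fun setT w -> (forall x, `|w x| <= `|x|) ->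
  \int[P0]_x (g m x - w x) ^+ 2 @[m --> \oo] --> \int[P0]_x (x - w x) ^+ 2.
Proof.
move=> mw wx; apply: (@cvg_Rintegral _ _ _ P0 (fun m x => (g m x - w x) ^+ 2)
  (fun x => (x - w x) ^+ 2) (fun x => 4 * x ^+ 2)).
- by move=> m; apply: measurable_funX; exact: measurable_funB.
- move=> x; rewrite expr2; under eq_fun do rewrite expr2.
  by apply: cvgM; apply: cvgB; [exact: vc|exact: cvg_cst|exact: vc|exact: cvg_cst].
- exact: integrable_scale.
- move=> m x; rewrite ger0_norm ?sqr_ge0//.
  have := ler_normB (g m x) (w x); have := vx m x; have := wx x.
  rewrite -[x ^+ 2]real_normK ?num_real// -[(_ - _) ^+ 2]real_normK ?num_real// -/(g m x).
  have := normr_ge0 (g m x - w x).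
  by move: `|_ - _| `|x| `|w x| `|g m x| => a b c d; nra.
Qed.

End sequence.


Section two_quantizers.
Variables (A A' : finType) (q : R -> A) (v : A -> R) (q' : R -> A') (v' : A' -> R).
Hypotheses (mq : forall a, measurable (q @^-1` [set a]))
  (mq' : forall a, measurable (q' @^-1` [set a])).
Hypotheses (vx : forall x, `|v (q x)| <= `|x|) (vx' : forall x, `|v' (q' x)| <= `|x|).
Let g x := v (q x).
Let g' x := v' (q' x).

Let qq x := (q x, q' x).

Let mqq a : measurable (qq @^-1` [set a]).
Proof.
case: a => a b; rewrite (_ : _ @^-1` _ = (q @^-1` [set a]) `&` (q' @^-1` [set b])).
  exact: measurableI.
by apply/seteqP; split => [x /= [<- <-]//|x /= [<- <-]].
Qed.

Let p := qlaw P0 qq.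
Let pp : weights p. Proof. exact: qlaw_weights. Qed.

Lemma second_moment_le (w : R -> R) : measurable_fun setT w -> (forall x, `|w x| <= `|x|) ->
  \int[P0]_x w x ^+ 2 <= 1.
Proof.
move=> mw wx.
have w2 x : w x ^+ 2 <= x ^+ 2.
  by rewrite -(real_normK (num_real x)) -(real_normK (num_real (w x))) lerXn2r ?nnegrE.
rewrite -var1; apply: le_Rintegral => //.
by apply: (integrable_bound _ _ i2) => [|x]; [exact: measurable_funX|rewrite ger0_norm ?sqr_ge0].
Qed.

Let v1 : avg p (fun a => v a.1 ^+ 2) <= 1.
Proof.
rewrite -(Rintegral_quantized P0 mqq); apply: second_moment_le => //.
exact: measurable_quantized.
Qed.

Let v1' : avg p (fun a => v' a.2 ^+ 2) <= 1.
Proof.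
rewrite -(Rintegral_quantized P0 mqq); apply: second_moment_le => //.
exact: measurable_quantized.
Qed.

(** Both quantizations are functions of the pair [qq], hence live on one finite alphabet where
    [spin_compare] applies. *)
Lemma PhiP_compare_quantized n lambda t : 0 <= lambda -> (0 < n)%N -> 0 < t ->
  `|PhiP g' n lambda - PhiP g n lambda| <=
  n%:R * (lambda * (t / 4 + \int[P0]_x (g' x - g x) ^+ 2 / t)).
Proof.
move=> l0 n0 t0.
rewrite (PhiP_quantized (fun a => v a.1) mqq) (PhiP_quantized (fun a => v' a.2) mqq).
apply: (le_trans (spin_compare pp l0 n0 t0 v1 v1')).
by rewrite (Rintegral_quantized P0 mqq (fun a => (v' a.2 - v a.1) ^+ 2)).
Qed.

Lemma psiP_compare_quantized h h' t : 0 <= h -> 0 <= h' -> 0 < t ->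
  `|psiP g' h' - psiP g h| <= t / 2 * Num.max h h' +
    t^-1 * (h * \int[P0]_x (g' x - g x) ^+ 2 + `|h' - h|).
Proof.
move=> h0 h0' t0.
rewrite (psiP_quantized (fun a => v a.1) mqq) (psiP_quantized (fun a => v' a.2) mqq).
apply: (le_trans (psi_compare pp h0 h0' t0 v1 v1')).
by rewrite (Rintegral_quantized P0 mqq (fun a => (v' a.2 - v a.1) ^+ 2)).
Qed.

End two_quantizers.

Section one_quantizer.
Variables (A : finType) (q : R -> A) (v : A -> R).
Hypotheses (mq : forall a, measurable (q @^-1` [set a])) (vx : forall x, `|v (q x)| <= `|x|).
Let g x := v (q x).

(** The second quantizer is refined to the identity while the first stays fixed. *)
Lemma PhiP_compare n lambda t : 0 <= lambda -> (0 < n)%N -> 0 < t ->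
  `|PhiP id n lambda - PhiP g n lambda| <=
  n%:R * (lambda * (t / 4 + \int[P0]_x (x - g x) ^+ 2 / t)).
Proof.
move=> l0 n0 t0; have [A' [q' [v' [mq' vx' vc']]]] := quantizers (R := R).
have H m := PhiP_compare_quantized mq (mq' m) vx (vx' m) l0 n0 t0.
have mg : measurable_fun setT g by exact: measurable_quantized.
apply: (ler_cvgn H).
- by apply: cvg_norm; apply: cvgB; [exact: cvg_PhiP|exact: cvg_cst].
- apply: cvgMr; apply: cvgMr; apply: cvgD; first exact: cvg_cst.
  by apply: cvgMl; exact: cvg_sqr_dist.
Qed.

Lemma psiP_compare h h' t : 0 <= h -> 0 <= h' -> 0 < t ->
  `|psiP id h' - psiP g h| <= t / 2 * Num.max h h' +
    t^-1 * (h * \int[P0]_x (x - g x) ^+ 2 + `|h' - h|).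
Proof.
move=> h0 h0' t0; have [A' [q' [v' [mq' vx' vc']]]] := quantizers (R := R).
have H m := psiP_compare_quantized mq (mq' m) vx (vx' m) h0 h0' t0.
have mg : measurable_fun setT g by exact: measurable_quantized.
apply: (ler_cvgn H).
- by apply: cvg_norm; apply: cvgB; [exact: cvg_psiP|exact: cvg_cst].
- apply: cvgD; first exact: cvg_cst.
  apply: cvgMr; apply: cvgD; last exact: cvg_cst.
  by apply: cvgMr; exact: cvg_sqr_dist.
Qed.

End one_quantizer.

Lemma cvg_quantization_error (A : nat -> finType) (q : forall m, R -> A m)
    (v : forall m, A m -> R) : (forall m a, measurable (q m @^-1` [set a])) ->
  (forall m x, `|v m (q m x)| <= `|x|) -> (forall x, v m (q m x) @[m --> \oo] --> x) ->
  \int[P0]_x (x - v m (q m x)) ^+ 2 @[m --> \oo] --> 0.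
Proof.
move=> mq vx vc.
have := cvg_sqr_dist mq vx vc (@measurable_id _ _ setT) (fun x => lexx _).
under eq_fun do under eq_Rintegral do rewrite -sqrrN opprB.
rewrite (_ : \int[P0]_x (x - id x) ^+ 2 = 0)//.
rewrite -[RHS](RintegralP_cst P0 0); apply: eq_Rintegral => x _.
by rewrite subrr expr0n.
Qed.

(** [psiP_compare] with the quantization error sent to 0. The parameter t is kept free, to be tuned
    to the desired modulus of continuity. *)
Lemma psiP_continuity h h' t : 0 <= h -> 0 <= h' -> 0 < t ->
  `|psiP id h' - psiP id h| <= t / 2 * Num.max h h' + t^-1 * `|h' - h|.
Proof.
move=> h0 h0' t0; have [A [q [v [mq vx vc]]]] := quantizers (R := R).
have H m := psiP_compare (mq m) (vx m) h0 h0' t0.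
have D0 := cvg_quantization_error mq vx vc.
apply: (ler_cvgn H).
- by apply: cvg_norm; apply: cvgB; [exact: cvg_cst|exact: cvg_psiP].
- apply: cvgD; first exact: cvg_cst; apply: cvgMr.
  rewrite -[X in _ --> X]add0r -[X in _ --> X + _](mulr0 h).
  by apply: cvgD; [exact: cvgMr|exact: cvg_cst].
Qed.

Lemma psiP_bounds h : 0 <= h -> 0 <= psiP id h <= h / 2.
Proof.
move=> h0; have [A [q [v [mq vx vc]]]] := quantizers (R := R).
have mg m : measurable_fun setT (fun x => v m (q m x)) by exact: measurable_quantized.
have pp m := qlaw_weights P0 (mq m).
have C := cvg_psiP mq vx vc h0.
apply/andP; split.
  apply: (cvgr_to_ge C); apply: nearW => m; rewrite psiP_quantized//.
  apply: le_trans (ent_lower _ (pp m)).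
  by apply: sumr_ge0 => i _; rewrite divr_ge0 ?sqr_ge0.
apply: (cvgr_to_le C); apply: nearW => m; rewrite psiP_quantized//.
apply: psi_le => //; rewrite -(Rintegral_quantized P0 (mq m)).
exact: second_moment_le.
Qed.

Lemma DP_tangent n lambda lambda' : 0 <= lambda -> 0 <= lambda' ->
  (lambda' - lambda) / (2 * n%:R) * DP id n lambda <= PhiP id n lambda' - PhiP id n lambda.
Proof.
move=> l0 l0'; have [A [q [v [mq vx vc]]]] := quantizers (R := R).
apply: (ler_cvgn (fun m => DP_tangent_quantized (v m) (mq m) n l0 l0')).
- by apply: cvgMr; exact: cvg_DP.
- by apply: cvgB; exact: cvg_PhiP.
Qed.

End approximation.

(** * The limit of the free energy per spin *)

Section free_energy_limit.
Context {R : realType}.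
Variable P0 : probability R R.
Hypothesis i2 : P0.-integrable setT (EFin \o (fun x : R => x ^+ 2)).
Hypothesis var1 : \int[P0]_x x ^+ 2 = 1.

Lemma small_error (C e : R) : 0 <= C -> 0 < e ->
  exists2 t, 0 < t & exists2 d, 0 < d & forall D, `|D| <= d -> C * (t + D / t) <= e.
Proof.
move=> C0 e0; have C1 : 0 < 2 * (C + 1) by rewrite mulr_gt0// ltr_wpDl.
pose t := e / (2 * (C + 1)); have t0 : 0 < t by rewrite divr_gt0.
exists t => //; exists (t ^+ 2); first exact: exprn_gt0.
move=> D /(le_trans (ler_norm _)) Dt.
have : D / t <= t by rewrite ler_pdivrMr.
have te : e = 2 * (C + 1) * t by rewrite /t; field; rewrite gt_eqF// ltr_wpDl.
move: (D / t) => x xt; rewrite te; nra.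
Qed.

(** One fine quantizer, chosen before n, changes the free energy per spin and the relevant values of
    [psi] by at most e. For that finite model [cavity_limit] gives the upper bound and [guerra], at
    a nearly optimal g0, the lower one. *)
Lemma PhiP_limit (lambda S : R) : 0 < lambda ->
  (forall g, 0 <= g -> psiP P0 id g <= S + g ^+ 2 / (4 * lambda)) ->
  (forall e, 0 < e -> exists2 g, 0 <= g & S - e + g ^+ 2 / (4 * lambda) <= psiP P0 id g) ->
  PhiP P0 id n lambda / n%:R @[n --> \oo] --> S.
Proof.
move=> l0 HS LS; apply/cvgrPdist_le => e4 e40.
pose e := e4 / 4; have e0 : 0 < e by rewrite divr_gt0.
have [g0 g00 Hg0] := LS _ e0.
(* Closeness of the scalar entropies is needed only up to G: beyond 2 lambda the bound psi(g) <= g/2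
   <= g^2/(4 lambda) suffices. *)
pose G := Num.max (2 * lambda) g0.
have G2 : 2 * lambda <= G by rewrite le_max lexx.
have Gg0 : g0 <= G by rewrite le_max lexx orbT.
have G0 : 0 <= G by apply: le_trans Gg0.
have C0 : 0 <= lambda + G by rewrite addr_ge0// ltW.
have [t t0 [d d0 Hd]] := small_error C0 e0.
have [A [q [v [mq vx vc]]]] := quantizers (R := R).
have /cvgrPdist_le /(_ _ d0) := cvg_quantization_error i2 mq vx vc.
move=> [m _ /(_ m (leqnn m))] /=; rewrite sub0r normrN => Dm.
set D := \int[P0]_x _ in Dm.
have D0 : 0 <= D by apply: Rintegral_ge0 => x _; exact: sqr_ge0.
have {Hd}Hd := Hd _ Dm.
have mg : measurable_fun setT (fun x => v m (q m x)) by exact: measurable_quantized.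
pose p := qlaw P0 (q m); have pp : weights p by exact: qlaw_weights.
have [B B1 vB] := finite_bound (v m).
have tD : 0 <= D / t by rewrite divr_ge0// ltW.
have psi_close g : 0 <= g -> g <= G ->
    psi p (v m) g - e <= psiP P0 id g <= psi p (v m) g + e.
  move=> g0' gG.
  have := psiP_compare i2 var1 (mq m) (vx m) g0' g0' t0.
  rewrite psiP_quantized// maxxx subrr normr0 addr0 -/D mulrCA [t^-1 * D]mulrC.
  have gC : g <= lambda + G by rewrite (le_trans gG)// lerDr ltW.
  have : t / 2 * g + g * (D / t) <= e.
    by apply: le_trans Hd; move: (D / t) tD => x x0; nra.
  rewrite -/p => H1 H2; have := le_trans H2 H1.
  by rewrite ler_distl.
have Phi_close n : (0 < n)%N ->
    `|PhiP P0 id n lambda - PhiN p (v m) n (lambda / n%:R) 0| <= n%:R * e.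
  move=> n0; rewrite PhiN_spin// -PhiP_quantized//.
  apply: (le_trans (PhiP_compare i2 var1 (mq m) (vx m) (ltW l0) n0 t0)).
  rewrite -/D ler_wpM2l//; apply: le_trans Hd.
  by move: (D / t) tD => x x0; nra.
have S0 : 0 <= S.
  have := HS 0 (lexx _); rewrite expr0n/= mul0r addr0; apply: le_trans.
  by have /andP[] := psiP_bounds i2 var1 (lexx 0).
have HSm g : 0 <= g -> psi p (v m) g <= S + e + g ^+ 2 / (4 * lambda).
  move=> g0'; have [gl|gl] := leP g (2 * lambda).
    have /andP[+ _] := psi_close g g0' (le_trans gl G2).
    by have := HS g g0'; rewrite lerBlDr => H1 H2; rewrite addrAC (le_trans H2)// lerD2r.
  have : psi p (v m) g <= g / 2.
    apply: psi_le => //; rewrite -(Rintegral_quantized P0 (mq m)).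
    exact: second_moment_le.
  move=> /le_trans; apply; apply: (@le_trans _ _ (g ^+ 2 / (4 * lambda))).
    rewrite ler_pdivlMr ?mulr_gt0//; move: gl g0'; clear -l0; nra.
  by rewrite lerDr addr_ge0// ltW.
have [N HN] := cavity_limit pp B1 vB l0 HSm e0.
have [N' HN'] := archimedean_mul (lambda / 4 * B ^+ 4) e0.
exists (N + N').+1 => // n /= nN.
have n0 : (0 < n)%N by case: (n) nN.
have nR : 0 < n%:R :> R by rewrite ltr0n.
have {}HN := HN n (leq_trans (leq_addr N' N) (ltnW nN)).
have {}HN' := HN' n (leq_trans (leq_addl N N') (ltnW nN)).
have q0 : 0 <= g0 / lambda by rewrite divr_ge0// ltW.
have Gu := guerra pp B1 vB (ltW l0) q0 n0.
have E1 : lambda * (g0 / lambda) = g0 by field; rewrite gt_eqF.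
have E2 : lambda / 4 * (g0 / lambda) ^+ 2 = g0 ^+ 2 / (4 * lambda).
  by field; rewrite gt_eqF.
rewrite {}E1 {}E2 in Gu.
have /andP[_ Pg] := psi_close g0 g00 Gg0.
have Ec := Phi_close n n0.
have L : n%:R * (S - 2 * e) <= n%:R * (psi p (v m) g0 - g0 ^+ 2 / (4 * lambda)).
  by rewrite ler_wpM2l//; move: Hg0 Pg; clear; lra.
have e4E : e4 = 4 * e by rewrite /e; field.
rewrite distrC ler_distl ler_pdivlMr// ler_pdivrMr// e4E.
move: Ec; rewrite ler_distl => /andP[Ec1 Ec2].
clear - Ec1 Ec2 L Gu HN HN' nR e0.
move: (PhiN _ _ _ _ _) (PhiP _ _ _ _) (psi _ _ _) (_ / (4 * _)) (lambda / 4 * _) Ec1 Ec2 L Gu HN HN'.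
move=> x y z w u Ec1 Ec2 L Gu HN HN'; clear -Ec1 Ec2 L Gu HN HN'; apply/andP; split; nra.
Qed.

End free_energy_limit.

(** * The law of signal and data in the given model *)

Section joint_law.
Context {R : realType}.
Variables (P0 : probability R R) (n : nat) (M : spiked_wigner P0 n).
Notation gauss := (@gauss R).
Let P := sw_prob M.

Definition sw_Zvec (w : sw_space M) : #|edge n|.-tuple R := mk (fun e => sw_Z M e w).

Lemma measurable_sw_Zvec : measurable_fun setT sw_Zvec.
Proof. by apply: measurable_mk => e; exact: measurable_funPT. Qed.

HB.instance Definition _ :=
  isMeasurableFun.Build _ _ _ _ sw_Zvec measurable_sw_Zvec.

Let X := @sw_Xvec R P0 n M.

Lemma noise_cobox (I : finType) (G : I -> set R) : (forall i, measurable (G i)) ->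
  noise I [set y | forall i, G i (co y i)] = (\prod_i gauss (G i))%E.
Proof.
move=> mG.
rewrite (_ : [set y | _] = box (fun k => G (enum_val k))).
  rewrite /noise tprod_box// (reindex (fun i : I => enum_rank i))/=.
    by apply: eq_bigr => i _; rewrite enum_rankK.
  by exists (fun k => enum_val k) => k _; rewrite ?enum_rankK ?enum_valK.
apply/seteqP; split => [y /= H k|y /= H i].
  by have := H (enum_val k); rewrite /co enum_valK.
by have := H (enum_rank i); rewrite enum_rankK.
Qed.

Lemma sw_law_boxes (D : 'I_n -> set R) (G : edge n -> set R) :
  (forall i, measurable (D i)) -> (forall e, measurable (G e)) ->
  P (X @^-1` box D `&` sw_Zvec @^-1` [set y | forall e, G e (co y e)]) =
  (tprod P0 n (box D) * noise (edge n) [set y | forall e, G e (co y e)])%E.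
Proof.
move=> mD mG.
pose B (k : 'I_n + edge n) := match k with inl i => D i | inr e => G e end.
have mB k : measurable (B k) by case: k.
have := sw_indep M [set: 'I_n + edge n]%SET mB.
rewrite (_ : \bigcap_(i in _) _ = X @^-1` box D `&` sw_Zvec @^-1` [set y | forall e, G e (co y e)]).
  move=> ->; under eq_bigl do rewrite finset.inE.
  rewrite big_sumType/= tprod_box//; congr (_ * _)%E.
    by apply: eq_bigr => i _; rewrite -(sw_X_law M i (mD i)).
  transitivity (\prod_e gauss (G e))%E.
    by apply: eq_bigr => e _; rewrite gaussE// -(sw_Z_law M e (mG e)).
  by rewrite noise_cobox.
apply/seteqP; split => [w /= H|w /= [HX HZ] [i|e] _ /=].
- split=> [i|e]; first by rewrite tnth_mktuple; apply: (H (inl i)); rewrite /= finset.inE.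
  by rewrite co_mk; apply: (H (inr e)); rewrite /= finset.inE.
- by have := HX i; rewrite tnth_mktuple.
- by have := HZ e; rewrite co_mk.
Qed.

(** Mutual independence gives the product formula on boxes. It extends to all measurable sets one
    factor at a time, by uniqueness of finite measures restricted to the event concerning the other
    factor. *)
Lemma sw_law (A : set (n.-tuple R)) (C : set (#|edge n|.-tuple R)) :
  measurable A -> measurable C ->
  P (X @^-1` A `&` sw_Zvec @^-1` C) = (tprod P0 n A * noise (edge n) C)%E.
Proof.
have mX (D : set (n.-tuple R)) : measurable D -> measurable (X @^-1` D).
  by move=> mD; rewrite -[X in measurable X]setTI; exact: measurable_sw_Xvec.
have mZ (D : set (#|edge n|.-tuple R)) : measurable D -> measurable (sw_Zvec @^-1` D).
  by move=> mD; rewrite -[X in measurable X]setTI; exact: measurable_sw_Zvec.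
have fE d (T : measurableType d) (Q : probability T R) (D : set T) : measurable D ->
    Q D = (NngNum (fine_ge0 (measure_ge0 Q D)))%:num%:E.
  by move=> mD; rewrite /= fineK// fin_num_measure.
have step1 D (G : edge n -> set R) : measurable D -> (forall e, measurable (G e)) ->
    P (X @^-1` D `&` sw_Zvec @^-1` [set y | forall e, G e (co y e)]) =
    (tprod P0 n D * noise (edge n) [set y | forall e, G e (co y e)])%E.
  move=> mD mG; have mc := measurable_cobox mG.
  rewrite muleC (fE _ _ (noise (edge n)) _ mc).
  set c := NngNum _.
  transitivity (pushforward (mrestr P (mZ _ mc)) X D); first by [].
  transitivity (mscale c (tprod P0 n) D); last by [].
  apply: tuple_measure_unique => //.
    rewrite /pushforward /mrestr (le_lt_trans _ (ltry 1))//; apply: probability_le1.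
    by apply: measurableI; [exact: mX|exact: mZ].
  move=> B mB; transitivity (P (X @^-1` box B `&`
    sw_Zvec @^-1` [set y | forall e, G e (co y e)])); first by [].
  by rewrite sw_law_boxes// muleC (fE _ _ (noise (edge n)) _ mc).
move=> mA mC.
rewrite (fE _ _ (tprod P0 n) _ mA); set c := NngNum _.
rewrite setIC.
transitivity (pushforward (mrestr P (mX _ mA)) sw_Zvec C); first by [].
transitivity (mscale c (noise (edge n)) C); last by [].
apply: tuple_measure_unique => //.
  rewrite /pushforward /mrestr (le_lt_trans _ (ltry 1))//; apply: probability_le1.
  by apply: measurableI; [exact: mZ|exact: mX].
move=> B mB; transitivity (P (sw_Zvec @^-1` box B `&` X @^-1` A)); first by [].
rewrite (_ : box B = [set y | forall e, B (enum_rank e) (co y e)]).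
  rewrite setIC (step1 A (fun e => B (enum_rank e)) mA (fun e => mB _)).
  by rewrite [in LHS](fE _ _ (tprod P0 n) _ mA).
apply/seteqP; split => [y /= H e|y /= H k]; first exact: H.
by have := H (enum_val k); rewrite /co enum_valK.
Qed.


Let N := #|edge n|.
Lemma sw_joint (h : n.-tuple R * N.-tuple R -> \bar R) :
  measurable_fun setT h -> (forall z, 0 <= h z)%E ->
  (\int[P]_w h (X w, sw_Zvec w) =
   \int[tprod P0 n]_x \int[noise (edge n)]_y h (x, y))%E.
Proof.
move=> mh h0.
pose XZ := pair_rv (P := P) (@sw_Xvec R P0 n M) sw_Zvec.
transitivity (\int[pushforward P XZ]_z h z)%E.
  by rewrite ge0_integral_pushforward//; exact: measurable_pair_rv.
transitivity (\int[(tprod P0 n \x noise (edge n))%E]_z h z)%E; last first.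
  exact: (@fubini_tonelli1 _ _ _ _ R (tprod P0 n) (noise (edge n)) h mh h0).
apply: eq_measure_integral => D mD _; apply: esym.
apply: product_measure_unique => // A C mA mC.
exact: sw_law.
Qed.


Section observation.
Variable lambda : R.
Hypothesis l0 : 0 <= lambda.
Let Y := @sw_Yvec R P0 n M lambda.
Let f := @pobs R id n lambda.

Let mf : measurable_obs f. Proof. exact: measurable_pobs. Qed.

Lemma sw_YvecE w : Y w = yshift (f (X w)) (sw_Zvec w).
Proof.
apply: eq_from_tnth => k; rewrite tnth_mktuple tnth_mk co_mk addrC.
by rewrite /f /pobs !tnth_mktuple.
Qed.

(** Given the signal x, the data are noise shifted by f x; the Cameron-Martin formula shows that (X,
    Y) has density [expo] (f x) y relative to prior times noise. *)
Lemma sw_law_XY (h : n.-tuple R * N.-tuple R -> \bar R) :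
  measurable_fun setT h -> (forall z, 0 <= h z)%E ->
  (\int[P]_w h (X w, Y w) =
   \int[tprod P0 n]_x \int[noise (edge n)]_y ((expo (f x) y)%:E * h (x, y)))%E.
Proof.
move=> mh h0; pose h' z := h (z.1, yshift (f z.1) z.2).
transitivity (\int[P]_w h' (X w, sw_Zvec w))%E.
  by apply: eq_integral => w _; rewrite sw_YvecE.
have mg : measurable_fun setT (fun z : n.-tuple R * N.-tuple R => (z.1, yshift (f z.1) z.2)).
  apply: measurable_fun_pair; first exact: measurable_fst.
  apply: measurable_mk => e; apply: measurable_funD.
    by apply: measurableT_comp (measurable_co e) _; exact: measurable_snd.
  by apply: measurableT_comp (mf e) _; exact: measurable_fst.
have mh' : measurable_fun setT h' by exact: (measurableT_comp mh mg).
rewrite (sw_joint mh' (fun z => h0 _)).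
apply: eq_integral => x _; rewrite /h' /=.
have mhx : measurable_fun setT (fun y => h (x, y)).
  exact: (mfun_section1 x mh).
have := @tprod_shift R _ (mk (f x)) (fun y => h (x, y)) mhx (fun y => h0 (x, y)).
under eq_integral do rewrite -shiftE.
move=> ->; apply: eq_integral => y _; congr (_%:E * _)%E; congr expR.
rewrite [RHS](reindex (fun k : 'I_N => enum_val k))/=; last first.
  by exists (fun e => enum_rank e) => k _; rewrite ?enum_rankK ?enum_valK.
by apply: eq_bigr => k _; rewrite tnth_mk /co enum_valK.
Qed.

Lemma sw_law_XY_swap (h : n.-tuple R * N.-tuple R -> \bar R) :
  measurable_fun setT h -> (forall z, 0 <= h z)%E ->
  (\int[P]_w h (X w, Y w) =
   \int[noise (edge n)]_y \int[tprod P0 n]_x ((expo (f x) y)%:E * h (x, y)))%E.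
Proof.
move=> mh h0; rewrite sw_law_XY//.
apply: (@fubini_tonelli _ _ _ _ R (tprod P0 n) (noise (edge n))
  (fun z => (expo (f z.1) z.2)%:E * h z)%E).
  by apply: emeasurable_funM => //; apply/measurable_EFinP; exact: measurable_expo2_swap.
by move=> z; rewrite mule_ge0// lee_fin ltW// expo_gt0.
Qed.

End observation.

End joint_law.

(** * Conditional expectation and the mean square error *)

Section mean_square_error.
Context {R : realType}.
Variables (P0 : probability R R) (n : nat) (M : spiked_wigner P0 n) (lambda : R).
Hypothesis i2 : P0.-integrable setT (EFin \o (fun x : R => x ^+ 2)).
Hypothesis var1 : \int[P0]_x x ^+ 2 = 1.
Hypothesis l0 : 0 <= lambda.
Let P := sw_prob M.
Let N := #|edge n|.
Let X := @sw_Xvec R P0 n M.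
Let Y := @sw_Yvec R P0 n M lambda.
Let f := @pobs R id n lambda.
Let mu := tprod P0 n.

Let mf : measurable_obs f. Proof. exact: measurable_pobs. Qed.
Let mX : measurable_fun setT X. Proof. exact: measurable_sw_Xvec. Qed.
Let mY : measurable_fun setT Y. Proof. exact: measurable_sw_Yvec. Qed.

Lemma integral_kX_gY (k : n.-tuple R -> R) (g : N.-tuple R -> \bar R) :
  measurable_fun setT g -> (forall y, 0 <= g y)%E ->
  mu.-integrable setT (EFin \o k) -> (forall x, 0 <= k x) ->
  (\int[P]_w ((k (X w))%:E * g (Y w)) = \int[noise (edge n)]_y ((gnum mu f k y)%:E * g y))%E.
Proof.
move=> mg g0 ki k0; have mk' := integrable_measurable ki.
have mh : measurable_fun setT (fun z : n.-tuple R * N.-tuple R => (k z.1)%:E * g z.2)%E.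
  apply: emeasurable_funM.
    by apply/measurable_EFinP; apply: measurableT_comp mk' _; exact: measurable_fst.
  by apply: measurableT_comp mg _; exact: measurable_snd.
have h0 z : (0 <= (k z.1)%:E * g z.2)%E by rewrite mule_ge0// lee_fin.
rewrite (sw_law_XY_swap M lambda mh h0); apply: eq_integral => y _ /=.
rewrite Rintegral_EFin; last exact: integrable_hexpo.
rewrite -ge0_integralZr//; last 2 first.
- apply/measurable_EFinP; apply: measurable_funM => //; exact: measurable_expo_x.
- by move=> x _; rewrite lee_fin mulr_ge0// ltW// expo_gt0.
by apply: eq_integral => x _; rewrite muleA -EFinM mulrC.
Qed.

Lemma integral_gY (g : N.-tuple R -> \bar R) :
  measurable_fun setT g -> (forall y, 0 <= g y)%E ->
  (\int[P]_w g (Y w) = \int[noise (edge n)]_y ((glik mu f y)%:E * g y))%E.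
Proof.
move=> mg g0.
have i1 : mu.-integrable setT (EFin \o (fun=> 1)) by exact: finite_measure_integrable_cst.
apply: etrans (etrans _ (@integral_kX_gY (fun=> 1) g mg g0 i1 (fun=> ler01))) _.
  by apply: eq_integral => w _; rewrite mul1e.
apply: eq_integral => y _; congr (_%:E * _)%E.
by apply: eq_Rintegral => x _; rewrite mul1r.
Qed.

Variable e : edge n.
Let h (x : n.-tuple R) : R := tnth x (val e).1 * tnth x (val e).2.

Let mh : measurable_fun setT h.
Proof. exact: (measurable_pair _ _ (g := id)). Qed.
Let hi : mu.-integrable setT (EFin \o h).
Proof. exact/integrable_pair/edge_neq. Qed.
Let h2i : mu.-integrable setT (EFin \o (fun x => h x ^+ 2)).
Proof. exact/integrable_pair2/edge_neq. Qed.

Let hX w : h (X w) = sw_XX e w.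
Proof. by rewrite /h /X !tnth_mktuple. Qed.

Definition post_mean (k : n.-tuple R -> R) (y : N.-tuple R) : R := gnum mu f k y / glik mu f y.

Lemma measurable_post_mean k : measurable_fun setT k -> measurable_fun setT (post_mean k).
Proof.
move=> mk'; apply: measurable_funM; first exact: measurable_gnum.
by apply: measurable_inv_pos => [y|]; [exact: glik_gt0|exact: measurable_glik].
Qed.

Lemma post_mean_ge0 (k : n.-tuple R -> R) y : (forall x, 0 <= k x) -> 0 <= post_mean k y.
Proof.
move=> k0; apply: divr_ge0; last by apply/ltW; exact: glik_gt0.
by apply: Rintegral_ge0 => x _; apply: mulr_ge0 => //; exact/ltW/expo_gt0.
Qed.

Lemma integral_post_mean (k : n.-tuple R -> R) (C : set (N.-tuple R)) :
  mu.-integrable setT (EFin \o k) -> (forall x, 0 <= k x) -> measurable C ->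
  (\int[P]_(w in Y @^-1` C) (post_mean k (Y w))%:E = \int[P]_(w in Y @^-1` C) (k (X w))%:E)%E.
Proof.
move=> ki k0 mC; have mk' := integrable_measurable ki.
pose I1 y : \bar R := (\1_C y)%:E.
have mI : measurable_fun setT I1 by apply/measurable_EFinP; exact: measurable_indic.
have I0 y : (0 <= I1 y)%E by rewrite lee_fin.
have patchI (u : sw_space M -> R) :
    (\int[P]_(w in Y @^-1` C) (u w)%:E = \int[P]_w ((u w)%:E * I1 (Y w)))%E.
  rewrite integral_mkcond; apply: eq_integral => w _; rewrite patchE /I1 indicE.
  have -> : (w \in Y @^-1` C) = (Y w \in C) by apply/idP/idP => /set_mem H; exact: mem_set.
  by case: ifPn => _; rewrite ?mule1 ?mule0.
rewrite !patchI integral_kX_gY//.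
have pm0 y := post_mean_ge0 y k0.
rewrite (@integral_gY (fun y => (post_mean k y)%:E * I1 y)%E); last 2 first.
- by apply: emeasurable_funM => //; apply/measurable_EFinP; exact: measurable_post_mean.
- by move=> y; rewrite mule_ge0// lee_fin.
apply: eq_integral => y _; rewrite muleA -EFinM /post_mean mulrCA divff ?mulr1//.
by rewrite gt_eqF// glik_gt0.
Qed.

Let hp x := Num.max (h x) 0.
Let hn x := Num.max (- h x) 0.


Let hp0 x : 0 <= hp x. Proof. by rewrite le_max lexx orbT. Qed.
Let hn0 x : 0 <= hn x. Proof. by rewrite le_max lexx orbT. Qed.
Let hpi : mu.-integrable setT (EFin \o hp).
Proof.
apply: (@integrable_bound _ _ _ _ _ (fun x => `|h x|)).
- exact: measurable_maxr.
- by move=> x; rewrite ger0_norm// /hp ge_max ler_norm normr_ge0.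
- by rewrite (_ : EFin \o _ = abse \o (EFin \o h))//; exact: integrable_abse.
Qed.
Let hni : mu.-integrable setT (EFin \o hn).
Proof.
apply: (@integrable_bound _ _ _ _ _ (fun x => `|h x|)).
- by apply: measurable_maxr => //; exact: measurableT_comp.
- by move=> x; rewrite ger0_norm// /hn ge_max -normrN ler_norm normr_ge0.
- by rewrite (_ : EFin \o _ = abse \o (EFin \o h))//; exact: integrable_abse.
Qed.
Let hpn x : h x = hp x - hn x.
Proof.
rewrite /hp /hn; have [h0|h0] := lerP 0 (h x).
  by rewrite max_r ?oppr_le0// subr0.
by rewrite max_l ?oppr_ge0 ?ltW// sub0r opprK.
Qed.

Let pm_sub y : post_mean h y = post_mean hp y - post_mean hn y.
Proof.
rewrite /post_mean -mulrBl; congr (_ / _); rewrite /gnum -RintegralB//.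
- by apply: eq_Rintegral => x _; rewrite hpn mulrBl.
- exact: integrable_hexpo.
- exact: integrable_hexpo.
Qed.

Let integrable_kX k : mu.-integrable setT (EFin \o k) -> (forall x, 0 <= k x) ->
  P.-integrable setT (fun w => (k (X w))%:E).
Proof.
move=> ki k0; have mk' := integrable_measurable ki; apply/integrableP; split.
  by apply/measurable_EFinP; exact: measurableT_comp mk' mX.
under eq_integral => w _ do rewrite /= ger0_norm//.
have [gi E] := hexpo_energy mf ki k0.
have E1 : (\int[P]_w (k (X w))%:E = \int[noise (edge n)]_y (gnum mu f k y)%:E)%E.
  apply: etrans (etrans _ (@integral_kX_gY k (fun=> 1%E) (measurable_cst _) (fun=> lee01) ki k0)) _.
    by apply: eq_integral => w _; rewrite mule1.
  by apply: eq_integral => w _; rewrite mule1.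
by rewrite E1 -Rintegral_EFin// ltry.
Qed.

Let integrable_pmY k : mu.-integrable setT (EFin \o k) -> (forall x, 0 <= k x) ->
  P.-integrable setT (fun w => (post_mean k (Y w))%:E).
Proof.
move=> ki k0; have mk' := integrable_measurable ki; apply/integrableP; split.
  by apply/measurable_EFinP; exact: measurableT_comp (measurable_post_mean mk') mY.
have pm0 y := post_mean_ge0 y k0.
under eq_integral => w _ do rewrite /= ger0_norm//.
have := integral_post_mean ki k0 measurableT; rewrite preimage_setT => ->.
by have /integrableP[_] := integrable_kX ki k0; under eq_integral => w _ do rewrite /= ger0_norm//.
Qed.

(** Bayes' formula. The product h is split into positive and negative parts, since the change of law
    is available for nonnegative integrands. *)
Lemma post_mean_condexp :
  is_cond_expectation (P := P) (sw_XX e) (@sw_Yvec R P0 n M lambda) (fun w => post_mean h (Y w)).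
Proof.
have pE : (fun w => (post_mean h (Y w))%:E) =
    (fun w => (post_mean hp (Y w))%:E - (post_mean hn (Y w))%:E)%E.
  by apply/funext => w; rewrite pm_sub.
have xE : (fun w => (sw_XX e w)%:E) = (fun w => (hp (X w))%:E - (hn (X w))%:E)%E.
  by apply/funext => w; rewrite -hX hpn.
split.
- move=> _ C mC; rewrite setTI; exists (post_mean h @^-1` C); last by rewrite setTI.
  by rewrite -[X in measurable X]setTI; exact: measurable_post_mean.
- rewrite (_ : EFin \o _ = fun w => (post_mean h (Y w))%:E)// pE.
  by apply: integrableB => //; exact: integrable_pmY.
move=> E [C mC]; rewrite setTI => <-.
have mE : measurable (Y @^-1` C) by rewrite -[X in measurable X]setTI; exact: mY.
rewrite pE xE integralB//; last 2 first.
- by apply: (integrableS measurableT) => //; exact: integrable_pmY.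
- by apply: (integrableS measurableT) => //; exact: integrable_pmY.
rewrite [RHS]integralB//; last 2 first.
- by apply: (integrableS measurableT) => //; exact: integrable_kX.
- by apply: (integrableS measurableT) => //; exact: integrable_kX.
by rewrite !integral_post_mean.
Qed.


(** The probability is pushed forward by the identity to the sigma-algebra generated by Y; there
    both versions are measurable with equal integrals on all measurable sets, hence equal almost
    everywhere. *)
Lemma condexp_unique (g1 g2 : sw_space M -> R) (u : sw_space M -> R) :
  is_cond_expectation (P := P) u (@sw_Yvec R P0 n M lambda) g1 ->
  is_cond_expectation (P := P) u (@sw_Yvec R P0 n M lambda) g2 ->
  ae_eq P setT (EFin \o g1) (EFin \o g2).
Proof.
move=> [m1 i1 E1] [m2 i2' E2].
pose S := g_sigma_algebra_preimageType Y.
pose J : sw_space M -> S := id.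
have mJ : measurable_fun setT J.
  by move=> _ C [D mD]; rewrite setTI => <-; rewrite setTI -[X in measurable X]setTI; exact: mY.
pose nu := measure_function_pushforward__canonical__measure_function_Measure P mJ.
have me (g : sw_space M -> R) : measurable_fun [set: S] g -> measurable_fun [set: S] (EFin \o g).
  by move=> mg; exact/measurable_EFinP.
have pint (g : sw_space M -> R) E : measurable_fun [set: S] g ->
    P.-integrable setT (EFin \o g) -> measurable (E : set S) ->
    (\int[nu]_(w in E) (EFin \o g) w = \int[P]_(w in E) (g w)%:E)%E.
  move=> mg gi mE; rewrite (integral_pushforward mJ (me _ mg))//.
  apply: (integrableS measurableT) => //.
  by have := mJ measurableT E mE; rewrite setTI.
have H : ae_eq nu [set: S] (EFin \o g1) (EFin \o g2).
  apply: integral_ae_eq => //.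
  - exact: (integrable_pushforward mJ (me _ m1)).
  - exact: me.
  - by move=> E _ mE; rewrite !pint// E1// E2.
case: H => A [mA A0 HA]; exists A; split => //.
by have := mJ measurableT A mA; rewrite setTI.
Qed.

(** Expanding the square under the posterior: the error is the second moment of h, equal to 1 for
    distinct indices, minus the second moment of its posterior mean. *)
Lemma mean_square_post_mean :
  (\int[P]_w ((sw_XX e w - post_mean h (Y w)) ^+ 2)%:E = (1 - gsqm mu f h)%:E)%E.
Proof.
have mpm := measurable_post_mean mh.
have mh2 : measurable_fun setT (fun z : n.-tuple R * N.-tuple R => ((h z.1 - post_mean h z.2) ^+ 2)%:E).
  apply/measurable_EFinP; apply: measurable_funX; apply: measurable_funB.
    by apply: measurableT_comp mh _; exact: measurable_fst.
  by apply: measurableT_comp mpm _; exact: measurable_snd.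
have h20 (z : n.-tuple R * N.-tuple R) : (0 <= ((h z.1 - post_mean h z.2) ^+ 2)%:E)%E.
  by rewrite lee_fin sqr_ge0.
have := sw_law_XY_swap M lambda mh2 h20.
rewrite [LHS](_ : _ = \int[P]_w ((sw_XX e w - post_mean h (Y w)) ^+ 2)%:E)%E; last first.
  by apply: eq_integral => w _; rewrite -hX.
move=> ->.
pose G y := gnum mu f (fun x => h x ^+ 2) y - gnum mu f h y ^+ 2 / glik mu f y.
have [gi Eg] := hexpo_energy mf h2i (fun x => sqr_ge0 (h x)).
have ms : measurable_fun setT (fun y => gnum mu f h y ^+ 2 / glik mu f y).
  apply: measurable_funM; first by apply: measurable_funX; exact: measurable_gnum.
  by apply: measurable_inv_pos => [y|]; [exact: glik_gt0|exact: measurable_glik].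
have si : (noise (edge n)).-integrable setT (EFin \o (fun y => gnum mu f h y ^+ 2 / glik mu f y)).
  apply: (integrable_bound ms _ gi) => y; rewrite ger0_norm ?gsqm_bound//.
  by apply: divr_ge0; [exact: sqr_ge0|apply/ltW; exact: glik_gt0].
transitivity (\int[noise (edge n)]_y (G y)%:E)%E.
  apply: eq_integral => y _ /=.
  have i3 := integrable_expo mu y mf.
  have i1 := integrable_hexpo y mf hi.
  have i4 := integrable_hexpo y mf h2i.
  have E x : expo (f x) y * (h x - post_mean h y) ^+ 2 =
     h x ^+ 2 * expo (f x) y - (2 * post_mean h y) * (h x * expo (f x) y) +
     post_mean h y ^+ 2 * expo (f x) y by ring.
  transitivity (\int[mu]_x (expo (f x) y * (h x - post_mean h y) ^+ 2)%:E)%E.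
    by apply: eq_integral => x _; rewrite EFinM.
  under eq_integral do rewrite E.
  rewrite -Rintegral_EFin; last first.
    apply: integrable_add; last exact: integrable_scale.
    by apply: integrable_sub => //; exact: integrable_scale.
  rewrite RintegralD//; last 2 first.
  - by apply: integrable_sub => //; exact: integrable_scale.
  - exact: integrable_scale.
  rewrite RintegralB//; last exact: integrable_scale.
  rewrite !RintegralZl// -/(gnum mu f h y) -/(glik mu f y) /G.
  rewrite -/(gnum mu f (fun x => h x ^+ 2) y) /post_mean; congr EFin.
  have := glik_gt0 mu y mf; move: (glik _ _ _) (gnum _ _ _ _) (gnum _ _ _ _) => a b c a0.
  by field; rewrite gt_eqF.
rewrite -Rintegral_EFin; last exact: integrable_sub.
rewrite /G RintegralB// -/(EG _) Eg; congr (_ - _)%:E.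
by rewrite Rintegral_pair2//; exact: edge_neq.
Qed.

Lemma expectation_residual : ('E_P[fun w => ((sw_XX e w -
    cond_expectation (P := P) (sw_XX e) (@sw_Yvec R P0 n M lambda) w) ^+ 2)%R] =
  (1 - gsqm mu f h)%:E)%E.
Proof.
rewrite -mean_square_post_mean unlock.
set g := cond_expectation _ _.
have gP : is_cond_expectation (P := P) (sw_XX e) (@sw_Yvec R P0 n M lambda) g.
  by apply: xgetI; exact: post_mean_condexp.
have gi : P.-integrable setT (EFin \o g) by case: gP.
have mXX : measurable_fun setT (sw_XX (M := M) e).
  rewrite (_ : sw_XX e = h \o X); first exact: measurableT_comp.
  by apply/funext => w; rewrite /= hX.
apply: ae_eq_integral => //.
- apply/measurable_EFinP; apply: measurable_funX; apply: measurable_funB => //.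
  exact: integrable_measurable gi.
- apply/measurable_EFinP; apply: measurable_funX; apply: measurable_funB => //.
  by apply: measurableT_comp mY; exact: measurable_post_mean.
have [A [mA A0 HA]] := condexp_unique gP post_mean_condexp.
exists A; split => // w /= H; apply: HA => /= H'; apply: H => _.
by have [->] := H' Logic.I.
Qed.

End mean_square_error.

Lemma sw_mmseE {R : realType} (P0 : probability R R) n (M : spiked_wigner P0 n) (lambda : R) :
  P0.-integrable setT (EFin \o (fun x : R => x ^+ 2)) -> \int[P0]_x x ^+ 2 = 1 ->
  0 <= lambda -> (1 < n)%N ->
  sw_mmse M lambda = (1 - 2 / (n%:R * (n%:R - 1)) * DP P0 id n lambda)%:E.
Proof.
move=> i2 var1 l0 n1; rewrite /sw_mmse.
have nR : n%:R * (n%:R - 1) != 0 :> R.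
  by rewrite mulf_neq0// ?subr_eq0 ?pnatr_eq0 ?pnatr_eq1; case: (n) n1 => [|[]].
under eq_bigr => e _ do rewrite (expectation_residual M lambda i2 var1 e).
rewrite sumEFin -EFinM; congr EFin.
rewrite sumrB -/(DP P0 id n lambda) (@sum_edge R n (fun _ _ => 1))//.
rewrite !sumr_const !card_ord; move: (DP _ _ _ _) => D.
rewrite -mulrnA mulrBr (_ : 1 *+ (n * n) = n%:R * n%:R); last by rewrite -natrM.
rewrite (_ : n%:R * n%:R - n%:R = n%:R * (n%:R - 1)); last by ring.
by move: (n%:R * (n%:R - 1)) nR => k k0; field.
Qed.

(** * Splitting the logarithm into nonnegative parts *)

Section positive_part_of_log.
Context {R : realType}.

(* [ln] splits as the difference of the nonnegative functions [poslog t] and [1/t - 1],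
   so that changes of variables can be made for nonnegative integrands only. *)
Definition poslog (t : R) : R := ln t + t^-1 - 1.

Lemma poslog_ge0 t : 0 < t -> 0 <= poslog t.
Proof.
move=> t0; have := @ln_le_subr1 R t^-1; rewrite invr_gt0 => /(_ t0).
by rewrite lnV ?posrE// /poslog; move: (ln t) (t^-1) => a b; lra.
Qed.

Lemma mul_poslog t : 0 < t -> t * poslog t = relent t.
Proof.
by move=> t0; rewrite /poslog /relent; move: (ln t) => l; field; rewrite gt_eqF.
Qed.

Lemma measurable_poslog d (U : measurableType d) (u : U -> R) :
  measurable_fun setT u -> measurable_fun setT (fun x => (u x)^-1) ->
  measurable_fun setT (fun x => poslog (u x)).
Proof.
move=> mu_ mi; apply: measurable_funB => //; apply: measurable_funD => //.
exact: measurableT_comp (@measurable_ln R) mu_.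
Qed.

Lemma integrable_of_integral d (U : measurableType d) (P : probability U R) (u : U -> R) (c : R) :
  measurable_fun setT u -> (forall w, 0 <= u w) -> (\int[P]_w (u w)%:E = c%:E)%E ->
  P.-integrable setT (EFin \o u).
Proof.
move=> mu_ u0 E; apply/integrableP; split; first exact/measurable_EFinP.
by under eq_integral => w _ do rewrite /= ger0_norm//; rewrite E ltry.
Qed.

End positive_part_of_log.

(** * Mutual information in terms of the free energy *)

Section information.
Context {R : realType}.
Variables (P0 : probability R R) (n : nat) (M : spiked_wigner P0 n) (lambda : R).
Hypothesis i2 : P0.-integrable setT (EFin \o (fun x : R => x ^+ 2)).
Hypothesis var1 : \int[P0]_x x ^+ 2 = 1.
Hypotheses (l0 : 0 <= lambda) (n0 : (0 < n)%N).
Let P := sw_prob M.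
Let N := #|edge n|.
Let Xf := @sw_Xvec R P0 n M.
Let Yf := @sw_Yvec R P0 n M lambda.
Let f := @pobs R id n lambda.
Let mu := tprod P0 n.
Let T := (n.-tuple R * N.-tuple R)%type.

Let mf : measurable_obs f. Proof. exact: measurable_pobs. Qed.
Let mX : measurable_fun setT Xf. Proof. exact: measurable_sw_Xvec. Qed.
Let mY : measurable_fun setT Yf. Proof. exact: measurable_sw_Yvec. Qed.

Let J : probability _ R := distribution P (pair_rv (P := P) Xf Yf).
Let Q : probability _ R := (distribution P Xf \x distribution P Yf)%E.

Let rho (z : T) : R := expo (f z.1) z.2 / glik mu f z.2.

Let rho_gt0 z : 0 < rho z.
Proof. by rewrite divr_gt0 ?expo_gt0 ?glik_gt0. Qed.

Let mrho : measurable_fun setT rho.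
Proof.
apply: measurable_funM; first exact: measurable_expo2_swap.
have mi : measurable_fun setT (fun y => (glik mu f y)^-1).
  by apply: measurable_inv_pos => [y|]; [exact: glik_gt0|exact: measurable_glik].
by apply: measurableT_comp mi _; exact: measurable_snd.
Qed.

Lemma integral_product_law (h : T -> \bar R) :
  measurable_fun setT h -> (forall z, 0 <= h z)%E ->
  (\int[Q]_z h z = \int[mu]_x \int[noise (edge n)]_y ((glik mu f y)%:E * h (x, y)))%E.
Proof.
move=> mh h0; rewrite /Q.
transitivity (\int[distribution P Xf]_x \int[distribution P Yf]_y h (x, y))%E.
  exact: (@fubini_tonelli1 _ _ _ _ R (distribution P Xf) (distribution P Yf) h mh h0).
pose k x := (\int[noise (edge n)]_y ((glik mu f y)%:E * h (x, y)))%E.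
have k0 x : (0 <= k x)%E.
  by apply: integral_ge0 => y _; rewrite mule_ge0// lee_fin ltW// glik_gt0.
have mk' : measurable_fun setT k.
  apply: (measurable_integral_section (noise (edge n))
    (f := fun z => ((glik mu f z.2)%:E * h z)%E)).
    apply: emeasurable_funM => //; apply/measurable_EFinP.
    by apply: measurableT_comp (measurable_glik mu mf) _; exact: measurable_snd.
  by move=> z; rewrite mule_ge0// lee_fin ltW// glik_gt0.
have inner x : (\int[distribution P Yf]_y h (x, y) = k x)%E.
  have mhx : measurable_fun setT (fun y => h (x, y)) by exact: (mfun_section1 x mh).
  rewrite ge0_integral_pushforward//.
  exact: (integral_gY M lambda mhx (fun y => h0 _)).
under eq_integral do rewrite inner.
rewrite ge0_integral_pushforward//.
have mk1 : measurable_fun setT (fun z : T => k z.1).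
  by apply: measurableT_comp mk' _; exact: measurable_fst.
transitivity (\int[P]_w (fun z : T => k z.1) (Xf w, sw_Zvec w))%E; first by [].
rewrite (sw_joint M mk1 (fun z => k0 _)); apply: eq_integral => x _ /=.
exact: integral_probability_cst.
Qed.

(** The likelihood of y given x divided by the marginal likelihood; the latter cancels against the
    density of the law of Y relative to noise. *)
Lemma joint_density D : measurable D -> J D = (\int[Q]_(z in D) (rho z)%:E)%E.
Proof.
move=> mD.
have mI : measurable_fun setT (fun z : T => (\1_D z)%:E : \bar R).
  by apply/measurable_EFinP; exact: measurable_indic.
have I0 (z : T) : (0 <= (\1_D z)%:E :> \bar R)%E by rewrite lee_fin.
transitivity (\int[P]_w (\1_D (Xf w, Yf w))%:E)%E.
  transitivity (\int[J]_z (\1_D z)%:E)%E; first by rewrite integral_indic// setIT.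
  by rewrite ge0_integral_pushforward//; exact: measurable_pair_rv.
rewrite (sw_law_XY M lambda mI I0) [RHS]integral_mkcond.
rewrite [RHS](eq_integral (fun z => ((rho z)%:E * (\1_D z)%:E)%E)); last first.
  by move=> z _; rewrite patchE indicE; case: ifPn => _; rewrite ?mule1 ?mule0.
rewrite integral_product_law; last 2 first.
- by apply: emeasurable_funM => //; exact/measurable_EFinP.
- by move=> z; rewrite mule_ge0// lee_fin ltW.
apply: eq_integral => x _; apply: eq_integral => y _.
rewrite [RHS]muleA; congr (_ * _)%E; rewrite -EFinM /rho /= mulrCA divff ?mulr1// gt_eqF//.
exact: glik_gt0.
Qed.

Lemma joint_dominated : J `<< Q.
Proof.
apply/null_content_dominatesP => D mD QD; rewrite joint_density//.
by apply: null_set_integral => //; apply: measurable_funTS; exact/measurable_EFinP.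
Qed.

Lemma joint_Radon_Nikodym :
  ae_eq Q setT (Radon_Nikodym (charge_of_finite_measure J) Q) (EFin \o rho).
Proof.
apply: integral_ae_eq => //.
- exact/Radon_Nikodym_integrable/joint_dominated.
- exact/measurable_EFinP.
- move=> E _ mE; rewrite -Radon_Nikodym_integral//; first exact: joint_density.
  exact: joint_dominated.
Qed.

Lemma measurable_lne_fin d (U : measurableType d) (u : U -> \bar R) :
  (forall x, u x \is a fin_num) -> measurable_fun setT u -> measurable_fun setT (@lne R \o u).
Proof.
move=> uf mu_; have mv : measurable_fun setT (fine \o u) by exact: measurableT_comp.
rewrite (_ : @lne R \o u = fun x => if fine (u x) <= 0 then -oo%E else (ln (fine (u x)))%:E).
  apply: measurable_fun_ifT => //; first exact: measurable_fun_ler.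
  by apply/measurable_EFinP; exact: measurableT_comp (@measurable_ln R) mv.
by apply/funext => x /=; have := uf x; case: (u x).
Qed.


Let e w : R := expo (f (Xf w)) (Yf w).
Let g w : R := glik mu f (Yf w).

Let e_gt0 w : 0 < e w. Proof. exact: expo_gt0. Qed.
Let g_gt0 w : 0 < g w. Proof. exact: glik_gt0. Qed.

Let mXY : measurable_fun setT (fun w => (Xf w, Yf w)).
Proof. exact: measurable_fun_pair. Qed.

Let me2 : measurable_fun setT (fun z : T => expo (f z.1) z.2).
Proof. exact: measurable_expo2_swap. Qed.
Let me2i : measurable_fun setT (fun z : T => (expo (f z.1) z.2)^-1).
Proof.
rewrite (_ : (fun z => _) = fun z : T => expR (- ln (expo (f z.1) z.2))).
  apply: measurableT_comp => //; apply: measurableT_comp => //.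
  exact: measurableT_comp (@measurable_ln R) me2.
by apply/funext => z; rewrite expRN lnK// posrE expo_gt0.
Qed.
Let mg1 : measurable_fun setT (fun y => glik mu f y). Proof. exact: measurable_glik. Qed.
Let mg1i : measurable_fun setT (fun y => (glik mu f y)^-1).
Proof. by apply: measurable_inv_pos => // y; exact: glik_gt0. Qed.

Let me : measurable_fun setT e. Proof. exact: (measurableT_comp me2 mXY). Qed.
Let mei : measurable_fun setT (fun w => (e w)^-1).
Proof. exact: (measurableT_comp me2i mXY). Qed.
Let mg : measurable_fun setT g. Proof. exact: (measurableT_comp mg1 mY). Qed.
Let mgi : measurable_fun setT (fun w => (g w)^-1).
Proof. exact: (measurableT_comp mg1i mY). Qed.

Let energy : R := \int[mu]_x \sum_i f x i ^+ 2 / 2.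

Let int_e_log : (\int[P]_w (poslog (e w))%:E = energy%:E)%E.
Proof.
have mh : measurable_fun setT (fun z : T => (poslog (expo (f z.1) z.2))%:E).
  by apply/measurable_EFinP; exact: measurable_poslog.
have h0 (z : T) : (0 <= (poslog (expo (f z.1) z.2))%:E)%E.
  by rewrite lee_fin poslog_ge0// expo_gt0.
have := sw_law_XY M lambda mh h0; rewrite -/Xf -/Yf => ->.
rewrite /energy Rintegral_EFin; last exact: integrable_pobs.
apply: eq_integral => x _ /=; rewrite -EG_relent_expo EG_EFin; last exact: tame_relent_expo.
by apply: eq_integral => y _; rewrite -EFinM mul_poslog// expo_gt0.
Qed.

Let int_e_inv : (\int[P]_w ((e w)^-1)%:E = 1%E)%E.
Proof.
have mh : measurable_fun setT (fun z : T => ((expo (f z.1) z.2)^-1)%:E).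
  exact/measurable_EFinP.
have h0 (z : T) : (0 <= ((expo (f z.1) z.2)^-1)%:E)%E.
  by rewrite lee_fin invr_ge0 ltW// expo_gt0.
have := sw_law_XY M lambda mh h0; rewrite -/Xf -/Yf => ->.
rewrite -[RHS](integral_probability_cst mu); apply: eq_integral => x _ /=.
rewrite -[RHS](integral_probability_cst (noise (edge n))); apply: eq_integral => y _.
by rewrite -EFinM divff// gt_eqF// expo_gt0.
Qed.

Let int_g_log : (\int[P]_w (poslog (g w))%:E = (gent mu f)%:E)%E.
Proof.
have mh : measurable_fun setT (fun y => (poslog (glik mu f y))%:E).
  by apply/measurable_EFinP; exact: measurable_poslog.
have h0 y : (0 <= (poslog (glik mu f y))%:E)%E.
  by rewrite lee_fin poslog_ge0// glik_gt0.
have := integral_gY M lambda mh h0; rewrite -/Yf => ->.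
have [ri _] := relent_energy mf (integrable_pobs i2 var1 n l0).
rewrite [RHS]Rintegral_EFin; last first.
  apply: (integrable_bound _ _ ri); first exact: measurable_relent.
  by move=> y; rewrite ger0_norm ?relent_jensen// relent_ge0// glik_gt0.
by apply: eq_integral => y _; rewrite -EFinM mul_poslog// glik_gt0.
Qed.

Let int_g_inv : (\int[P]_w ((g w)^-1)%:E = 1%E)%E.
Proof.
have mh : measurable_fun setT (fun y => ((glik mu f y)^-1)%:E) by exact/measurable_EFinP.
have h0 y : (0 <= ((glik mu f y)^-1)%:E)%E.
  by rewrite lee_fin invr_ge0 ltW// glik_gt0.
have := integral_gY M lambda mh h0; rewrite -/Yf => ->.
rewrite -[RHS](integral_probability_cst (noise (edge n))); apply: eq_integral => y _.
by rewrite -EFinM divff// gt_eqF// glik_gt0.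
Qed.

Let i_el : P.-integrable setT (EFin \o (fun w => poslog (e w))).
Proof.
apply: (integrable_of_integral _ _ int_e_log); first exact: measurable_poslog.
by move=> w; exact: poslog_ge0.
Qed.
Let i_ei : P.-integrable setT (EFin \o (fun w => (e w)^-1)).
Proof. by apply: (integrable_of_integral _ _ int_e_inv) => // w; rewrite invr_ge0 ltW. Qed.
Let i_gl : P.-integrable setT (EFin \o (fun w => poslog (g w))).
Proof.
apply: (integrable_of_integral _ _ int_g_log); first exact: measurable_poslog.
by move=> w; exact: poslog_ge0.
Qed.
Let i_gi : P.-integrable setT (EFin \o (fun w => (g w)^-1)).
Proof. by apply: (integrable_of_integral _ _ int_g_inv) => // w; rewrite invr_ge0 ltW. Qed.

Let lnrhoE w : ln (rho (Xf w, Yf w)) = (poslog (e w) - (e w)^-1) - (poslog (g w) - (g w)^-1).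
Proof.
rewrite /rho -/(e w) -/(g w) ln_div ?posrE// /poslog.
by move: (ln _) (ln _) (_^-1) (_^-1) => a b c d; ring.
Qed.

Let i_ln : P.-integrable setT (EFin \o (fun w => ln (rho (Xf w, Yf w)))).
Proof.
rewrite (_ : (fun w => _) = fun w => (poslog (e w) - (e w)^-1) - (poslog (g w) - (g w)^-1)).
  by apply: integrable_sub; exact: integrable_sub.
by apply/funext => w; exact: lnrhoE.
Qed.

(** The logarithm of the density ratio is a difference of two logarithms, each written through
    [poslog] and an inverse. The expected inverses are both 1 and cancel, leaving energy minus
    entropy. *)
Lemma sw_informationE : sw_information M lambda = (energy - gent mu f)%:E.
Proof.
rewrite /sw_information /mutual_information /kl_divergence -/P -/Xf -/Yf -/J -/Q.
rewrite asboolT; last exact: joint_dominated.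
have mRN := measurable_int _ (@Radon_Nikodym_integrable _ _ R
  (charge_of_finite_measure J) Q joint_dominated).
have mln : measurable_fun setT (fun z => (ln (rho z))%:E).
  by apply/measurable_EFinP; exact: measurableT_comp (@measurable_ln R) mrho.
transitivity (\int[J]_z (ln (rho z))%:E)%E.
  apply: ae_eq_integral => //.
    by apply: measurable_lne_fin mRN => z; apply: Radon_Nikodym_fin_num; exact: joint_dominated.
  (* The derivative is known almost everywhere for the product law only; absolute continuity
     transfers this to the joint law. *)
  apply: (null_dominates_ae_eq measurableT joint_dominated).
  have [A [mA A0 HA]] := joint_Radon_Nikodym.
  exists A; split => // z /= H; apply: HA => /= H'; apply: H => _.
  by rewrite H'// lne_EFin.
rewrite (@integral_pushforward _ _ _ _ _ _ (measurable_pair_rv _ _) P setT _ mln)//.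
rewrite preimage_setT.
transitivity (\int[P]_w (ln (rho (Xf w, Yf w)))%:E)%E; first by [].
rewrite -Rintegral_EFin//; congr EFin.
transitivity (\int[P]_w ((poslog (e w) - (e w)^-1) - (poslog (g w) - (g w)^-1))).
  by apply: eq_Rintegral => w _; exact: lnrhoE.
rewrite (RintegralB measurableT (integrable_sub i_el i_ei) (integrable_sub i_gl i_gi)).
rewrite (RintegralB measurableT i_el i_ei) (RintegralB measurableT i_gl i_gi).
by rewrite /Rintegral int_e_log int_e_inv int_g_log int_g_inv /=; ring.
Qed.

Lemma sw_information_formula :
  sw_information M lambda = (lambda * (n%:R - 1) / 4 - PhiP P0 id n lambda)%:E.
Proof.
rewrite sw_informationE /PhiP; congr (_ - _)%:E.
have nR : 0 < n%:R :> R by rewrite ltr0n.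
have fE i x : f x i ^+ 2 / 2 = lambda / n%:R / 2 * (tnth x (val i).1 * tnth x (val i).2) ^+ 2.
  by rewrite /f /pobs [in LHS]exprMn sqr_sqrtr ?divr_ge0// mulrAC.
rewrite /energy Rintegral_sumr; last first.
  move=> i; under eq_fun do rewrite fE.
  by apply: integrable_scale; apply: integrable_pair2 => //; exact: edge_neq.
transitivity (\sum_(i : edge n) lambda / n%:R / 2 * 1).
  apply: eq_bigr => i _; under eq_Rintegral do rewrite fE.
  rewrite RintegralZl//; last by apply: integrable_pair2 => //; exact: edge_neq.
  by rewrite Rintegral_pair2//; exact: edge_neq.
rewrite (@sum_edge R n (fun _ _ => lambda / n%:R / 2 * 1))// !sumr_const !card_ord.
rewrite -mulrnA -(mulr_natr _ (n * n)) -(mulr_natr _ n) natrM.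
by field; rewrite gt_eqF.
Qed.

End information.

(** * The replica potential as a scalar channel entropy *)

Section replica_potential.
Context {R : realType}.
Variable P0 : probability R R.
Notation gauss := (@gauss R).
Hypothesis i2 : P0.-integrable setT (EFin \o (fun x : R => x ^+ 2)).

Variable s : R.
Let F (x : R) (_ : unit) : R := s * x.
Let ell (t : R) : R := \int[P0]_x expR (s * x * t - (s * x) ^+ 2 / 2).

Let mF : measurable_obs F. Proof. by move=> i; exact: measurable_funM. Qed.

Let expoE (x : R) y : expo (F x) y = expR (s * x * co y tt - (s * x) ^+ 2 / 2).
Proof. by rewrite /expo sum_unit. Qed.

Let glikE y : glik P0 F y = ell (co y tt).
Proof. by apply: eq_Rintegral => x _; exact: expoE. Qed.

Let ell_gt0 t : 0 < ell t.
Proof.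
by have := @glik_gt0 R _ _ P0 _ F (mk (fun=> t)) mF; rewrite glikE co_mk.
Qed.

Let mexp : measurable_fun setT (fun z : R * R => expR (s * z.2 * z.1 - (s * z.2) ^+ 2 / 2)).
Proof.
apply: measurableT_comp => //; apply: measurable_funB.
  by apply: measurable_funM => //; apply: measurable_funM.
by apply: measurable_funM => //; apply: measurable_funX; apply: measurable_funM.
Qed.

Let mell : measurable_fun setT ell.
Proof. exact: (measurable_Rintegral_section P0 mexp). Qed.

Let mellV : measurable_fun setT (fun t => (ell t)^-1).
Proof.
rewrite (_ : (fun t => _) = fun t => expR (- ln (ell t))).
  apply: measurableT_comp => //; apply: measurableT_comp => //.
  exact: measurableT_comp (@measurable_ln R) mell.
by apply/funext => t; rewrite expRN lnK// posrE.
Qed.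

Lemma noise_unit (k : R -> \bar R) : measurable_fun setT k -> (forall x, 0 <= k x)%E ->
  (\int[noise unit]_y k (co y tt) = \int[gauss]_x k x)%E.
Proof.
move=> mk' k0.
have bu (G : unit -> \bar R) : (\prod_i G i = G tt)%E.
  by rewrite (bigD1 tt)//= big1 ?mule1// => -[].
have := @noise_prod R unit (fun=> k) (fun=> mk') (fun=> k0).
by rewrite bu => <-; apply: eq_integral => y _; rewrite bu.
Qed.

(** Given X = x the scalar data are noise shifted by s x; removing the shift and integrating over
    the prior produces the density [ell]. *)
Lemma integral_replica (k : R -> R) : measurable_fun setT k -> (forall t, 0 <= k t) ->
  (\int[(P0 \x normal_prob 0 1)%E]_z (k (unborel z.2 + s * z.1))%:E =
   \int[gauss]_t (ell t * k t)%:E)%E.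
Proof.
move=> mk' k0.
have mh : measurable_fun setT (fun z : R * measurableTypeR R => (k (unborel z.2 + s * z.1))%:E).
  apply/measurable_EFinP; apply: measurableT_comp mk' _; apply: measurable_funD.
    by apply: measurableT_comp; [exact: measurable_unborel|exact: measurable_snd].
  by apply: measurable_funM => //; exact: measurable_fst.
have h0 (z : R * measurableTypeR R) : (0 <= (k (unborel z.2 + s * z.1))%:E)%E by rewrite lee_fin.
rewrite (@fubini_tonelli1 _ _ _ _ R P0 (normal_prob 0 1) _ mh h0) /fubini_F/=.
transitivity (\int[P0]_x \int[gauss]_t ((expR (s * x * t - (s * x) ^+ 2 / 2))%:E * (k t)%:E))%E.
  apply: eq_integral => x _.
  have mkx : measurable_fun setT (fun t : R => (k (t + s * x))%:E).
    by apply/measurable_EFinP; apply: measurableT_comp mk' _; exact: measurable_funD.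
  have := @integral_gaussE R (fun t : R => (k (t + s * x))%:E) mkx.
  move=> /(_ (fun t => k0 _)) <-.
  rewrite (gauss_shift (s * x) (h := fun t => (k t)%:E))//.
  exact/measurable_EFinP.
have mG : measurable_fun setT (fun z : R * R =>
    ((expR (s * z.1 * z.2 - (s * z.1) ^+ 2 / 2))%:E * (k z.2)%:E)%E).
  apply: emeasurable_funM; apply/measurable_EFinP.
    apply: measurableT_comp => //; apply: measurable_funB.
      by apply: measurable_funM => //; apply: measurable_funM.
    by apply: measurable_funM => //; apply: measurable_funX; apply: measurable_funM.
  exact: measurableT_comp mk' measurable_snd.
have G0 (z : R * R) : (0 <= (expR (s * z.1 * z.2 - (s * z.1) ^+ 2 / 2))%:E * (k z.2)%:E)%E.
  by rewrite mule_ge0// lee_fin.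
rewrite (@fubini_tonelli _ _ _ _ R P0 gauss _ mG G0).
apply: eq_integral => t _ /=; rewrite EFinM /ell Rintegral_EFin; last first.
  have := integrable_expo P0 (mk (fun _ : unit => t)) mF.
  by under [X in EFin \o X]eq_fun do rewrite expoE co_mk.
rewrite ge0_integralZr//; last by rewrite lee_fin.
by apply/measurable_EFinP; exact: (mfun_section1 t mexp).
Qed.


Let energy_i : P0.-integrable setT (EFin \o (fun x => \sum_i F x i ^+ 2 / 2)).
Proof.
rewrite (_ : EFin \o _ = EFin \o (fun x : R => s ^+ 2 / 2 * x ^+ 2)).
  exact: integrable_scale.
by apply/funext => x; rewrite /= sum_unit /F exprMn mulrAC.
Qed.

(** The expectation of the log-likelihood under the law of the data is the relative entropy; the
    logarithm is again split as [poslog] minus an inverse plus 1. *)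
Lemma integral_ln_replica :
  \int[(P0 \x normal_prob 0 1)%E]_z ln (ell (unborel z.2 + s * z.1)) = gent P0 F.
Proof.
pose Z : probability _ R := (P0 \x normal_prob 0 1)%E.
pose w (z : R * measurableTypeR R) := ell (unborel z.2 + s * z.1).
have mw (k : R -> R) : measurable_fun setT k ->
    measurable_fun setT (fun z : R * measurableTypeR R => k (unborel z.2 + s * z.1)).
  move=> mk'; apply: measurableT_comp mk' _; apply: measurable_funD.
    by apply: measurableT_comp; [exact: measurable_unborel|exact: measurable_snd].
  by apply: measurable_funM => //; exact: measurable_fst.
have mpl : measurable_fun setT (fun t => poslog (ell t)) by exact: measurable_poslog.
have E1 : (\int[Z]_z (poslog (w z))%:E = (gent P0 F)%:E)%E.
  rewrite /Z (integral_replica (k := fun t => poslog (ell t)) mpl) => [|t]; last exact: poslog_ge0.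
  have [ri _] := relent_energy mF energy_i.
  have mr : measurable_fun setT (fun t => (relent (ell t))%:E).
    by apply/measurable_EFinP; exact: measurable_relent.
  rewrite [RHS]Rintegral_EFin; last first.
    apply: (integrable_bound _ _ ri); first by apply: measurable_relent; exact: measurable_glik.
    by move=> y; rewrite ger0_norm ?relent_jensen// relent_ge0// glik_gt0.
  under [LHS]eq_integral do rewrite mul_poslog//.
  rewrite -(noise_unit mr) => [|t]; last by rewrite lee_fin relent_ge0.
  by apply: eq_integral => y _; rewrite glikE.
have E2 : (\int[Z]_z ((w z)^-1)%:E = 1%:E)%E.
  rewrite /Z (integral_replica (k := fun t => (ell t)^-1) mellV) => [|t]; last first.
    by rewrite invr_ge0 ltW.
  rewrite -[RHS](integral_probability_cst gauss); apply: eq_integral => t _.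
  by rewrite divff// gt_eqF.
have i1 : Z.-integrable setT (EFin \o (fun z => poslog (w z))).
  apply: (integrable_of_integral _ _ E1); first exact: mw mpl.
  by move=> z; rewrite poslog_ge0// ell_gt0.
have i3 : Z.-integrable setT (EFin \o (fun z => (w z)^-1)).
  apply: (integrable_of_integral _ _ E2); first exact: mw mellV.
  by move=> z; rewrite invr_ge0 ltW// ell_gt0.
have c1 : Z.-integrable setT (EFin \o (fun=> 1)) by exact: finite_measure_integrable_cst.
transitivity (\int[Z]_z ((poslog (w z) - (w z)^-1) + 1)).
  by apply: eq_Rintegral => z _; rewrite /poslog -/(w z); ring.
rewrite (RintegralD measurableT (integrable_sub i1 i3) c1) (RintegralB measurableT i1 i3).
by rewrite RintegralP_cst /Rintegral E1 E2 /= subrK.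
Qed.

End replica_potential.

Lemma rs_potentialE {R : realType} (P0 : probability R R) (lambda q : R) :
  P0.-integrable setT (EFin \o (fun x : R => x ^+ 2)) -> 0 <= lambda -> 0 <= q ->
  rs_potential P0 lambda q = - (lambda / 4) * q ^+ 2 + psiP P0 id (lambda * q).
Proof.
move=> i2 l0 q0; rewrite /rs_potential; congr (_ + _).
rewrite /psiP -(integral_ln_replica i2); apply: eq_Rintegral => z _; congr ln.
apply: eq_Rintegral => x _; congr expR; rewrite /unborel exprMn.
have h0 : 0 <= lambda * q by rewrite mulr_ge0.
have E : Num.sqrt (lambda * q) ^+ 2 = lambda * q by exact: sqr_sqrtr.
set r := Num.sqrt (lambda * q) in E *.
rewrite (_ : lambda / 2 * q = r ^+ 2 / 2); last by rewrite E mulrAC.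
rewrite (_ : lambda * q * x * z.1 = r ^+ 2 * x * z.1); last by rewrite E.
by move: r {E} => r; ring.
Qed.

Lemma max0_lipschitz (R : realDomainType) (x y : R) :
  `|Num.max x 0 - Num.max y 0| <= `|x - y|.
Proof.
have [x0|x0] := ltP x 0; have [y0|y0] := ltP y 0.
- by rewrite subrr normr0.
- by rewrite sub0r normrN (ger0_norm y0) ler0_norm; move: x0 y0; clear; lra.
- by rewrite subr0 (ger0_norm x0) ger0_norm; move: x0 y0; clear; lra.
- by [].
Qed.

(** * Maximizers of the potential in the variable g = lambda q *)

Section maximizers.
Context {R : realType}.
Variable psi : R -> R.
Hypothesis psi_bounds : forall h : R, 0 <= h -> 0 <= psi h <= h / 2.
Hypothesis psi_cont : forall h h' t : R, 0 <= h -> 0 <= h' -> 0 < t ->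
  `|psi h' - psi h| <= t / 2 * Num.max h h' + t^-1 * `|h' - h|.

(** In the variable g = l q the parameter l enters only through the factor 1/(4 l), so values at
    different l compare exactly; see [gain_shift]. *)
Definition gain (l g : R) : R := psi g - g ^+ 2 / (4 * l).

Definition maximizes (l g : R) : Prop := 0 <= g /\ forall g', 0 <= g' -> gain l g' <= gain l g.

Lemma psi0 : psi 0 = 0.
Proof. by apply/eqP; rewrite eq_le; have := psi_bounds (lexx 0); rewrite mul0r andbC. Qed.

Lemma continuous_psi : continuous (fun x : R => psi (Num.max x 0)).
Proof.
move=> x; apply/cvgrPdist_le => e e0.
have m0 (y : R) : 0 <= Num.max y 0 by rewrite le_max lexx orbT.
have M0 : 0 < Num.max x 0 + 1 by rewrite ltr_wpDl.
(* This t makes the first error term at most e/2 on the unit neighbourhood of x; the distance to x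
   then takes care of the second. *)
pose t := e / (Num.max x 0 + 1); have t0 : 0 < t by rewrite divr_gt0.
have d0 : 0 < Num.min 1 (t * (e / 2)) by rewrite lt_min ltr01 mulr_gt0 ?divr_gt0.
near=> y.
have xy : `|x - y| <= Num.min 1 (t * (e / 2)).
  by near: y; apply: cvgr_dist_le => //; exact: cvg_id.
have lip : `|Num.max x 0 - Num.max y 0| <= `|x - y|.
  exact: max0_lipschitz.
rewrite distrC; apply: (le_trans (psi_cont (m0 x) (m0 y) t0)).
have mM : Num.max (Num.max x 0) (Num.max y 0) <= Num.max x 0 + 1.
  have x1 : `|x - y| <= 1 by apply: (le_trans xy); rewrite ge_min lexx.
  rewrite ge_max; apply/andP; split; first by rewrite lerDl.
  have := le_trans lip x1; rewrite ler_norml; move: (Num.max x 0) (Num.max y 0) => a b.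
  lra.
have h1 : t / 2 * Num.max (Num.max x 0) (Num.max y 0) <= e / 2.
  apply: (@le_trans _ _ (t / 2 * (Num.max x 0 + 1))).
    by rewrite ler_wpM2l// divr_ge0// ltW.
  by rewrite /t mulrAC divfK ?gt_eqF.
have h2 : t^-1 * `|Num.max y 0 - Num.max x 0| <= e / 2.
  rewrite distrC ler_pdivrMl//; apply: (le_trans lip); apply: (le_trans xy).
  by rewrite ge_min lexx orbT.
by rewrite [leRHS]splitr; exact: lerD.
Unshelve. all: by end_near. Qed.

(** Since psi(g) <= g/2, the gain is at most its value 0 at the origin once g > 2 l, so the extreme
    value theorem on [0, 2 l] suffices. *)
Lemma maximizer_exists l : 0 < l -> exists g, maximizes l g.
Proof.
move=> l0; have l20 : 0 <= 2 * l by rewrite mulr_ge0// ltW.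
pose u x := psi (Num.max x 0) - x ^+ 2 / (4 * l).
have cu : continuous u.
  move=> x; apply: cvgB; first exact: continuous_psi.
  by apply: cvgMl; exact: exprn_continuous.
have [c] := EVT_max l20 (continuous_subspaceT cu).
rewrite in_itv/= => /andP[c0 c2] cmax; exists c; split => // g g0.
have uE x : 0 <= x -> u x = gain l x by move=> x0; rewrite /u max_l.
rewrite -!uE//; have [g2|g2] := leP g (2 * l).
  by apply: cmax; rewrite in_itv/= g0 g2.
apply: (@le_trans _ _ (u 0)); last by apply: cmax; rewrite in_itv/= lexx l20.
rewrite !uE// /gain psi0 expr0n/= mul0r subrr.
have /andP[_ H] := psi_bounds g0; rewrite subr_le0 (le_trans H)//.
by rewrite ler_pdivlMr ?mulr_gt0//; move: g2 g0; clear -l0; nra.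
Qed.

Lemma gain_shift l l' g : 0 < l -> 0 < l' ->
  gain l' g = gain l g + g ^+ 2 / (4 * l * l') * (l' - l).
Proof. by move=> l0 l0'; rewrite /gain; move: (psi g) => p; field; rewrite !gt_eqF. Qed.

Lemma maximizes_tangent l l' g g' : 0 < l -> 0 < l' -> maximizes l g -> maximizes l' g' ->
  gain l g + g ^+ 2 / (4 * l * l') * (l' - l) <= gain l' g'.
Proof. by move=> l0 l0' [g0 _] [_ H]; rewrite -gain_shift//; exact: H. Qed.

(** Adding the two tangent inequalities leaves a positive multiple of g'^2 - g^2 that must be
    nonnegative. *)
Lemma maximizes_mono l l' g g' : 0 < l -> l < l' -> maximizes l g -> maximizes l' g' -> g <= g'.
Proof.
move=> l0 ll mg mg'; have l0' : 0 < l' by apply: lt_trans ll.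
have H1 := maximizes_tangent l0 l0' mg mg'.
have H2 := maximizes_tangent l0' l0 mg' mg.
have [g0 _] := mg; have [g0' _] := mg'.
have E : 4 * l' * l = 4 * l * l' by ring.
rewrite E in H2.
have k0 : 0 < (l' - l) / (4 * l * l') by rewrite divr_gt0 ?subr_gt0// !mulr_gt0.
have : g ^+ 2 * ((l' - l) / (4 * l * l')) <= g' ^+ 2 * ((l' - l) / (4 * l * l')).
  have e1 : g ^+ 2 / (4 * l * l') * (l' - l) = g ^+ 2 * ((l' - l) / (4 * l * l')) by ring.
  have e2 : g' ^+ 2 / (4 * l * l') * (l - l') = - (g' ^+ 2 * ((l' - l) / (4 * l * l'))) by ring.
  rewrite e1 in H1; rewrite e2 in H2.
  by move: (gain _ _) (gain _ _) (_ * _) (_ * _) H1 H2 => a b c d; clear; lra.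
by rewrite ler_pM2r// ler_sqr.
Qed.

Lemma slope_close (l0 G0 e : R) : 0 < l0 -> 0 < e -> exists2 d, 0 < d & forall G l : R,
  `|G - G0| < d -> `|l - l0| < d -> 0 < l /\ `|G ^+ 2 / (4 * l0 * l) - G0 ^+ 2 / (4 * l0 * l0)| <= e.
Proof.
move=> l0p e0.
have C : z.1 ^+ 2 / (4 * l0 * z.2) @[z --> (G0, l0)] --> G0 ^+ 2 / (4 * l0 * l0).
  apply: cvgM.
    by rewrite expr2; under eq_fun do rewrite expr2; apply: cvgM; exact: cvg_fst.
  apply: cvgV; first by rewrite !mulf_neq0// gt_eqF.
  by apply: cvgMr; exact: cvg_snd.
move/cvgrPdist_le : C => /(_ e e0) /nbhs_ballP[d /= d0 H].
exists (Num.min d l0); first by rewrite lt_min d0.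
move=> G l; rewrite !lt_min => /andP[Gd _] /andP[ld ll]; split.
  by move: ll; rewrite ltr_norml => /andP[+ _]; clear; lra.
rewrite distrC; apply: (H (G, l)); split => /=.
  by rewrite /ball /= distrC.
by rewrite /ball /= distrC.
Qed.

End maximizers.

(** * Jumps of the maximizer and derivative of the maximum *)

Section selection.
Context {R : realType}.
Variable psi : R -> R.
Variable Gam : R -> R.
Hypothesis GamP : forall l : R, 0 < l -> maximizes psi l (Gam l).

(** The monotone function Gam has no jump at l. *)
Definition stable (l : R) : Prop :=
  forall e : R, 0 < e -> exists l1 l2 : R, [/\ 0 < l1, l1 < l, l < l2 & Gam l2 - Gam l1 < e].

Lemma Gam_le (l l' : R) : 0 < l -> l < l' -> Gam l <= Gam l'.
Proof.
move=> l0 ll; apply: (maximizes_mono l0 ll (GamP l0)).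
by apply: GamP; exact: lt_trans ll.
Qed.

(** Every jump contains a rational that separates the values on the left from those on the right,
    and a rational cannot serve two points, because of the values between them. *)
Lemma unstable_countable : countable [set l : R | 0 < l /\ ~ stable l].
Proof.
pose S (r : rat) : set R := [set l : R | 0 < l /\ forall l1 l2 : R,
  0 < l1 -> l1 < l -> l < l2 -> Gam l1 < ratr r /\ ratr r < Gam l2].
have S1 r l l' : S r l -> S r l' -> l < l' -> False.
  move=> [l0 H] [l0' H'] ll.
  have [_ h1] := H (l / 2) ((l + l') / 2) ltac:(lra) ltac:(lra) ltac:(lra).
  have [h2 _] := H' ((l + l') / 2) (l' + 1) ltac:(lra) ltac:(lra) ltac:(lra).
  by have := lt_trans h1 h2; rewrite ltxx.
apply: (@sub_countable _ _ _ (\bigcup_(r in [set: rat]) S r)); last first.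
  apply: bigcup_countable; first exact: countableP.
  move=> r _; apply: finite_set_countable.
  have [[l Sl]|N] := pselect (exists l, S r l).
    apply: (@sub_finite_set _ _ [set l]); last exact: finite_set1.
    move=> l' Sl'; apply/eqP; rewrite eq_le !leNgt.
    by apply/andP; split; apply/negP; [exact: S1 Sl Sl'|exact: S1 Sl' Sl].
  apply: (@sub_finite_set _ _ set0); last exact: finite_set0.
  by move=> l' Sl'; apply: N; exists l'.
apply: subset_card_le => l [l0 /existsNP[e /not_implyP[e0 N]]].
have gap (l1 l2 : R) : 0 < l1 -> l1 < l -> l < l2 -> Gam l1 + e <= Gam l2.
  move=> h1 h2 h3; rewrite leNgt; apply/negP => lt; apply: N.
  by exists l1, l2; split => //; rewrite ltrBlDl.
pose B := [set Gam l1 | l1 in [set l1 : R | 0 < l1 /\ l1 < l]].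
have B0 : B !=set0 by exists (Gam (l / 2)), (l / 2) => //=; split; lra.
have ubB (l2 : R) : l < l2 -> ubound B (Gam l2 - e).
  by move=> ll _ [l1 /= [h1 h2] <-]; rewrite lerBrDr; exact: gap.
have supB : has_sup B by split => //; exists (Gam (l + 1) - e); apply: ubB; rewrite ltrDl.
have [r] := @rat_in_itvoo R (sup B) (sup B + e) ltac:(by rewrite ltrDl).
rewrite in_itv/= => /andP[r1 r2]; exists r => //; split => // l1 l2 h1 h2 h3; split.
  by apply: le_lt_trans r1; apply: sup_upper_bound => //; exists l1.
by apply: (lt_le_trans r2); rewrite -lerBrDr; apply: ge_sup => //; exact: ubB.
Qed.

(** By monotonicity every maximizer at l lies between Gam l1 and Gam l2 for l1 < l < l2, and this
    gap is arbitrarily small. *)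
Lemma stable_unique (l g : R) : 0 < l -> stable l -> maximizes psi l g -> g = Gam l.
Proof.
move=> l0 sl mg; apply/eqP/negPn/negP => ne.
have d0 : 0 < `|g - Gam l| by rewrite normr_gt0 subr_eq0.
have [l1 [l2 [h1 h2 h3 h4]]] := sl _ d0.
have m1 := maximizes_mono h1 h2 (GamP h1) mg.
have m2 := maximizes_mono l0 h3 mg (GamP (lt_trans l0 h3)).
have m3 := Gam_le h1 h2; have m4 := Gam_le l0 h3.
have : `|g - Gam l| <= Gam l2 - Gam l1.
  rewrite ler_norml; move: m1 m2 m3 m4.
  by move: (Gam _) (Gam _) (Gam _) => a b c; clear; lra.
by move/(lt_le_trans h4); rewrite ltxx.
Qed.

Definition max_gain (l : R) : R := gain psi l (Gam l).

(** Differentiability with derivative c in explicit form; positivity of the nearby points is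
    included because the maximizers are only available there. *)
Definition linearizes (F : R -> R) (l c : R) : Prop := forall e : R, 0 < e ->
  exists2 d : R, 0 < d & forall l' : R, `|l' - l| < d ->
    0 < l' /\ `|F l' - F l - c * (l' - l)| <= e * `|l' - l|.

Lemma slope_squeeze (A B C D e h : R) : `|A - C| <= e -> `|B - C| <= e ->
  A * h <= D -> D <= B * h -> `|D - C * h| <= e * `|h|.
Proof.
rewrite !ler_norml => /andP[a1 a2] /andP[b1 b2] h1 h2.
have [h0|h0] := leP 0 h.
  by rewrite (ger0_norm h0); apply/andP; split; nra.
by rewrite (ltr0_norm h0); apply/andP; split; nra.
Qed.

(** An envelope argument: the tangents from l and from l' squeeze the increment between two slopes,
    which both tend to the stated one because Gam has no jump at l. *)
Lemma stable_linearizes (l : R) : 0 < l -> stable l ->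
  linearizes max_gain l (Gam l ^+ 2 / (4 * l * l)).
Proof.
move=> l0 sl e e0.
have [d d0 Hd] := slope_close (Gam l) l0 e0.
have [l1 [l2 [h1 h2 h3 h4]]] := sl _ d0.
exists (Num.min d (Num.min (l - l1) (l2 - l))).
  by rewrite !lt_min d0 !subr_gt0 h2 h3.
move=> l'; rewrite !lt_min => /and3P[k1 k2 k3].
have [g1 g2] : l1 < l' /\ l' < l2.
  by move: k2 k3; rewrite !ltr_norml => /andP[? ?] /andP[? ?]; split; lra.
have l0' := lt_trans h1 g1; split => //.
have m1 := Gam_le h1 g1; have m2 := Gam_le l0' g2.
have m3 := Gam_le h1 h2; have m4 := Gam_le l0 h3.
have cl : `|Gam l' - Gam l| < d.
  apply: le_lt_trans h4; rewrite ler_norml; move: m1 m2 m3 m4.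
  by move: (Gam l') (Gam _) (Gam _) (Gam _) => a b c f; clear; lra.
have [_ s1] := Hd (Gam l') l' cl k1.
have [_ s2] := Hd (Gam l) l' ltac:(by rewrite subrr normr0) k1.
apply: (slope_squeeze s2 s1).
  by rewrite lerBrDl; exact: (maximizes_tangent l0 l0' (GamP l0) (GamP l0')).
have := maximizes_tangent l0' l0 (GamP l0') (GamP l0).
rewrite (_ : 4 * l' * l = 4 * l * l'); last by ring.
rewrite -/(max_gain l) -/(max_gain l') -(opprB l' l) mulrN.
move: (max_gain l) (max_gain l') (_ * (l' - l)) => a b k; clear; lra.
Qed.

End selection.

Lemma linearizes_derivable (R : realType) (F : R -> R) (l c : R) :
  linearizes F l c -> derivable F l 1.
Proof.
move=> H; apply/cvg_ex; exists c; apply/cvgrPdist_le => e e0.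
have [d d0 Hd] := H e e0; near=> h.
have h0 : h != 0 by near: h; exact: nbhs_dnbhs_neq.
have hd : `|h| < d by near: h; apply: dnbhs0_lt.
have [|_] := Hd (h + l); first by rewrite addrK.
rewrite addrK => B; rewrite /= [h *: 1]mulr1 distrC.
rewrite -(ler_pM2r (_ : 0 < `|h|)) ?normr_gt0// -normrM.
by rewrite mulrBl [h^-1 *: _]mulrC divfK.
Unshelve. all: by end_near. Qed.

(** Griffiths' argument: subgradients at l are squeezed between difference quotients at l - h and l
    + h; these converge to those of the limit, which are close to c. *)
Lemma tangent_limit (R : realType) (P : nat -> R -> R) (D : nat -> R) (F : R -> R)
    (l c : R) : 0 < l ->
  (forall l', 0 < l' -> P n l' @[n --> \oo] --> F l') ->
  (forall n l', 0 < l' -> (l' - l) * D n <= P n l' - P n l) ->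
  linearizes F l c -> D n @[n --> \oo] --> c.
Proof.
move=> l0 PF tan lin; apply/cvgrPdist_le => e e0.
have e20 : 0 < e / 2 by rewrite divr_gt0.
have [d d0 Hd] := lin _ e20.
pose h := d / 2; have h0 : 0 < h by rewrite divr_gt0.
have hd : h < d by rewrite /h; move: d0; clear; lra.
have [p1 s1] := Hd (l + h) ltac:(by rewrite addrC addKr gtr0_norm).
have [p2 s2] := Hd (l - h) ltac:(by rewrite addrC addKr normrN gtr0_norm).
have eh : 0 < e / 2 * h by rewrite mulr_gt0.
have C l' : 0 < l' -> \forall n \near \oo,
    `|(F l' - F l) - (P n l' - P n l)| <= e / 2 * h.
  by move=> l0'; apply: (iffLR (cvgrPdist_le _ _) (cvgB (PF _ l0') (PF _ l0))).
near=> n.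
have b1 : `|(F (l + h) - F l) - (P n (l + h) - P n l)| <= e / 2 * h.
  by near: n; exact: C.
have b2 : `|(F (l - h) - F l) - (P n (l - h) - P n l)| <= e / 2 * h.
  by near: n; exact: C.
have t1 := tan n _ p1; have t2 := tan n _ p2.
move: s1 s2 b1 b2 t1 t2; rewrite ![l + _ - l]addrC !addKr normrN (gtr0_norm h0).
move: (F (l + h)) (F (l - h)) (F l) (P n (l + h)) (P n (l - h)) (P n l) (D n).
move=> f1 f2 f p q r D'; rewrite !ler_norml.
move=> /andP[a1 a2] /andP[a3 a4] /andP[a5 a6] /andP[a7 a8] a9 a10.
have u1 : h * D' <= h * (c + e).
  by move: a1 a2 a3 a4 a5 a6 a7 a8 a9 a10; clear; lra.
have u2 : h * (c - e) <= h * D'.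
  by move: a1 a2 a3 a4 a5 a6 a7 a8 a9 a10; clear; lra.
move: u1 u2; rewrite !ler_pM2l// => u1 u2.
by apply/andP; split; move: u1 u2; clear; lra.
Unshelve. all: by end_near. Qed.

Lemma cvg_inv_subn (R : realType) (a : R) : (n%:R - a)^-1 @[n --> \oo] --> 0.
Proof.
apply/cvgrPdist_le => e e0.
have [N HN] := archimedean_mul (1 + a * e) e0.
exists N => // n /= Nn; have := HN n Nn; rewrite -lerBrDr -mulrBl => H.
have p0 : 0 < n%:R - a by rewrite -(pmulr_lgt0 _ e0); apply: lt_le_trans H.
by rewrite sub0r normrN gtr0_norm ?invr_gt0// -[leLHS]mul1r ler_pdivrMr// mulrC.
Qed.

(** * Limits of information and error in terms of the optimal gain *)

Section replica_symmetric.
Context {R : realType} (P0 : probability R R).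
Hypothesis i2 : P0.-integrable setT (EFin \o (fun x : R => x ^+ 2)).
Hypothesis var1 : \int[P0]_x x ^+ 2 = 1.

Local Notation psi := (psiP P0 id).

Lemma rs_potential_gain (l q : R) : 0 < l -> 0 <= q ->
  rs_potential P0 l q = gain psi l (l * q).
Proof.
move=> l0 q0; rewrite rs_potentialE ?(ltW l0)// /gain.
by move: (psiP _ _ _) => p; field; rewrite gt_eqF.
Qed.

Lemma is_maximizer_maximizes (l q : R) : 0 < l ->
  is_maximizer P0 l q <-> maximizes psi l (l * q).
Proof.
move=> l0; split=> -[q0 H].
  split=> [|g g0]; first by rewrite mulr_ge0// ltW.
  have := H (g / l) (divr_ge0 g0 (ltW l0)).
  by rewrite !rs_potential_gain ?divr_ge0 ?(ltW l0)// mulrCA divff ?mulr1// gt_eqF.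
have q1 : 0 <= q by rewrite -(pmulr_rge0 _ l0).
split; first exact: q1.
move=> q' q'0; rewrite (rs_potential_gain l0 q'0) (rs_potential_gain l0 q1).
by apply: H; rewrite (mulr_ge0 (ltW l0)).
Qed.

Lemma rs_sup_gain (l g : R) : 0 < l -> maximizes psi l g -> rs_sup P0 l = gain psi l g.
Proof.
move=> l0 [g0 H].
have gE : gain psi l g = rs_potential P0 l (g / l).
  by rewrite rs_potential_gain ?divr_ge0 ?(ltW l0)// mulrCA divff ?mulr1// gt_eqF.
have ub : ubound [set rs_potential P0 l q | q in [set q : R | 0 <= q]] (gain psi l g).
  move=> _ [q /= q0 <-]; rewrite rs_potential_gain//.
  by apply: H; rewrite mulr_ge0// ltW.
rewrite /rs_sup; move: (rs_potential P0 l) (gain _ l g) gE ub => F G gE ub.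
apply/eqP; rewrite eq_le; apply/andP; split.
  by apply: ge_sup => //; exists (F 0), 0 => /=.
apply: ub_le_sup; first by exists G.
by exists (g / l); rewrite /= ?gE// divr_ge0// ltW.
Qed.

Lemma maximizer_selection :
  exists Gam : R -> R, forall l, 0 < l -> maximizes psi l (Gam l).
Proof.
have H (l : R) : exists g, 0 < l -> maximizes psi l g.
  have [l0|l0] := ltP 0 l; last by exists 0.
  have [g Hg] := maximizer_exists (@psiP_bounds _ _ i2 var1) (@psiP_continuity _ _ i2 var1) l0.
  by exists g.
by have [Gam GamP] := choice H; exists Gam.
Qed.

Variable Gam : R -> R.
Hypothesis GamP : forall l, 0 < l -> maximizes psi l (Gam l).

Local Notation phi := (max_gain psi Gam).

Lemma is_qstar_stable (l : R) : 0 < l -> stable Gam l -> is_qstar P0 l (Gam l / l).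
Proof.
move=> l0 sl; have ln : l != 0 by rewrite gt_eqF.
split; first by apply/is_maximizer_maximizes; rewrite // mulrC divfK//; exact: GamP.
move=> q /is_maximizer_maximizes -/(_ l0) /(stable_unique GamP l0 sl) <-.
by rewrite mulrC mulKf.
Qed.

Lemma linearizes_rs_sup (l c : R) : linearizes phi l c -> linearizes (rs_sup P0) l c.
Proof.
move=> H e e0; have [d d0 Hd] := H e e0; exists d => // l' ll.
have [l0 _] := Hd l ltac:(by rewrite subrr normr0).
have [l0' B] := Hd l' ll; split => //.
by rewrite (rs_sup_gain l0 (GamP l0)) (rs_sup_gain l0' (GamP l0')).
Qed.

Lemma PhiP_cvg (l : R) : 0 < l -> PhiP P0 id n l / n%:R @[n --> \oo] --> phi l.
Proof.
move=> l0; have [G0 GM] := GamP l0.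
apply: (PhiP_limit i2 var1 l0) => [g g0|e e0].
  by have := GM _ g0; rewrite {1}/gain -/(phi l) lerBlDr.
by exists (Gam l) => //; rewrite /max_gain /gain addrAC subrK gerBl ltW.
Qed.

Variable M : forall n : nat, spiked_wigner P0 n.

Lemma sw_information_cvg (l : R) : 0 < l ->
  ((n%:R^-1)%:E * sw_information (M n) l)%E @[n --> \oo] --> (l / 4 - phi l)%:E.
Proof.
move=> l0.
have C : (l / 4 - l / 4 * (n%:R - 0)^-1 - PhiP P0 id n l / n%:R)%:E @[n --> \oo]
    --> (l / 4 - phi l)%:E.
  apply: cvg_EFin; first by near=> n.
  apply: cvgB; last exact: PhiP_cvg.
  rewrite -[X in _ --> X]subr0; apply: cvgB; first exact: cvg_cst.
  by rewrite -(mulr0 (l / 4)); apply: cvgMr; exact: cvg_inv_subn.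
apply: cvg_trans C; apply: near_eq_cvg; near=> n.
have n0 : (0 < n)%N by near: n; exact: nbhs_infty_gt.
rewrite (sw_information_formula _ i2 var1 (ltW l0) n0) -EFinM subr0; congr EFin.
by move: (PhiP _ _ _ _) => p; field; rewrite pnatr_eq0 -lt0n.
Unshelve. all: by end_near. Qed.

Lemma sw_mmse_cvg (l c : R) : 0 < l -> linearizes phi l c ->
  sw_mmse (M n) l @[n --> \oo] --> (1 - 4 * c)%:E.
Proof.
move=> l0 lin; pose D n := DP P0 id n l / (2 * n%:R) / n%:R.
have CD : D n @[n --> \oo] --> c.
  apply: (tangent_limit l0 PhiP_cvg) => // n l' l0'.
  rewrite -mulrBl (_ : _ * D n = (l' - l) / (2 * n%:R) * DP P0 id n l / n%:R).
    by apply: ler_wpM2r; [rewrite invr_ge0 | exact: (DP_tangent i2 var1 n (ltW l0) (ltW l0'))].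
  by rewrite /D; move: (DP _ _ _ _) (_^-1) (_^-1) => p a b; ring.
(* The factor 2/(n(n-1)) of the MMSE is 4/(2 n^2) times 1 + 1/(n-1), and D n is [DP] / (2 n^2), the
   slope of the free energy per spin. *)
have C : (1 - (4 * D n + 4 * D n * (n%:R - 1)^-1))%:E @[n --> \oo] --> (1 - 4 * c)%:E.
  apply: cvg_EFin; first by near=> n.
  apply: cvgB; first exact: cvg_cst.
  rewrite -[X in _ --> X]addr0; apply: cvgD; first by apply: cvgMr.
  rewrite -(mulr0 (4 * c)); apply: cvgM; last exact: cvg_inv_subn.
  by apply: cvgMr.
apply: cvg_trans C; apply: near_eq_cvg; near=> n.
have n1 : (1 < n)%N by near: n; exact: nbhs_infty_gt.
rewrite (sw_mmseE _ i2 var1 (ltW l0) n1) /D; congr EFin.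
move: (DP _ _ _ _) => p; field.
by rewrite subr_eq0 !pnatr_eq1 !pnatr_eq0; move: n1; clear; case: n => [|[|n]].
Unshelve. all: by end_near. Qed.

(** Decreasing l increases the penalty g^2/(4 l), so if g = 0 is optimal at l it remains so at l',
    with gain 0. *)
Lemma subcritical_max_gain (l l' : R) : is_qstar P0 l 0 -> 0 < l' -> l' <= l -> phi l' = 0.
Proof.
move=> [q0 _] l0' ll; have l0 := lt_le_trans l0' ll.
have p0 := psi0 (@psiP_bounds _ _ i2 var1).
have [_ G0] := (is_maximizer_maximizes 0 l0).1 q0.
have g00 k : gain psi k 0 = 0 by rewrite /gain p0 expr0n/= mul0r subrr.
have [Gp GM] := GamP l0'.
apply/eqP; rewrite eq_le /max_gain -{2}(g00 l') GM// andbT.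
have := G0 _ Gp; rewrite mulr0 g00; apply: le_trans.
rewrite /gain lerD2l lerN2 ler_wpM2l ?sqr_ge0// lef_pV2 ?posrE ?mulr_gt0//.
by rewrite ler_pM2l.
Qed.

Lemma subcritical_linearizes (l l' : R) : is_qstar P0 l 0 -> 0 < l' -> l' < l ->
  linearizes phi l' 0.
Proof.
move=> qs l0' ll e e0; exists (Num.min l' (l - l')); first by rewrite lt_min l0' subr_gt0.
move=> k; rewrite lt_min => /andP[]; rewrite !ltr_norml => /andP[k1 _] /andP[_ k2].
have k0 : 0 < k by rewrite -(ltrD2r (- l')) sub0r.
have kl : k <= l by move: k2; rewrite ltrD2r => /ltW.
split => //; rewrite !(subcritical_max_gain qs)// ?(ltW ll)//.
by rewrite mul0r !subr0 normr0 mulr_ge0// ltW.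
Qed.

End replica_symmetric.

Theorem proposition4 (R : realType) (P0 : probability R R)
    (P0_mean : (\int[P0]_x x%:E = 0)%E)
    (P0_var : (\int[P0]_x (x ^+ 2)%:E = 1)%E)
    (M : forall n : nat, spiked_wigner P0 n) :
  (forall lambda : R, 0 < lambda -> (lambda%:E < lambda_c P0)%E ->
     ((n%:R^-1)%:E * sw_information (M n) lambda)%E @[n --> \oo]
       --> (lambda / 4)%:E
     /\ sw_mmse (M n) lambda @[n --> \oo] --> 1%E)
  /\
  {ae lebesgue_measure, forall lambda : R, (lambda_c P0 < lambda%:E)%E ->
     exists q : R,
     [/\ is_qstar P0 lambda q,
         ((n%:R^-1)%:E * sw_information (M n) lambda)%E @[n --> \oo]
           --> (lambda / 4 - rs_potential P0 lambda q)%:E,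
         sw_mmse (M n) lambda @[n --> \oo] --> (1 - q ^+ 2)%:E
       & 1 - q ^+ 2 < 1]}.
Proof.
have i2 : P0.-integrable setT (EFin \o (fun x : R => x ^+ 2)).
  apply/integrableP; split.
    by apply/measurable_EFinP; apply: measurable_funX; exact: measurable_id.
  under eq_integral do rewrite /= ger0_norm ?sqr_ge0//.
  by rewrite P0_var ltry.
have var1 : \int[P0]_x x ^+ 2 = 1 by rewrite /Rintegral P0_var.
have [Gam GamP] := maximizer_selection i2 var1.
split=> [l l0|].
  (* As lambda is positive, the maximum with 0 is not what exceeds it: some k > lambda has q*(k) =
     0. *)
  rewrite /lambda_c lt_max => /orP[|/ereal_sup_gt[_ [k [rk qk] <-]]].
    by rewrite lte_fin => /(lt_trans l0); rewrite ltxx.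
  rewrite lte_fin => lk; split.
    have := sw_information_cvg i2 var1 GamP M l0.
    by rewrite (subcritical_max_gain i2 var1 GamP qk l0 (ltW lk)) subr0.
  have := sw_mmse_cvg i2 var1 GamP M l0 (subcritical_linearizes i2 var1 GamP qk l0 lk).
  by rewrite mulr0 subr0.
(* The exceptional set is countable, hence Lebesgue null. Since lambda_c >= 0, only positive lambda
   need be considered. *)
exists [set l | 0 < l /\ ~ stable Gam l]; split.
- exact/countable_measurable/unstable_countable.
- exact/countable_lebesgue_measure0/unstable_countable.
move=> /= l N; split.
  rewrite ltNge; apply/negP => l0; apply: N; rewrite /lambda_c gt_max => /andP[].
  by rewrite lte_fin => /(le_lt_trans l0); rewrite ltxx.
move=> sl; apply: N; rewrite /lambda_c gt_max lte_fin => /andP[l0 lc].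
have ln : l != 0 by rewrite gt_eqF.
have lin := stable_linearizes GamP l0 sl.
have qs := is_qstar_stable i2 GamP l0 sl.
have q0 : 0 <= Gam l / l by case: qs => -[].
exists (Gam l / l); split => //.
- rewrite rs_potential_gain// (_ : l * (Gam l / l) = Gam l); last by rewrite mulrC divfK.
  exact: (sw_information_cvg i2 var1 GamP M l0).
- rewrite (_ : (Gam l / l) ^+ 2 = 4 * (Gam l ^+ 2 / (4 * l * l))); last by field.
  exact: (sw_mmse_cvg i2 var1 GamP M l0 lin).
rewrite gtrBl exprn_gt0// lt_neqAle q0 andbT eq_sym; apply/eqP => z.
(* If q* vanished here, lambda itself would belong to the set defining lambda_c, contradicting
   lambda > lambda_c; differentiability of [rs_sup] comes from stability. *)
have rl : regular_snr P0 l.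
  by split => //; apply: linearizes_derivable; exact: linearizes_rs_sup lin.
have ql : is_qstar P0 l 0 by rewrite -z.
have in_c : [set k%:E | k in regular_snr P0 `&` [set k | is_qstar P0 k 0]] l%:E.
  by exists l; [exact: conj rl ql|exact: erefl].
by have := lt_le_trans lc (ereal_sup_ubound in_c); rewrite ltxx.
Qed.
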